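(* Let $K$ be an algebraically closed field, let $\Lambda$ be a finite-dimensional basic $K$-algebra, let $X_1,\ldots,X_r$ be a set of simple-minded objects in $\mathcal{D}^b(\mathrm{mod}\,\Lambda)$, let $T_1,\ldots,T_r$ be obtained from them by Rickard's construction, let $\nu^{-1}T=\bigoplus_{i=1}^r\nu^{-1}T_i$, and let $\tilde\Gamma$ be the dg endomorphism algebra of $\nu^{-1}T$. Then the following three $t$-structures on $\mathcal{D}(\mathrm{Mod}\,\Lambda)$ coincide: $$(X^{\le0},\ \Sigma(X^{\le0})^{\perp}),\qquad (\Sigma^{-1}\,{}^{\perp}(X^{\ge0}),\ X^{\ge0}),\qquad (\mathcal{D}^{\le0},\mathcal{D}^{\ge0}),$$ where the third is the image, under the triangle equivalence $?\overset{L}{\otimes}_{\tilde\Gamma}\nu^{-1}T:\mathcal{D}(\tilde\Gamma)\to\mathcal{D}(\mathrm{Mod}\,\Lambda)$, of the standard $t$-structure on $\mathcal{D}(\tilde\Gamma)$.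
   Context: $\mathrm{Mod}\,\Lambda$ (resp. $\mathrm{mod}\,\Lambda$) is the category of right (resp. finite-dimensional right) $\Lambda$-modules; $\mathcal{D}(\mathrm{Mod}\,\Lambda)$ is the unbounded derived category, and $\mathcal{D}^b(\mathrm{mod}\,\Lambda)$ is viewed as a triangulated subcategory of it. $\Sigma$ is the suspension (shift), $\mathrm{Hom}$ is taken in $\mathcal{D}(\mathrm{Mod}\,\Lambda)$. $\mathrm{thick}(\mathcal{S})$ is the smallest triangulated subcategory containing $\mathcal{S}$ and stable under direct summands. $\mathrm{per}(\Lambda)=\mathrm{thick}(\Lambda_\Lambda)$. Simple-minded objects: let $r$ be the rank of the Grothendieck group of $\mathrm{mod}\,\Lambda$. Objects $X_1,\ldots,X_r$ of $\mathcal{D}^b(\mathrm{mod}\,\Lambda)$ are simple-minded if (1) $\mathrm{Hom}(X_i,\Sigma^mX_j)=0$ for all $m<0$ and all $i,j$; (2) $\mathrm{Hom}(X_i,X_j)=K$ if $i=j$ and $0$ otherwise; (3) $\mathcal{D}^b(\mathrm{mod}\,\Lambda)=\mathrm{thick}(X_1,\ldots,X_r)$. Rickard's construction: set $X_i^{(0)}=X_i$. Given $X_i^{(n-1)}$, for $1\le j\le r$ and $m<0$ let $B(j,m,i)$ be a basis of $\mathrm{Hom}(\Sigma^mX_j,X_i^{(n-1)})$, put $Z_i^{(n-1)}=\bigoplus_{m<0}\bigoplus_j\bigoplus_{B(j,m,i)}\Sigma^mX_j$, and let $\alpha_i^{(n-1)}:Z_i^{(n-1)}\to X_i^{(n-1)}$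 be the map whose component corresponding to $f\in B(j,m,i)$ is $f$. Let $X_i^{(n)}$ be a cone of $\alpha_i^{(n-1)}$, with triangle $Z_i^{(n-1)}\to X_i^{(n-1)}\xrightarrow{\beta_i^{(n-1)}}X_i^{(n)}\to\Sigma Z_i^{(n-1)}$. Then $T_i$ is the Milnor colimit of $X_i^{(0)}\xrightarrow{\beta_i^{(0)}}X_i^{(1)}\xrightarrow{\beta_i^{(1)}}\cdots$, i.e. there is a triangle $\bigoplus_{n\ge0}X_i^{(n)}\xrightarrow{\mathrm{id}-\beta}\bigoplus_{n\ge0}X_i^{(n)}\to T_i\to\Sigma\bigoplus_{n\ge0}X_i^{(n)}$. By a result of Rickard each $T_i$ is isomorphic to a bounded complex of finitely generated injective $\Lambda$-modules, and $T_i$ is taken to be such a complex. Nakayama functor: with $\mathrm{D}=\mathrm{Hom}_K(?,K)$, the Nakayama functor $\nu:\mathrm{per}(\Lambda)\to\mathrm{thick}(\mathrm{D}({}_\Lambda\Lambda))$ is a triangle equivalence with quasi-inverse $\nu^{-1}$ (induced by applying $\nu=\mathrm{D}\mathrm{Hom}_\Lambda(?,\Lambda)$ to complexes of finitely generated projectives, and $\nu^{-1}=\mathrm{Hom}_\Lambda(\mathrm{D}({}_\Lambda\Lambda),?)$ to complexes of finitely generated injectives). Thus $\nu^{-1}T$ is a bounded complex of finitely generated projective $\Lambda$-modules. A $t$-structure on a triangulated category $\mathcal{C}$ is a pair $(\mathcal{C}^{\le0},\mathcal{C}^{\ge0})$ of strictly full subcategories with $\Sigma\mathcal{C}^{\le0}\subseteq\mathcal{C}^{\le0}$,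 $\Sigma^{-1}\mathcal{C}^{\ge0}\subseteq\mathcal{C}^{\ge0}$; $\mathrm{Hom}(M,\Sigma^{-1}N)=0$ for $M\in\mathcal{C}^{\le0}$, $N\in\mathcal{C}^{\ge0}$; and for each $M\in\mathcal{C}$ a triangle $M'\to M\to M''\to\Sigma M'$ with $M'\in\mathcal{C}^{\le0}$, $M''\in\Sigma^{-1}\mathcal{C}^{\ge0}$. $X^{\le0}$ is the smallest full subcategory of $\mathcal{D}(\mathrm{Mod}\,\Lambda)$ containing $X_1,\ldots,X_r$ and stable under suspensions, extensions and coproducts (closed under isomorphism); $(X^{\le0})^\perp$ is the full subcategory of objects $M$ with $\mathrm{Hom}(N,M)=0$ for all $N\in X^{\le0}$. $X^{\ge0}$ is the smallest full subcategory of $\mathcal{D}(\mathrm{Mod}\,\Lambda)$ containing $X_1,\ldots,X_r$ and stable under cosuspensions $\Sigma^{-1}$, extensions and products (closed under isomorphism); ${}^\perp(X^{\ge0})$ is the full subcategory of objects $M$ with $\mathrm{Hom}(M,N)=0$ for all $N\in X^{\ge0}$. $\tilde\Gamma$ is the dg algebra whose degree $n$ component consists of the $\Lambda$-linear maps $\nu^{-1}T\to\nu^{-1}T$ homogeneous of degree $n$, with differential $f\mapsto d\circ f-(-1)^nf\circ d$ for $f$ of degree $n$, where $d$ is the differential of $\nu^{-1}T$; thus $H^m(\tilde\Gamma)=\mathrm{Hom}(\nu^{-1}T,\Sigma^m\nu^{-1}T)$. It is finite-dimensional with cohomology concentrated in non-positive degrees. $\mathcal{D}(\tilde\Gamma)$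 is the derived category of right dg $\tilde\Gamma$-modules. Its standard $t$-structure $(\mathcal{D}^{\le0},\mathcal{D}^{\ge0})$ is given by: $\mathcal{D}^{\le0}$ (resp. $\mathcal{D}^{\ge0}$) is the full subcategory of dg modules $M$ with $H^m(M)=0$ for $m>0$ (resp. $m<0$). $\nu^{-1}T$ is naturally a dg $\tilde\Gamma$-$\Lambda$-bimodule, and $?\overset{L}{\otimes}_{\tilde\Gamma}\nu^{-1}T$ is a triangle equivalence sending $\tilde\Gamma$ to $\nu^{-1}T$; the image of the standard $t$-structure is again denoted $(\mathcal{D}^{\le0},\mathcal{D}^{\ge0})$. *)

(* Defs.v *)
From HB Require Import structures.
From mathcomp Require Import all_boot all_order all_algebra all_field.
From mathcomp Require Import boolp.

Set Implicit Arguments.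
Unset Strict Implicit.
Unset Printing Implicit Defensive.

Import GRing.Theory.
Local Open Scope ring_scope.


Definition mkLin (R : pzRingType) (U V : lmodType R) (f : U -> V)
  (H : linear f) : {linear U -> V} :=
  HB.pack f (GRing.isLinear.Build R U V _ f H).

Lemma lin_eq (R : pzRingType) (U V : lmodType R) (f g : {linear U -> V}) :
  f =1 g -> f = g.
Proof.
case: f => f [[f1] [f2]]; case: g => g [[g1] [g2]] /= fg.
have E : f = g by apply: funext.
by subst g; rewrite (Prop_irrelevance f1 g1) (Prop_irrelevance f2 g2).
Qed.

(** [(-1)^n x], for [n] an integer. *)
Definition ksgn (n : int) (V : zmodType) (x : V) : V :=
  if odd `|n|%N then - x else x.


(** Products of arbitrary families of modules.  They serve both as finite
    direct sums and as homogeneous components of endomorphism algebras. *)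
Definition dprod (I : Type) (R : pzRingType) (V : I -> lmodType R) : Type :=
  forall t : I, V t.

Section DProd.
Variables (I : Type) (R : pzRingType) (V : I -> lmodType R).

HB.instance Definition _ := gen_eqMixin (dprod V).
HB.instance Definition _ := gen_choiceMixin (dprod V).

Definition dprod_add (f g : dprod V) : dprod V := fun t => f t + g t.
Definition dprod_opp (f : dprod V) : dprod V := fun t => - f t.
Definition dprod_zero : dprod V := fun t => 0.
Definition dprod_scale (a : R) (f : dprod V) : dprod V := fun t => a *: f t.

Fact dprod_addA : associative dprod_add.
Proof. by move=> f g h; apply: functional_extensionality_dep => t; apply: addrA. Qed.
Fact dprod_addC : commutative dprod_add.
Proof. by move=> f g; apply: functional_extensionality_dep => t; apply: addrC. Qed.
Fact dprod_add0 : left_id dprod_zero dprod_add.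
Proof. by move=> f; apply: functional_extensionality_dep => t; apply: add0r. Qed.
Fact dprod_addN : left_inverse dprod_zero dprod_opp dprod_add.
Proof. by move=> f; apply: functional_extensionality_dep => t; apply: addNr. Qed.

HB.instance Definition _ := GRing.isZmodule.Build (dprod V)
  dprod_addA dprod_addC dprod_add0 dprod_addN.

Fact dprod_scaleA a b f : dprod_scale a (dprod_scale b f) = dprod_scale (a * b) f.
Proof. by apply: functional_extensionality_dep => t; apply: scalerA. Qed.
Fact dprod_scale1 : left_id 1 dprod_scale.
Proof. by move=> f; apply: functional_extensionality_dep => t; apply: scale1r. Qed.
Fact dprod_scaleDr : right_distributive dprod_scale +%R.
Proof. by move=> a f g; apply: functional_extensionality_dep => t; apply: scalerDr. Qed.
Fact dprod_scaleDl f : {morph dprod_scale^~ f : a b / a + b}.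
Proof. by move=> a b; apply: functional_extensionality_dep => t; apply: scalerDl. Qed.

HB.instance Definition _ := GRing.Zmodule_isLmodule.Build R (dprod V)
  dprod_scaleA dprod_scale1 dprod_scaleDr dprod_scaleDl.
End DProd.

Definition linHom (R : pzRingType) (U V : lmodType R) : Type := {linear U -> V}.
Definition hfun (R : pzRingType) (U V : lmodType R) (f : linHom U V) :
  {linear U -> V} := f.

Section LinHom.
Variables (R : pzRingType) (U V : lmodType R).
Local Notation hom := (linHom U V).

HB.instance Definition _ := gen_eqMixin hom.
HB.instance Definition _ := gen_choiceMixin hom.

Fact linHom_add_linear (f g : hom) : linear (fun x => hfun f x + hfun g x).
Proof. by move=> a x y; rewrite !linearP scalerDr addrACA. Qed.
Fact linHom_opp_linear (f : hom) : linear (fun x => - hfun f x).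
Proof. by move=> a x y; rewrite linearP opprD scalerN. Qed.
Fact linHom_zero_linear : linear (fun _ : U => 0 : V).
Proof. by move=> a x y; rewrite scaler0 addr0. Qed.

Definition linHom_add (f g : hom) : hom := mkLin (linHom_add_linear f g).
Definition linHom_opp (f : hom) : hom := mkLin (linHom_opp_linear f).
Definition linHom_zero : hom := mkLin linHom_zero_linear.

Fact linHom_addA : associative linHom_add.
Proof. by move=> f g h; apply: lin_eq => x; apply: addrA. Qed.
Fact linHom_addC : commutative linHom_add.
Proof. by move=> f g; apply: lin_eq => x; apply: addrC. Qed.
Fact linHom_add0 : left_id linHom_zero linHom_add.
Proof. by move=> f; apply: lin_eq => x; apply: add0r. Qed.
Fact linHom_addN : left_inverse linHom_zero linHom_opp linHom_add.
Proof. by move=> f; apply: lin_eq => x; apply: addNr. Qed.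

HB.instance Definition _ := GRing.isZmodule.Build hom
  linHom_addA linHom_addC linHom_add0 linHom_addN.
End LinHom.

Definition lcomp (R : pzRingType) (U V W : lmodType R)
  (g : linHom V W) (f : linHom U V) : linHom U W := hfun g \o hfun f.

(** Right [L]-modules are left modules over the converse ring [L^c]; the field
    acts on them through [k |-> k%:A]. *)

Section RightModules.
Variables (K : fieldType) (L : falgType K).

Definition calg (k : K) : L^c := k%:A : L.

Lemma calgC (k : K) (a : L^c) : calg k * a = a * calg k.
Proof. by rewrite /calg; apply: etrans (mulr_algr _ _) (esym (mulr_algl _ _)). Qed.

Section HomK.
Variables U V : lmodType L^c.
Local Notation hom := (linHom U V).

Fact linHom_scale_linear (k : K) (f : hom) : linear (fun x => calg k *: hfun f x).
Proof. by move=> a x y; rewrite linearP scalerDr !scalerA calgC. Qed.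
Definition linHom_scale k (f : hom) : hom := mkLin (linHom_scale_linear k f).

Fact linHom_scaleA a b f : linHom_scale a (linHom_scale b f) = linHom_scale (a * b) f.
Proof.
apply: lin_eq => x /=; rewrite scalerA; congr (_ *: _).
by rewrite calgC /calg /=; apply: etrans (mulr_algl _ _) _; rewrite scalerA mulrC.
Qed.
Fact linHom_scale1 : left_id 1 linHom_scale.
Proof. by move=> f; apply: lin_eq => x /=; rewrite /calg scale1r; apply: scale1r. Qed.
Fact linHom_scaleDr : right_distributive linHom_scale +%R.
Proof. by move=> a f g; apply: lin_eq => x; apply: scalerDr. Qed.
Fact linHom_scaleDl f : {morph linHom_scale^~ f : a b / a + b}.
Proof. by move=> a b; apply: lin_eq => x /=; rewrite /calg scalerDl; apply: scalerDl. Qed.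

HB.instance Definition _ := GRing.Zmodule_isLmodule.Build K hom
  linHom_scaleA linHom_scale1 linHom_scaleDr linHom_scaleDl.
End HomK.

(** The dual [D(L)] of the left regular module, a right module by
    [(phi a) x = phi (a x)]. *)
Definition dualL : Type := 'Hom(L, K^o).
HB.instance Definition _ := GRing.Zmodule.on dualL.

Section DualL.
Lemma dualLaddE (f g : dualL) (x : L) :
  (f + g : 'Hom(L, K^o)) x = (f : 'Hom(L, K^o)) x + (g : 'Hom(L, K^o)) x.
Proof. exact: (@add_lfunE _ _ _ (f : 'Hom(L, K^o)) g x). Qed.

Fact dualL_scale_linear (a : L) (phi : 'Hom(L, K^o)) :
  linear (fun x : L => phi (a * x)).
Proof. by move=> k x y; rewrite mulrDr -scalerAr linearP. Qed.
Definition dualL_scale (a : L^c) (phi : dualL) : dualL :=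
  linfun (mkLin (dualL_scale_linear (a : L) phi)).

Fact dualL_scaleA a b phi : dualL_scale a (dualL_scale b phi) = dualL_scale (a * b) phi.
Proof. by apply/lfunP => x; rewrite !lfunE /= !lfunE /= mulrA. Qed.
Fact dualL_scale1 : left_id 1 dualL_scale.
Proof. by move=> phi; apply/lfunP => x; rewrite !lfunE /= mul1r. Qed.
Fact dualL_scaleDr : right_distributive dualL_scale +%R.
Proof.
move=> a f g; apply/lfunP => x.
by rewrite dualLaddE !lfunE /= dualLaddE.
Qed.
Fact dualL_scaleDl f : {morph dualL_scale^~ f : a b / a + b}.
Proof.
move=> a b; apply/lfunP => x.
by rewrite dualLaddE !lfunE /= mulrDl linearD.
Qed.

HB.instance Definition _ := GRing.Zmodule_isLmodule.Build L^c dualL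
  dualL_scaleA dualL_scale1 dualL_scaleDr dualL_scaleDl.
End DualL.

(** The left multiplication [(a phi) x = phi (x a)], which makes [D(L)] a
    bimodule. *)
Definition dualLmul (a : L) (phi : dualL) : dualL := (phi \o amulr a)%VF.

Lemma dualLmulE (a : L) (phi : 'Hom(L, K^o)) x :
  (dualLmul a phi : 'Hom(L, K^o)) x = phi (x * a).
Proof. by rewrite comp_lfunE lfunE. Qed.

(** [Hom_L (D(L), V)], with the right module structure coming from the left
    module structure of [D(L)]. *)
Definition nuHom (V : lmodType L^c) : Type := linHom dualL V.
HB.instance Definition _ (V : lmodType L^c) := GRing.Zmodule.on (nuHom V).

Section NuHom.
Variable V : lmodType L^c.

Lemma dualLscaleE (a : L^c) (phi : dualL) (x : L) :
  (a *: phi : 'Hom(L, K^o)) x = (phi : 'Hom(L, K^o)) ((a : L) * x).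
Proof. by rewrite lfunE. Qed.

Fact dualLmul_linear a : linear (dualLmul a).
Proof.
move=> b f g; apply/lfunP => x; rewrite dualLmulE !dualLaddE.
by rewrite dualLscaleE [X in _ = X + _]dualLscaleE !dualLmulE mulrA.
Qed.

Definition nuHom_scale (a : L^c) (g : nuHom V) : nuHom V := lcomp g (mkLin (dualLmul_linear a)).

Fact nuHom_scaleA a b f : nuHom_scale a (nuHom_scale b f) = nuHom_scale (a * b) f.
Proof.
apply: lin_eq => phi /=; congr (hfun f _); apply/lfunP => x.
by rewrite !dualLmulE -mulrA.
Qed.
Fact nuHom_scale1 : left_id 1 nuHom_scale.
Proof.
move=> f; apply: lin_eq => phi /=; congr (hfun f _); apply/lfunP => x.
by rewrite dualLmulE mulr1.
Qed.
Fact nuHom_scaleDr : right_distributive nuHom_scale +%R.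
Proof. by move=> a f g; apply: lin_eq. Qed.
Fact nuHom_scaleDl f : {morph nuHom_scale^~ f : a b / a + b}.
Proof.
move=> a b; apply: lin_eq => phi /=.
rewrite -[RHS](linearD (hfun f)); congr (hfun f _); apply/lfunP => x.
by rewrite dualLaddE !dualLmulE mulrDr linearD.
Qed.

HB.instance Definition _ := GRing.Zmodule_isLmodule.Build L^c (nuHom V)
  nuHom_scaleA nuHom_scale1 nuHom_scaleDr nuHom_scaleDl.
End NuHom.

End RightModules.

(** The differential is indexed by a proof of [i + 1 = j] rather than having
    codomain of index [i + 1], so that shifting requires no transport. *)

Record cplx (R : pzRingType) := Cplx {
  cobj :> int -> lmodType R;
  cd : forall i j : int, i + 1 = j -> {linear cobj i -> cobj j};
  cdd : forall (i j k : int) (e : i + 1 = j) (e' : j + 1 = k) (x : cobj i),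
    cd e' (cd e x) = 0
}.
Arguments cd {R} c {i j} e.

Record cmap (R : pzRingType) (M N : cplx R) := CMap {
  cfun :> forall i : int, {linear M i -> N i};
  cfunC : forall (i j : int) (e : i + 1 = j) (x : M i),
    cfun j (cd M e x) = cd N e (cfun i x)
}.

Section Complexes.
Variable R : pzRingType.
Implicit Types M N P : cplx R.

Definition cycle M (i : int) (x : M i) : Prop :=
  forall (j : int) (e : i + 1 = j), cd M e x = 0.
Definition bdry M (i : int) (x : M i) : Prop :=
  exists (j : int) (e : j + 1 = i) (y : M j), x = cd M e y.

Definition cohom0 M (m : int) : Prop :=
  forall x : M m, cycle x -> bdry x.
Definition acyclic M : Prop := forall m, cohom0 M m.

Definition qis M N (s : cmap M N) : Prop :=
  forall i : int,
    (forall x : M i, cycle x -> bdry (s i x) -> bdry x) /\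
    (forall y : N i, cycle y -> exists2 x : M i, cycle x & bdry (y - s i x)).

Fact cid_linear (V : lmodType R) : linear (fun x : V => x).
Proof. by []. Qed.
Definition cid M : cmap M M :=
  @CMap R M M (fun i => mkLin (@cid_linear (M i))) (fun _ _ _ _ => erefl).

Fact ccomp_subproof M N P (g : cmap N P) (f : cmap M N) i j (e : i + 1 = j)
  (x : M i) : (g j \o f j) (cd M e x) = cd P e ((g i \o f i) x).
Proof. by rewrite /= !cfunC. Qed.
Definition ccomp M N P (g : cmap N P) (f : cmap M N) : cmap M P :=
  @CMap R M P (fun i => g i \o f i) (ccomp_subproof g f).

Fact czero_subproof M N i j (e : i + 1 = j) (x : M i) :
  linHom_zero (M j) (N j) (cd M e x) = cd N e (linHom_zero (M i) (N i) x).
Proof. by rewrite /= linear0. Qed.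
Definition czero M N : cmap M N :=
  @CMap R M N (fun i => linHom_zero (M i) (N i)) (@czero_subproof M N).

(** Shifts: [(shift m M)^i = M^(i+m)], with differential [(-1)^m d]. *)
Fact shift_index (m i j : int) : i + 1 = j -> i + m + 1 = j + m.
Proof. by move=> <-; rewrite addrAC. Qed.

Fact ksgn_linear (m : int) (V W : lmodType R) (f : {linear V -> W}) :
  linear (fun x => ksgn m (f x)).
Proof.
by move=> a x y; rewrite /ksgn; case: (odd _); rewrite linearP // opprD scalerN.
Qed.

Fact shift_subproof (m : int) M i j k (e : i + 1 = j) (e' : j + 1 = k)
  (x : M (i + m)) :
  ksgn m (cd M (shift_index m e') (ksgn m (cd M (shift_index m e) x))) = 0.
Proof. by rewrite /ksgn; case: (odd _); rewrite ?linearN ?opprK cdd. Qed.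

Definition shift (m : int) M : cplx R :=
  @Cplx R (fun i => M (i + m))
    (fun i j e => mkLin (ksgn_linear m (cd M (shift_index m e))))
    (@shift_subproof m M).

Fact cshift_subproof m M N (f : cmap M N) i j (e : i + 1 = j)
  (x : shift m M i) :
  f (j + m) (cd (shift m M) e x) = cd (shift m N) e (f (i + m) x).
Proof.
by rewrite /= /ksgn; case: (odd _); rewrite ?linearN cfunC.
Qed.
Definition cshift m M N (f : cmap M N) : cmap (shift m M) (shift m N) :=
  @CMap R (shift m M) (shift m N) (fun i => f (i + m)) (cshift_subproof f).

Lemma cycle_shift m M i (x : shift m M i) : @cycle (shift m M) i x <-> @cycle M (i + m) x.
Proof.
split=> H j e.
- have e' : i + 1 = j - m by rewrite -e addrAC addrK.
  have := H _ e'; rewrite /= /ksgn.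
  have E : j - m + m = j by rewrite subrK.
  move: (shift_index m e'); rewrite E => e''; rewrite (eq_irrelevance e'' e).
  by case: (odd _) => // /eqP; rewrite oppr_eq0 => /eqP.
- by rewrite /= H /ksgn oppr0 if_same.
Qed.

Lemma bdry_shift m M i (x : shift m M i) : @bdry (shift m M) i x <-> @bdry M (i + m) x.
Proof.
split=> [[j [e [y ->]]]|[j [e [y ->]]]].
- exists (j + m), (shift_index m e), (ksgn m y).
  by rewrite /= /ksgn; case: (odd _) => //; rewrite linearN.
- have E : j = j - m + m by rewrite subrK.
  move: e y; rewrite {}E; move: (j - m) => {}j e y.
  have e' : j + 1 = i by apply: (addIr m); rewrite addrAC.
  exists j, e', (ksgn m y); rewrite /= (eq_irrelevance e (shift_index m e')).
  by rewrite /ksgn; case: (odd _) => //; rewrite linearN opprK.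
Qed.

Lemma qis_shift m M N (s : cmap M N) : qis s -> qis (cshift m s).
Proof.
move=> H i; have [H1 H2] := H (i + m); split=> [x|y].
  by move=> /cycle_shift cx /bdry_shift bx; apply/bdry_shift; apply: H1.
move=> /cycle_shift /H2 [x cx bx]; exists x; first exact/cycle_shift.
exact/bdry_shift.
Qed.

Fact csum_linear M N i j (e : i + 1 = j) :
  linear (fun p : M i * N i => (cd M e p.1, cd N e p.2)).
Proof. by move=> a x y /=; rewrite !linearP. Qed.
Fact csum_subproof M N i j k (e : i + 1 = j) (e' : j + 1 = k) (p : M i * N i) :
  (cd M e' (cd M e p.1), cd N e' (cd N e p.2)) = 0.
Proof. by congr pair; apply: cdd. Qed.
Definition csum M N : cplx R :=
  @Cplx R (fun i => (M i * N i)%type) (fun i j e => mkLin (@csum_linear M N i j e))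
    (@csum_subproof M N).

Fact fst_linear (V W : lmodType R) : linear (fun p : V * W => p.1).
Proof. by []. Qed.
Fact snd_linear (V W : lmodType R) : linear (fun p : V * W => p.2).
Proof. by []. Qed.
Fact add_linear (V : lmodType R) : linear (fun p : V * V => p.1 + p.2).
Proof. by move=> a x y /=; rewrite scalerDr addrACA. Qed.

Definition cfst M N : cmap (csum M N) M :=
  @CMap R (csum M N) M (fun i => mkLin (@fst_linear (M i) (N i)))
    (fun _ _ _ _ => erefl).
Definition csnd M N : cmap (csum M N) N :=
  @CMap R (csum M N) N (fun i => mkLin (@snd_linear (M i) (N i)))
    (fun _ _ _ _ => erefl).
Definition cfold M : cmap (csum M M) M :=
  @CMap R (csum M M) M (fun i => mkLin (@add_linear (M i)))
    (fun i j e x => esym (linearD (cd M e) x.1 x.2)).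

Section FiniteSum.
Variables (I : finType) (M : I -> cplx R).

Fact cbigsum_linear i j (e : i + 1 = j) :
  linear (fun x : dprod (fun t => M t i) => (fun t => cd (M t) e (x t)) : dprod (fun t => M t j)).
Proof. by move=> a x y; apply: functional_extensionality_dep => t; apply: linearP. Qed.
Fact cbigsum_subproof i j k (e : i + 1 = j) (e' : j + 1 = k)
  (x : dprod (fun t => M t i)) :
  (fun t => cd (M t) e' (cd (M t) e (x t))) = 0 :> dprod (fun t => M t k).
Proof. by apply: functional_extensionality_dep => t; apply: cdd. Qed.
Definition cbigsum : cplx R :=
  @Cplx R (fun i => dprod (fun t => M t i)) (fun i j e => mkLin (cbigsum_linear e))
    cbigsum_subproof.
End FiniteSum.

(** The mapping cone: [cone(f)^i = N^i + M^(i+1)], with differential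
    [(y, x) |-> (d y + f x, - d x)]. *)
Section Cone.
Variables (M N : cplx R) (f : cmap M N).

Definition cone_obj (i : int) : lmodType R := (N i * M (i + 1)%R)%type.

Definition cone_d (i j : int) (e : i + 1 = j) : cone_obj i -> cone_obj j :=
  match e in (_ = j) return cone_obj i -> cone_obj j with
  | erefl => fun p =>
      (cd N (erefl (i + 1)) p.1 + f (i + 1) p.2, - cd M (erefl (i + 1 + 1)) p.2)
  end.

Fact cone_d_linear i j (e : i + 1 = j) : linear (cone_d e).
Proof.
case: j / e => a x y /=; congr pair => /=.
  by rewrite !linearP /= -addrACA -scalerDr.
by rewrite linearP opprD scalerN.
Qed.
Fact cone_subproof i j k (e : i + 1 = j) (e' : j + 1 = k) (p : cone_obj i) :
  cone_d e' (cone_d e p) = 0.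
Proof.
case: k / e'; case: j / e => /=; congr pair.
  by rewrite linearD cdd add0r linearN cfunC subrr.
by rewrite linearN cdd !oppr0.
Qed.
Definition cone : cplx R :=
  @Cplx R cone_obj (fun i j e => mkLin (@cone_d_linear i j e)) cone_subproof.

Fact cone_in_linear i : linear (fun y : N i => (y, 0) : cone_obj i).
Proof. by move=> a x y; congr pair => /=; rewrite scaler0 addr0. Qed.
Fact cone_in_subproof i j (e : i + 1 = j) (x : N i) :
  (cd N e x, 0) = cone_d e (x, 0).
Proof. by case: j / e; congr pair; rewrite /= !linear0 ?oppr0 ?addr0. Qed.
Definition cone_in : cmap N cone :=
  @CMap R N cone (fun i => mkLin (@cone_in_linear i)) cone_in_subproof.

Fact cone_out_linear i : linear (fun p : cone_obj i => p.2 : M (i + 1)).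
Proof. by []. Qed.
Fact cone_out_subproof i j (e : i + 1 = j) (p : cone_obj i) :
  (cone_d e p).2 = cd (shift 1 M) e p.2.
Proof. by case: j / e => /=; rewrite /ksgn /= (eq_irrelevance (shift_index 1 _) erefl). Qed.
Definition cone_out : cmap cone (shift 1 M) :=
  @CMap R cone (shift 1 M) (fun i => mkLin (@cone_out_linear i)) cone_out_subproof.
End Cone.

End Complexes.

(** The derived category [D(R)] is the localization of the category of complexes at the
    quasi-isomorphisms: its morphisms are formal composites of chain maps and
    of formal inverses of quasi-isomorphisms, modulo the congruence [deq]. *)

Inductive dhom (R : pzRingType) : cplx R -> cplx R -> Type :=
| dmap (M N : cplx R) of cmap M N : dhom M N
| dinv (M N : cplx R) (s : cmap M N) of qis s : dhom N M
| dcomp (M N P : cplx R) of dhom N P & dhom M N : dhom M P.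
Arguments dinv {R M N} s _.

Inductive deq (R : pzRingType) :
  forall M N : cplx R, dhom M N -> dhom M N -> Prop :=
| deq_refl M N (f : dhom M N) : deq f f
| deq_sym M N (f g : dhom M N) : deq f g -> deq g f
| deq_trans M N (f g h : dhom M N) : deq f g -> deq g h -> deq f h
| deq_comp M N P (g g' : dhom N P) (f f' : dhom M N) :
    deq g g' -> deq f f' -> deq (dcomp g f) (dcomp g' f')
| deq_compA M N P Q (h : dhom P Q) (g : dhom N P) (f : dhom M N) :
    deq (dcomp h (dcomp g f)) (dcomp (dcomp h g) f)
| deq_idl M N (f : dhom M N) : deq (dcomp (dmap (cid N)) f) f
| deq_idr M N (f : dhom M N) : deq (dcomp f (dmap (cid M))) f
| deq_map M N (f g : cmap M N) : (forall i, f i =1 g i) -> deq (dmap f) (dmap g)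
| deq_mapC M N P (g : cmap N P) (f : cmap M N) :
    deq (dmap (ccomp g f)) (dcomp (dmap g) (dmap f))
| deq_invl M N (s : cmap M N) (qs : qis s) :
    deq (dcomp (dinv s qs) (dmap s)) (dmap (cid M))
| deq_invr M N (s : cmap M N) (qs : qis s) :
    deq (dcomp (dmap s) (dinv s qs)) (dmap (cid N)).

Section DerivedCategory.
Variable R : pzRingType.
Implicit Types (M N P : cplx R) (C : cplx R -> Prop).

Definition did M : dhom M M := dmap (cid M).
Definition dzero M N : dhom M N := dmap (czero M N).
Definition hom_zero M N : Prop := forall f : dhom M N, deq f (dzero M N).

Definition diso M N (f : dhom M N) : Prop :=
  exists g : dhom N M, deq (dcomp g f) (did M) /\ deq (dcomp f g) (did N).
Definition dIso M N : Prop := exists f : dhom M N, diso f.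

(** [h = f + g] in the additive category [D(R)]: [h] is the composite of
    the morphism [M -> N + N] with components [f] and [g] and of the codiagonal. *)
Definition is_dadd M N (f g h : dhom M N) : Prop :=
  exists p : dhom M (csum N N),
    [/\ deq (dcomp (dmap (cfst N N)) p) f,
        deq (dcomp (dmap (csnd N N)) p) g
      & deq (dcomp (dmap (cfold N)) p) h].

Fixpoint dsusp M N (f : dhom M N) : dhom (shift 1 M) (shift 1 N) :=
  match f in dhom M N return dhom (shift 1 M) (shift 1 N) with
  | dmap _ _ f => dmap (cshift 1 f)
  | dinv _ _ s qs => dinv (cshift 1 s) (qis_shift 1 qs)
  | dcomp _ _ _ g f => dcomp (dsusp g) (dsusp f)
  end.

Definition dist M N P (u : dhom M N) (v : dhom N P) (w : dhom P (shift 1 M)) : Prop :=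
  exists (A B : cplx R) (f : cmap A B)
    (a : dhom M A) (b : dhom N B) (c : dhom P (cone f)),
    [/\ diso a, diso b & diso c] /\
    [/\ deq (dcomp b u) (dcomp (dmap f) a),
        deq (dcomp c v) (dcomp (dmap (cone_in f)) b)
      & deq (dcomp (dsusp a) w) (dcomp (dmap (cone_out f)) c)].

Definition triangle M N P : Prop :=
  exists (u : dhom M N) (v : dhom N P) (w : dhom P (shift 1 M)), dist u v w.

Definition is_coproduct (I : Type) (M : I -> cplx R) (C : cplx R)
    (inj : forall t, dhom (M t) C) : Prop :=
  forall (N : cplx R) (f : forall t, dhom (M t) N),
    exists g : dhom C N, (forall t, deq (dcomp g (inj t)) (f t)) /\
      (forall g' : dhom C N, (forall t, deq (dcomp g' (inj t)) (f t)) -> deq g' g).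

Definition is_product (I : Type) (M : I -> cplx R) (C : cplx R)
    (proj : forall t, dhom C (M t)) : Prop :=
  forall (N : cplx R) (f : forall t, dhom N (M t)),
    exists g : dhom N C, (forall t, deq (dcomp (proj t) g) (f t)) /\
      (forall g' : dhom N C, (forall t, deq (dcomp (proj t) g') (f t)) -> deq g' g).

(** Full subcategories are given by predicates on objects. *)
Definition iso_closed C : Prop := forall M N, dIso M N -> C M -> C N.
Definition ext_closed C : Prop :=
  forall M N P, triangle M N P -> C M -> C P -> C N.
Definition coprod_closed C : Prop :=
  forall (I : Type) (M : I -> cplx R) (N : cplx R) (inj : forall t, dhom (M t) N),
    is_coproduct inj -> (forall t, C (M t)) -> C N.
Definition prod_closed C : Prop :=
  forall (I : Type) (M : I -> cplx R) (N : cplx R) (proj : forall t, dhom N (M t)),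
    is_product proj -> (forall t, C (M t)) -> C N.
Definition shift_closed (m : int) C : Prop := forall M, C M -> C (shift m M).

Definition shift_class (m : int) C : cplx R -> Prop :=
  fun M => exists2 N, C N & dIso (shift m N) M.

Definition rperp C : cplx R -> Prop := fun M => forall N, C N -> hom_zero N M.
Definition lperp C : cplx R -> Prop := fun M => forall N, C N -> hom_zero M N.

Definition triangulated C : Prop :=
  [/\ iso_closed C, shift_closed 1 C, shift_closed (-1) C
    & forall M N P, triangle M N P -> C M -> C N -> C P].
Definition summand_closed C : Prop :=
  forall M N P, dIso P (csum M N) -> C P -> C M.

Definition is_thick C : Prop :=
  [/\ (exists M, C M), triangulated C & summand_closed C].

Section Generated.
Variables (I : Type) (X : I -> cplx R).

Definition thick : cplx R -> Prop := fun M =>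
  forall C, is_thick C -> (forall i, C (X i)) -> C M.

(** The subcategory written [X^{<=0}]. *)
Definition aisle : cplx R -> Prop := fun M =>
  forall C, iso_closed C -> shift_closed 1 C -> ext_closed C ->
    coprod_closed C -> (forall i, C (X i)) -> C M.

(** The subcategory written [X^{>=0}]. *)
Definition coaisle : cplx R -> Prop := fun M =>
  forall C, iso_closed C -> shift_closed (-1) C -> ext_closed C ->
    prod_closed C -> (forall i, C (X i)) -> C M.
End Generated.

Record t_structure (Cle Cge : cplx R -> Prop) : Prop := TStructure {
  ts_iso_le : iso_closed Cle;
  ts_iso_ge : iso_closed Cge;
  ts_shift_le : shift_closed 1 Cle;
  ts_shift_ge : shift_closed (-1) Cge;
  ts_hom : forall M N, Cle M -> Cge N -> hom_zero M (shift (-1) N);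
  ts_tri : forall M, exists M' M'',
    [/\ Cle M', shift_class (-1) Cge M'' & triangle M' M M'']
}.

(** [T] is a Milnor colimit of [Y 0 -> Y 1 -> Y 2 -> ...]; the condition on
    [phi] says that it is the identity minus the shift map. *)
Definition milnor_colimit (Y : nat -> cplx R)
    (beta : forall n, dhom (Y n) (Y n.+1)) (T : cplx R) : Prop :=
  exists (C : cplx R) (inj : forall n, dhom (Y n) C) (phi : dhom C C)
         (v : dhom C T) (w : dhom T (shift 1 C)),
    [/\ is_coproduct inj,
        forall n, is_dadd (dcomp phi (inj n)) (dcomp (inj n.+1) (beta n)) (inj n)
      & dist phi v w].

End DerivedCategory.

Section OverAlgebra.
Variables (K : fieldType) (L : falgType K).
Local Notation Lop := (L^c).
Local Notation cpx := (cplx Lop).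
Implicit Types M N : cpx.

Definition fin_dim (V : lmodType Lop) : Prop :=
  exists (n : nat) (e : 'I_n -> V), forall x : V,
    exists c : 'I_n -> K, x = \sum_i calg L (c i) *: e i.

Definition fin_gen (V : lmodType Lop) : Prop :=
  exists (n : nat) (e : 'I_n -> V), forall x : V,
    exists c : 'I_n -> Lop, x = \sum_i c i *: e i.

Definition injective_module (V : lmodType Lop) : Prop :=
  forall (A B : lmodType Lop) (u : {linear A -> B}) (f : {linear A -> V}),
    injective u -> exists g : {linear B -> V}, forall x, g (u x) = f x.

Definition primitive_idempotent (e : L) : Prop :=
  [/\ e != 0, e * e = e
    & forall f g : L, f * f = f -> g * g = g -> f * g = 0 -> g * f = 0 ->
        e = f + g -> f = 0 \/ g = 0].

(** The right modules [e L] and [f L] are isomorphic. *)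
Definition iso_eL (e f : L) : Prop :=
  exists u v : L -> L,
    [/\ forall x, e * x = x -> f * u x = u x,
        forall y, f * y = y -> e * v y = v y,
        forall x x' a, e * x = x -> e * x' = x' -> u (x * a + x') = u x * a + u x',
        forall x, e * x = x -> v (u x) = x
      & forall y, f * y = y -> u (v y) = y].

(** For some, equivalently every, decomposition of [1] into orthogonal
    primitive idempotents, the modules [e_i L] are pairwise non-isomorphic. *)
Definition basic : Prop :=
  exists (n : nat) (e : 'I_n -> L),
    [/\ forall i, primitive_idempotent (e i),
        forall i j, i != j -> e i * e j = 0,
        \sum_i e i = 1
      & forall i j, i != j -> ~ iso_eL (e i) (e j)].

Record fd_module := FdModule { fdm :> lmodType Lop; fdmP : fin_dim fdm }.

Definition additive_function (G : zmodType) (phi : fd_module -> G) : Prop :=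
  forall (A B C : fd_module) (u : {linear A -> B}) (v : {linear B -> C}),
    injective u -> (forall z : C, exists y : B, v y = z) ->
    (forall y : B, v y = 0 <-> exists x : A, u x = y) ->
    phi B = phi A + phi C.

(** The Grothendieck group is the target of the universal additive function;
    it is required to be free of rank [r]. *)
Definition K0_rank (r : nat) : Prop :=
  exists phi : fd_module -> 'rV[int]_r, additive_function phi /\
    forall (G : zmodType) (psi : fd_module -> G), additive_function psi ->
      exists g : {additive 'rV[int]_r -> G}, (forall V, psi V = g (phi V)) /\
        (forall g' : {additive 'rV[int]_r -> G},
           (forall V, psi V = g' (phi V)) -> g' =1 g).

Definition bounded M : Prop :=
  exists a b : int, forall i : int, (i < a) || (b < i) -> forall x : M i, x = 0.

(** The image of [D^b(mod L)] in [D(Mod L)]. *)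
Definition in_Db M : Prop :=
  exists N : cpx, [/\ bounded N, forall i, fin_dim (N i) & dIso N M].

Fact cscale_subproof (k : K) M i j (e : i + 1 = j) (x : M i) :
  calg L k *: cd M e x = cd M e (calg L k *: x).
Proof. by rewrite linearZ. Qed.
Definition cscale (k : K) M : cmap M M :=
  @CMap Lop M M (fun i => linHom_scale k (mkLin (@cid_linear Lop (M i)) : linHom (M i) (M i)))
    (@cscale_subproof k M).

Definition dscale (k : K) M N (f : dhom M N) : dhom M N :=
  dcomp (dmap (cscale k N)) f.

Fixpoint lincomb M N (I : Type) (b : I -> dhom M N) (s : seq (K * I))
    (h : dhom M N) : Prop :=
  match s with
  | [::] => deq h (dzero M N)
  | kt :: s' => exists2 h' : dhom M N,
      lincomb b s' h' & is_dadd (dscale kt.1 (b kt.2)) h' h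
  end.

Definition hom_basis M N (I : eqType) (b : I -> dhom M N) : Prop :=
  (forall h : dhom M N, exists s : seq (K * I), lincomb b s h) /\
  (forall s : seq (K * I), uniq [seq kt.2 | kt <- s] ->
     lincomb b s (dzero M N) -> forall kt, kt \in s -> kt.1 = 0).

(** [Hom(M, M) = K]: the identity of [M] is a basis over [K]. *)
Definition end_is_K M : Prop := hom_basis (fun _ : unit => did M).

Definition simple_minded (r : nat) (X : 'I_r -> cpx) : Prop :=
  [/\ K0_rank r, forall i, in_Db (X i)
    & [/\ forall (m : int) i j, m < 0 -> hom_zero (X i) (shift m (X j)),
          forall i, end_is_K (X i),
          forall i j, i != j -> hom_zero (X i) (X j)
        & forall M, in_Db M <-> thick X M]].

Record rickard_index (r : nat) (B : 'I_r -> int -> eqType) := RickardIndex {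
  ri_j : 'I_r;
  ri_m : int;
  ri_neg : ri_m < 0;
  ri_b : B ri_j ri_m
}.

Definition rickard_step (r : nat) (X : 'I_r -> cpx) (Y Y' : cpx)
    (beta : dhom Y Y') : Prop :=
  exists (B : 'I_r -> int -> eqType)
         (b : forall j m, B j m -> dhom (shift m (X j)) Y)
         (Z : cpx)
         (inj : forall t : rickard_index B, dhom (shift (ri_m t) (X (ri_j t))) Z)
         (alpha : dhom Z Y) (gamma : dhom Y' (shift 1 Z)),
    [/\ forall j m, m < 0 -> hom_basis (b j m),
        is_coproduct inj,
        forall t, deq (dcomp alpha (inj t)) (b _ _ (ri_b t))
      & dist alpha beta gamma].

Definition rickard (r : nat) (X : 'I_r -> cpx) (i : 'I_r) (T : cpx) : Prop :=
  exists (Y : nat -> cpx) (beta : forall n, dhom (Y n) (Y n.+1)),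
    [/\ Y 0%N = X i,
        forall n, rickard_step X (beta n)
      & milnor_colimit beta T].

Definition bounded_injective (T : cpx) : Prop :=
  bounded T /\ forall i, injective_module (T i) /\ fin_gen (T i).

Fact nuinv_linear (V W : lmodType Lop) (f : {linear V -> W}) :
  linear (fun g : nuHom V => lcomp f g : nuHom W).
Proof. by move=> a g h; apply: lin_eq => phi /=; rewrite linearD. Qed.

Fact nuinv_subproof M i j k (e : i + 1 = j) (e' : j + 1 = k) (g : nuHom (M i)) :
  lcomp (cd M e') (lcomp (cd M e) g) = 0 :> nuHom (M k).
Proof. by apply: lin_eq => phi /=; apply: cdd. Qed.

(** The inverse Nakayama functor [Hom_L (D(L), ?)], applied degreewise. *)
Definition nuinv M : cpx :=
  @Cplx Lop (fun i => nuHom (M i)) (fun i j e => mkLin (nuinv_linear (cd M e)))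
    (@nuinv_subproof M).

End OverAlgebra.

Record dgAlg (K : fieldType) := DGAlg {
  dga :> cplx K;
  dgmul : forall i j k : int, i + j = k -> dga i -> dga j -> dga k;
  dgone : dga 0;
  dgmulDl : forall i j k (e : i + j = k) x x' y,
    dgmul e (x + x') y = dgmul e x y + dgmul e x' y;
  dgmulZl : forall i j k (e : i + j = k) c x y,
    dgmul e (c *: x) y = c *: dgmul e x y;
  dgmulDr : forall i j k (e : i + j = k) x y y',
    dgmul e x (y + y') = dgmul e x y + dgmul e x y';
  dgmulZr : forall i j k (e : i + j = k) c x y,
    dgmul e x (c *: y) = c *: dgmul e x y;
  dgmulA : forall i j k ij jk n (e1 : i + j = ij) (e2 : ij + k = n)
      (e3 : j + k = jk) (e4 : i + jk = n) x y z,
    dgmul e2 (dgmul e1 x y) z = dgmul e4 x (dgmul e3 y z);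
  dgmul1l : forall i (e : 0 + i = i) x, dgmul e dgone x = x;
  dgmul1r : forall i (e : i + 0 = i) x, dgmul e x dgone = x;
  dgleibniz : forall i j k i' j' k' (e : i + j = k)
      (ei : i + 1 = i') (ej : j + 1 = j') (ek : k + 1 = k')
      (e1 : i' + j = k') (e2 : i + j' = k') x y,
    cd dga ek (dgmul e x y)
      = dgmul e1 (cd dga ei x) y + ksgn i (dgmul e2 x (cd dga ej y))
}.
Arguments dgmul {K} d {i j k} e x y.

Record dgMod (K : fieldType) (A : dgAlg K) := DGMod {
  dgm :> cplx K;
  dgact : forall i j k : int, i + j = k -> dgm i -> A j -> dgm k;
  dgactDl : forall i j k (e : i + j = k) x x' a,
    dgact e (x + x') a = dgact e x a + dgact e x' a;
  dgactZl : forall i j k (e : i + j = k) c x a,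
    dgact e (c *: x) a = c *: dgact e x a;
  dgactDr : forall i j k (e : i + j = k) x a a',
    dgact e x (a + a') = dgact e x a + dgact e x a';
  dgactZr : forall i j k (e : i + j = k) c x a,
    dgact e x (c *: a) = c *: dgact e x a;
  dgactA : forall i j k ij jk n (e1 : i + j = ij) (e2 : ij + k = n)
      (e3 : j + k = jk) (e4 : i + jk = n) x a b,
    dgact e2 (dgact e1 x a) b = dgact e4 x (dgmul A e3 a b);
  dgact1 : forall i (e : i + 0 = i) x, dgact e x (dgone A) = x;
  dgact_leibniz : forall i j k i' j' k' (e : i + j = k)
      (ei : i + 1 = i') (ej : j + 1 = j') (ek : k + 1 = k')
      (e1 : i' + j = k') (e2 : i + j' = k') x a,
    cd dgm ek (dgact e x a)
      = dgact e1 (cd dgm ei x) a + ksgn i (dgact e2 x (cd A ej a))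
}.
Arguments dgact {K A} d {i j k} e x a.

Record dgMap (K : fieldType) (A : dgAlg K) (M N : dgMod A) := DGMap {
  dgf :> cmap M N;
  dgf_act : forall i j k (e : i + j = k) (x : M i) (a : A j),
    dgf k (dgact M e x a) = dgact N e (dgf i x) a
}.

Section DGModules.
Variables (K : fieldType) (A : dgAlg K).
Implicit Types M N P : dgMod A.

Definition null_homotopic M N (f : dgMap M N) : Prop :=
  exists h : forall i j : int, j + 1 = i -> {linear M i -> N j},
    (forall i j k i' k' (e : i + j = k) (ei : i' + 1 = i) (ek : k' + 1 = k)
        (e' : i' + j = k') (x : M i) (a : A j),
       h k k' ek (dgact M e x a) = dgact N e' (h i i' ei x) a) /\
    (forall i j k (e : j + 1 = i) (e' : i + 1 = k) (x : M i),
       f i x = cd N e (h i j e x) + h k i e' (cd M e' x)).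

Definition h_projective P : Prop :=
  forall (N : dgMod A) (f : dgMap P N), acyclic N -> null_homotopic f.

Definition std_le N : Prop := forall m : int, 0 < m -> cohom0 N m.
Definition std_ge N : Prop := forall m : int, m < 0 -> cohom0 N m.
End DGModules.

Section EndDG.
Variables (K : fieldType) (L : falgType K) (U : cplx L^c).

(** A homogeneous map of degree [n] is a family of linear maps
    [U i -> U j], for [i + n = j]. *)
Record end_index (n : int) := EndIndex {
  ei_src : int; ei_tgt : int; ei_deg : ei_src + n = ei_tgt
}.

Definition end_obj (n : int) : lmodType K :=
  dprod (fun t : end_index n => linHom (U (ei_src t)) (U (ei_tgt t)) : lmodType K).

Definition end_app n (f : end_obj n) (i j : int) (e : i + n = j) : linHom (U i) (U j) :=
  f (EndIndex e).

Lemma end_eq n (f g : end_obj n) :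
  (forall i j (e : i + n = j) x, hfun (end_app f e) x = hfun (end_app g e) x) ->
  f = g.
Proof.
by move=> H; apply: functional_extensionality_dep => -[i j e]; apply: lin_eq => x; apply: H.
Qed.

(** The intermediate index of a composite does not matter. *)
Lemma end_mid (a b i k : int) (F : forall j, i + a = j -> U i -> U j)
  (G : forall j, j + b = k -> U j -> U k) j j' e1 e2 e1' e2' x :
  G j e2 (F j e1 x) = G j' e2' (F j' e1' x).
Proof. by case: j / e1 e2 => e2; case: j' / e1' e2' => e2'; rewrite (eq_irrelevance e2 e2'). Qed.

Fact end_d_index1 (n n' i k : int) : n + 1 = n' -> i + n' = k -> i + n + 1 = k.
Proof. by move=> <- <-; rewrite addrA. Qed.
Fact end_d_index2 (n n' i k : int) : n + 1 = n' -> i + n' = k -> i + 1 + n = k.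
Proof. by move=> <- <-; rewrite addrAC addrA. Qed.
Fact end_mul_index (n m l i k : int) : n + m = l -> i + l = k -> i + m + n = k.
Proof. by move=> <- <-; rewrite -addrA [m + n]addrC. Qed.

Definition end_d (n n' : int) (e : n + 1 = n') (f : end_obj n) : end_obj n' :=
  fun t =>
    lcomp (cd U (end_d_index1 e (ei_deg t))) (end_app f (erefl (ei_src t + n)))
    - ksgn n (lcomp (end_app f (end_d_index2 e (ei_deg t)))
                    (cd U (erefl (ei_src t + 1)))).

Definition end_mul (n m l : int) (e : n + m = l) (f : end_obj n) (g : end_obj m) : end_obj l :=
  fun t => lcomp (end_app f (end_mul_index e (ei_deg t)))
                 (end_app g (erefl (ei_src t + m))).

Definition end_one : end_obj 0 :=
  fun t => match ei_deg t in (_ = j) return linHom (U (ei_src t)) (U j) with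
           | erefl => match esym (addr0 (ei_src t)) in (_ = j)
                        return linHom (U (ei_src t)) (U j) with
                      | erefl => mkLin (@cid_linear _ (U (ei_src t)))
                      end
           end.

Lemma hfunD (V W : lmodType L^c) (f g : linHom V W) x :
  hfun (f + g) x = hfun f x + hfun g x.
Proof. by []. Qed.
Lemma hfunN (V W : lmodType L^c) (f : linHom V W) x : hfun (- f) x = - hfun f x.
Proof. by []. Qed.
Lemma hfunZ (V W : lmodType L^c) c (f : linHom V W) x :
  hfun (c *: f) x = calg L c *: hfun f x.
Proof. by []. Qed.
Lemma hfun_sgn n (V W : lmodType L^c) (f : linHom V W) x :
  hfun (ksgn n f) x = ksgn n (hfun f x).
Proof. by rewrite /ksgn; case: (odd _). Qed.

Lemma ksgnD n (V : zmodType) (x y : V) : ksgn n (x + y) = ksgn n x + ksgn n y.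
Proof. by rewrite /ksgn; case: (odd _) => //; rewrite opprD. Qed.
Lemma ksgnN n (V : zmodType) (x : V) : ksgn n (- x) = - ksgn n x.
Proof. by rewrite /ksgn; case: (odd _). Qed.
Lemma ksgnZ n (R : pzRingType) (V : lmodType R) a (x : V) :
  ksgn n (a *: x) = a *: ksgn n x.
Proof. by rewrite /ksgn; case: (odd _); rewrite ?scalerN. Qed.
Lemma ksgn_lin n (R : pzRingType) (V W : lmodType R) (f : {linear V -> W}) x :
  f (ksgn n x) = ksgn n (f x).
Proof. by rewrite /ksgn; case: (odd _); rewrite ?linearN. Qed.

Lemma odd_absD (m n : int) : odd `|(m + n)%R|%N = odd `|m|%N (+) odd `|n|%N.
Proof.
have odd_sub (a b : nat) : odd `|a%:Z - b%:Z|%N = odd a (+) odd b.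
  have [le|/ltnW le] := leqP a b.
    by rewrite distnC distnEl // oddB // addbC.
  by rewrite distnEl // oddB.
case: m => m; case: n => n; rewrite ?NegzE ?abszN.
- by rewrite -PoszD !absz_nat oddD.
- by rewrite odd_sub absz_nat.
- by rewrite addrC odd_sub absz_nat addbC.
- by rewrite -opprD abszN -PoszD !absz_nat oddD.
Qed.
Lemma ksgn_add m n (V : zmodType) (x : V) : ksgn (m + n) x = ksgn m (ksgn n x).
Proof.
by rewrite /ksgn odd_absD; case: (odd `|m|%N); case: (odd `|n|%N) => //=; rewrite opprK.
Qed.
Lemma ksgn1 (V : zmodType) (x : V) : ksgn 1 x = - x.
Proof. by []. Qed.

Lemma end_appD n (f g : end_obj n) i j (e : i + n = j) :
  end_app (f + g) e = end_app f e + end_app g e.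
Proof. by []. Qed.
Lemma end_appZ n c (f : end_obj n) (i j : int) (e : i + n = j) :
  end_app (c *: f) e = c *: end_app f e.
Proof. by []. Qed.

Lemma end_dE (n n' : int) (e : n + 1 = n') f (i k : int) (ik : i + n' = k) (j : int) (e1 : i + n = j)
    (e2 : j + 1 = k) (j' : int) (e3 : i + 1 = j') (e4 : j' + n = k) x :
  hfun (end_app (end_d e f) ik) x
  = cd U e2 (hfun (end_app f e1) x) - ksgn n (hfun (end_app f e4) (cd U e3 x)).
Proof.
transitivity (cd U (end_d_index1 e ik) (hfun (end_app f erefl) x)
    - ksgn n (hfun (end_app f (end_d_index2 e ik)) (cd U erefl x))).
  by rewrite -(hfun_sgn n (lcomp (end_app f (end_d_index2 e ik)) (cd U erefl))).
congr (_ - ksgn n _).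
  exact: (@end_mid n 1 i k (fun j h => hfun (end_app f h)) (fun j h => cd U h)).
exact: (@end_mid 1 n i k (fun j h => cd U h) (fun j h => hfun (end_app f h))).
Qed.

Lemma end_mulE (n m l : int) (e : n + m = l) f g (i k : int) (ik : i + l = k) (j : int) (e1 : i + m = j)
    (e2 : j + n = k) x :
  hfun (end_app (end_mul e f g) ik) x = hfun (end_app f e2) (hfun (end_app g e1) x).
Proof.
exact: (@end_mid m n i k (fun j h => hfun (end_app g h)) (fun j h => hfun (end_app f h))).
Qed.

Lemma end_oneE (i : int) (e : i + 0 = i) x : hfun (end_app end_one e) x = x.
Proof.
rewrite /end_app /end_one /=; move: (esym _); move: e; rewrite addr0 => e e'.
by rewrite (eq_irrelevance e erefl) (eq_irrelevance e' erefl).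
Qed.

Fact end_d_linear (n n' : int) (e : n + 1 = n') : linear (end_d e).
Proof.
move=> a f g; apply: end_eq => i k ik x.
rewrite (end_appD (a *: end_d e f) (end_d e g)) hfunD (end_appZ a (end_d e f)) hfunZ.
have e2 := end_d_index1 e ik; have e4 := end_d_index2 e ik.
rewrite !(end_dE e _ ik erefl e2 erefl e4) !end_appD !end_appZ !hfunD !hfunZ.
by rewrite linearD linearZ ksgnD ksgnZ opprD addrACA scalerDr scalerN.
Qed.

Fact end_dd (n1 n2 n3 : int) (e : n1 + 1 = n2) (e' : n2 + 1 = n3) f :
  end_d e' (end_d e f) = 0.
Proof.
apply: end_eq => i k ik x.
have e2 := end_d_index1 e' ik; have e4 := end_d_index2 e' ik.
rewrite (end_dE e' _ ik erefl e2 erefl e4).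
have a2 := end_d_index1 e (erefl (i + n2)); have a4 := end_d_index2 e (erefl (i + n2)).
rewrite (end_dE e f erefl erefl a2 erefl a4).
have b4 := end_d_index2 e e4.
rewrite (end_dE e f e4 a4 e2 erefl b4).
have sgn2 (y : U k) : ksgn n2 y = - ksgn n1 y by rewrite -e addrC ksgn_add ksgn1.
rewrite linearB !cdd sub0r ksgn_lin sgn2 linear0 {3}/ksgn oppr0 if_same subr0 opprK.
exact: addNr.
Qed.

Definition end_cplx : cplx K :=
  @Cplx K end_obj (fun n n' e => mkLin (@end_d_linear n n' e)) end_dd.

Fact end_mulDl (i j k : int) (e : i + j = k) f f' g :
  end_mul e (f + f') g = end_mul e f g + end_mul e f' g.
Proof. by apply: end_eq. Qed.
Fact end_mulZl (i j k : int) (e : i + j = k) c f g :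
  end_mul e (c *: f) g = c *: end_mul e f g.
Proof. by apply: end_eq. Qed.
Fact end_mulDr (i j k : int) (e : i + j = k) f g g' :
  end_mul e f (g + g') = end_mul e f g + end_mul e f g'.
Proof.
apply: end_eq => a b ab x; have e2 := end_mul_index e ab.
by rewrite (end_appD (end_mul e f g) (end_mul e f g')) hfunD !(end_mulE e _ _ ab erefl e2) end_appD hfunD linearD.
Qed.
Fact end_mulZr (i j k : int) (e : i + j = k) c f g :
  end_mul e f (c *: g) = c *: end_mul e f g.
Proof.
apply: end_eq => a b ab x; have e2 := end_mul_index e ab.
by rewrite (end_appZ c (end_mul e f g)) hfunZ !(end_mulE e _ _ ab erefl e2) end_appZ hfunZ linearZ.
Qed.
Fact end_mulA (i j k ij jk n : int) (e1 : i + j = ij) (e2 : ij + k = n)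
    (e3 : j + k = jk) (e4 : i + jk = n) f g h :
  end_mul e2 (end_mul e1 f g) h = end_mul e4 f (end_mul e3 g h).
Proof.
apply: end_eq => a b ab x.
have h1 := end_mul_index e2 ab; have h2 := end_mul_index e4 ab.
rewrite (end_mulE e2 _ _ ab erefl h1) (end_mulE e4 _ _ ab erefl h2).
have h3 := end_mul_index e3 (erefl (a + jk)).
by rewrite (end_mulE e3 _ _ erefl erefl h3) (end_mulE e1 _ _ h1 h3 h2).
Qed.
Fact end_mul1l (i : int) (e : 0 + i = i) f : end_mul e end_one f = f.
Proof.
by apply: end_eq => a b ab x; rewrite (end_mulE e _ _ ab ab (addr0 b)) end_oneE.
Qed.
Fact end_mul1r (i : int) (e : i + 0 = i) f : end_mul e f end_one = f.
Proof.
by apply: end_eq => a b ab x; rewrite (end_mulE e _ _ ab (addr0 a) ab) end_oneE.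
Qed.
Fact end_leibniz (i j k i' j' k' : int) (e : i + j = k)
    (ei : i + 1 = i') (ej : j + 1 = j') (ek : k + 1 = k')
    (e1 : i' + j = k') (e2 : i + j' = k') f g :
  end_d ek (end_mul e f g)
  = end_mul e1 (end_d ei f) g + ksgn i (end_mul e2 f (end_d ej g)).
Proof.
apply: end_eq => a b ab x.
have sgnE (F : end_obj k') : end_app (ksgn i F) ab = ksgn i (end_app F ab).
  by rewrite /ksgn; case: (odd _).
rewrite (end_appD (end_mul e1 _ _)) hfunD sgnE hfun_sgn.
have h1 := end_d_index1 ek ab; have h2 := end_d_index2 ek ab.
rewrite (end_dE ek _ ab erefl h1 erefl h2).
have m1 := end_mul_index e1 ab; have m2 := end_mul_index e2 ab.
rewrite (end_mulE e1 _ _ ab erefl m1) (end_mulE e2 _ _ ab erefl m2).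
have h3 := end_mul_index e (erefl (a + k)).
rewrite (end_mulE e _ _ erefl erefl h3).
have h4 := end_d_index1 ej (erefl (a + j')); have h5 := end_d_index2 ej (erefl (a + j')).
rewrite (end_mulE e _ _ h2 h5 m2).
rewrite (end_dE ej g erefl erefl h4 erefl h5).
rewrite (end_dE ei f m1 h3 h1 h4 m2).
rewrite linearB ksgnD ksgnN addrA subrK; congr (_ - _).
by rewrite -e ksgn_add ksgn_lin.
Qed.

Definition endDG : dgAlg K :=
  @DGAlg K end_cplx end_mul end_one end_mulDl end_mulZl end_mulDr end_mulZr
    end_mulA end_mul1l end_mul1r end_leibniz.

(** [balanced P W] stands for the chain maps from [P (x)_{endDG} U] to [W];
    the tensor product is then defined by its universal property. *)
Record balanced (P : dgMod endDG) (W : cplx L^c) := Balanced {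
  bal :> forall i j k : int, i + j = k -> P i -> U j -> W k;
  balDl : forall i j k (e : i + j = k) x x' u,
    bal e (x + x') u = bal e x u + bal e x' u;
  bal_linear : forall i j k (e : i + j = k) x, linear (bal e x);
  bal_act : forall i n i' j j' k (e1 : i + n = i') (e2 : j + n = j')
      (e : i' + j = k) (e' : i + j' = k) (x : P i) (f : end_obj n) (u : U j),
    bal e (dgact P e1 x f) u = bal e' x (hfun (end_app f e2) u);
  bal_d : forall i j k i' j' k' (e : i + j = k)
      (ei : i + 1 = i') (ej : j + 1 = j') (ek : k + 1 = k')
      (e1 : i' + j = k') (e2 : i + j' = k') x u,
    cd W ek (bal e x u) = bal e1 (cd P ei x) u + ksgn i (bal e2 x (cd U ej u))
}.

Definition is_tensor (P : dgMod endDG) (W : cplx L^c) : Prop :=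
  exists tau : balanced P W, forall (V : cplx L^c) (phi : balanced P V),
    exists g : cmap W V,
      (forall i j k (e : i + j = k) x u, g k (tau i j k e x u) = phi i j k e x u) /\
      (forall g' : cmap W V,
         (forall i j k (e : i + j = k) x u, g' k (tau i j k e x u) = phi i j k e x u) ->
         forall i, g' i =1 g i).

Definition is_Ltensor (N : dgMod endDG) (W : cplx L^c) : Prop :=
  exists (P : dgMod endDG) (q : dgMap P N),
    [/\ h_projective P, qis q & is_tensor P W].

Definition Ltensor_image (C : dgMod endDG -> Prop) : cplx L^c -> Prop := fun M =>
  exists (N : dgMod endDG) (W : cplx L^c), [/\ C N, is_Ltensor N W & dIso W M].

End EndDG.

(* Main.v *)
From HB Require Import structures.
Require Import Defs.
From mathcomp Require Import all_boot all_order all_algebra all_field.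
From Stdlib Require Import Setoid Morphisms.
From mathcomp Require classical_sets.
From mathcomp Require Import boolp zify ring.

(** Put [U = nu^-1 T] and write [h^k(M) = Hom(U, M[k])]. Nakayama duality makes
    [Hom(U, M[k])] dual to [Hom(M, T[-k])], and this turns the properties of Rickard's
    telescopes into: [U] is perfect and silting, [h^k(X_j)] is nonzero exactly for
    [k = 0], and [h^k(T_j) = 0] for [k < 0]. A map [V -> X_j[m]] in the lowest degree
    [m] survives in [T_j[m]]; as the [X_j] generate [D^b], it follows that [U] generates
    [D(Mod L)]. Hence [h^k = 0] for [k > 0] and for [k < 0] define a t-structure, whose
    aisle is generated by [U]; resolving by cells [U[-m]] identifies it with the
    image of the standard t-structure of the endomorphism algebra of [U].

    If [M] in [D^b] has top degree [b], either some map [M -> X_j[-b]] is nonzero, and then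
    it is onto in [h^b] because [End(X_j) = K], or [h^b(M) = 0]. Peeling off such maps
    filters [M] by the [X_j[-k]], for [k] in the degrees of [M]. Applied to [U], this
    shows that [U] is in the aisle generated by the [X_j]. Applied to [T], it shows that
    [T] is in the coaisle cogenerated by them; every object with [h^k = 0] for [k < 0]
    is then obtained from products of shifts of the [T_j] through a tower of fibres
    of maps to such products, whose limit vanishes. *)

(** Three obstacles shape the details. The derived category is presented by formal composites modulo
    a congruence, so an equation between morphisms yields nothing by inspection. Its action on
    homotopy classes of maps from a K-projective complex ([act]) turns it into a homotopy, and from
    then on everything is computed in complexes of homomorphisms. Objects of D^b need not be
    perfect, hence need not be compact; but against targets with cohomology bounded below, and in
    degrees bounded above, they can be replaced by perfect complexes. This is why lower bounds [sge]
    and explicit degree constants accompany the telescope arguments. The derived tensor product is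
    given by any h-projective resolution and any object with the universal property, so it has to be
    compared with a cellular one, where [Hom(U, -)] and tensoring with [U] are visibly inverse. A
    single construction, attaching all cells of prescribed degrees countably often, provides
    K-projective resolutions (cells from the regular module), truncations (cells [U[-m]] with [m]
    bounded above) and resolutions of dg modules. *)

Set Implicit Arguments.
Unset Strict Implicit.
Unset Printing Implicit Defensive.

Import Order.TTheory GRing.Theory Num.Theory.
Local Open Scope ring_scope.
Local Notation cycle := Defs.cycle.

(** * Complexes, exact sequences and cones *)

Section Casts.
Variable R : pzRingType.
Implicit Types M N : cplx R.

(** Shifting and composing produce degrees such as [i - 1 + 1] and [i] that are only propositionally
    equal. This identity map carries elements between them, and the lemmas below absorb it into
    differentials. *)
Definition cc M i j (e : i = j) : {linear M i -> M j} :=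
  match e in _ = j return {linear M i -> M j} with
  | erefl => mkLin (@cid_linear _ (M i))
  end.

Lemma cc_id M i (e : i = i) (x : M i) : cc M e x = x.
Proof. by rewrite (eq_irrelevance e erefl). Qed.

Lemma cc_cc M i j k (e : i = j) (e' : j = k) (e2 : i = k) (x : M i) :
  cc M e' (cc M e x) = cc M e2 x.
Proof. by case: k / e' e2; case: j / e => e2; rewrite !cc_id. Qed.

Lemma cc_cd M i j k (e : i = j) (e1 : j + 1 = k) (e2 : i + 1 = k) (x : M i) :
  cd M e1 (cc M e x) = cd M e2 x.
Proof. by case: j / e e1 => e1; rewrite cc_id (eq_irrelevance e1 e2). Qed.

Lemma cd_cc M i j k (e1 : i + 1 = j) (e : j = k) (e2 : i + 1 = k) (x : M i) :
  cc M e (cd M e1 x) = cd M e2 x.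
Proof. by case: k / e e2 => e2; rewrite cc_id (eq_irrelevance e1 e2). Qed.

Lemma cd_irr M i j (e e' : i + 1 = j) (x : M i) : cd M e x = cd M e' x.
Proof. by rewrite (eq_irrelevance e e'). Qed.

Lemma cycle1 M i j (e : i + 1 = j) (x : M i) : cd M e x = 0 -> cycle x.
Proof. by move=> H k e'; case: j / e H => H; case: k / e'; exact: H. Qed.

Lemma bdry_intro M i j (e : j + 1 = i) (y : M j) : bdry (cd M e y).
Proof. by exists j, e, y. Qed.

Lemma bdry_elim M i j (e : j + 1 = i) (x : M i) : bdry x -> exists y : M j, x = cd M e y.
Proof.
case=> k [e' [y ->]]; have ek : k = j by apply: (addIr 1); rewrite e e'.
by subst k; exists y; apply: cd_irr.
Qed.

Lemma bdry0 M i : bdry (0 : M i).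
Proof. by exists (i - 1), (subrK 1 i), 0; rewrite linear0. Qed.

Lemma bdryD M i (x y : M i) : bdry x -> bdry y -> bdry (x + y).
Proof.
move=> /(bdry_elim (subrK 1 i)) [a ->] /(bdry_elim (subrK 1 i)) [b ->].
by rewrite -linearD; apply: bdry_intro.
Qed.

Lemma bdryZ M i a (x : M i) : bdry x -> bdry (a *: x).
Proof. by move=> /(bdry_elim (subrK 1 i)) [b ->]; rewrite -linearZ; apply: bdry_intro. Qed.

Lemma bdryN M i (x : M i) : bdry x -> bdry (- x).
Proof. by move=> /(bdry_elim (subrK 1 i)) [b ->]; rewrite -linearN; apply: bdry_intro. Qed.

Lemma bdryB M i (x y : M i) : bdry x -> bdry y -> bdry (x - y).
Proof. by move=> bx by_; apply: bdryD => //; apply: bdryN. Qed.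

Lemma cycleD M i (x y : M i) : cycle x -> cycle y -> cycle (x + y).
Proof. by move=> cx cy j e; rewrite linearD cx cy addr0. Qed.

Lemma cycleN M i (x : M i) : cycle x -> cycle (- x).
Proof. by move=> cx j e; rewrite linearN cx oppr0. Qed.

Lemma cycleB M i (x y : M i) : cycle x -> cycle y -> cycle (x - y).
Proof. by move=> cx cy; apply: cycleD => //; apply: cycleN. Qed.

Lemma cycle0 M i : cycle (0 : M i).
Proof. by move=> j e; rewrite linear0. Qed.

Lemma bdry_cycle M i (x : M i) : bdry x -> cycle x.
Proof. by case=> j [e [y ->]] k e'; rewrite cdd. Qed.

Lemma cyc_map M N (f : cmap M N) i (x : M i) : cycle x -> cycle (f i x).
Proof. by move=> cx j e; rewrite -cfunC cx linear0. Qed.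

Lemma bdry_map M N (f : cmap M N) i (x : M i) : bdry x -> bdry (f i x).
Proof. by case=> j [e [y ->]]; rewrite cfunC; apply: bdry_intro. Qed.

End Casts.

Section ExactSequences.
Variable R : pzRingType.
Implicit Types P Q S M N : cplx R.

(** [cv f m] says that the cohomology of the cone of [f] vanishes in degree [m]. *)
Definition cv M N (f : cmap M N) (m : int) : Prop :=
  forall (m' : int) (e : m + 1 = m') (z : M m') (y : N m),
    cycle z -> f m' z = cd N e y -> exists2 x : M m, z = cd M e x & bdry (y - f m x).

(** The condition [cv f m] packs two halves: an arbitrary [z] gives injectivity on cohomology in
    degree [m + 1], and [z = 0] gives surjectivity in degree [m]. *)
Lemma qis_cv M N (f : cmap M N) : qis f <-> forall m, cv f m.
Proof.
split=> [H m m' e z y cz fz|H m].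
  have [H1 _] := H m'; have [_ H2] := H m.
  have /(bdry_elim e) [x zx] : bdry z by apply: H1 => //; rewrite fz; apply: bdry_intro.
  have [|x' cx' bx'] := H2 (y - f m x).
    by apply: (@cycle1 _ _ _ _ e); rewrite linearB -cfunC -zx -fz subrr.
  exists (x + x'); first by rewrite linearD (cx' _ e) addr0.
  by rewrite linearD opprD addrA.
split=> [x cx|y cy].
  move=> /(bdry_elim (subrK 1 m)) [y fx].
  have [z -> _] := H _ _ (subrK 1 m) x y cx fx; exact: bdry_intro.
have [||x x0 bx] := H m _ erefl 0 y; first exact: cycle0.
  by rewrite linear0 cy.
by exists x => //; apply: cycle1 (esym x0).
Qed.

Record ses P Q S (i : cmap P Q) (p : cmap Q S) : Prop := Ses {
  ses_inj : forall n x, i n x = 0 -> x = 0;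
  ses_surj : forall n y, exists x, p n x = y;
  ses_zero : forall n x, p n (i n x) = 0;
  ses_ex : forall n x, p n x = 0 -> exists y, x = i n y }.

Section Ses.
Variables (P Q S : cplx R) (i : cmap P Q) (p : cmap Q S).
Variable H : ses i p.

(** The quotient [S] has the cohomology of the cone of [i]. This lemma and the three that follow are
    the long exact sequence, cut into statements about a single vanishing. *)
Lemma ses_cv m : cohom0 S m <-> cv i m.
Proof.
split=> [H0 m' e z y cz iz|H0 x cx].
  have cpy : cycle (p m y).
    by apply: (@cycle1 _ _ _ _ e); rewrite -cfunC -iz (ses_zero H).
  have [j [ej [s ps]]] := H0 _ cpy; have [w pw] := ses_surj H s.
  have [x xE] : exists x, y - cd Q ej w = i m x.
    by apply: (ses_ex H); rewrite linearB cfunC pw ps subrr.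
  have yE : y - i m x = cd Q ej w by rewrite -xE opprB addrC subrK.
  exists x; last by rewrite yE; apply: bdry_intro.
  apply/eqP; rewrite -subr_eq0; apply/eqP; apply: (ses_inj H).
  by rewrite linearB iz cfunC -xE linearB cdd subr0 subrr.
have [y py] := ses_surj H x.
have [z zE] : exists z, cd Q (erefl (m + 1)) y = i _ z.
  by apply: (ses_ex H); rewrite cfunC py cx.
have cz : cycle z.
  by apply: (@cycle1 _ _ _ _ erefl); apply: (ses_inj H); rewrite cfunC -zE cdd.
have [x' _ b] := H0 _ _ z y cz (esym zE).
rewrite -py -[X in bdry X](subr0) -(ses_zero H x') -linearB.
exact: bdry_map.
Qed.

Lemma ses_mid m : cohom0 P m -> cohom0 S m -> cohom0 Q m.
Proof.
move=> HP HS x cx.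
have /(bdry_elim (subrK 1 m)) [s ps] := HS _ (cyc_map p cx).
have [w pw] := ses_surj H s.
have [y yE] : exists y, x - cd Q (subrK 1 m) w = i m y.
  by apply: (ses_ex H); rewrite linearB cfunC pw ps subrr.
have cy : cycle y.
  apply: (@cycle1 _ _ _ _ erefl); apply: (ses_inj H).
  by rewrite cfunC -yE linearB cdd cx subrr.
rewrite -[x](subrK (cd Q (subrK 1 m) w)) yE.
by apply: bdryD (bdry_intro _ _); apply/bdry_map/HP.
Qed.

Lemma ses_right m m' : m + 1 = m' -> cohom0 Q m -> cohom0 P m' -> cohom0 S m.
Proof.
move=> e HQ HP; apply/ses_cv => m'' e'; have em : m'' = m' by rewrite -e -e'.
move: e'; rewrite em => e' z y cz iz; have /(bdry_elim e') [x zx] := HP _ cz.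
exists x => //; apply: HQ; apply: (@cycle1 _ _ _ _ e').
by rewrite linearB -cfunC -zx iz subrr.
Qed.

Lemma ses_left m m' : m + 1 = m' -> cohom0 S m -> cohom0 Q m' -> cohom0 P m'.
Proof.
move=> e /ses_cv HS HQ x cx.
have /(bdry_elim e) [y yE] := HQ _ (cyc_map i cx).
by have [z -> _] := HS _ e x y cx yE; apply: bdry_intro.
Qed.

End Ses.

(** The data of an extension that is split in every degree: the identity makes the triangular
    differential on the sum square to zero. Cones, attached cells, cocones and fibres over products
    all have this shape, so exactness of Hom on them is proved once. *)
Record twist (B C : cplx R) := Twist {
  tw : forall i j : int, i + 1 = j -> {linear C i -> B j};
  twC : forall i j k (e : i + 1 = j) (e' : j + 1 = k) x,
    cd B e' (tw e x) + tw e' (cd C e x) = 0 }.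

Arguments tw {B C} t {i j} e.

Section TwistedSum.
Variables (B C : cplx R) (q : twist B C).

Definition tsum_obj (i : int) : lmodType R := (B i * C i)%type.

Fact tsum_linear i j (e : i + 1 = j) :
  linear (fun p : tsum_obj i => (cd B e p.1 + tw q e p.2, cd C e p.2) : tsum_obj j).
Proof.
move=> a [x1 x2] [y1 y2]; congr pair => /=; last by rewrite linearP.
by rewrite !linearP /= scalerDr addrACA.
Qed.

Fact tsum_subproof i j k (e : i + 1 = j) (e' : j + 1 = k) (p : tsum_obj i) :
  mkLin (tsum_linear e') (mkLin (tsum_linear e) p) = 0 :> tsum_obj k.
Proof. by congr pair => /=; rewrite ?cdd // linearD cdd add0r twC. Qed.

Definition tsum : cplx R := @Cplx R tsum_obj (fun i j e => mkLin (tsum_linear e)) tsum_subproof.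

Lemma tsum_dE i j (e : i + 1 = j) (p : tsum i) :
  cd tsum e p = (cd B e p.1 + tw q e p.2, cd C e p.2).
Proof. by []. Qed.

Fact tin_linear i : linear (fun b : B i => (b, 0) : tsum_obj i).
Proof. by move=> a x y; congr pair => /=; rewrite scaler0 addr0. Qed.
Fact tin_subproof i j (e : i + 1 = j) (x : B i) :
  mkLin (@tin_linear j) (cd B e x) = cd tsum e (mkLin (@tin_linear i) x).
Proof. by rewrite tsum_dE /= !linear0 addr0. Qed.
Definition tin : cmap B tsum := @CMap R B tsum (fun i => mkLin (@tin_linear i)) tin_subproof.

Fact tout_linear i : linear (fun p : tsum_obj i => p.2).
Proof. by []. Qed.
Definition tout : cmap tsum C :=
  @CMap R tsum C (fun i => mkLin (@tout_linear i)) (fun _ _ _ _ => erefl).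

Lemma tinE i (b : B i) : tin i b = (b, 0).
Proof. by []. Qed.
Lemma toutE i (p : tsum i) : tout i p = p.2.
Proof. by []. Qed.

Lemma tses : ses tin tout.
Proof.
split=> [n x [] //|n y|n x //|n [x y] /= ->]; last by exists x.
by exists (0, y).
Qed.

Section TsumOut.
Variables (D : cplx R) (f : cmap B D) (h : forall i, {linear C i -> D i}).
Variable hH : forall i j (e : i + 1 = j) x, h j (cd C e x) + f j (tw q e x) = cd D e (h i x).
Fact tsum_map_linear i : linear (fun p : tsum_obj i => f i p.1 + h i p.2).
Proof. by move=> a x y; rewrite /= !linearP /= scalerDr addrACA. Qed.
Fact tsum_map_subproof i j (e : i + 1 = j) (p : tsum i) :
  mkLin (@tsum_map_linear j) (cd tsum e p) = cd D e (mkLin (@tsum_map_linear i) p).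
Proof. by rewrite tsum_dE /= !linearD /= -hH cfunC -addrA [f j (tw q _ _) + _]addrC. Qed.
(** By [hH], the graded map [h] is a null-homotopy of the composite of [f] with the twist; this is
    what extends [f] over the twisted sum. *)
Definition tsum_map : cmap tsum D :=
  @CMap R tsum D (fun i => mkLin (@tsum_map_linear i)) tsum_map_subproof.
End TsumOut.

End TwistedSum.

Section KCone.
Variables (A B : cplx R) (f : cmap A B).

Definition twcone_fun i j (e : i + 1 = j) : {linear shift 1 A i -> B j} :=
  f j \o (cc A e : {linear (shift 1 A) i -> A j}).
Fact twcone_subproof i j k (e : i + 1 = j) (e' : j + 1 = k) (x : shift 1 A i) :
  cd B e' (twcone_fun e x) + twcone_fun e' (cd (shift 1 A) e x) = 0.
Proof.
have E : i + 1 + 1 = k by rewrite e.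
by rewrite /= -cfunC (cc_cd _ _ E) /ksgn /= linearN (cd_cc _ _ E) linearN subrr.
Qed.
Definition twcone : twist B (shift 1 A) := Twist twcone_subproof.
(** The complex [cone f] presented as a twisted sum. Its differential unfolds for every proof of
    [i + 1 = j], whereas that of [cone] is defined by matching on such a proof. *)
Definition kone : cplx R := tsum twcone.

Lemma twconeE i j (e : i + 1 = j) (x : shift 1 A i) : tw twcone e x = f j (cc A e x).
Proof. by []. Qed.

Lemma kone_dE i j (e : i + 1 = j) (p : kone i) :
  cd kone e p = (cd B e p.1 + f j (cc A e p.2), - cd A (shift_index 1 e) p.2).
Proof. by []. Qed.

Fact cone_kone_subproof i j (e : i + 1 = j) (x : cone f i) :
  (cd (cone f) e x : kone j) = cd kone e (x : kone i).
Proof.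
case: j / e; rewrite tsum_dE /= /ksgn /=; congr pair => /=.
by congr (- _); apply: cd_irr.
Qed.
End KCone.
End ExactSequences.

(** * Submodules, products and direct sums *)

Section FiniteSupport.
Variables (I : Type) (V : zmodType).
Implicit Types (F G : I -> V) (s : seq {classic I}).

(** [{classic I}] gives an arbitrary index type a boolean equality, so that a finite support can be
    a list. *)
Definition supp_in F s : Prop := forall t : {classic I}, t \notin s -> F t = 0.
Definition finsupp F : Prop := exists s, supp_in F s.

(** The sum of a finitely supported family ([0] if the support is infinite). *)
Definition fsum F : V :=
  if pselect (finsupp F) is left h then \sum_(t <- undup (sval (cid h))) F t else 0.

Lemma supp_big F s1 s2 : uniq s1 -> uniq s2 -> {subset s1 <= s2} ->
  supp_in F s1 -> \sum_(t <- s1) F t = \sum_(t <- s2) F t.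
Proof.
move=> u1 u2 s12 F1.
rewrite -(perm_big _ (permEl (perm_filterC (mem s1) s2))) big_cat /=.
rewrite [X in _ + X]big_seq [X in _ + X]big1 ?addr0; last first.
  by move=> t; rewrite mem_filter => /andP[/= /F1].
apply: perm_big; apply: uniq_perm => //; first exact: filter_uniq.
by move=> t; rewrite mem_filter /=; case: (boolP (t \in s1)) => //= /s12 ->.
Qed.

Lemma fsumE F s : supp_in F s -> fsum F = \sum_(t <- undup s) F t.
Proof.
move=> Fs; rewrite /fsum; case: pselect => [h|[]]; last by exists s.
case: (cid h) => s' /= Fs'.
have key r r' : supp_in F r ->
    \sum_(t <- undup r) F t = \sum_(t <- undup (r ++ r')) F t.
  move=> Fr; apply: supp_big; rewrite ?undup_uniq //.
    by move=> t; rewrite !mem_undup mem_cat => ->.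
  by move=> t; rewrite mem_undup; apply: Fr.
rewrite (key _ s Fs') (key _ s' Fs); apply: perm_big.
by apply: uniq_perm; rewrite ?undup_uniq // => t; rewrite !mem_undup !mem_cat orbC.
Qed.

Lemma fsum1 F t0 : (forall t, t <> t0 -> F t = 0) -> fsum F = F t0.
Proof.
move=> H; rewrite (@fsumE _ [:: t0 : {classic I}]) /= ?big_seq1 //.
by move=> t; rewrite inE => /eqP; apply: H.
Qed.

Lemma fsum0 F : (forall t, F t = 0) -> fsum F = 0.
Proof. by move=> H; rewrite (@fsumE _ [::]) ?big_nil // => t _. Qed.

Lemma supp_catl F s s' : supp_in F s -> supp_in F (s ++ s').
Proof. by move=> H t; rewrite mem_cat negb_or => /andP[/H]. Qed.
Lemma supp_catr F s s' : supp_in F s -> supp_in F (s' ++ s).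
Proof. by move=> H t; rewrite mem_cat negb_or => /andP[_ /H]. Qed.

Arguments supp_catl {F s} s' _ [t] _.
Arguments supp_catr {F s} s' _ [t] _.

Lemma fsumD F G : finsupp F -> finsupp G -> fsum (fun t => F t + G t) = fsum F + fsum G.
Proof.
move=> [s Fs] [s' Gs].
rewrite (fsumE (supp_catl s' Fs)) (fsumE (supp_catr s Gs)) -big_split /=.
by apply: fsumE => t ts; rewrite (supp_catl s' Fs ts) (supp_catr s Gs ts) addr0.
Qed.
End FiniteSupport.

Lemma finsupp_map (I : Type) (V W : zmodType) (F : I -> V) (f : I -> V -> W) :
  (forall t, f t 0 = 0) -> finsupp F -> finsupp (fun t => f t (F t)).
Proof. by move=> f0 [s Fs]; exists s => t ts; rewrite Fs. Qed.

Lemma fsum_map (I : Type) (V W : zmodType) (F : I -> V) (f : V -> W) :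
  f 0 = 0 -> {morph f : x y / x + y} -> finsupp F -> f (fsum F) = fsum (fun t => f (F t)).
Proof.
move=> f0 fD [s Fs]; rewrite (fsumE Fs) (@fsumE _ _ _ s); last by move=> t /Fs ->.
exact: big_morph.
Qed.

Section Submodules.
Variables (R : pzRingType) (V : lmodType R) (P : V -> Prop).

Definition is_submod : Prop := P 0 /\ forall a x y, P x -> P y -> P (a *: x + y).

(** The proof of closure is an argument of the type, so that the module structure can be recovered
    from the type alone. *)
Definition submod (H : is_submod) : Type := {x : V | P x}.

Variable H : is_submod.
Local Notation S := (submod H).

HB.instance Definition _ := gen_eqMixin S.
HB.instance Definition _ := gen_choiceMixin S.

Definition subval (x : S) : V := sval x.

Lemma subval_inj : injective subval.
Proof. by case=> x px [y py] /= xy; subst y; congr exist; apply: Prop_irrelevance. Qed.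

Fact submodD x y : P x -> P y -> P (x + y).
Proof. by case: H => _ HP px py; have := HP 1 _ _ px py; rewrite scale1r. Qed.
Fact submodN x : P x -> P (- x).
Proof. by case: H => P0 HP px; have := HP (-1) _ _ px P0; rewrite scaleN1r addr0. Qed.
Fact submodZ a x : P x -> P (a *: x).
Proof. by case: H => P0 HP px; have := HP a _ _ px P0; rewrite addr0. Qed.

Definition sub_add (x y : S) : S := exist _ _ (submodD (svalP x) (svalP y)).
Definition sub_opp (x : S) : S := exist _ _ (submodN (svalP x)).
Definition sub_zero : S := exist _ _ (proj1 H).
Definition sub_scale (a : R) (x : S) : S := exist _ _ (submodZ a (svalP x)).

Fact sub_addA : associative sub_add.
Proof. by move=> x y z; apply: subval_inj; apply: addrA. Qed.
Fact sub_addC : commutative sub_add.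
Proof. by move=> x y; apply: subval_inj; apply: addrC. Qed.
Fact sub_add0 : left_id sub_zero sub_add.
Proof. by move=> x; apply: subval_inj; apply: add0r. Qed.
Fact sub_addN : left_inverse sub_zero sub_opp sub_add.
Proof. by move=> x; apply: subval_inj; apply: addNr. Qed.
HB.instance Definition _ := GRing.isZmodule.Build S sub_addA sub_addC sub_add0 sub_addN.

Fact sub_scaleA a b x : sub_scale a (sub_scale b x) = sub_scale (a * b) x.
Proof. by apply: subval_inj; apply: scalerA. Qed.
Fact sub_scale1 : left_id 1 sub_scale.
Proof. by move=> x; apply: subval_inj; apply: scale1r. Qed.
Fact sub_scaleDr : right_distributive sub_scale +%R.
Proof. by move=> a x y; apply: subval_inj; apply: scalerDr. Qed.
Fact sub_scaleDl x : {morph sub_scale^~ x : a b / a + b}.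
Proof. by move=> a b; apply: subval_inj; apply: scalerDl. Qed.
HB.instance Definition _ := GRing.Zmodule_isLmodule.Build R S
  sub_scaleA sub_scale1 sub_scaleDr sub_scaleDl.

Fact subval_linear : linear subval.
Proof. by []. Qed.
Definition sublin : {linear S -> V} := mkLin subval_linear.

Definition mksub (x : V) (px : P x) : S := exist _ x px.
Lemma mksubK x (px : P x) : sublin (mksub px) = x.
Proof. by []. Qed.
Lemma sublinP (x : S) : P (sublin x).
Proof. exact: svalP. Qed.
Lemma sublin_inj : injective sublin.
Proof. exact: subval_inj. Qed.

Section Corestriction.
Variables (W : lmodType R) (f : {linear W -> V}) (fP : forall x, P (f x)).
Fact subco_linear : linear (fun x => mksub (fP x)).
Proof. by move=> a x y; apply: subval_inj; rewrite /= linearP. Qed.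
Definition subco : {linear W -> S} := mkLin subco_linear.
End Corestriction.
End Submodules.

Section SubComplexes.
Variables (R : pzRingType) (M : cplx R) (P : forall i, M i -> Prop).
Variables (HP : forall i, is_submod (@P i))
  (Pd : forall i j (e : i + 1 = j) x, P x -> P (cd M e x)).

Definition subc_d i j (e : i + 1 = j) : {linear submod (HP i) -> submod (HP j)} :=
  @subco _ _ _ (HP j) _ (cd M e \o sublin (HP i)) (fun x => Pd e (sublinP x)).
Fact subc_subproof i j k (e : i + 1 = j) (e' : j + 1 = k) x : subc_d e' (subc_d e x) = 0.
Proof. by apply: sublin_inj; apply: cdd. Qed.
Definition subc : cplx R := @Cplx R (fun i => submod (HP i)) subc_d subc_subproof.
Definition subc_in : cmap subc M :=
  @CMap R subc M (fun i => sublin (HP i)) (fun _ _ _ _ => erefl).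
Lemma subc_in_inj i : injective (subc_in i).
Proof. exact: sublin_inj. Qed.
Lemma subc_inP i (x : subc i) : P (subc_in i x).
Proof. exact: sublinP. Qed.

Section Corestriction.
Variables (N : cplx R) (f : cmap N M) (fP : forall i x, P (f i x)).
Fact subc_co_subproof i j (e : i + 1 = j) x :
  subco (HP j) (@fP j) (cd N e x) = cd subc e (subco (HP i) (@fP i) x).
Proof. by apply: sublin_inj; apply: cfunC. Qed.
Definition subc_co : cmap N subc := @CMap R N subc (fun i => subco (HP i) (@fP i)) subc_co_subproof.
Lemma subc_coE i x : subc_in i (subc_co i x) = f i x.
Proof. by []. Qed.
End Corestriction.
End SubComplexes.

Section Families.
Variables (R : pzRingType) (I : Type) (M : I -> cplx R).

Fact cprod_linear i j (e : i + 1 = j) :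
  linear (fun x : dprod (fun t => M t i) => (fun t => cd (M t) e (x t)) : dprod (fun t => M t j)).
Proof. by move=> a x y; apply: functional_extensionality_dep => t; apply: linearP. Qed.
Fact cprod_subproof i j k (e : i + 1 = j) (e' : j + 1 = k) (x : dprod (fun t => M t i)) :
  (fun t => cd (M t) e' (cd (M t) e (x t))) = 0 :> dprod (fun t => M t k).
Proof. by apply: functional_extensionality_dep => t; apply: cdd. Qed.
Definition cprod : cplx R :=
  @Cplx R (fun i => dprod (fun t => M t i)) (fun i j e => mkLin (cprod_linear e)) cprod_subproof.

Fact pproj_linear t i : linear (fun x : dprod (fun t => M t i) => x t).
Proof. by []. Qed.
Definition pproj t : cmap cprod (M t) :=
  @CMap R cprod (M t) (fun i => mkLin (@pproj_linear t i)) (fun _ _ _ _ => erefl).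

Lemma cprod_eq i (x y : cprod i) : (forall t, pproj t i x = pproj t i y) -> x = y.
Proof. by move=> H; apply: functional_extensionality_dep. Qed.

Section Tuple.
Variables (N : cplx R) (f : forall t, cmap N (M t)).
Fact ptuple_linear i : linear (fun x => (fun t => f t i x) : dprod (fun t => M t i)).
Proof. by move=> a x y; apply: functional_extensionality_dep => t; apply: linearP. Qed.
Fact ptuple_subproof i j (e : i + 1 = j) (x : N i) :
  mkLin (@ptuple_linear j) (cd N e x) = cd cprod e (mkLin (@ptuple_linear i) x).
Proof. by apply: functional_extensionality_dep => t; apply: cfunC. Qed.
Definition ptuple : cmap N cprod := @CMap R N cprod (fun i => mkLin (@ptuple_linear i)) ptuple_subproof.
Lemma ptupleE t i x : pproj t i (ptuple i x) = f t i x.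
Proof. by []. Qed.
End Tuple.

Definition psupp i (x : cprod i) : Prop :=
  exists s : seq {classic I}, forall t : {classic I}, t \notin s -> pproj t i x = 0.

Fact dsumc_submod i : is_submod (@psupp i).
Proof.
split=> [|a x y [s xs] [s' ys']]; first by exists [::].
exists (s ++ s') => t; rewrite mem_cat negb_or => /andP[/xs xt /ys' yt].
by rewrite linearP xt yt scaler0 addr0.
Qed.
Fact dsumc_d i j (e : i + 1 = j) (x : cprod i) : psupp x -> psupp (cd cprod e x).
Proof. by case=> s xs; exists s => t /xs xt; rewrite cfunC xt linear0. Qed.

(** Cut out of the product by finite support, so that components and equality are those of families.
    The index type is arbitrary, since cells are attached along all available maps at once. *)
Definition dsumc : cplx R := subc dsumc_submod dsumc_d.
Definition dsum_in : cmap dsumc cprod := subc_in _ _.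
Definition dproj t : cmap dsumc (M t) := ccomp (pproj t) dsum_in.

Lemma dsum_eq i (x y : dsumc i) : (forall t, dproj t i x = dproj t i y) -> x = y.
Proof. by move=> H; apply: subc_in_inj; apply: cprod_eq. Qed.

Lemma dsum_supp i (x : dsumc i) :
  exists s : seq {classic I}, forall t : {classic I}, t \notin s -> dproj t i x = 0.
Proof. exact: (subc_inP x). Qed.

Definition single t i (x : M t i) : cprod i := fun t' =>
  if pselect (t = t') is left e then
    match e in _ = t' return M t' i with erefl => x end
  else 0.

Lemma single_eq t i (x : M t i) : single x t = x.
Proof. by rewrite /single; case: pselect => // e; rewrite (Prop_irrelevance e erefl). Qed.
Lemma single_neq t t' i (x : M t i) : t <> t' -> single x t' = 0.
Proof. by move=> H; rewrite /single; case: pselect. Qed.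

Fact single_linear t i : linear (@single t i).
Proof.
move=> a x y; apply: functional_extensionality_dep => t'.
have [e|ne] := pselect (t = t').
  by subst t'; rewrite single_eq -[RHS]/(a *: single x t + single y t) !single_eq.
by rewrite single_neq // -[RHS]/(a *: single x t' + single y t') !single_neq // scaler0 addr0.
Qed.
Fact single_supp t i (x : M t i) : psupp (mkLin (@single_linear t i) x).
Proof.
exists [:: t : {classic I}] => t'; rewrite inE => /eqP ne.
by apply: single_neq => /esym.
Qed.
Fact single_subproof t i j (e : i + 1 = j) (x : M t i) :
  mkLin (@single_linear t j) (cd (M t) e x) = cd cprod e (mkLin (@single_linear t i) x).
Proof.
apply: cprod_eq => t'; rewrite [RHS]cfunC /=.
have [eq|ne] := pselect (t = t'); first by subst t'; rewrite !single_eq.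
by rewrite !single_neq // linear0.
Qed.
Definition psingle t : cmap (M t) cprod :=
  @CMap R (M t) cprod (fun i => mkLin (@single_linear t i)) (@single_subproof t).
Definition dinj t : cmap (M t) dsumc := @subc_co _ _ _ _ _ _ (psingle t) (@single_supp t).

Lemma dprojK t i (x : M t i) : dproj t i (dinj t i x) = x.
Proof. exact: single_eq. Qed.
Lemma dproj_neq t t' i (x : M t i) : t <> t' -> dproj t' i (dinj t i x) = 0.
Proof. exact: single_neq. Qed.

Lemma dsumE i (x : dsumc i) : x = fsum (fun t => dinj t i (dproj t i x)).
Proof.
have [s xs] := dsum_supp x.
apply: dsum_eq => t'; rewrite (@fsum_map _ _ _ _ (dproj t' i)); last 1 first.
- by exists s => t /xs ->; rewrite linear0.
- by rewrite (@fsum1 _ _ _ t') ?dprojK // => t ne; rewrite dproj_neq.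
- exact: linear0.
exact: linearD.
Qed.

Section LinearOut.
Variables (i : int) (W : lmodType R) (f : forall t, {linear M t i -> W}).
Fact dlin_finsupp (x : dsumc i) : finsupp (fun t => f t (dproj t i x)).
Proof. by have [s xs] := dsum_supp x; exists s => t /xs ->; rewrite linear0. Qed.
Fact dlin_linear : linear (fun x : dsumc i => fsum (fun t => f t (dproj t i x))).
Proof.
move=> a x y; rewrite (@fsum_map _ _ _ _ ( *:%R a)) ?scaler0 //; first last.
- exact: dlin_finsupp.
- exact: scalerDr.
rewrite -fsumD; first 1 last.
- by have [s xs] := dlin_finsupp x; exists s => t /xs ->; rewrite scaler0.
- exact: dlin_finsupp.
by congr fsum; apply: funext => t; rewrite !linearP.
Qed.
Definition dlin : {linear dsumc i -> W} := mkLin dlin_linear.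
Lemma dlinE t x : dlin (dinj t i x) = f t x.
Proof.
rewrite /= (@fsum1 _ _ _ t) ?single_eq // => t' ne.
by rewrite single_neq ?linear0 // => /esym.
Qed.
End LinearOut.

Lemma dlin_ext i (W : lmodType R) (f g : {linear dsumc i -> W}) :
  (forall t x, f (dinj t i x) = g (dinj t i x)) -> f =1 g.
Proof.
move=> H x; rewrite (dsumE x) /=; have [s xs] := dsum_supp x.
have fs : finsupp (fun t => dinj t i (dproj t i x)).
  by exists s => t /xs ->; rewrite linear0.
rewrite (@fsum_map _ _ _ _ f) // ?(@fsum_map _ _ _ _ g) ?linear0 //; try exact: linearD.
by congr fsum; apply: funext => t; apply: H.
Qed.

Section Copair.
Variables (N : cplx R) (f : forall t, cmap (M t) N).
Fact dcopair_subproof i j (e : i + 1 = j) (x : dsumc i) :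
  dlin (fun t => f t j) (cd dsumc e x) = cd N e (dlin (fun t => f t i) x).
Proof.
rewrite -[LHS]/((dlin (fun t => f t j) \o cd dsumc e) x).
rewrite -[RHS]/((cd N e \o dlin (fun t => f t i)) x).
apply: dlin_ext => t {}x.
rewrite -[LHS]/(dlin (fun t => f t j) (cd dsumc e (dinj t i x))) -(cfunC (dinj t)) dlinE.
by rewrite -[RHS]/(cd N e (dlin (fun t => f t i) (dinj t i x))) dlinE cfunC.
Qed.
Definition dcopair : cmap dsumc N := @CMap R dsumc N (fun i => dlin (fun t => f t i)) dcopair_subproof.
Lemma dcopairE t i x : dcopair i (dinj t i x) = f t i x.
Proof. exact: dlinE. Qed.
End Copair.

End Families.

(** * Complexes of homomorphisms *)

Local Notation cid := Defs.cid.
Lemma ksgn0 n (V : zmodType) : ksgn n (0 : V) = 0.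
Proof. by rewrite /ksgn oppr0 if_same. Qed.
Lemma ksgnK n (V : zmodType) (x : V) : ksgn n (ksgn n x) = x.
Proof. by rewrite /ksgn; case: (odd _); rewrite ?opprK. Qed.
Lemma ksgnB n (V : zmodType) (x y : V) : ksgn n (x - y) = ksgn n x - ksgn n y.
Proof. by rewrite ksgnD ksgnN. Qed.
Lemma ksgnNn n (V : zmodType) (x : V) : ksgn (- n) x = ksgn n x.
Proof. by rewrite /ksgn abszN. Qed.
Lemma ksgn_succ n n' (V : zmodType) (x : V) : n + 1 = n' -> ksgn n' x = - ksgn n x.
Proof. by move=> <-; rewrite addrC ksgn_add ksgn1. Qed.
Lemma ksgn_inj n (V : zmodType) (x : V) : ksgn n x = 0 -> x = 0.
Proof. by move=> H; rewrite -(ksgnK n x) H ksgn0. Qed.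

Section HomComplex.
Variables (K : fieldType) (L : falgType K).
Local Notation cpx := (cplx L^c).
Implicit Types A B C D : cpx.

Lemma hom_mid (R : pzRingType) A B C (a b i k : int) (F : forall j, i + a = j -> A i -> B j)
  (G : forall j, j + b = k -> B j -> C k) j j' e1 e2 e1' e2' x :
  G j e2 (F j e1 x) = G j' e2' (F j' e1' x).
Proof. by case: j / e1 e2 => e2; case: j' / e1' e2' => e2'; rewrite (eq_irrelevance e2 e2'). Qed.

(** The indexing by proofs of [i + n = j] is that of [end_obj]: the graded pieces of [HomC U U] and
    of [endDG U] agree by conversion, and [cdGE] matches the differentials. *)
Definition hob A B (n : int) : lmodType K :=
  dprod (fun t : end_index n => linHom (A (ei_src t)) (B (ei_tgt t)) : lmodType K).

Definition hx A B n (f : hob A B n) i j (e : i + n = j) : {linear A i -> B j} :=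
  hfun (f (EndIndex e)).

Lemma hext A B n (f g : hob A B n) :
  (forall i j (e : i + n = j) x, hx f e x = hx g e x) -> f = g.
Proof.
by move=> H; apply: functional_extensionality_dep => -[i j e]; apply: lin_eq => x; apply: H.
Qed.

Lemma hx_eq A B n (f g : hob A B n) (H : f = g) i j (e : i + n = j) x : hx f e x = hx g e x.
Proof. by rewrite H. Qed.

Definition mkh A B n (F : forall i j, i + n = j -> {linear A i -> B j}) : hob A B n :=
  fun t => F _ _ (ei_deg t).
Lemma mkhE A B n (F : forall i j, i + n = j -> {linear A i -> B j}) i j (e : i + n = j) x :
  hx (mkh F) e x = F i j e x.
Proof. by []. Qed.

Lemma hx_irr A B n (f : hob A B n) i j (e e' : i + n = j) x : hx f e x = hx f e' x.
Proof. by rewrite (eq_irrelevance e e'). Qed.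
Lemma hxD A B n (f g : hob A B n) i j (e : i + n = j) x :
  hx (f + g) e x = hx f e x + hx g e x.
Proof. by []. Qed.
Lemma hxN A B n (f : hob A B n) i j (e : i + n = j) x : hx (- f) e x = - hx f e x.
Proof. by []. Qed.
Lemma hxZ A B n c (f : hob A B n) i j (e : i + n = j) x :
  hx (c *: f) e x = calg L c *: hx f e x.
Proof. by []. Qed.
Lemma hx0 A B n i j (e : i + n = j) x : hx (0 : hob A B n) e x = 0.
Proof. by []. Qed.
Lemma hx_sgn A B n m (f : hob A B n) i j (e : i + n = j) x :
  hx (ksgn m f) e x = ksgn m (hx f e x).
Proof. by rewrite /ksgn; case: (odd _). Qed.
Lemma hx_sum A B n (I : Type) (s : seq I) (F : I -> hob A B n) i j (e : i + n = j) x :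
  hx (\sum_(t <- s) F t) e x = \sum_(t <- s) hx (F t) e x.
Proof. by elim/big_rec2: _ => // t y1 y2 _ <-. Qed.

Fact hdf_key : unit. Proof. exact: tt. Qed.
(* Locked, since its body is a sum that rewriting would otherwise expose. *)
Definition hdf A B n n' (e : n + 1 = n') (f : hob A B n) : hob A B n' :=
  locked_with hdf_key (fun t : end_index n' =>
    lcomp (cd B (end_d_index1 e (ei_deg t))) (hx f (erefl (ei_src t + n)))
    - ksgn n (lcomp (hx f (end_d_index2 e (ei_deg t)))
                    (cd A (erefl (ei_src t + 1)))) : linHom _ _).

Lemma hdfE A B n n' (e : n + 1 = n') (f : hob A B n) i k (ik : i + n' = k) j (e1 : i + n = j)
    (e2 : j + 1 = k) j' (e3 : i + 1 = j') (e4 : j' + n = k) x :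
  hx (hdf e f) ik x = cd B e2 (hx f e1 x) - ksgn n (hx f e4 (cd A e3 x)).
Proof.
rewrite /hdf; case: hdf_key; rewrite /=.
transitivity (cd B (end_d_index1 e ik) (hx f erefl x)
    - ksgn n (hx f (end_d_index2 e ik) (cd A erefl x))).
  by rewrite -(hfun_sgn n (lcomp (hx f (end_d_index2 e ik)) (cd A erefl))).
congr (_ - ksgn n _).
  exact: (@hom_mid L^c A B B n 1 i k (fun j h => hx f h) (fun j h => cd B h)).
exact: (@hom_mid L^c A A B 1 n i k (fun j h => cd A h) (fun j h => hx f h)).
Qed.

Fact hdf_linear A B n n' (e : n + 1 = n') : linear (@hdf A B n n' e).
Proof.
move=> a f g; apply: hext => i k ik x; rewrite (hxD (a *: hdf e f)) (hxZ a (hdf e f)).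
have e2 := end_d_index1 e ik; have e4 := end_d_index2 e ik.
rewrite !(hdfE e _ ik erefl e2 erefl e4) !hxD !hxZ.
by rewrite linearD linearZ ksgnD ksgnZ opprD addrACA scalerDr scalerN.
Qed.

Fact hdf_subproof A B n1 n2 n3 (e : n1 + 1 = n2) (e' : n2 + 1 = n3) (f : hob A B n1) :
  hdf e' (hdf e f) = 0.
Proof.
apply: hext => i k ik x.
have e2 := end_d_index1 e' ik; have e4 := end_d_index2 e' ik.
rewrite (hdfE e' _ ik erefl e2 erefl e4).
have a2 := end_d_index1 e (erefl (i + n2)); have a4 := end_d_index2 e (erefl (i + n2)).
rewrite (hdfE e f erefl erefl a2 erefl a4).
have b4 := end_d_index2 e e4.
rewrite (hdfE e f e4 a4 e2 erefl b4) linearB !cdd sub0r ksgn_lin linear0 !ksgn0 subr0.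
by rewrite (ksgn_succ _ e) opprK addNr hx0.
Qed.

Definition HomC A B : cplx K :=
  @Cplx K (hob A B) (fun n n' e => mkLin (@hdf_linear A B n n' e)) (@hdf_subproof A B).

Lemma hdE A B n n' (e : n + 1 = n') (f : HomC A B n) i k (ik : i + n' = k) j (e1 : i + n = j)
    (e2 : j + 1 = k) j' (e3 : i + 1 = j') (e4 : j' + n = k) x :
  hx (cd (HomC A B) e f : hob A B n') ik x = cd B e2 (hx f e1 x) - ksgn n (hx f e4 (cd A e3 x)).
Proof. exact: hdfE. Qed.

Lemma hcycleP A B n (f : HomC A B n) :
  (forall i j i' j' (e : i + n = j) (e' : i' + n = j') (ei : i + 1 = i') (ej : j + 1 = j') x,
     cd B ej (hx f e x) = ksgn n (hx f e' (cd A ei x))) <-> cycle f.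
Proof.
split=> [H|H i j i' j' e e' ei ej x].
  apply: (@cycle1 _ _ _ _ erefl); apply: hext => i k ik x.
  have e2 := end_d_index1 erefl ik; have e4 := end_d_index2 erefl ik.
  by rewrite (hdE erefl f ik erefl e2 erefl e4) (H _ _ _ _ erefl e4 erefl e2) subrr.
have ik : i + (n + 1) = j' by rewrite -ej -e addrA.
apply/eqP; rewrite -subr_eq0; apply/eqP.
by rewrite -(hdE erefl f ik e ej ei e') H.
Qed.

Definition hcomp A B C n m l (e : n + m = l) (f : hob B C n) (g : hob A B m) : hob A C l :=
  fun t => lcomp (hx f (end_mul_index e (ei_deg t))) (hx g (erefl (ei_src t + m))).

Lemma hcompE A B C n m l (e : n + m = l) (f : hob B C n) (g : hob A B m) i k (ik : i + l = k)
    j (e1 : i + m = j) (e2 : j + n = k) x :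
  hx (hcomp e f g) ik x = hx f e2 (hx g e1 x).
Proof.
exact: (@hom_mid L^c A B C m n i k (fun j h => hx g h) (fun j h => hx f h)).
Qed.

Lemma hcompDl A B C n m l (e : n + m = l) (f f' : hob B C n) (g : hob A B m) :
  hcomp e (f + f') g = hcomp e f g + hcomp e f' g.
Proof. exact: hext. Qed.
Lemma hcompZl A B C n m l (e : n + m = l) c (f : hob B C n) (g : hob A B m) :
  hcomp e (c *: f) g = c *: hcomp e f g.
Proof. exact: hext. Qed.
Lemma hcompDr A B C n m l (e : n + m = l) (f : hob B C n) (g g' : hob A B m) :
  hcomp e f (g + g') = hcomp e f g + hcomp e f g'.
Proof.
apply: hext => a b ab x; have e2 := end_mul_index e ab.
by rewrite hxD !(hcompE e _ _ ab erefl e2) hxD linearD.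
Qed.
Lemma hcompZr A B C n m l (e : n + m = l) c (f : hob B C n) (g : hob A B m) :
  hcomp e f (c *: g) = c *: hcomp e f g.
Proof.
apply: hext => a b ab x; have e2 := end_mul_index e ab.
by rewrite hxZ !(hcompE e _ _ ab erefl e2) hxZ linearZ.
Qed.
Lemma hcomp0l A B C n m l (e : n + m = l) (g : hob A B m) : hcomp e (0 : hob B C n) g = 0.
Proof. exact: hext. Qed.
Lemma hcomp0r A B C n m l (e : n + m = l) (f : hob B C n) : hcomp e f (0 : hob A B m) = 0.
Proof. by have := hcompZr e 0 f (0 : hob A B m); rewrite !scale0r. Qed.
Lemma hcompNl A B C n m l (e : n + m = l) (f : hob B C n) (g : hob A B m) :
  hcomp e (- f) g = - hcomp e f g.
Proof. exact: hext. Qed.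
Lemma hcompNr A B C n m l (e : n + m = l) (f : hob B C n) (g : hob A B m) :
  hcomp e f (- g) = - hcomp e f g.
Proof. by rewrite -scaleN1r hcompZr scaleN1r. Qed.
Lemma hcomp_sgnl A B C n m l (e : n + m = l) k (f : hob B C n) (g : hob A B m) :
  hcomp e (ksgn k f) g = ksgn k (hcomp e f g).
Proof. by rewrite /ksgn; case: (odd _); rewrite ?hcompNl. Qed.

Lemma hcompA A B C D i j k ij jk n (e1 : i + j = ij) (e2 : ij + k = n)
    (e3 : j + k = jk) (e4 : i + jk = n) (f : hob C D i) (g : hob B C j) (h : hob A B k) :
  hcomp e2 (hcomp e1 f g) h = hcomp e4 f (hcomp e3 g h).
Proof.
apply: hext => a b ab x.
have h1 := end_mul_index e2 ab; have h2 := end_mul_index e4 ab.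
rewrite (hcompE e2 _ _ ab erefl h1) (hcompE e4 _ _ ab erefl h2).
have h3 := end_mul_index e3 (erefl (a + jk)).
by rewrite (hcompE e3 _ _ erefl erefl h3) (hcompE e1 _ _ h1 h3 h2).
Qed.

Lemma hd_comp A B C (i j k i' j' k' : int) (e : i + j = k)
    (ei : i + 1 = i') (ej : j + 1 = j') (ek : k + 1 = k')
    (e1 : i' + j = k') (e2 : i + j' = k') (f : HomC B C i) (g : HomC A B j) :
  cd (HomC A C) ek (hcomp e f g)
  = hcomp e1 (cd (HomC B C) ei f) g + ksgn i (hcomp e2 f (cd (HomC A B) ej g)).
Proof.
apply: hext => a b ab x; rewrite hxD hx_sgn.
have h1 := end_d_index1 ek ab; have h2 := end_d_index2 ek ab.
rewrite (hdE ek _ ab erefl h1 erefl h2).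
have m1 := end_mul_index e1 ab; have m2 := end_mul_index e2 ab.
rewrite (hcompE e1 _ _ ab erefl m1) (hcompE e2 _ _ ab erefl m2).
have h3 := end_mul_index e (erefl (a + k)).
rewrite (hcompE e _ _ erefl erefl h3).
have h4 := end_d_index1 ej (erefl (a + j')); have h5 := end_d_index2 ej (erefl (a + j')).
rewrite (hcompE e _ _ h2 h5 m2).
rewrite (hdE ej g erefl erefl h4 erefl h5).
rewrite (hdE ei f m1 h3 h1 h4 m2).
rewrite linearB ksgnD ksgnN addrA subrK; congr (_ - _).
by rewrite -e ksgn_add ksgn_lin.
Qed.

Lemma hcomp_cycle A B C n m l (e : n + m = l) (f : HomC B C n) (g : HomC A B m) :
  cycle f -> cycle g -> cycle (hcomp e f g : HomC A C l).
Proof.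
move=> cf cg; apply: (@cycle1 _ _ _ _ (erefl (l + 1))).
have e1 : n + 1 + m = l + 1 by rewrite -e addrAC.
have e2 : n + (m + 1) = l + 1 by rewrite -e addrA.
by rewrite (hd_comp e erefl erefl erefl e1 e2) cf cg hcomp0l hcomp0r ksgn0 addr0.
Qed.

Lemma hcomp_bdryr A B C n m l (e : n + m = l) (f : HomC B C n) (g : HomC A B m) :
  cycle f -> bdry g -> bdry (hcomp e f g : HomC A C l).
Proof.
move=> cf [j [ej [h ->]]].
have e2 : n + j = l - 1 by rewrite -e -ej addrA addrK.
have e3 : n + 1 + j = l by rewrite -e -ej addrAC addrA.
exists (l - 1), (subrK 1 l), (ksgn n (hcomp e2 f h)).
by rewrite ksgn_lin (hd_comp e2 erefl ej _ e3 e) cf hcomp0l add0r ksgnK.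
Qed.

Lemma hcomp_bdryl A B C n m l (e : n + m = l) (f : HomC B C n) (g : HomC A B m) :
  bdry f -> cycle g -> bdry (hcomp e f g : HomC A C l).
Proof.
move=> [j [ej [h ->]]] cg.
have e2 : j + m = l - 1 by rewrite -e -ej addrAC addrK.
have e3 : j + (m + 1) = l by rewrite -e -ej addrAC addrA.
exists (l - 1), (subrK 1 l), (hcomp e2 h g).
by rewrite (hd_comp e2 ej erefl _ e e3) cg hcomp0r ksgn0 addr0.
Qed.

Definition hid A : hob A A 0 := mkh (fun i j (e : i + 0 = j) => cc A (etrans (esym (addr0 i)) e)).
Lemma hidE A i (e : i + 0 = i) x : hx (hid A) e x = x.
Proof. by rewrite mkhE cc_id. Qed.

Definition c2h A B (f : cmap A B) : hob A B 0 :=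
  mkh (fun i j (e : i + 0 = j) => cc B (etrans (esym (addr0 i)) e) \o f i).
Lemma c2hE A B (f : cmap A B) i (e : i + 0 = i) x : hx (c2h f) e x = f i x.
Proof. by rewrite mkhE /= cc_id. Qed.

Lemma hext0 A B (f g : hob A B 0) :
  (forall i (e : i + 0 = i) x, hx f e x = hx g e x) -> f = g.
Proof.
move=> H; apply: hext => i j e x; have ij : i = j by rewrite -e addr0.
by move: e x; case: j / ij => e x; exact: H.
Qed.

Lemma c2h_cycle A B (f : cmap A B) : cycle (c2h f : HomC A B 0).
Proof.
apply/hcycleP => i j i' j' e e' ei ej x.
have ij : i = j by rewrite -e addr0.
have ij' : i' = j' by rewrite -e' addr0.
move: e e' ej; case: j / ij; case: j' / ij' => e e' ej.
by rewrite !c2hE cfunC; apply: cd_irr.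
Qed.

Lemma hid_cycle A : cycle (hid A : HomC A A 0).
Proof.
have -> : hid A = c2h (Defs.cid A) by apply: hext0 => i e x; rewrite hidE c2hE.
exact: c2h_cycle.
Qed.

Lemma hcomp1r A B n (e : n + 0 = n) (f : hob A B n) : hcomp e f (hid A) = f.
Proof. by apply: hext => a b ab x; rewrite (hcompE e _ _ ab (addr0 a) ab) hidE. Qed.
Lemma hcomp1l A B n (e : 0 + n = n) (f : hob A B n) : hcomp e (hid B) f = f.
Proof. by apply: hext => a b ab x; rewrite (hcompE e _ _ ab ab (addr0 b)) hidE. Qed.

Section H2C.
Variables (A B : cpx) (f : HomC A B 0) (cf : cycle f).
Fact h2c_subproof i j (e : i + 1 = j) (x : A i) :
  hx f (addr0 j) (cd A e x) = cd B e (hx f (addr0 i) x).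
Proof.
by have /hcycleP H := cf; rewrite (H _ _ _ _ (addr0 i) (addr0 j) e e).
Qed.
Definition h2c : cmap A B := CMap h2c_subproof.
Lemma h2cK : c2h h2c = f.
Proof. by apply: hext0 => i e x; rewrite c2hE; apply: hx_irr. Qed.
End H2C.

Section HPost.
Variables (A B C : cpx) (f : cmap B C).
Definition hpost_fun n (g : hob A B n) : hob A C n := mkh (fun i j e => f j \o hx g e).
Fact hpost_linear n : linear (@hpost_fun n).
Proof.
move=> c g h; apply: hext => i j e x.
by rewrite -[LHS]/(f j (hx (c *: g + h) e x)) hxD hxZ linearP.
Qed.
Fact hpost_subproof n n' (e : n + 1 = n') (g : HomC A B n) :
  mkLin (@hpost_linear n') (cd (HomC A B) e g) = cd (HomC A C) e (mkLin (@hpost_linear n) g).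
Proof.
apply: hext => i k ik x; have e2 := end_d_index1 e ik; have e4 := end_d_index2 e ik.
rewrite (hdE e _ ik erefl e2 erefl e4) -[LHS]/(f k (hx (cd (HomC A B) e g : hob A B n') ik x)).
by rewrite (hdE e _ ik erefl e2 erefl e4) linearB ksgn_lin cfunC.
Qed.
Definition hpost : cmap (HomC A B) (HomC A C) :=
  @CMap K (HomC A B) (HomC A C) (fun n => mkLin (@hpost_linear n)) hpost_subproof.
Lemma hpostE n (g : HomC A B n) i j (e : i + n = j) x : hx (hpost n g) e x = f j (hx g e x).
Proof. by []. Qed.
Lemma hpost_comp n (e : 0 + n = n) (g : HomC A B n) : hpost n g = hcomp e (c2h f) g.
Proof.
by apply: hext => i j ij x; rewrite (hcompE e _ _ ij ij (addr0 j)) c2hE hpostE.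
Qed.
End HPost.

Section HPre.
Variables (A' A B : cpx) (f : cmap A' A).
Definition hpre_fun n (g : hob A B n) : hob A' B n := mkh (fun i j e => hx g e \o f i).
Fact hpre_linear n : linear (@hpre_fun n).
Proof. by move=> c g h; apply: hext => i j e x. Qed.
Fact hpre_subproof n n' (e : n + 1 = n') (g : HomC A B n) :
  mkLin (@hpre_linear n') (cd (HomC A B) e g) = cd (HomC A' B) e (mkLin (@hpre_linear n) g).
Proof.
apply: hext => i k ik x; have e2 := end_d_index1 e ik; have e4 := end_d_index2 e ik.
rewrite (hdE e _ ik erefl e2 erefl e4) -[LHS]/(hx (cd (HomC A B) e g : hob A B n') ik (f i x)).
rewrite (hdE e _ ik erefl e2 erefl e4).
by rewrite -cfunC.
Qed.
Definition hpre : cmap (HomC A B) (HomC A' B) :=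
  @CMap K (HomC A B) (HomC A' B) (fun n => mkLin (@hpre_linear n)) hpre_subproof.
Lemma hpreE n (g : HomC A B n) i j (e : i + n = j) x : hx (hpre n g) e x = hx g e (f i x).
Proof. by []. Qed.
End HPre.

(** Vanishing of [Hom(A, Sigma^m B)] in the homotopy category. *)
Definition hv A B (m : int) : Prop := cohom0 (HomC A B) m.

Section Tsum.
Variables (B C : cpx) (q : twist B C).

(** A twisted sum splits in every degree, so [Hom(A, -)], and below [Hom(-, D)], preserve its exact
    sequence for all [A] and [D]. *)
Lemma hses_post A : ses (hpost A (tin q)) (hpost A (tout q)).
Proof.
split=> [n f H|n f|n f|n f H].
- by apply: hext => i j e x; have := f_equal (fun g : hob _ _ _ => hx g e x) H => -[].
- exists (mkh (fun i j e => mkLin (fun a x y => congr2 pair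
     (etrans (esym (addr0 0)) (congr1 (+%R^~ 0) (esym (scaler0 _ a)))) (linearP (hx f e) a x y)
     : (0, hx f e (a *: x + y)) = a *: (0, hx f e x) + (0, hx f e y) :> tsum q j))).
  exact: hext.
- exact: hext.
exists (mkh (fun i j e => mkLin (fun a x y => congr1 fst (linearP (hx f e) a x y)
   : (hx f e (a *: x + y) : tsum q j).1
     = a *: (hx f e x : tsum q j).1 + (hx f e y : tsum q j).1))).
apply: hext => i j e x; rewrite hpostE tinE mkhE /=.
have : (hx f e x : tsum q j).2 = 0.
  exact: (f_equal (fun g : hob _ _ _ => hx g e x) H).
by case: (hx f e x) => a b /= ->.
Qed.

Lemma hses_pre D : ses (hpre D (tout q)) (hpre D (tin q)).
Proof.
split=> [n f H|n f|n f|n f H].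
- apply: hext => i j e x.
  by have := f_equal (fun g : hob _ _ _ => hx g e ((0, x) : tsum q i)) H.
- exists (mkh (fun i j e => mkLin (fun a (x y : tsum q i) => linearP (hx f e) a x.1 y.1))).
  exact: hext.
- by apply: hext => i j e x; rewrite !hpreE tinE toutE linear0.
have L0 i j (e : i + n = j) : linear (fun x => hx f e ((0, x) : tsum q i)).
  move=> a x y; rewrite -linearP; congr (hx f e _); congr pair => /=.
  by rewrite scaler0 addr0.
exists (mkh (fun i j e => mkLin (L0 i j e))).
apply: hext => i j e [x y]; rewrite hpreE mkhE /=.
have h0 : hx f e ((x, 0) : tsum q i) = 0.
  exact: (f_equal (fun g : hob _ _ _ => hx g e x) H).
have xy : (x, y) = (x, 0) + (0, y) :> tsum q i.
  by congr pair => /=; rewrite ?addr0 ?add0r.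
by rewrite xy linearD h0 add0r.
Qed.

End Tsum.
End HomComplex.

Lemma ksgn_pair n (V W : zmodType) (a : V) (b : W) :
  ksgn n ((a, b) : V * W) = (ksgn n a, ksgn n b).
Proof. by rewrite /ksgn; case: (odd _). Qed.

(** * Closed isomorphisms of nonzero degree *)

Section Shifts.
Variables (K : fieldType) (L : falgType K).
Local Notation cpx := (cplx L^c).
Implicit Types A B C Q : cpx.

(** Invertible closed maps of degree [p]. A complex and its shift are related by one, and Hom
    vanishing is moved along it by composition instead of by transport of degrees. *)
Record giso (p : int) A B := GIso {
  ga : HomC A B p; gp : int; gb : HomC B A gp;
  gpE : p + gp = 0; gpE' : gp + p = 0;
  ga_cycle : cycle ga; gb_cycle : cycle gb;
  gab : hcomp gpE ga gb = hid B; gba : hcomp gpE' gb ga = hid A }.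

Lemma giso_hv_r p A B Q m m' : giso p A B -> m + p = m' -> hv Q A m -> hv Q B m'.
Proof.
case=> a q b e e' ca cb ab ba em H f cf.
have e1 : q + m' = m by rewrite -em addrCA e' addr0.
have e2 : p + m = m' by rewrite addrC.
have -> : f = hcomp e2 a (hcomp e1 b f).
  by rewrite -(@hcompA _ _ _ _ _ _ p q m' 0 m m' e (add0r m') e1 e2) ab hcomp1l.
by apply: hcomp_bdryr => //; apply/H/hcomp_cycle.
Qed.

Lemma giso_hv_l p A B Q m m' : giso p A B -> m + p = m' -> hv B Q m -> hv A Q m'.
Proof.
case=> a q b e e' ca cb ab ba em H f cf.
have e1 : m' + q = m by rewrite -em -addrA e addr0.
have -> : f = hcomp em (hcomp e1 f b) a.
  by rewrite (@hcompA _ _ _ _ _ _ m' q p m 0 m' e1 em e' (addr0 m')) ba hcomp1r.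
by apply: hcomp_bdryl => //; apply/H/hcomp_cycle.
Qed.

Definition giso_sym p A B (g : giso p A B) : giso (gp g) B A :=
  GIso (@gb_cycle _ _ _ g) (@ga_cycle _ _ _ g) (gba g) (gab g).

Section ShiftIso.
Variables (p k : int) (pk : p + k = 0) (A : cpx).
Fact shift_ga_index i j : i + p = j -> i = j + k.
Proof. by move=> <-; rewrite -addrA pk addr0. Qed.
(** The identity on underlying modules. The sign in the differential of [shift] is the one that a
    map of degree [p] needs in order to be a cycle. *)
Definition shift_ga : HomC A (shift k A) p :=
  mkh (fun i j e => cc A (shift_ga_index e) : {linear A i -> shift k A j}).
Definition shift_gb : HomC (shift k A) A k :=
  mkh (fun i j e => cc A e : {linear shift k A i -> A j}).
Lemma shift_gbE i j (e : i + k = j) x : hx shift_gb e x = cc A e x.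
Proof. by []. Qed.
Fact ksgn_pk (V : zmodType) (x : V) : ksgn p x = ksgn k x.
Proof.
have E : p = - k by apply/eqP; rewrite -addr_eq0 pk.
by rewrite E; apply: ksgnNn.
Qed.
Fact shift_ga_cycle : cycle shift_ga.
Proof.
apply/hcycleP => i j i' j' e e' ei ej x; rewrite !mkhE.
have E : i + 1 = j' + k by rewrite -ej (shift_ga_index e) addrAC.
by rewrite (cd_cc _ _ E) /= (cc_cd _ _ E) ksgn_pk.
Qed.
Fact shift_gb_cycle : cycle shift_gb.
Proof.
apply/hcycleP => i j i' j' e e' ei ej x; rewrite !mkhE.
have E : i + k + 1 = j' by rewrite -ej -e.
by rewrite (cc_cd _ _ E) /= ksgn_lin ksgnK (cd_cc _ _ E).
Qed.
Fact shift_pk : k + p = 0.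
Proof. by rewrite addrC. Qed.
Fact shift_gab : hcomp pk shift_ga shift_gb = hid (shift k A).
Proof.
have E i : i + k + p = i by rewrite -addrA shift_pk addr0.
apply: hext0 => i e x; rewrite hidE (hcompE _ _ _ e erefl (E i)) shift_gbE mkhE.
by rewrite cc_id cc_id.
Qed.
Fact shift_gba : hcomp shift_pk shift_gb shift_ga = hid A.
Proof.
have E i : i + p + k = i by rewrite -addrA pk addr0.
apply: hext0 => i e x; rewrite hidE (hcompE _ _ _ e erefl (E i)) shift_gbE mkhE.
by rewrite (cc_cc _ _ erefl).
Qed.
Definition shift_giso : giso p A (shift k A) :=
  GIso shift_ga_cycle shift_gb_cycle shift_gab shift_gba.
End ShiftIso.

Lemma hv_shift_r k Q A m : hv Q (shift k A) m <-> hv Q A (m + k).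
Proof.
split; first exact: (giso_hv_r (giso_sym (shift_giso (addNr k) A))).
by apply: (giso_hv_r (shift_giso (addNr k) A)); rewrite addrK.
Qed.
Lemma hv_shift_l k A Q m : hv (shift k A) Q m <-> hv A Q (m - k).
Proof.
split; first exact: (giso_hv_l (shift_giso (addNr k) A)).
by apply: (giso_hv_l (giso_sym (shift_giso (addNr k) A))); rewrite /= subrK.
Qed.
End Shifts.

Section KCones.
Variable R : pzRingType.
Lemma kone_cv (A B : cplx R) (f : cmap A B) m : cohom0 (kone f) m <-> cv f m.
Proof.
split=> [H m' e z y cz fz|H [b a] cba].
  subst m'.
  have [|j [ej [[b a]]]] := H (y, - z).
    apply: (@cycle1 _ _ _ _ erefl); rewrite kone_dE /= ?cc_id linearN -fz subrr.
    by rewrite linearN opprK cz.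
  rewrite kone_dE /= => -[yE /eqP]; rewrite eqr_oppLR opprK => /eqP zE.
  exists (cc A ej a); first by rewrite zE (cc_cd _ _ (shift_index 1 ej)).
  by rewrite yE addrK; apply: bdry_intro.
have := cba _ erefl; rewrite kone_dE /= ?cc_id => -[db /eqP]; rewrite oppr_eq0 => /eqP da.
have [||x ax bx] := H _ erefl (- a) b.
- by apply: (@cycle1 _ _ _ _ (shift_index 1 erefl)); rewrite linearN da oppr0.
- by rewrite linearN; apply/eqP; rewrite eq_sym -subr_eq0 opprK; apply/eqP.
have [y bE] := bdry_elim (subrK 1 m) bx.
have E : m = m - 1 + 1 by rewrite subrK.
exists (m - 1), (subrK 1 m), ((y, cc A E x) : kone f (m - 1)).
rewrite kone_dE /= (cc_cc _ _ erefl) cc_id -bE subrK; congr pair.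
by rewrite (cc_cd _ _ erefl) -ax opprK.
Qed.
Lemma kone_acyclic (A B : cplx R) (f : cmap A B) : acyclic (kone f) <-> qis f.
Proof.
split=> H; first by apply/qis_cv => m; apply/kone_cv.
by move=> m; apply/kone_cv; move: m; apply/qis_cv.
Qed.

Lemma acyclic_shift k (A : cplx R) : acyclic A -> acyclic (shift k A).
Proof. by move=> H m x /cycle_shift /H /bdry_shift. Qed.
Lemma cohom0_shift k (A : cplx R) m : cohom0 (shift k A) m <-> cohom0 A (m + k).
Proof.
split=> H x; first by move=> cx; apply/bdry_shift/H/cycle_shift.
by move=> /cycle_shift /H /bdry_shift.
Qed.
End KCones.

(** * K-projective complexes and maps into cones *)

Section Resolving.
Variables (K : fieldType) (L : falgType K).
Local Notation cpx := (cplx L^c).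
Implicit Types A B C Q N : cpx.

Definition kproj A : Prop := forall B, acyclic B -> acyclic (HomC A B).
Definition kinj B : Prop := forall A, acyclic A -> acyclic (HomC A B).

Lemma kproj_tsum B C (q : twist B C) : kproj B -> kproj C -> kproj (tsum q).
Proof. by move=> HB HC N aN m; exact: (ses_mid (hses_pre q N) (HC _ aN m) (HB _ aN m)). Qed.

Lemma kproj_shift k A : kproj A -> kproj (shift k A).
Proof. by move=> H B aB m; apply/hv_shift_l/H. Qed.

Lemma kproj_kone A B (f : cmap A B) : kproj A -> kproj B -> kproj (kone f).
Proof. by move=> HA HB; apply: kproj_tsum => //; apply: kproj_shift. Qed.

(** Maps of degree [m] into a cone, as pairs [(y, - z)]. *)
Section IntoCone.
Variables (A B C : cpx) (s : cmap B C).

Fact kl_index (m m' i j : int) : m + 1 = m' -> i + m = j -> i + m' = j + 1.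
Proof. by move=> <-; rewrite addrA => ->. Qed.
Fact kl_linear m m' (e : m + 1 = m') (y : HomC A C m) (z : HomC A B m') i j (ij : i + m = j) :
  linear (fun x => (hx y ij x, - hx z (kl_index e ij) x) : kone s j).
Proof. by move=> a x1 x2; rewrite !linearP; congr pair => /=; rewrite opprD scalerN. Qed.
Definition kl m m' (e : m + 1 = m') (y : HomC A C m) (z : HomC A B m') : HomC A (kone s) m :=
  mkh (fun i j ij => mkLin (kl_linear e y z ij)).

Lemma klE m m' (e : m + 1 = m') (y : HomC A C m) (z : HomC A B m') i j (ij : i + m = j) x :
  hx (kl e y z) ij x = (hx y ij x, - hx z (kl_index e ij) x).
Proof. by []. Qed.

Lemma kl_inj m m' (e : m + 1 = m') (y y' : HomC A C m) (z z' : HomC A B m') :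
  kl e y z = kl e y' z' -> y = y' /\ z = z'.
Proof.
move=> H; split; apply: hext => i k ik x.
  exact: (f_equal fst (hx_eq H ik x)).
have jk : i + m + 1 = k by rewrite -ik -e addrA.
case: k / jk ik => ik.
have /eqP := f_equal snd (hx_eq H (erefl (i + m)) x); rewrite eqr_opp => /eqP.
by rewrite (eq_irrelevance (kl_index e erefl) ik).
Qed.

Lemma kl_surj m m' (e : m + 1 = m') (w : HomC A (kone s) m) : exists (y : HomC A C m) (z : HomC A B m'), w = kl e y z.
Proof.
have lin1 i j (ij : i + m = j) : linear (fun x => (hx w ij x : kone s j).1 : C j).
  by move=> a x1 x2; rewrite linearP.
exists (mkh (fun i j ij => mkLin (lin1 i j ij))).
have idx i k : i + m' = k -> i + m = k - 1 by move=> <-; rewrite -e addrA addrK.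
have lin i k (ik : i + m' = k) :
    linear (fun x => - cc B (subrK 1 k) (hx w (idx _ _ ik) x : kone s (k - 1)).2).
  by move=> a x1 x2; rewrite linearP /= linearP opprD scalerN.
exists (mkh (fun i k ik => mkLin (lin i k ik))).
apply: hext => i j ij x; rewrite klE [X in X = _]surjective_pairing; congr pair.
rewrite mkhE /= opprK; move: (subrK 1 (j + 1)) (idx _ _ _).
have jj : j = j + 1 - 1 by rewrite addrK.
case: (j + 1 - 1) / jj => e1 e2; rewrite (eq_irrelevance e1 erefl).
by rewrite (eq_irrelevance e2 ij).
Qed.

(** Due to the sign on the second component, a cycle into the cone is a cycle [z] together with [y]
    such that [d y = s z]: exactly the data in [cv]. *)
Lemma kl_d m m' m'' (e : m + 1 = m') (e' : m' + 1 = m'')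
    (y : HomC A C m) (z : HomC A B m') :
  cd (HomC A (kone s)) e (kl e y z)
  = kl e' (cd (HomC A C) e y - hpost A s m' z) (- cd (HomC A B) e' z).
Proof.
apply: hext => i k ik x.
have [j ij jk] : exists2 j, i + m = j & j + 1 = k by exists (i + m); rewrite // -ik -e addrA.
case: k / jk ik => ik.
have i'k : i + 1 + m = j + 1 by rewrite -ij addrAC.
rewrite (hdE e _ ik ij erefl erefl i'k) !klE (hxD (cd (HomC A C) e y)) !hxN hpostE.
have i'k1 : i + 1 + m' = j + 1 + 1 by rewrite -ik addrAC.
rewrite (hdE e y ik ij erefl erefl i'k).
rewrite (hdE e' z (kl_index e' ik) ik erefl erefl i'k1) opprK.
apply: etrans (f_equal (fun w => _ - w) (ksgn_pair m _ _)) _; rewrite kone_dE.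
rewrite (eq_irrelevance (kl_index e ij) ik).
congr pair; rewrite /= ?linearN ?opprK ?cc_id; first by rewrite addrAC.
rewrite ksgnN opprK (ksgn_succ _ e) opprK.
by congr (_ + ksgn m _); [apply: cd_irr | apply: hx_irr].
Qed.
End IntoCone.

(** The data [(y, z)] form a cycle in [Hom(A, kone s)], which is acyclic because the cone is; a
    primitive of this cycle contains both the lift of [z] and the remaining homotopy. *)
Lemma kproj_cv A B C (s : cmap B C) : kproj A -> qis s -> forall m, cv (hpost A s) m.
Proof.
move=> HA qs m m' e z y cz sz.
have akl := HA _ (proj2 (kone_acyclic s) qs).
have [|w kE] := bdry_elim (subrK 1 m) (akl m (kl s e y z) _).
  apply: (@cycle1 _ _ _ _ e); rewrite (kl_d _ e erefl) sz subrr cz oppr0.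
  by apply: hext => i j ij x; rewrite klE !hx0 oppr0.
have [y' [z' wE]] := kl_surj (subrK 1 m) w.
move: kE; rewrite wE (kl_d _ (subrK 1 m) e) => /kl_inj [yE zE].
exists (- z'); first by rewrite linearN.
by rewrite yE linearN opprK subrK; apply: bdry_intro.
Qed.
End Resolving.

(** * K-projective, K-injective and perfect complexes *)

Section Families.
Variables (K : fieldType) (L : falgType K).
Local Notation cpx := (cplx L^c).
Implicit Types A B C Q N T : cpx.

Section HomDsum.
Variables (I : Type) (M : I -> cpx).

Definition hcopair N n (h : forall t, HomC (M t) N n) : HomC (dsumc M) N n :=
  mkh (fun i j e => dlin (fun t => hx (h t) e)).
Lemma hcopairE N n (h : forall t, HomC (M t) N n) t i j (e : i + n = j) x :
  hx (hcopair h) e (dinj M t i x) = hx (h t) e x.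
Proof. exact: dlinE. Qed.
Lemma hdsum_ext N n (f g : HomC (dsumc M) N n) :
  (forall t, hpre N (dinj M t) n f = hpre N (dinj M t) n g) -> f = g.
Proof.
move=> H; apply: hext => i j e; apply: dlin_ext => t x.
exact: (f_equal (fun k : hob _ _ _ => hx k e x) (H t)).
Qed.
Lemma hpre_copair N n (h : forall t, HomC (M t) N n) t : hpre N (dinj M t) n (hcopair h) = h t.
Proof. by apply: hext => i j e x; rewrite hpreE hcopairE. Qed.

Lemma hd_copair N n n' (e : n + 1 = n') (h : forall t, HomC (M t) N n) :
  cd (HomC (dsumc M) N) e (hcopair h) = hcopair (fun t => cd (HomC (M t) N) e (h t)).
Proof. by apply: hdsum_ext => t; rewrite cfunC !hpre_copair. Qed.

Lemma hv_dsum_l N n : (forall t, hv (M t) N n) -> hv (dsumc M) N n.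
Proof.
move=> H f cf.
have F t := boolp.cid (bdry_elim (subrK 1 n) (H t _ (cyc_map (hpre N (dinj M t)) cf))).
suff -> : f = cd (HomC (dsumc M) N) (subrK 1 n) (hcopair (fun t => sval (F t))).
  exact: bdry_intro.
by apply: hdsum_ext => t; rewrite cfunC hpre_copair -(svalP (F t)).
Qed.

Fact htuple_linear N n (h : forall t, HomC N (M t) n) i j (e : i + n = j) :
  linear (fun x => (fun t => hx (h t) e x) : cprod M j).
Proof. by move=> a x y; apply: cprod_eq => t; apply: linearP. Qed.
Definition htuple N n (h : forall t, HomC N (M t) n) : HomC N (cprod M) n :=
  mkh (fun i j e => mkLin (htuple_linear h e)).
Lemma hpost_tuple N n (h : forall t, HomC N (M t) n) t : hpost N (pproj M t) n (htuple h) = h t.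
Proof. exact: hext. Qed.
Lemma hprod_ext N n (f g : HomC N (cprod M) n) :
  (forall t, hpost N (pproj M t) n f = hpost N (pproj M t) n g) -> f = g.
Proof.
move=> H; apply: hext => i j e x; apply: cprod_eq => t.
exact: (f_equal (fun k : hob _ _ _ => hx k e x) (H t)).
Qed.
Lemma hd_tuple N n n' (e : n + 1 = n') (h : forall t, HomC N (M t) n) :
  cd (HomC N (cprod M)) e (htuple h) = htuple (fun t => cd (HomC N (M t)) e (h t)).
Proof. by apply: hprod_ext => t; rewrite cfunC !hpost_tuple. Qed.

Lemma hv_prod_r N n : (forall t, hv N (M t) n) -> hv N (cprod M) n.
Proof.
move=> H f cf.
have F t := boolp.cid (bdry_elim (subrK 1 n) (H t _ (cyc_map (hpost N (pproj M t)) cf))).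
suff -> : f = cd (HomC N (cprod M)) (subrK 1 n) (htuple (fun t => sval (F t))).
  exact: bdry_intro.
by apply: hprod_ext => t; rewrite cfunC hpost_tuple -(svalP (F t)).
Qed.

Lemma kproj_dsum : (forall t, kproj (M t)) -> kproj (dsumc M).
Proof. by move=> H B aB m; apply: hv_dsum_l => t; apply: H. Qed.
End HomDsum.

(** Smallness for graded maps, not only for classes: every map into a direct sum, cycle or not, has
    finitely many components, so that sums over cells are finite on the nose. Bounded complexes of
    finitely generated modules have this property. *)
Definition small A : Prop := forall (I : Type) (M : I -> cpx) n (f : HomC A (dsumc M) n),
  exists s : seq {classic I}, forall t : {classic I}, t \notin s -> hpost A (dproj M t) n f = 0.

Lemma small_sum A I (M : I -> cpx) n (f : HomC A (dsumc M) n) (s : seq {classic I}) :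
  (forall t : {classic I}, t \notin s -> hpost A (dproj M t) n f = 0) ->
  f = \sum_(t <- undup s) hpost A (dinj M t) n (hpost A (dproj M t) n f).
Proof.
move=> H; apply: hext => i j e x; rewrite hx_sum.
rewrite [LHS]dsumE; apply: etrans (fsumE (s := s) _) _ => // t /H ft.
by have := hx_eq ft e x; rewrite hpostE hx0 => ->; rewrite linear0.
Qed.

Lemma hv_dsum_r A I (M : I -> cpx) n :
  small A -> (forall t, hv A (M t) n) -> hv A (dsumc M) n.
Proof.
move=> sA H f cf; have [s fs] := sA _ _ _ f.
rewrite (small_sum fs); apply: big_ind => [||t _]; first exact: bdry0.
  exact: bdryD.
by apply/bdry_map/H/cyc_map.
Qed.

Definition hsup A B n i0 j0 (e0 : i0 + n = j0) (k : {linear A i0 -> B j0}) : HomC A B n :=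
  mkh (fun i j e => if pselect (i = i0) is left E then
     (cc B (etrans (esym e0) (etrans (f_equal (+%R^~ n) (esym E)) e)) \o k \o cc A E)
   else (linHom_zero (A i) (B j))).
Lemma hsupE A B n i0 j0 (e0 : i0 + n = j0) (k : {linear A i0 -> B j0}) (e : i0 + n = j0) x :
  hx (hsup e0 k) e x = k x.
Proof. by rewrite mkhE; case: pselect => // E; rewrite /= !cc_id. Qed.
Lemma hsup_neq A B n i0 j0 (e0 : i0 + n = j0) (k : {linear A i0 -> B j0}) i j (e : i + n = j) x :
  i <> i0 -> hx (hsup e0 k) e x = 0.
Proof. by rewrite mkhE; case: pselect. Qed.

(** By the dual basis lemma, these are the finitely generated projective modules. *)
Definition dbasis (V : lmodType L^c) : Prop :=
  exists n (u : 'I_n -> V) (l : 'I_n -> {linear V -> (L^c)^o}), forall x, x = \sum_i (l i x : L^c) *: u i.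

Lemma dbasis_lift (P B C : lmodType L^c) (f : {linear P -> C}) (g : {linear B -> C}) :
  dbasis P -> (forall x, exists b, g b = f x) -> exists h : {linear P -> B}, forall x, g (h x) = f x.
Proof.
move=> [n [u [l uE]]] H.
have F i := boolp.cid (H (u i)).
have Lh : linear (fun x => \sum_i (l i x : L^c) *: sval (F i)).
  move=> a x y; rewrite scaler_sumr -big_split; apply: eq_bigr => i _.
  by rewrite (linearP (l i) a x y : _ = a * (l i x : L^c) + l i y) scalerDl scalerA.
exists (mkLin Lh) => x; rewrite /= linear_sum {2}(uE x) linear_sum; apply: eq_bigr => i _.
by rewrite !linearZ /= (svalP (F i)).
Qed.

Lemma kproj_bounded Q : bounded Q -> (forall i, dbasis (Q i)) -> kproj Q.
Proof.
move=> [a [b ab]] PQ N aN m f cf.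
(* The homotopy is built from the top degree downwards: after [n] steps it is correct above degree
   [b - n]. The remaining error [g] then takes the next module [Q i0] to cycles of [N], hence to
   boundaries, and can be lifted. *)
suff H n : exists h : HomC Q N (m - 1), forall i j (e : i + m = j) x, b - n%:Z < i ->
    hx f e x = hx (cd (HomC Q N) (subrK 1 m) h : hob _ _ _) e x.
  have [h hE] := H (`|b - a| + 1)%N.
  suff -> : f = cd (HomC Q N) (subrK 1 m) h by apply: bdry_intro.
  apply: hext => i j e x; have [|i_le] := ltP (b - (`|b - a| + 1)%N%:Z) i; first exact: hE.
  by rewrite (ab i _ x) ?linear0 //; apply/orP; left; lia.
elim: n => [|n [h hE]].
  exists 0 => i j e x bi; rewrite (ab i _ x) ?linear0 //; apply/orP; right; lia.
pose g : HomC Q N m := f - cd (HomC Q N) (subrK 1 m) h.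
have cg : cycle g by apply: cycleB => //; apply/bdry_cycle/bdry_intro.
pose i0 : int := b - n%:Z; pose j0 := i0 + m.
have g0 i j (e : i + m = j) x : i0 < i -> hx g e x = 0.
  by move=> ii; rewrite hxD hxN -hE ?subrr.
have e0 : i0 + (m - 1) = j0 - 1 by rewrite addrA.
have [|k kE] := @dbasis_lift _ _ _ (hx g (erefl j0)) (cd N (subrK 1 j0)) (PQ i0).
  move=> x; have [|y ->] := bdry_elim (subrK 1 j0) (aN _ (hx g (erefl j0) x) _); last by exists y.
  apply: (@cycle1 _ _ _ _ erefl).
  have e1 : i0 + 1 + m = j0 + 1 by rewrite addrAC.
  have /hcycleP H := cg; rewrite (H _ _ _ _ _ e1 erefl erefl) g0 ?ksgn0 //; lia.
exists (h + hsup e0 k) => i j e x bi; rewrite linearD hxD.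
have ij : i + (m - 1) = j - 1 by rewrite -e addrA.
have i'j : i + 1 + (m - 1) = j by rewrite -e addrACA subrr addr0.
rewrite (hdE _ (hsup e0 k) e ij (subrK 1 j) erefl i'j).
rewrite [hx (hsup e0 k) i'j _]hsup_neq ?ksgn0 ?subr0; last by rewrite /i0 => E; lia.
have [E|ne] := pselect (i = i0); last first.
  by rewrite hsup_neq // linear0 addr0 hE // /i0; lia.
subst i; have E : j0 = j by rewrite -e.
case: j / E e ij i'j => e ij i'j; rewrite hsupE kE (hx_irr g _ e) hxD hxN addrC subrK //.
Qed.

Lemma kinj_bounded T : bounded T -> (forall i, injective_module (T i)) -> kinj T.
Proof.
move=> [a [b ab]] IT N aN m f cf.
(* Now from the bottom degree of the target upwards, extending maps by injectivity instead of
   lifting them. *)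
suff H n : exists h : HomC N T (m - 1), forall i j (e : i + m = j) x, j < a + n%:Z ->
    hx f e x = hx (cd (HomC N T) (subrK 1 m) h : hob _ _ _) e x.
  have [h hE] := H (`|b - a| + 1)%N.
  suff -> : f = cd (HomC N T) (subrK 1 m) h by apply: bdry_intro.
  apply: hext => i j e x; have [|i_le] := ltP j (a + (`|b - a| + 1)%N%:Z); first exact: hE.
  by rewrite [LHS](ab j) ?[RHS](ab j) //; apply/orP; right; lia.
elim: n => [|n [h hE]].
  exists 0 => i j e x bi; rewrite [LHS](ab j) ?[RHS](ab j) //; apply/orP; left; lia.
pose g : HomC N T m := f - cd (HomC N T) (subrK 1 m) h.
have cg : cycle g by apply: cycleB => //; apply/bdry_cycle/bdry_intro.
pose j0 : int := a + n%:Z; pose i0 := j0 - m.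
have g0 i j (e : i + m = j) x : j < j0 -> hx g e x = 0.
  by move=> ii; rewrite hxD hxN -hE ?subrr.
have ij0 : i0 + m = j0 by rewrite subrK.
have e0 : i0 + 1 + (m - 1) = j0 by rewrite addrACA subrr addr0.
have gd x : bdry x -> hx g ij0 x = 0.
  move=> /(bdry_elim (subrK 1 i0)) [y ->].
  have ij1 : i0 - 1 + m = j0 - 1 by rewrite addrAC ij0.
  have /hcycleP H := cg; have := H _ _ _ _ ij1 ij0 (subrK 1 i0) (subrK 1 j0) y.
  rewrite g0 ?linear0; last by lia.
  by move=> /esym /ksgn_inj.
(* [g] kills boundaries in degree [i0], hence cycles, as [N] is acyclic. So it factors through the
   image [Sd] of the differential, and injectivity of [T j0] extends it to [N (i0 + 1)]. *)
have Sd : is_submod (fun z : N (i0 + 1) => exists x : N i0, z = cd N erefl x).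
  split=> [|c x y [x' ->] [y' ->]]; first by exists 0; rewrite linear0.
  by exists (c *: x' + y'); rewrite linearP.
pose k0 (z : submod Sd) := hx g ij0 (sval (boolp.cid (sublinP z))).
have k0E z x : sublin Sd z = cd N erefl x -> k0 z = hx g ij0 x.
  rewrite /k0; case: (boolp.cid _) => y yE xE.
  have yx : cd N (erefl (i0 + 1)) y = cd N erefl x by rewrite -yE.
  suff : hx g ij0 (y - x) = 0 by rewrite linearB => /eqP; rewrite subr_eq0 => /eqP.
  by apply/gd/aN/(@cycle1 _ _ _ _ erefl); rewrite linearB yx subrr.
have k0L : linear k0.
  move=> c x y; have [x' xE] := sublinP x; have [y' yE] := sublinP y.
  rewrite (k0E x x' xE) (k0E y y' yE) -linearP; apply: k0E.
  by rewrite !linearP -xE -yE.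
have [k kE] := IT j0 _ _ (sublin Sd) (mkLin k0L) (@sublin_inj _ _ _ Sd).
have kd x : k (cd N erefl x) = hx g ij0 x.
  have z : exists x0, cd N (erefl (i0 + 1)) x = cd N erefl x0 by exists x.
  by rewrite -(mksubK Sd z) kE; apply: k0E.
(* The sign cancels the one with which a homotopy of degree [m - 1] is composed with the
   differential of [N]. *)
exists (h + ksgn m (hsup e0 k)) => i j e x bi; rewrite linearD hxD ksgn_lin hx_sgn.
have ij : i + (m - 1) = j - 1 by rewrite -e addrA.
have i'j : i + 1 + (m - 1) = j by rewrite -e addrACA subrr addr0.
rewrite (hdE _ (hsup e0 k) e ij (subrK 1 j) erefl i'j).
rewrite [X in ksgn m (_ - X)](_ : _ = - ksgn m (hx (hsup e0 k) i'j (cd N erefl x))); last first.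
  by rewrite (ksgn_succ _ (subrK 1 m)) opprK.
rewrite opprK ksgnD ksgnK (_ : hx (hsup e0 k) ij x = 0) ?linear0 ?ksgn0 ?add0r; last first.
  by apply: hsup_neq; rewrite /i0 /j0 => E; lia.
have [E|ne] := pselect (j = j0); last first.
  rewrite hsup_neq ?addr0 ?hE //; first by rewrite /j0 in ne *; lia.
  by rewrite /i0 => E; apply: ne; lia.
have E' : i0 = i by rewrite /i0 -E -e addrK.
clear bi.
case: i / E' x e ij i'j => x e ij i'j; move: (esym E) => {}E; case: j / E e ij i'j => e ij i'j; rewrite hsupE kd (hx_irr g _ e) hxD hxN addrC subrK //.
Qed.

Lemma small_bounded Q : bounded Q -> (forall i, fin_gen (Q i)) -> small Q.
Proof.
move=> [a [b ab]] gQ I M n f.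
have H i : exists s : seq {classic I}, forall t : {classic I}, t \notin s ->
    forall j (e : i + n = j) x, dproj M t j (hx f e x) = 0.
  have [d [u uE]] := gQ i.
  have S k := boolp.cid (dsum_supp (hx f (erefl (i + n)) (u k))).
  exists (flatten [seq sval (S k) | k <- enum 'I_d]) => t ts j e x; subst j.
  have [c ->] := uE x; rewrite !linear_sum big1 // => k _.
  suff h : dproj M t (i + n) (hx f erefl (u k)) = 0 by rewrite 2!linearZ; move: h => /= ->; rewrite scaler0.
  apply: (svalP (S k)); apply: contra ts => ts; apply/flattenP; exists (sval (S k)) => //.
  by apply: map_f; rewrite mem_enum.
exists (flatten [seq sval (boolp.cid (H (a + k%:Z))) | k <- iota 0 (`|b - a| + 1)%N]) => t ts.
apply: hext => i j e x; rewrite hpostE hx0.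
have [i_out|/norP[]] := boolP ((i < a) || (b < i)).
  by rewrite (ab i i_out x) !linear0.
rewrite -!leNgt => ai ib.
have ik : i = a + (`|i - a|%N)%:Z by lia.
move: x e; rewrite ik => x e.
have Hs := svalP (boolp.cid (H (a + `|i - a|%N%:Z))) t.
apply: Hs; apply: contra ts => ts.
apply/flattenP; exists (sval (boolp.cid (H (a + `|i - a|%N%:Z)))) => //.
by apply/mapP; exists `|i - a|%N; rewrite ?mem_iota; first lia.
Qed.

Lemma dbasis_fin_gen (V : lmodType L^c) : dbasis V -> fin_gen V.
Proof. by move=> [n [u [l H]]]; exists n, u => x; exists (fun i => l i x); exact: H. Qed.

Definition perfb Q : Prop := bounded Q /\ forall i, dbasis (Q i).
Lemma perfb_kproj Q : perfb Q -> kproj Q.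
Proof. by case; apply: kproj_bounded. Qed.
Lemma perfb_small Q : perfb Q -> small Q.
Proof. by case=> bQ dQ; apply: small_bounded => // i; apply: dbasis_fin_gen. Qed.

(** The regular module, as a complex concentrated in degree [0]. *)
Definition RR : cpx := @Cplx L^c (fun i => dprod (fun _ : i = 0 => (L^c)^o))
  (fun i j _ => linHom_zero _ _) (fun _ _ _ _ _ _ => erefl).

Lemma RR_eq i (x y : RR i) : (forall e : i = 0, x e = y e) -> x = y.
Proof. by move=> H; apply: functional_extensionality_dep. Qed.

Lemma RR_perfb : perfb RR.
Proof.
split=> [|i].
  exists 0, 0 => i /orP i0 x; apply: RR_eq => e; lia.
have [e|ne] := pselect (i = 0); last first.
  exists 0%N, (fun _ => 0), (fun _ => linHom_zero _ _) => x.
  by rewrite big_ord0; apply: RR_eq => e.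
exists 1%N, (fun _ => (fun _ => 1) : RR i).
have lin : linear (fun x : RR i => x e : (L^c)^o) by [].
exists (fun _ => mkLin lin) => x; rewrite big_ord1; apply: RR_eq => e' /=.
by rewrite (Prop_irrelevance e' e); apply: esym (mulr1 _).
Qed.

Fact rr_elt_linear (V : lmodType L^c) (x : V) : linear (fun u : RR 0 => (u erefl : L^c) *: x).
Proof. by move=> a u v; rewrite scalerDl scalerA. Qed.
(** Evaluation at one identifies [HomC RR N] with [N]; results on Hom out of a small K-projective
    complex thereby specialise to cohomology. *)
Definition rr_elt N n (x : N n) : HomC RR N n := hsup (add0r n) (mkLin (rr_elt_linear x)).
Definition rr_one : RR 0 := fun _ => 1.
Definition rr_ev N n (f : HomC RR N n) : N n := hx f (add0r n) rr_one.

Lemma rr_eltK N n (x : N n) : rr_ev (rr_elt x) = x.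
Proof. by rewrite /rr_ev hsupE /= scale1r. Qed.

Lemma rr_evK N n (f : HomC RR N n) : rr_elt (rr_ev f) = f.
Proof.
apply: hext => i j e x; have [i0|ne] := pselect (i = 0); last first.
  by rewrite hsup_neq // (_ : x = 0) ?linear0 //; apply: RR_eq => i0.
move: (esym i0) => {}i0; case: i / i0 e x => e x; have jn : n = j by rewrite -e add0r.
case: j / jn e => e; rewrite (eq_irrelevance e (add0r n)) hsupE -[LHS]/(x erefl *: hx f (add0r n) rr_one).
rewrite -linearZ; congr (hx f _ _); apply: RR_eq => e0.
by rewrite (Prop_irrelevance e0 erefl); apply: mulr1.
Qed.

Lemma rr_ev_inj N n (f g : HomC RR N n) : rr_ev f = rr_ev g -> f = g.
Proof. by move=> H; rewrite -(rr_evK f) H rr_evK. Qed.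

Lemma rr_ev_d N n n' (e : n + 1 = n') (f : HomC RR N n) :
  rr_ev (cd (HomC RR N) e f) = cd N e (rr_ev f).
Proof.
have e4 : 0 + 1 + n = n' by rewrite add0r addrC.
rewrite /rr_ev (hdE e f (add0r n') (add0r n) e erefl e4).
by rewrite [cd RR _ _](_ : _ = 0) // linear0 ksgn0 subr0.
Qed.

Lemma rr_cycle N n (f : HomC RR N n) : cycle f <-> cycle (rr_ev f).
Proof.
split=> cf j e; first by rewrite -rr_ev_d cf.
by apply: rr_ev_inj; rewrite rr_ev_d cf.
Qed.

Lemma rr_bdry N n (f : HomC RR N n) : bdry f <-> bdry (rr_ev f).
Proof.
split=> [[j [e [y ->]]]|[j [e [y yE]]]]; first by rewrite rr_ev_d; apply: bdry_intro.
suff -> : f = cd (HomC RR N) e (rr_elt y) by apply: bdry_intro.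
by apply: rr_ev_inj; rewrite rr_ev_d rr_eltK.
Qed.

Lemma hv_rr N n : hv RR N n <-> cohom0 N n.
Proof.
split=> H x.
  by rewrite -{1}(rr_eltK x) => /rr_cycle /H /rr_bdry; rewrite rr_eltK.
by move=> /rr_cycle /H /rr_bdry.
Qed.

Lemma rr_post M N (s : cmap M N) n (f : HomC RR M n) :
  rr_ev (hpost RR s n f) = s n (rr_ev f).
Proof. by []. Qed.

Lemma rr_silting m : 0 < m -> hv RR RR m.
Proof.
move=> m0 f _; suff -> : f = 0 by apply: bdry0.
by apply: rr_ev_inj; apply: RR_eq => e; lia.
Qed.
End Families.

(** * Telescopes *)

Lemma add5 (V : zmodType) (a b c d e : V) : b + a + (d + c + e) = a + c + (b + (d + e)).
Proof. by rewrite [b + a]addrC [d + c]addrC -!addrA; congr (_ + _); rewrite addrCA. Qed.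

Section Telescope.
Variable R : pzRingType.

Section CSub.
Variables (M N : cplx R) (f g : cmap M N).
Fact csubm_linear i : linear (fun x => f i x - g i x).
Proof. by move=> a x y; rewrite (linearP (f i)) (linearP (g i)) opprD addrACA scalerBr. Qed.
Fact csubm_subproof i j (e : i + 1 = j) (x : M i) :
  mkLin (@csubm_linear j) (cd M e x) = cd N e (mkLin (@csubm_linear i) x).
Proof. by rewrite /= linearB !cfunC. Qed.
Definition csubm : cmap M N := @CMap R M N (fun i => mkLin (@csubm_linear i)) csubm_subproof.
Lemma csubmE i x : csubm i x = f i x - g i x.
Proof. by []. Qed.
End CSub.

Variables (C : nat -> cplx R) (u : forall n, cmap (C n) (C n.+1)).

Definition tel_shift : cmap (dsumc C) (dsumc C) := dcopair (fun n => ccomp (dinj C n.+1) (u n)).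
Definition tel_map : cmap (dsumc C) (dsumc C) := csubm (Defs.cid _) tel_shift.
Definition tel : cplx R := kone tel_map.

Lemma tel_mapE n i (x : C n i) :
  tel_map i (dinj C n i x) = dinj C n i x - dinj C n.+1 i (u n i x).
Proof. by rewrite csubmE dcopairE. Qed.

Lemma tel_proj0 i (x : dsumc C i) : dproj C 0%N i (tel_map i x) = dproj C 0%N i x.
Proof.
pose f : {linear dsumc C i -> C 0%N i} := dproj C 0%N i \o tel_map i.
apply: (dlin_ext (f := f)) => n {}x; rewrite -[LHS]/(dproj C 0%N i (tel_map i _)) tel_mapE.
by rewrite linearB (dproj_neq (t := n.+1)) ?subr0.
Qed.

Lemma tel_projS n i (x : dsumc C i) :
  dproj C n.+1 i (tel_map i x) = dproj C n.+1 i x - u n i (dproj C n i x).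
Proof.
pose f : {linear dsumc C i -> C n.+1 i} := dproj C n.+1 i \o tel_map i.
pose g : {linear dsumc C i -> C n.+1 i} := csubm (dproj C n.+1) (ccomp (u n) (dproj C n)) i.
apply: (dlin_ext (f := f) (g := g)) => k {}x.
rewrite -[LHS]/(dproj C n.+1 i (tel_map i _)) tel_mapE.
rewrite -[RHS]/(dproj C n.+1 i (dinj C k i x) - u n i (dproj C n i (dinj C k i x))).
rewrite linearB; congr (_ - _); have [kn|ne] := pselect (k = n).
  by subst k; rewrite !dprojK.
by rewrite !dproj_neq ?linear0 // => -[].
Qed.
End Telescope.

Section TelescopeHom.
Variables (K : fieldType) (L : falgType K).
Local Notation cpx := (cplx L^c).
Variables (C : nat -> cpx) (u : forall n, cmap (C n) (C n.+1)).
Variables (N : cpx) (sN : small N).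

Definition tel_in n : cmap (C n) (tel u) := ccomp (tin (twcone (tel_map u))) (dinj C n).

Lemma hpost_tel_in n m m' (e : m + 1 = m') (c : HomC N (C n) m) :
  hpost N (tel_in n) m c = kl (tel_map u) e (hpost N (dinj C n) m c) 0.
Proof. by apply: hext => i j ij x; rewrite klE hx0 oppr0. Qed.

Lemma kl0 (A B D : cpx) (s : cmap B D) m m' (e : m + 1 = m') :
  kl s e (0 : HomC A D m) (0 : HomC A B m') = 0.
Proof. by apply: hext => i j ij x; rewrite klE !hx0 oppr0. Qed.

Lemma kl_linearB (A B D : cpx) (s : cmap B D) m m' (e : m + 1 = m')
    (y y' : HomC A D m) (z z' : HomC A B m') :
  kl s e y z - kl s e y' z' = kl s e (y - y') (z - z').
Proof.
apply: hext => i j ij x.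
rewrite hxD hxN !klE (hxD y) (hxD z) !hxN; congr pair; rewrite /= opprB opprK; apply: addrC.
Qed.

Lemma kl_linearD (A B D : cpx) (s : cmap B D) m m' (e : m + 1 = m')
    (y y' : HomC A D m) (z z' : HomC A B m') :
  kl s e y z + kl s e y' z' = kl s e (y + y') (z + z').
Proof. by apply: hext => i j ij x; rewrite hxD !klE (hxD y) (hxD z) opprD. Qed.

Lemma tel_step n m (c : HomC N (C n) m) m' (e : m' + 1 = m) : cycle c ->
  hpost N (tel_in n) m c - hpost N (tel_in n.+1) m (hpost N (u n) m c)
  = cd (HomC N (tel u)) e (kl (tel_map u) e 0 (- hpost N (dinj C n) m c)).
Proof.
move=> cc; rewrite (kl_d _ e erefl) linear0 (linearN (hpost _ _ _)) sub0r opprK !linearN opprK.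
rewrite -cfunC cc linear0 (hpost_tel_in erefl c) (hpost_tel_in erefl (hpost N (u n) m c)).
rewrite kl_linearB subrr; congr kl; apply: hext => i j ij x.
by rewrite hxD hxN !hpostE tel_mapE.
Qed.

Lemma tel_push n m (c : HomC N (C n) m) k : cycle c ->
  exists2 c' : HomC N (C (n + k)) m, cycle c' &
    exists z, hpost N (tel_in n) m c - hpost N (tel_in (n + k)) m c'
      = cd (HomC N (tel u)) (subrK 1 m) (kl (tel_map u) (subrK 1 m) 0 z).
Proof.
move=> cc; elim: k => [|k [c' cc' [z zE]]].
  rewrite addn0; exists c => //; exists 0; by rewrite subrr kl0 linear0.
rewrite addnS; exists (hpost N (u (n + k)) m c'); first exact: cyc_map.
have := tel_step (subrK 1 m) cc'; move/(congr1 (+%R (cd (HomC N (tel u)) (subrK 1 m)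
   (kl (tel_map u) (subrK 1 m) 0 z)))); rewrite -{1}zE addrA subrK => ->.
exists (z - hpost N (dinj C (n + k)) m c').
by rewrite -linearD kl_linearD addr0.
Qed.

(** A cycle into the telescope is a pair [(y, a)] with [d y = (id - shift) a]. The components of [a]
    are boundaries by induction on the stage, and by smallness so is [a], which can be removed. The
    finitely many components of what is left of [y] are then pushed to a common stage. *)
Lemma TelA m (w : HomC N (tel u) m) : cycle w ->
  exists n, exists2 c : HomC N (C n) m, cycle c & exists e : HomC N (tel u) (m - 1),
    w = hpost N (tel_in n) m c + cd (HomC N (tel u)) (subrK 1 m) e.
Proof.
move=> cw; have [y [a wE]] := kl_surj erefl w; subst w.
have := cw _ erefl; rewrite (kl_d _ erefl erefl).
rewrite -(kl0 _ _ erefl) => /kl_inj[/eqP]; rewrite subr_eq0 => /eqP dy /eqP; rewrite oppr_eq0 => /eqP da.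
have [s sa] := sN a.
have bd n : bdry (hpost N (dproj C n) _ a).
  elim: n => [|n IH].
    have -> : hpost N (dproj C 0%N) _ a = hpost N (dproj C 0%N) _ (cd (HomC N _) erefl y).
      by rewrite dy; apply: hext => i j ij x; rewrite !hpostE tel_proj0.
    by rewrite cfunC; apply: bdry_intro.
  have -> : hpost N (dproj C n.+1) _ a = hpost N (dproj C n.+1) _ (cd (HomC N _) erefl y)
      + hpost N (u n) _ (hpost N (dproj C n) _ a).
    by rewrite dy; apply: hext => i j ij x; rewrite hxD !hpostE tel_projS subrK.
  by apply: bdryD; [rewrite cfunC; apply: bdry_intro | apply: bdry_map].
have [a' aE] : exists a', a = cd (HomC N (dsumc C)) erefl a'.
  apply: (bdry_elim erefl); rewrite (small_sum sa).
  by apply: big_ind => [||t _]; [exact: bdry0 | exact: bdryD | apply/bdry_map/bd].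
pose y' := y - hpost N (tel_map u) m a'.
have cy' : cycle y'.
  by apply: (@cycle1 _ _ _ _ erefl); rewrite linearB -cfunC -aE dy subrr.
have wE : kl (tel_map u) erefl y a = kl (tel_map u) erefl y' 0
    + cd (HomC N (tel u)) (subrK 1 m) (kl (tel_map u) (subrK 1 m) 0 (- a')).
  rewrite (kl_d _ (subrK 1 m) erefl) linear0 (linearN (hpost _ _ _)) sub0r opprK.
  by rewrite linearN opprK -aE kl_linearD subrK add0r.
suff [n [c cc [e eE]]] : exists n, exists2 c : HomC N (C n) m, cycle c &
    exists e : HomC N (tel u) (m - 1), kl (tel_map u) erefl y' 0
      = hpost N (tel_in n) m c + cd (HomC N (tel u)) (subrK 1 m) e.
  exists n, c => //; exists (e + kl (tel_map u) (subrK 1 m) 0 (- a')).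
  by rewrite wE eE linearD; apply: esym (addrA _ _ _).
have [s' sy] := sN y'.
have -> : kl (tel_map u) erefl y' 0
    = \sum_(t <- undup s') hpost N (tel_in t) m (hpost N (dproj C t) m y').
  rewrite {1}(small_sum sy); apply: hext => i j ij x; rewrite klE !hx_sum hx0 oppr0.
  elim/big_rec2: _ => // t p q _ [<-]; rewrite hpostE; congr pair.
  by rewrite /= addr0.
elim: (undup s') => [|t l [n [c cc [e eE]]]].
  exists 0%N, 0; first exact: cycle0.
  by exists 0; rewrite big_nil !linear0 addr0.
rewrite big_cons eE.
have ct : cycle (hpost N (dproj C t) m y') by apply: cyc_map.
have [c1 cc1 [z1 z1E]] := tel_push n ct.
have [c2 cc2 [z2 z2E]] := tel_push t cc.
move: (c2) cc2 z2E; rewrite addnC => {}c2 cc2 z2E.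
exists (t + n)%N, (c1 + c2); first exact: cycleD.
exists (kl (tel_map u) (subrK 1 m) 0 z1 + (kl (tel_map u) (subrK 1 m) 0 z2 + e)).
have E1 := subrK (hpost N (tel_in (t + n)) m c1) (hpost N (tel_in t) m (hpost N (dproj C t) m y')).
have E2 := subrK (hpost N (tel_in (t + n)) m c2) (hpost N (tel_in n) m c).
rewrite -E1 -E2 z1E z2E !linearD; exact: add5.
Qed.

(** In a bounding pair [(y, a)] the components of [a] are boundaries: below stage [n] by induction
    upwards from stage zero, and from stage [n] on by induction downwards from a stage outside the
    finite support, where injectivity of the transition maps is used. *)
Lemma TelB m n (c : HomC N (C n) m) :
  (forall k (x : HomC N (C k) m), cycle x -> bdry (hpost N (u k) m x) -> bdry x) ->
  cycle c -> bdry (hpost N (tel_in n) m c) -> bdry c.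
Proof.
move=> inj cc; rewrite (hpost_tel_in erefl c) => /(bdry_elim (subrK 1 m)) [w].
have [y [a ->]] := kl_surj (subrK 1 m) w.
rewrite (kl_d _ (subrK 1 m) erefl) => /kl_inj[cE /eqP]; rewrite eq_sym oppr_eq0 => /eqP da.
have ca : cycle a by apply: cycle1 da.
pose p k := hpost N (dproj C k) m a.
have dpE k : hpost N (dproj C k) m (hpost N (dinj C n) m c)
    = cd (HomC N (C k)) (subrK 1 m) (hpost N (dproj C k) (m - 1) y)
      - hpost N (dproj C k) m (hpost N (tel_map u) m a).
  by rewrite cE linearB -cfunC.
have p_bd k : (k < n)%N -> bdry (p k).
  elim: k => [|k IH] kn.
    have := dpE 0%N; rewrite (_ : hpost _ _ m (hpost _ _ m c) = 0); last first.
      by apply: hext => i j ij x; rewrite !hpostE dproj_neq // => E; subst n.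
    move=> /eqP; rewrite eq_sym subr_eq0 => /eqP pE.
    have -> : p 0%N = hpost N (dproj C 0%N) m (hpost N (tel_map u) m a).
      by apply: hext => i j ij x; rewrite !hpostE tel_proj0.
    by rewrite -pE; apply: bdry_intro.
  have := dpE k.+1; rewrite (_ : hpost _ _ m (hpost _ _ m c) = 0); last first.
    by apply: hext => i j ij x; rewrite !hpostE dproj_neq // => E; subst n; rewrite ltnn in kn.
  move=> /eqP; rewrite eq_sym subr_eq0 => /eqP pE.
  have -> : p k.+1 = hpost N (dproj C k.+1) m (hpost N (tel_map u) m a) + hpost N (u k) m (p k).
    by apply: hext => i j ij x; rewrite hxD !hpostE tel_projS subrK.
  by rewrite -pE; apply: bdryD; [apply: bdry_intro | apply/bdry_map/IH; rewrite ltnW].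
have p_top : exists k, p (n + k)%N = 0.
  have [s sa] := sN a.
  suff [k nk] : exists k, (n + k)%N \notin s by exists k; apply: sa.
  apply: contrapT => H.
  have : (size [seq (n + k)%N | k <- iota 0 (size s).+1] <= size s)%N.
    apply: (@uniq_leq_size {classic nat}).
      by rewrite (@map_inj_uniq nat {classic nat}) ?iota_uniq // => x z /addnI.
    move=> x /mapP[k _ ->]; apply/negPn/negP => hk; apply: H.
    by exists k.
  by rewrite size_map size_iota ltnn.
have p_step k : bdry (p (n + k.+1)%N) -> bdry (p (n + k)%N).
  move=> b; apply: inj; first exact: cyc_map.
  have := dpE (n + k.+1)%N; rewrite (_ : hpost _ _ m (hpost _ _ m c) = 0); last first.
    by apply: hext => i j ij x; rewrite !hpostE dproj_neq //; lia.
  move: b; rewrite addnS => b.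
  move=> /eqP; rewrite eq_sym subr_eq0 => /eqP pE.
  have -> : hpost N (u (n + k)) m (p (n + k)%N)
      = p (n + k).+1 - hpost N (dproj C (n + k).+1) m (hpost N (tel_map u) m a).
    by apply: hext => i j ij x; rewrite hxD hxN !hpostE tel_projS opprB addrC subrK.
  by apply: bdryB => //; rewrite -pE; apply: bdry_intro.
have pn : bdry (p n).
  have [k pk] := p_top; rewrite -[n]addn0.
  have : bdry (p (n + k)%N) by rewrite pk; apply: bdry0.
  by elim: k {pk} => // k IH /p_step.
have := dpE n; rewrite (_ : hpost _ _ m (hpost _ _ m c) = c); last first.
  by apply: hext => i j ij x; rewrite !hpostE dprojK.
move=> ->; apply: bdryB; first exact: bdry_intro.
suff H k : bdry (p k) -> (forall k', (k' < k)%N -> bdry (p k')) ->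
  bdry (hpost N (dproj C k) m (hpost N (tel_map u) m a)) by apply: H.
case: k => [|k] pk pk'.
  have -> // : hpost N (dproj C 0%N) m (hpost N (tel_map u) m a) = p 0%N.
  by apply: hext => i j ij x; rewrite !hpostE tel_proj0.
have -> : hpost N (dproj C k.+1) m (hpost N (tel_map u) m a) = p k.+1 - hpost N (u k) m (p k).
  by apply: hext => i j ij x; rewrite hxD hxN !hpostE tel_projS.
by apply: bdryB => //; apply/bdry_map/pk'.
Qed.
End TelescopeHom.

(** * Resolutions over the endomorphism algebra *)

Lemma zmod_lem2 (V : zmodType) (a b c d e : V) : a + b + (c + d + e) = a + c + (b + e + d).
Proof. by rewrite -[c + d + e]addrA addrACA [d + e]addrC; congr (_ + _); apply: addrA. Qed.

Lemma zmod_lem1 (V : zmodType) (a b c : V) : a - b + c - a = c - b.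
Proof. by rewrite addrC -!addrA addKr addrC. Qed.

Lemma ixC (i j k : int) : i + j = k -> j + i = k.
Proof. by rewrite addrC. Qed.

Lemma ksgnC m n (V : zmodType) (x : V) : ksgn m (ksgn n x) = ksgn n (ksgn m x).
Proof. by rewrite -!ksgn_add addrC. Qed.

Section PostFamily.
Variables (K : fieldType) (L : falgType K) (A B C : cplx L^c).
Variable g : forall i, {linear B i -> C i}.
Definition hfam_fun n (f : hob A B n) : hob A C n := mkh (fun i j e => g j \o hx f e).
Fact hfam_linear n : linear (@hfam_fun n).
Proof.
move=> c f h; apply: hext => i j e x.
by rewrite -[LHS]/(g j (hx (c *: f + h) e x)) hxD hxZ linearP.
Qed.
(** Composition with a map of graded modules of degree [0] that need not be a chain map. *)
Definition hfam n : {linear HomC A B n -> HomC A C n} := mkLin (@hfam_linear n).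
Lemma hfamE n (f : HomC A B n) i j (e : i + n = j) x : hx (hfam n f) e x = g j (hx f e x).
Proof. by []. Qed.
End PostFamily.
Arguments hfam {K L} [A] {B C} g n.

(** * Modules over the endomorphism algebra *)

Section Gamma.
Variables (K : fieldType) (L : falgType K) (U : cplx L^c).
Local Notation G := (endDG U).

Lemma cdGE j j' (ej : j + 1 = j') (a : G j) :
  cd G ej a = (cd (HomC U U) ej (a : HomC U U j) : HomC U U j') :> G j'.
Proof.
apply: hext => p r pr u; have h2 := end_d_index1 ej pr; have h4 := end_d_index2 ej pr.
rewrite [RHS](hdE ej _ pr erefl h2 erefl h4).
exact: (end_dE ej (a : end_obj U j) pr erefl h2 erefl h4 u).
Qed.

Section HomModule.
Variable W : cplx L^c.
Definition hact i j k (e : i + j = k) (f : HomC U W i) (a : G j) : HomC U W k :=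
  hcomp e f (a : hob U U j).
Fact hact1 i (e : i + 0 = i) f : hact e f (dgone G) = f.
Proof.
apply: hext => a b ab x.
by rewrite (hcompE e _ _ ab (addr0 a) ab) -[hx (dgone G : hob U U 0) _ x]/(hfun (end_app (end_one U) _) x) end_oneE.
Qed.
Fact hact_leibniz i j k i' j' k' (e : i + j = k)
      (ei : i + 1 = i') (ej : j + 1 = j') (ek : k + 1 = k')
      (e1 : i' + j = k') (e2 : i + j' = k') (x : HomC U W i) (a : G j) :
    cd (HomC U W) ek (hact e x a)
      = hact e1 (cd (HomC U W) ei x) a + ksgn i (hact e2 x (cd G ej a)).
Proof.
by rewrite cdGE; apply: (hd_comp e ei ej ek e1 e2 x (a : HomC U U j)).
Qed.
Definition homM : dgMod G := @DGMod K G (HomC U W) hact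
  (fun _ _ _ e x x' a => hcompDl e x x' a) (fun _ _ _ e c x a => hcompZl e c x a)
  (fun _ _ _ e x a a' => hcompDr e x a a') (fun _ _ _ e c x a => hcompZr e c x a)
  (fun _ _ _ _ _ _ e1 e2 e3 e4 x a b => hcompA e1 e2 e3 e4 x a b) hact1 hact_leibniz.
End HomModule.

Implicit Types (W : cplx L^c) (M N : dgMod G).

Lemma dgactNl N i j k (e : i + j = k) x (a : G j) : dgact N e (- x) a = - dgact N e x a.
Proof. by rewrite -scaleN1r dgactZl scaleN1r. Qed.
Lemma dgact_sgnl N n i j k (e : i + j = k) x (a : G j) :
  dgact N e (ksgn n x) a = ksgn n (dgact N e x a).
Proof. by rewrite /ksgn; case: (odd _); rewrite ?dgactNl. Qed.

(** Module maps of every degree [p] are kept, because [good] has to be carried along isomorphisms of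
    nonzero degree such as [shift_giso]. *)
Record glin M N (p : int) := GLin {
  gl : forall i j, i + p = j -> {linear M i -> N j};
  glA : forall i b k j l (e1 : i + b = k) (e2 : k + p = l) (e3 : i + p = j) (e4 : j + b = l) x a,
    gl e2 (dgact M e1 x a) = dgact N e4 (gl e3 x) a }.
Arguments gl {M N p} g {i j} e.

Lemma gl_irr M N p (F : glin M N p) i j (e e' : i + p = j) x : gl F e x = gl F e' x.
Proof. by rewrite (eq_irrelevance e e'). Qed.

Definition gclosed M N p (F : glin M N p) : Prop :=
  forall i j i' j' (e : i + p = j) (e' : i' + p = j') (ei : i + 1 = i') (ej : j + 1 = j') x,
    cd N ej (gl F e x) = ksgn p (gl F e' (cd M ei x)).

Definition ghtp M N p q (F : glin M N p) (H : glin M N q) : Prop :=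
  forall i j i' j0 (e : i + p = j) (ei : i + 1 = i') (e0 : i + q = j0) (e1 : j0 + 1 = j)
    (e2 : i' + q = j) x, gl F e x = cd N e1 (gl H e0 x) + ksgn p (gl H e2 (cd M ei x)).
Definition gnull M N p (F : glin M N p) : Prop := exists H : glin M N (p - 1), ghtp F H.

(** Balanced pairings into a graded module without differential. When the target is a complex, the
    induced map is seen to be a chain map through [good_span]. *)
Record gbal W (V : int -> lmodType L^c) := GBal {
  gb_f :> forall i j k, i + j = k -> HomC U W i -> U j -> V k;
  gb_D : forall i j k (e : i + j = k) f f' u, gb_f e (f + f') u = gb_f e f u + gb_f e f' u;
  gb_lin : forall i j k (e : i + j = k) f, linear (gb_f e f);
  gb_act : forall i n i' j j' k (e1 : i + n = i') (e2 : j + n = j') (e : i' + j = k)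
     (e' : i + j' = k) (f : HomC U W i) (a : HomC U U n) u,
     gb_f e (hcomp e1 f a) u = gb_f e' f (hx a e2 u) }.

(** [W] is good when [Hom(U, W)] is h-projective over the endomorphism algebra of [U],
    with [W] as its tensor product with [U]. *)
Record good W : Prop := Good {
  good_proj : forall N, acyclic N -> forall p (F : glin (homM W) N p), gclosed F -> gnull F;
  good_tens : forall V (phi : gbal W V), exists g : forall k, {linear W k -> V k},
    forall i j k (e : i + j = k) (e' : j + i = k) (f : HomC U W i) u,
      g k (hx f e' u) = phi _ _ _ e f u;
  good_span : forall k (Z : lmodType L^c) (g g' : {linear W k -> Z}),
    (forall i j (e : j + i = k) (f : HomC U W i) u, g (hx f e u) = g' (hx f e u)) -> g =1 g' }.

Section GoodU.

(** [Hom(U, U)] is free of rank one: a closed map is determined by its value at the identity, a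
    cycle of the acyclic [N], and acting on a primitive of that cycle gives the null-homotopy. *)
Lemma good_U : good U.
Proof.
split=> [N aN p F cF|V phi|k Z g g' H x].
- pose n := gl F (add0r p) (hid U : HomC U U 0).
  have FE i j (e : i + p = j) (f : HomC U U i) : gl F e f = dgact N (ixC e) n f.
    rewrite -(glA F (add0r i) e (add0r p) (ixC e) (hid U : HomC U U 0) f).
    by congr (gl F e _); apply: esym (hcomp1l _ _).
  have [|n' nE] := bdry_elim (subrK 1 p) (aN p n _).
    apply: (@cycle1 _ _ _ _ erefl).
    have e' : 0 + 1 + p = p + 1 by rewrite add0r addrC.
    by rewrite (cF _ _ _ _ (add0r p) e' erefl erefl) hid_cycle linear0 ksgn0.
  have lin i j (e : i + (p - 1) = j) :
      linear (fun f : homM U i => dgact N (ixC e) n' (f : HomC U U i)).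
    by move=> a f f'; rewrite dgactDr dgactZr.
  have lA i b k j l (e1 : i + b = k) (e2 : k + (p - 1) = l) (e3 : i + (p - 1) = j)
      (e4 : j + b = l) (x : homM U i) a :
      mkLin (lin k l e2) (dgact (homM U) e1 x a) = dgact N e4 (mkLin (lin i j e3) x) a.
    exact: (esym (dgactA (ixC e3) e4 e1 (ixC e2) n' x a)).
  exists (GLin lA) => i j i' j0 e ei e0 e1 e2 x; rewrite FE nE.
  have e3 : p - 1 + i = j0 by rewrite addrC.
  rewrite -[gl _ e0 x]/(dgact N (ixC e0) n' x) -[gl _ e2 _]/(dgact N (ixC e2) n' (cd (HomC U U) ei x)).
  rewrite (dgact_leibniz (ixC e0) (subrK 1 p) ei e1 (ixC e) (ixC e2)) cdGE.
  by rewrite (ksgn_succ _ (subrK 1 p)) addrK.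
- exists (fun k => mkLin (gb_lin phi (add0r k) (hid U : HomC U U 0))) => i j k e e' f u.
  rewrite -[LHS]/(phi _ _ _ (add0r k) (hid U : HomC U U 0) (hx f e' u)).
  by rewrite -(gb_act phi (add0r i) e' e) hcomp1l.
by have := H 0 k (addr0 k) (hid U : HomC U U 0) x; rewrite hidE.
Qed.
End GoodU.

Section GoodIso.
Variables (r : int) (W W' : cplx L^c) (g : giso r W W').

(** Composition with [a] pulls a map of degree [p] on [Hom(U, W')] back to one of degree [r + p] on
    [Hom(U, W)]; composition with [b] returns the homotopy. *)
Lemma good_giso : good W -> good W'.
Proof.
case: g => a q b ab ba ca cb abE baE [GP GT GS].
have sgnq (V : zmodType) (v : V) : ksgn q v = ksgn r v.
  have E : q = - r by apply/eqP; rewrite -addr_eq0 ba.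
  by rewrite E ksgnNn.
split=> [N aN p F cF|V phi|k Z h h' H x].
- have ix i j : i + (r + p) = j -> r + i + p = j by rewrite [r + i]addrC addrA.
  have lin i j (e : i + (r + p) = j) :
      linear (fun f : homM W i => gl F (ix _ _ e) (hcomp (erefl (r + i)) a f)).
    by move=> c f f'; rewrite hcompDr hcompZr linearP.
  pose F0 i j (e : i + (r + p) = j) := mkLin (lin i j e).
  have F0E i j (e : i + (r + p) = j) i1 (e1 : r + i = i1) (e2 : i1 + p = j) (f : HomC U W i) :
      F0 i j e f = gl F e2 (hcomp e1 a f : HomC U W' i1).
    by case: i1 / e1 e2 => e2; rewrite -[LHS]/(gl F (ix _ _ e) _); apply: gl_irr.
  have F0A i d k j l (e1 : i + d = k) (e2 : k + (r + p) = l) (e3 : i + (r + p) = j)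
      (e4 : j + d = l) (x : homM W i) (y : G d) :
      F0 k l e2 (dgact (homM W) e1 x y) = dgact N e4 (F0 i j e3 x) y.
    have e5 : r + i + d = r + k by rewrite -addrA e1.
    rewrite (F0E _ _ e2 _ erefl (ix _ _ e2)) (F0E _ _ e3 _ erefl (ix _ _ e3)).
    rewrite -(glA F e5 (ix _ _ e2) (ix _ _ e3) e4); congr (gl F _ _).
    exact: (esym (hcompA erefl e5 e1 erefl a x (y : hob U U d))).
  have cF0 : gclosed (GLin F0A).
    move=> i j i' j' e e' ei ej x; rewrite -[gl _ e x]/(F0 i j e x) -[gl _ e' _]/(F0 i' j' e' _).
    have er : r + i + 1 = r + i' by rewrite -addrA ei.
    rewrite (F0E _ _ e _ erefl (ix _ _ e)) (F0E _ _ e' _ erefl (ix _ _ e')).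
    rewrite (cF _ _ _ _ _ (ix _ _ e') er ej).
    have e6 : r + 1 + i = r + i' by rewrite addrAC.
    rewrite -[cd (homM W') er _]/(cd (HomC U W') er (hcomp erefl a x)).
    by rewrite (hd_comp erefl erefl ei er e6 erefl) ca hcomp0l add0r ksgn_lin ksgn_add ksgnC.
  have [H HF] := GP N aN _ _ cF0.
  have iq i j : i + (p - 1) = j -> q + i + (r + p - 1) = j.
    by move=> <-; rewrite -(addrA r) addrACA ba add0r.
  have linH i j (e : i + (p - 1) = j) :
      linear (fun f : homM W' i => gl H (iq _ _ e) (hcomp (erefl (q + i)) b f)).
    by move=> c f f'; rewrite hcompDr hcompZr linearP.
  pose H0 i j (e : i + (p - 1) = j) := mkLin (linH i j e).
  have H0A i d k j l (e1 : i + d = k) (e2 : k + (p - 1) = l) (e3 : i + (p - 1) = j)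
      (e4 : j + d = l) (x : homM W' i) (y : G d) :
      H0 k l e2 (dgact (homM W') e1 x y) = dgact N e4 (H0 i j e3 x) y.
    have e5 : q + i + d = q + k by rewrite -addrA e1.
    rewrite -[LHS]/(gl H (iq _ _ e2) _) -[H0 i j e3 x]/(gl H (iq _ _ e3) _).
    rewrite -(glA H e5 (iq _ _ e2) (iq _ _ e3) e4); congr (gl H _ _).
    exact: (esym (hcompA erefl e5 e1 erefl b x (y : hob U U d))).
  exists (GLin H0A) => i j i' j0 e ei e0 e1 e2 x.
  rewrite -[gl _ e0 x]/(gl H (iq _ _ e0) (hcomp erefl b x)).
  rewrite -[gl _ e2 _]/(gl H (iq _ _ e2) (hcomp erefl b (cd (HomC U W') ei x))).
  have eF : q + i + (r + p) = j by rewrite addrACA ba add0r.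
  have eq' : q + i + 1 = q + i' by rewrite -addrA ei.
  have e6 : r + (q + i) = i by rewrite addrA ab add0r.
  have xE : x = hcomp e6 a (hcomp (erefl (q + i)) b x).
    by rewrite -(hcompA ab (add0r i) erefl e6) abE hcomp1l.
  rewrite {1}xE -(F0E _ _ eF _ e6 e) -[F0 _ _ eF _]/(gl (GLin F0A) eF _).
  rewrite (HF _ _ _ _ eF eq' (iq _ _ e0) e1 (iq _ _ e2)); congr (_ + _).
  rewrite -[cd (homM W) eq' _]/(cd (HomC U W) eq' (hcomp erefl b x)).
  have e7 : q + 1 + i = q + i' by rewrite addrAC.
  rewrite (hd_comp erefl erefl ei eq' e7 erefl) cb hcomp0l add0r ksgn_lin ksgn_add sgnq.
  by rewrite [ksgn p (ksgn r _)]ksgnC ksgnK.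
- have ix i j k : i + j = k -> r + i + j = k + r by move=> <-; rewrite -addrA addrC.
  pose phi' i j k (e : i + j = k) (f : HomC U W i) u := phi _ _ _ (ix _ _ _ e) (hcomp (erefl (r + i)) a f) u.
  have phi'E i j k (e : i + j = k) f u i1 (e1 : r + i = i1) (e2 : i1 + j = k + r) :
      phi' i j k e f u = phi _ _ _ e2 (hcomp e1 a f) u.
    by case: i1 / e1 e2 => e2; rewrite /phi' (eq_irrelevance (ix _ _ _ e) e2).
  have phi'D i j k (e : i + j = k) f f' u : phi' i j k e (f + f') u = phi' i j k e f u + phi' i j k e f' u.
    by rewrite /phi' hcompDr gb_D.
  have phi'L i j k (e : i + j = k) f : linear (phi' i j k e f).
    by move=> c u v; rewrite /phi' gb_lin.
  have phi'A i n i' j j' k (e1 : i + n = i') (e2 : j + n = j') (e : i' + j = k)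
     (e' : i + j' = k) (f : HomC U W i) (y : HomC U U n) u :
     phi' i' j k e (hcomp e1 f y) u = phi' i j' k e' f (hx y e2 u).
    have e5 : r + i + n = r + i' by rewrite -addrA e1.
    rewrite /phi' -(hcompA (erefl (r + i)) e5 e1 erefl).
    exact: (gb_act phi e5 e2 (ix _ _ _ e) (ix _ _ _ e')).
  have [h hE] := GT _ (@GBal W (fun k => V (k + r)) phi' phi'D phi'L phi'A).
  have {}hE i j k (e : i + j = k) (e' : j + i = k) f u : h k (hx f e' u) = phi' i j k e f u.
    exact: hE.
  have kq k : k + q + r = k by rewrite -addrA ba addr0.
  pose vc i j (e : i = j) : {linear V i -> V j} :=
    match e in _ = j return {linear V i -> V j} with erefl => mkLin (@cid_linear _ (V i)) end.
  exists (fun k => vc _ _ (kq k) \o (h (k + q) \o hx b (erefl (k + q)))) => i j k e e' f u.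
  rewrite -[LHS]/(vc _ _ (kq k) (h (k + q) (hx b erefl (hx f e' u)))).
  have e1 : j + (q + i) = k + q by rewrite -e' addrA addrAC.
  rewrite -(hcompE (erefl (q + i)) b f e1 e' erefl) (hE _ _ _ (ixC e1)).
  have e6 : r + (q + i) = i by rewrite addrA ab add0r.
  have e7 : i + j = k + q + r by rewrite kq.
  rewrite (phi'E _ _ _ _ _ _ _ e6 e7) -(hcompA ab (add0r i) erefl e6) abE hcomp1l.
  have vcE k1 k2 (E : k1 = k2) (d1 : i + j = k1) (d2 : i + j = k2) :
      vc _ _ E (phi _ _ _ d1 f u) = phi _ _ _ d2 f u.
    by case: k2 / E d2 => d2; rewrite (eq_irrelevance d1 d2).
  exact: vcE.
have e1 : k + q + r = k by rewrite -addrA ba addr0.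
have -> : x = hx a e1 (hx b erefl x).
  by rewrite -(hcompE ab a b (addr0 k)) abE hidE.
refine (GS (k + q) Z (h \o hx a e1) (h' \o hx a e1) _ (hx b erefl x)) => i j e f u.
have e2 : j + (r + i) = k by rewrite [r + i]addrC addrA e.
have := H _ _ e2 (hcomp (erefl (r + i)) a f) u.
by rewrite (hcompE erefl a f e2 e e1).
Qed.
End GoodIso.

Lemma hfam_act (A B C : cplx L^c) (g : forall i, {linear B i -> C i}) n m l (e : n + m = l)
    (f : HomC A B n) (a : hob A A m) : hfam g l (hcomp e f a) = hcomp e (hfam g n f) a.
Proof. exact: hext. Qed.

Section GLinOps.
Variables (W W' : cplx L^c) (N : dgMod G) (g : forall i, {linear W i -> W' i}).
Variables (p : int) (F : glin (homM W') N p).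
Fact glin_fam_linear i j (e : i + p = j) : linear (fun f : homM W i => gl F e (hfam g i f)).
Proof. by move=> a f f'; rewrite !linearP. Qed.
Fact glin_famA i b k j l (e1 : i + b = k) (e2 : k + p = l) (e3 : i + p = j) (e4 : j + b = l)
    (x : homM W i) (a : G b) :
  mkLin (glin_fam_linear e2) (dgact (homM W) e1 x a) = dgact N e4 (mkLin (glin_fam_linear e3) x) a.
Proof.
rewrite -[LHS]/(gl F e2 (hfam g k (hcomp e1 x (a : hob U U b)))) hfam_act.
exact: (glA F e1 e2 e3 e4 (hfam g i x) a).
Qed.
Definition glin_fam : glin (homM W) N p := GLin glin_famA.
Lemma glin_famE i j (e : i + p = j) f : gl glin_fam e f = gl F e (hfam g i f).
Proof. by []. Qed.
End GLinOps.

Section GLinAdd.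
Variables (M N : dgMod G) (p : int) (F F' : glin M N p).
Fact glin_add_linear i j (e : i + p = j) : linear (fun x => gl F e x + gl F' e x).
Proof. by move=> a x y; rewrite !linearP scalerDr addrACA. Qed.
Fact glin_addA i b k j l (e1 : i + b = k) (e2 : k + p = l) (e3 : i + p = j) (e4 : j + b = l) x a :
  mkLin (glin_add_linear e2) (dgact M e1 x a) = dgact N e4 (mkLin (glin_add_linear e3) x) a.
Proof. by rewrite /= !(glA _ e1 e2 e3 e4) dgactDl. Qed.
Definition glin_add : glin M N p := GLin glin_addA.
End GLinAdd.

Section GoodTsum.
Variables (B C : cplx L^c) (q : twist B C).
Local Notation T := (tsum q).
Definition tfst i : {linear T i -> B i} := mkLin (fun a (x y : T i) => erefl : (a *: x + y).1 = _).
Fact tsnd_linear i : linear (fun x : C i => (0, x) : T i).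
Proof. by move=> a x y; congr pair => /=; rewrite scaler0 addr0. Qed.
Definition tsnd i : {linear C i -> T i} := mkLin (@tsnd_linear i).

Local Notation hT n := (HomC U T n).
Lemma tsum_split n (f : HomC U T n) :
  f = hpost U (tin q) n (hfam tfst n f) + hfam tsnd n (hpost U (tout q) n f).
Proof.
apply: hext => i j e x.
rewrite -[RHS]/(((hx f e x : T j).1, 0) + (0, (hx f e x : T j).2) : T j).
by rewrite [LHS]surjective_pairing; congr pair; rewrite /= ?addr0 ?add0r.
Qed.
Lemma tfst_tin n (f : HomC U B n) : hfam tfst n (hpost U (tin q) n f) = f.
Proof. exact: hext. Qed.
Lemma tout_tsnd n (f : HomC U C n) : hpost U (tout q) n (hfam tsnd n f) = f.
Proof. exact: hext. Qed.
Lemma tfst_tsnd n (f : HomC U C n) : hfam tfst n (hfam tsnd n f) = 0.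
Proof. exact: hext. Qed.

(** Composition with the twist, obtained as the failure of the graded section [tsnd] to be a chain
    map. *)
Definition tq n n' (e : n + 1 = n') (f : HomC U C n) : HomC U B n' :=
  hfam tfst n' (cd (HomC U T) e (hfam tsnd n f)).

Lemma tfst_d n n' (e : n + 1 = n') (f : HomC U T n) :
  hfam tfst n' (cd (HomC U T) e f)
  = cd (HomC U B) e (hfam tfst n f) + tq e (hpost U (tout q) n f).
Proof. by rewrite {1}(tsum_split f) (linearD (cd (HomC U T) e)) (linearD (hfam tfst n')) -cfunC tfst_tin. Qed.

Lemma tsnd_d n n' (e : n + 1 = n') (f : HomC U C n) :
  cd (HomC U T) e (hfam tsnd n f)
  = hpost U (tin q) n' (tq e f) + hfam tsnd n' (cd (HomC U C) e f).
Proof. by rewrite [LHS]tsum_split cfunC tout_tsnd. Qed.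

Lemma tq_d n n' n'' (e : n + 1 = n') (e' : n' + 1 = n'') (f : HomC U C n) :
  cd (HomC U B) e' (tq e f) = - tq e' (cd (HomC U C) e f).
Proof.
apply/eqP; rewrite -addr_eq0; apply/eqP.
have := tfst_d e' (cd (HomC U T) e (hfam tsnd n f)).
by rewrite cdd linear0 cfunC tout_tsnd => <-.
Qed.

Lemma tq_act i j k i' k' (e : i + j = k) (ei : i + 1 = i') (ek : k + 1 = k') (e1 : i' + j = k')
    (f : HomC U C i) (a : HomC U U j) :
  tq ek (hcomp e f a) = hcomp e1 (tq ei f) a.
Proof.
have e2 : i + (j + 1) = k' by rewrite -ek -e addrA.
rewrite /tq hfam_act (hd_comp e ei erefl ek e1 e2) linearD hfam_act ksgn_lin hfam_act.
by rewrite tfst_tsnd hcomp0l ksgn0 addr0.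
Qed.

Lemma good_tsum : good B -> good C -> good T.
Proof.
move=> [BP BT BS] [CP CT CS].
split=> [N aN p F cF|V phi|k Z h h' H [x1 x2]].
- pose FB : glin (homM B) N p := glin_fam (fun i => tin q i) F.
  have [|HB HBE] := BP N aN p FB.
    move=> i j i' j' e e' ei ej x; rewrite !glin_famE (cF _ _ _ _ e e' ei ej).
    by congr ksgn; congr (gl F e' _); apply: esym (cfunC (hpost U (tin q)) ei x).
  have ix i j : i + p = j -> i + 1 + (p - 1) = j by move=> <-; rewrite addrACA subrr addr0.
  (* Restricted to [Hom(U, C)] along the graded section, [F] is no longer closed, because of the
     twist. Subtracting the homotopy [HB] of its restriction to [Hom(U, B)], evaluated on the twist,
     repairs this. *)
  have FCL i j (e : i + p = j) : linear (fun f : homM C i =>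
      gl F e (hfam tsnd i f) - ksgn p (gl HB (ix _ _ e) (tq erefl f))).
    move=> a f f'; rewrite /tq !linearP ksgnD ksgnZ scalerBr opprD -!addrA; congr (_ + _).
    by rewrite addrCA.
  pose FC0 i j (e : i + p = j) := mkLin (FCL i j e).
  have FC0E i j (e : i + p = j) i' (ei : i + 1 = i') (e' : i' + (p - 1) = j) f :
      FC0 i j e f = gl F e (hfam tsnd i f) - ksgn p (gl HB e' (tq ei f)).
    by case: i' / ei e' => e'; rewrite (eq_irrelevance e' (ix _ _ e)).
  have FCA i b k j l (e1 : i + b = k) (e2 : k + p = l) (e3 : i + p = j) (e4 : j + b = l)
      (x : homM C i) (a : G b) :
      FC0 k l e2 (dgact (homM C) e1 x a) = dgact N e4 (FC0 i j e3 x) a.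
    have e5 : i + 1 + b = k + 1 by rewrite -e1 addrAC.
    rewrite -[dgact (homM C) e1 x a]/(hcomp e1 x (a : HomC U U b)).
    rewrite (FC0E _ _ e2 _ erefl (ix _ _ e2)) (FC0E _ _ e3 _ erefl (ix _ _ e3)).
    rewrite (tq_act e1 erefl erefl e5) hfam_act.
    rewrite (glA HB e5 (ix _ _ e2) (ix _ _ e3) e4 (tq erefl x) a).
    rewrite (glA F e1 e2 e3 e4 (hfam tsnd i x) a).
    by rewrite dgactDl dgactNl dgact_sgnl.
  have cFC : gclosed (GLin FCA).
    move=> i j i' j' e e' ei ej x; rewrite -[gl _ e x]/(FC0 i j e x) -[gl _ e' _]/(FC0 i' j' e' _).
    have e5 : i' + (p - 1) = j by rewrite -ei (ix _ _ e).
    have e6 : i' + 1 + (p - 1) = j' by rewrite (ix _ _ e').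
    rewrite (FC0E _ _ e _ ei e5) (FC0E _ _ e' _ erefl e6).
    rewrite linearB ksgn_lin (cF _ _ _ _ e e' ei ej).
    rewrite -[cd (homM T) ei _]/(cd (HomC U T) ei (hfam tsnd i x)) tsnd_d linearD ksgnD ksgnB ksgnK.
    rewrite -[gl F e' (hpost U _ _ _)]/(gl FB e' (tq ei x)).
    rewrite (HBE _ _ _ _ e' erefl e5 ej e6) ksgnD ksgnK.
    rewrite -[cd (homM B) _ _]/(cd (HomC U B) (erefl (i' + 1)) (tq ei x)) (tq_d ei erefl) linearN.
    exact: zmod_lem1.
  have [HC HCE] := CP N aN p _ cFC.
  exists (glin_add (glin_fam tfst HB) (glin_fam (fun i => tout q i) HC)) => i j i' j0 e ei e0 e1 e2 x.
  rewrite {1}(tsum_split (x : HomC U T i)) linearD.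
  rewrite -[gl F e (hpost U _ _ _)]/(gl FB e (hfam tfst i x)) (HBE _ _ _ _ e ei e0 e1 e2).
  have := HCE _ _ _ _ e ei e0 e1 e2 (hpost U (tout q) i x).
  rewrite -[gl _ e _]/(FC0 i j e (hpost U (tout q) i x)) (FC0E _ _ e _ ei e2).
  move=> /eqP; rewrite subr_eq => /eqP ->.
  rewrite -[gl (glin_add _ _) e0 x]/(gl HB e0 (hfam tfst i x) + gl HC e0 (hpost U (tout q) i x)).
  rewrite -[gl (glin_add _ _) e2 _]/(gl HB e2 (hfam tfst i' (cd (HomC U T) ei x))
    + gl HC e2 (hpost U (tout q) i' (cd (HomC U T) ei x))).
  rewrite tfst_d cfunC !linearD !ksgnD.
  rewrite -[cd (homM B) ei _]/(cd (HomC U B) ei (hfam tfst i x)).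
  rewrite -[cd (homM C) ei _]/(cd (HomC U C) ei (hpost U (tout q) i x)).
  exact: zmod_lem2.
- have bal (X : cplx L^c) (g : forall i, {linear X i -> T i}) : exists psi : gbal X V,
      forall i j k (e : i + j = k) f u, psi _ _ _ e f u = phi _ _ _ e (hfam g i f) u.
    have D i j k (e : i + j = k) f f' u : phi _ _ _ e (hfam g i (f + f')) u
       = phi _ _ _ e (hfam g i f) u + phi _ _ _ e (hfam g i f') u by rewrite linearD gb_D.
    have A i n i' j j' k (e1 : i + n = i') (e2 : j + n = j') (e : i' + j = k)
     (e' : i + j' = k) (f : HomC U X i) (a : HomC U U n) u :
     phi _ _ _ e (hfam g i' (hcomp e1 f a)) u = phi _ _ _ e' (hfam g i f) (hx a e2 u).
      by rewrite hfam_act (gb_act phi e1 e2 e e').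
    by exists (@GBal X V _ D (fun i j k e f => gb_lin phi e _) A).
  have [phiB phiBE] := bal B (fun i => tin q i).
  have [phiC phiCE] := bal C tsnd.
  have [gB gBE] := BT V phiB; have [gC gCE] := CT V phiC.
  have lin k : linear (fun x : T k => gB k x.1 + gC k x.2).
    by move=> a x y; rewrite /= !linearP /= scalerDr addrACA.
  exists (fun k => mkLin (lin k)) => i j k e e' f u.
  rewrite {2}(tsum_split f) gb_D.
  rewrite -[hpost U (tin q) i _]/(hfam (fun i => tin q i) i (hfam tfst i f)).
  rewrite -phiBE -phiCE -(gBE _ _ _ e e') -(gCE _ _ _ e e').
  exact: erefl.
have hB : h \o tin q k =1 h' \o tin q k.
  by apply: BS => i j e f u; apply: (H i j e (hpost U (tin q) i f) u).
have hC : h \o tsnd k =1 h' \o tsnd k.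
  by apply: CS => i j e f u; apply: (H i j e (hfam tsnd i f) u).
have xE : ((x1, x2) : T k) = tin q k x1 + tsnd k x2.
  by congr pair; rewrite /= ?addr0 ?add0r.
rewrite xE !linearD; congr (_ + _); [exact: hB | exact: hC].
Qed.
End GoodTsum.
End Gamma.

Section Resolution.
Variables (K : fieldType) (L : falgType K) (U : cplx L^c) (sU : small U).
Local Notation G := (endDG U).
Implicit Types (W : cplx L^c) (N : dgMod G).

Section FiniteSums.
Variables (I : Type) (W : I -> cplx L^c).

Section GSum.
Variables (N : dgMod G) (p : int) (F : forall t, glin (homM U (W t)) N p).
Let fs i j (e : i + p = j) (f : HomC U (dsumc W) i) :
  finsupp (fun t => gl (F t) e (hpost U (dproj W t) i f)).
Proof. by have [s sf] := sU f; exists s => t /sf ->; rewrite linear0. Qed.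
Fact gsum_linear i j (e : i + p = j) :
  linear (fun f : homM U (dsumc W) i => fsum (fun t => gl (F t) e (hpost U (dproj W t) i f))).
Proof.
move=> a f g; rewrite (@fsum_map _ _ _ _ ( *:%R a)) ?scaler0 //; first last.
- exact: scalerDr.
rewrite -fsumD; first 1 last.
- by apply: (finsupp_map (f := fun _ v => a *: v)) => [t|]; [rewrite scaler0 | exact: fs].
- exact: fs.
by congr fsum; apply: funext => t; rewrite !linearP.
Qed.
Fact gsumA i b k j l (e1 : i + b = k) (e2 : k + p = l) (e3 : i + p = j) (e4 : j + b = l)
    (x : homM U (dsumc W) i) (a : G b) :
  mkLin (gsum_linear e2) (dgact (homM U (dsumc W)) e1 x a)
  = dgact N e4 (mkLin (gsum_linear e3) x) a.
Proof.
rewrite [RHS](@fsum_map _ _ _ _ (fun v => dgact N e4 v a)); first last.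
- exact: fs.
- by move=> v w; rewrite dgactDl.
- by rewrite -(scale0r 0) dgactZl scale0r.
congr fsum; apply: funext => t; rewrite -(glA (F t) e1 e2).
congr (gl (F t) e2 _); exact: (hfam_act (fun i => dproj W t i)).
Qed.
Definition gsum : glin (homM U (dsumc W)) N p := GLin gsumA.
Lemma gsumE i j (e : i + p = j) f :
  gl gsum e f = fsum (fun t => gl (F t) e (hpost U (dproj W t) i f)).
Proof. by []. Qed.
End GSum.

Lemma small_fsum n (Z : zmodType) (h : {additive HomC U (dsumc W) n -> Z}) f :
  h f = fsum (fun t => h (hpost U (dinj W t) n (hpost U (dproj W t) n f))).
Proof.
have [s sf] := sU f; rewrite {1}(small_sum sf) raddf_sum.
by apply/esym/fsumE => t /sf ->; rewrite linear0 raddf0.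
Qed.

(** Since [U] is small, a map into the sum is a finite sum of maps into summands, so homotopies and
    pairings on the summands can be added up. *)
Lemma good_dsum : (forall t, good U (W t)) -> good U (dsumc W).
Proof.
move=> gW; split=> [N aN p F cF|V phi|k Z g g' H].
- pose Ft t : glin (homM U (W t)) N p := glin_fam (fun i => dinj W t i) F.
  have cFt t : gclosed (Ft t).
    move=> i j i' j' e e' ei ej x; rewrite !glin_famE (cF _ _ _ _ e e' ei ej).
    by congr ksgn; congr (gl F e' _); apply: esym (cfunC (hpost U (dinj W t)) ei x).
  pose H t := boolp.cid (good_proj (gW t) aN (cFt t)).
  exists (gsum (fun t => sval (H t))) => i j i' j0 e ei e0 e1 e2 x.
  have HE t := svalP (H t) i j i' j0 e ei e0 e1 e2 (hpost U (dproj W t) i x).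
  rewrite (small_fsum (gl F e)) !gsumE.
  rewrite (@fsum_map _ _ _ _ (cd N e1)); first last.
  + by have [s sx] := sU (x : HomC U (dsumc W) i); exists s => t /sx st; rewrite -?cfunC ?st ?linear0 // cfunC st !linear0.
  + exact: linearD.
  + exact: linear0.
  rewrite (@fsum_map _ _ _ _ (@ksgn p (N j))); first last.
  + by have [s sx] := sU (x : HomC U (dsumc W) i); exists s => t /sx st; rewrite -?cfunC ?st ?linear0 // cfunC st !linear0.
  + by move=> v w; apply: ksgnD.
  + exact: ksgn0.
  rewrite -fsumD; first last.
  + apply: (finsupp_map (f := fun _ => @ksgn p (N j))) => [t|]; first exact: ksgn0.
    by have [s sx] := sU (x : HomC U (dsumc W) i); exists s => t /sx st; rewrite -?cfunC ?st ?linear0 // cfunC st !linear0.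
  + apply: (finsupp_map (f := fun _ => cd N e1)) => [t|]; first exact: linear0.
    by have [s sx] := sU (x : HomC U (dsumc W) i); exists s => t /sx st; rewrite st linear0.
  congr fsum; apply: funext => t.
  rewrite -[LHS]/(gl (Ft t) e (hpost U (dproj W t) i x)) HE.
  by congr (_ + ksgn p (gl _ e2 _)); apply: esym (cfunC (hpost U (dproj W t)) ei x).
- have bal t : exists psi : gbal U (W t) V,
      forall i j k (e : i + j = k) f u, psi _ _ _ e f u = phi _ _ _ e (hpost U (dinj W t) i f) u.
    have D i j k (e : i + j = k) f f' u : phi _ _ _ e (hpost U (dinj W t) i (f + f')) u
       = phi _ _ _ e (hpost U (dinj W t) i f) u + phi _ _ _ e (hpost U (dinj W t) i f') u.
      by rewrite linearD gb_D.
    have A i n i' j j' k (e1 : i + n = i') (e2 : j + n = j') (e : i' + j = k)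
     (e' : i + j' = k) (f : HomC U (W t) i) (a : HomC U U n) u :
     phi _ _ _ e (hpost U (dinj W t) i' (hcomp e1 f a)) u
     = phi _ _ _ e' (hpost U (dinj W t) i f) (hx a e2 u).
      rewrite -(gb_act phi e1 e2 e e'); congr (phi _ _ _ e _ u).
      exact: (hfam_act (fun i => dinj W t i)).
    by exists (@GBal _ _ U (W t) V _ D (fun i j k e f => gb_lin phi e _) A).
  pose psi t := boolp.cid (bal t); pose g t := boolp.cid (good_tens (gW t) (sval (psi t))).
  exists (fun k => dlin (fun t => sval (g t) k)) => i j k e e' f u.
  have addphi : additive (fun f => phi _ _ _ e f u).
    by move=> f1 f2; apply/eqP; rewrite eq_sym subr_eq -gb_D subrK.
  pose h : {additive HomC U (dsumc W) i -> V k} :=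
    HB.pack (fun f => phi _ _ _ e f u) (GRing.isZmodMorphism.Build _ _ _ addphi).
  rewrite -[RHS]/(h f) (small_fsum h); apply: (f_equal (@fsum I (V k))); apply: funext => t.
  have := svalP (g t) i j k e e' (hpost U (dproj W t) i f) u.
  by rewrite (svalP (psi t)) => E; exact: E.
apply: dlin_ext => t x.
apply: (good_span (gW t) (g := g \o dinj W t k) (g' := g' \o dinj W t k)) => i j e f u.
exact: (H i j e (hpost U (dinj W t) i f) u).
Qed.
End FiniteSums.
End Resolution.

(** * Attaching cells *)

Section Attach.
Variables (K : fieldType) (L : falgType K) (U : cplx L^c) (sU : small U).
Local Notation G := (endDG U).
Implicit Types (N : dgMod G).

Section TwistOf.
Variables (B C : cplx L^c) (h : HomC C B 1) (ch : cycle h).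
Fact twist_of_subproof i j k (e : i + 1 = j) (e' : j + 1 = k) x :
  cd B e' (hx h e x) + hx h e' (cd C e x) = 0.
Proof. by have /hcycleP H := ch; rewrite (H _ _ _ _ e e' e e') ksgn1 addNr. Qed.
Definition twist_of : twist B C := Twist twist_of_subproof.
Lemma tq_of n n' (e : n + 1 = n') (e' : 1 + n = n') (f : HomC U C n) :
  tq twist_of e f = hcomp e' h f.
Proof.
apply: hext => i k ik x; have e2 := end_d_index1 e ik; have e4 := end_d_index2 e ik.
rewrite (hcompE _ _ _ ik erefl e2) hfamE (hdE e _ ik erefl e2 erefl e4) tsum_dE.
rewrite [hx (hfam _ _ _) e4 _](_ : _ = (0, hx f e4 (cd U erefl x))) //.
rewrite (_ : ksgn n _ = (0, ksgn n (hx f e4 (cd U erefl x)))); last first.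
  by apply: etrans (ksgn_pair _ _ _) _; rewrite ksgn0.
by rewrite /= linear0 add0r subr0.
Qed.
End TwistOf.

Variables (W : cplx L^c) (N : dgMod G) (phi : dgMap (homM U W) N).
Variables (C : Type) (m : C -> int) (z : forall c, HomC U W (m c + 1)) (y : forall c, N (m c)).
Arguments z : clear implicits.
Variables (cz : forall c, cycle (z c)) (zy : forall c, phi _ (z c) = cd N erefl (y c)).

Definition cell c : cplx L^c := shift (- m c) U.
Definition cell_in c : HomC U (cell c) (m c) := shift_ga (subrr (m c)) U.
Definition cell_out c : HomC (cell c) U (- m c) := @shift_gb K L (- m c) U.

Arguments cell_in : clear implicits.
Arguments cell_out : clear implicits.

Lemma cell_out_cycle c : cycle (cell_out c).
Proof. exact: (@shift_gb_cycle K L (- m c) U). Qed.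

Fact att_index c : m c + 1 + (- m c) = 1.
Proof. by rewrite addrAC subrr add0r. Qed.
Definition att_part c : HomC (cell c) W 1 := hcomp (att_index c) (z c) (cell_out c).
Arguments att_part : clear implicits.
Definition att_hom : HomC (dsumc cell) W 1 := hcopair att_part.
Fact att_cycle : cycle att_hom.
Proof.
move=> j e; rewrite hd_copair; apply: hdsum_ext => c; rewrite hpre_copair linear0.
exact: (hcomp_cycle (att_index c) (@cz c) (@cell_out_cycle c)).
Qed.
Definition att : cplx L^c := tsum (twist_of att_cycle).

Fact fill_index c i : m c + (- m c + i) = i.
Proof. by rewrite addrA subrr add0r. Qed.
(** The module map from [Hom(U, cell c)] that sends the generator [cell_in c] to [y c]. By [fill_d]
    it extends [phi] over the cell attached along [z c]. *)
Definition fill c i (g : HomC U (cell c) i) : N i :=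
  dgact N (fill_index c i) (y c) (hcomp (erefl (- m c + i)) (cell_out c) g : HomC U U _).

Lemma fillD c i : linear (@fill c i).
Proof. by move=> a g g'; rewrite /fill hcompDr hcompZr dgactDr dgactZr. Qed.

Lemma fill_d c i i' (e : i + 1 = i') (g : HomC U (cell c) i) :
  cd N e (fill g) = phi i' (hcomp (etrans (addrC 1 i) e) (att_part c) g)
    + fill (cd (HomC U (cell c)) e g).
Proof.
rewrite /fill.
have e1 : - m c + i + 1 = - m c + i' by rewrite -e addrA.
have e2 : m c + 1 + (- m c + i) = i' by rewrite -e addrACA subrr add0r addrC.
have e3 : - m c + 1 + i = - m c + i' by rewrite -e addrAC addrA.
rewrite (dgact_leibniz _ (erefl (m c + 1)) e1 e e2 (fill_index c i')) -zy.
congr (_ + _); last first.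
  rewrite cdGE (hd_comp erefl erefl e e1 e3 erefl).
  rewrite cell_out_cycle hcomp0l add0r.
  set w := hcomp erefl _ _.
  suff -> : ksgn (- m c) w = ksgn (m c) w.
    rewrite (_ : dgact _ _ _ _ = ksgn (m c) (dgact N (fill_index c i') (y c) (w : HomC U U _))) ?ksgnK //.
    by rewrite /ksgn; case: (odd _); rewrite // -scaleN1r dgactZr scaleN1r.
  exact: ksgnNn.
rewrite -(dgf_act phi e2); congr (phi i' _).
exact: (esym (hcompA (att_index c) (etrans (addrC 1 i) e) (erefl (- m c + i)) e2 (z c) (cell_out c) g)).
Qed.

Lemma fill_act c i b k (e : i + b = k) (g : HomC U (cell c) i) (a : G b) :
  fill (hcomp e g (a : HomC U U b)) = dgact N e (fill g) a.
Proof.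
rewrite /fill; have e1 : - m c + i + b = - m c + k by rewrite -addrA e.
rewrite (dgactA (fill_index c i) e e1 (fill_index c k)); congr (dgact N _ _ _).
exact: (esym (hcompA erefl e1 e erefl (cell_out c) g (a : HomC U U b))).
Qed.

Lemma fill0 c i : fill (0 : HomC U (cell c) i) = 0.
Proof. exact: (linear0 (mkLin (@fillD c i))). Qed.

Definition fsm i (f : HomC U (dsumc cell) i) : N i :=
  fsum (fun c => fill (hpost U (dproj cell c) i f)).

Lemma fsm_supp i (f : HomC U (dsumc cell) i) s :
  (forall c : {classic C}, c \notin s -> hpost U (dproj cell c) i f = 0) ->
  fsm f = \sum_(c <- undup s) fill (hpost U (dproj cell c) i f).
Proof. by move=> sf; apply: fsumE => c /sf ->; rewrite fill0. Qed.

Lemma fsm_linear i : linear (@fsm i).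
Proof.
move=> a f g; have [s sf] := sU f; have [s' sg] := sU g.
have cat1 (c : {classic C}) : c \notin s ++ s' -> hpost U (dproj cell c) i f = 0.
  by rewrite mem_cat negb_or => /andP[/sf].
have cat2 (c : {classic C}) : c \notin s ++ s' -> hpost U (dproj cell c) i g = 0.
  by rewrite mem_cat negb_or => /andP[_ /sg].
rewrite (fsm_supp cat1) (fsm_supp cat2) (@fsm_supp _ _ (s ++ s')); last first.
  by move=> c cs; rewrite linearP cat1 // cat2 // scaler0 addr0.
rewrite scaler_sumr -big_split; apply: eq_bigr => c _.
by rewrite linearP fillD.
Qed.

Definition att_fun i : homM U att i -> N i := fun f =>
  phi i (hfam (@tfst _ _ _ _ (twist_of att_cycle)) i f) + fsm (hpost U (tout (twist_of att_cycle)) i f).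
Fact att_linear i : linear (@att_fun i).
Proof.
move=> a f g; rewrite /att_fun !linearP fsm_linear scalerDr -!addrA; congr (_ + _).
by rewrite addrCA.
Qed.

Fact att_subproof i j (e : i + 1 = j) (f : homM U att i) :
  mkLin (@att_linear j) (cd (homM U att) e f) = cd N e (mkLin (@att_linear i) f).
Proof.
rewrite -[LHS]/(att_fun (cd (HomC U att) e f)) -[mkLin _ f]/(att_fun f) /att_fun.
have e' : 1 + i = j by rewrite addrC.
rewrite tfst_d (tq_of _ e e') cfunC linearD [RHS]linearD -addrA cfunC; congr (_ + _).
set g := hpost U (tout _) i f; have [s sg] := sU g.
rewrite (fsm_supp sg) linear_sum (@fsm_supp _ _ s); last first.
  by move=> c cs; rewrite cfunC sg // linear0.
rewrite {1}(small_sum sg).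
have -> : hcomp e' att_hom (\sum_(c <- undup s) hpost U (dinj cell c) i (hpost U (dproj cell c) i g))
    = \sum_(c <- undup s) hcomp e' (att_part c) (hpost U (dproj cell c) i g).
  elim: (undup s) => [|c l IH]; first by rewrite !big_nil hcomp0r.
  rewrite !big_cons hcompDr IH; congr (_ + _).
  apply: hext => a b ab x; have e2 := end_mul_index e' ab.
  by rewrite !(hcompE e' _ _ ab erefl e2) hpostE hcopairE.
rewrite linear_sum -big_split; apply: eq_bigr => c _.
by rewrite cfunC fill_d (eq_irrelevance e' (etrans (addrC 1 i) e)).
Qed.

Definition att_cmap : cmap (homM U att) N :=
  @CMap K (homM U att) N (fun i => mkLin (@att_linear i)) att_subproof.

Fact att_act i j k (e : i + j = k) (x : homM U att i) (a : G j) :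
  att_cmap k (dgact (homM U att) e x a) = dgact N e (att_cmap i x) a.
Proof.
rewrite -[LHS]/(att_fun (hcomp e x (a : HomC U U j))) -[att_cmap i x]/(att_fun x) /att_fun dgactDl.
rewrite hfam_act -(dgf_act phi e); congr (_ + _).
rewrite -[hpost U _ k _]/(hfam (fun i => tout (twist_of att_cycle) i) k _) hfam_act.
rewrite -[hfam (fun i => tout _ i) i x]/(hpost U (tout (twist_of att_cycle)) i x).
set g := hpost U (tout _) i x; have [s sg] := sU g.
rewrite (fsm_supp sg) (@fsm_supp _ _ s); last first.
  move=> c cs; apply: etrans (hfam_act (fun i => dproj cell c i) e g (a : HomC U U j)) _.
  by rewrite -[hfam _ _ g]/(hpost U (dproj cell c) i g) sg // hcomp0l.
rewrite (big_morph (fun v => dgact N e v a) (id1 := 0) (op1 := +%R)); first last.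
- by rewrite -(scale0r 0) dgactZl scale0r.
- by move=> v w; rewrite dgactDl.
apply: eq_bigr => c _; rewrite -fill_act; congr fill.
exact: (hfam_act (fun i => dproj cell c i) e g (a : HomC U U j)).
Qed.
Definition att_map : dgMap (homM U att) N := DGMap att_act.

Lemma att_mapE i (f : HomC U att i) :
  att_map i f = phi i (hfam (@tfst _ _ _ _ (twist_of att_cycle)) i f)
    + fsm (hpost U (tout (twist_of att_cycle)) i f).
Proof. by []. Qed.

Definition att_in : cmap W att := tin (twist_of att_cycle).

Lemma att_map_in i (f : HomC U W i) : att_map i (hpost U att_in i f) = phi i f.
Proof.
rewrite att_mapE tfst_tin (_ : hpost U (tout _) i _ = 0); last exact: hext.
by rewrite /fsm fsum0 ?addr0 // => c; rewrite linear0 fill0.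
Qed.

Lemma att_kill c : exists2 x : HomC U att (m c),
  hpost U att_in (m c + 1) (z c) = cd (HomC U att) erefl x & att_map (m c) x = y c.
Proof.
(* The generator of the cell, placed in the attached complex by the graded section: its differential
   is the attaching cycle, and [att_map] sends it to [y c]. *)
pose x0 := hpost U (dinj cell c) (m c) (cell_in c).
have e' : 1 + m c = m c + 1 by rewrite addrC.
exists (hfam (@tsnd _ _ _ _ (twist_of att_cycle)) (m c) x0).
  rewrite tsnd_d (tq_of _ _ e') /x0 -cfunC.
  rewrite [cd (HomC U (cell c)) _ _](shift_ga_cycle (subrr (m c))) !linear0 addr0.
  congr (hpost U _ _ _); apply: hext => i k ik u; have e2 := end_mul_index e' ik.
  rewrite (hcompE e' _ _ ik erefl e2) hpostE hcopairE.
  have e3 : i + m c - m c = i by rewrite addrK.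
  have e4 : i + (m c + 1) = k by [].
  rewrite (hcompE (att_index c) (z c) (cell_out c) e2 e3 e4).
  rewrite -(hcompE (shift_pk (subrr (m c))) (cell_out c) (cell_in c) (addr0 i)) shift_gba hidE.
  exact: hx_irr.
rewrite att_mapE tfst_tsnd linear0 add0r tout_tsnd /fsm (@fsum1 _ _ _ c); last first.
  move=> c' ne; rewrite (_ : hpost _ _ _ _ = 0) ?fill0 //.
  by apply: hext => i j ij u; rewrite !hpostE dproj_neq // => /esym.
have -> : hpost U (dproj cell c) (m c) x0 = cell_in c.
  by apply: hext => i j ij u; rewrite !hpostE dprojK.
have gen d (E : - m c + m c = d) (e2 : m c + d = m c) :
    fill (cell_in c) = dgact N e2 (y c) (hcomp E (cell_out c) (cell_in c) : HomC U U d).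
  by case: d / E e2 => e2; rewrite /fill (eq_irrelevance (fill_index c (m c)) e2).
rewrite (gen 0 (shift_pk (subrr (m c))) (addr0 (m c))) shift_gba -{2}(dgact1 (addr0 (m c)) (y c)).
congr (dgact N _ _ _); apply: hext0 => i e x; rewrite hidE.
exact: (esym (end_oneE e x)).
Qed.

Lemma good_att : good U W -> good U att.
Proof.
move=> gW; apply: good_tsum => //; apply: good_dsum => // c.
by apply: good_giso (shift_giso (subrr (m c)) U) (good_U U).
Qed.
End Attach.

(** * Countable iteration of the attachment *)

Section Resolution.
Variables (K : fieldType) (L : falgType K) (U : cplx L^c) (sU : small U).
Local Notation G := (endDG U).
Variables (N : dgMod G) (S : int -> Prop) (P : cplx L^c -> Prop).
Variables (P_cell : forall m, S m -> P (shift (- m) U))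
  (P_sum : forall I (W : I -> cplx L^c), (forall t, P (W t)) -> P (dsumc W))
  (P_ext : forall B C (q : twist B C), P B -> P C -> P (tsum q))
  (P_shift : forall A, P A -> P (shift 1 A)).

Record rstate := RState { rW : cplx L^c; rG : good U rW; rP : P rW; rphi : dgMap (homM U rW) N }.

Definition rcell (s : rstate) : Type :=
  {c : {m : int & prod (HomC U (rW s) (m + 1)) (N m)} |
    [/\ S (tag c), cycle (tagged c).1 & rphi s _ (tagged c).1 = cd N erefl (tagged c).2]}.

Section Next.
Variable s : rstate.
Definition rz (c : rcell s) : HomC U (rW s) (tag (sval c) + 1) := (tagged (sval c)).1.
Definition ry (c : rcell s) : N (tag (sval c)) := (tagged (sval c)).2.
Arguments rz : clear implicits.
Fact rcz c : cycle (rz c).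
Proof. by case: (svalP c). Qed.
Fact rzy c : rphi s _ (rz c) = cd N erefl (ry c).
Proof. by case: (svalP c). Qed.
Fact rnextP : P (att (@rcz)).
Proof.
apply: P_ext; first exact: rP.
by apply: P_sum => c; apply: P_cell; case: (svalP c).
Qed.
Definition rnext : rstate := RState (good_att sU (@rcz) (rG s)) rnextP (att_map sU (@rcz) rzy).
Definition rstep : cmap (rW s) (rW rnext) := att_in (@rcz).
Lemma rstepE i f : rphi rnext i (hpost U rstep i f) = rphi s i f.
Proof. exact: att_map_in. Qed.
Lemma rstep_kill m (z : HomC U (rW s) (m + 1)) (y : N m) : S m -> cycle z ->
  rphi s _ z = cd N erefl y -> exists2 x : HomC U (rW rnext) m,
    hpost U rstep (m + 1) z = cd (HomC U (rW rnext)) erefl x & rphi rnext m x = y.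
Proof.
move=> Sm cz zy.
pose c : rcell s := exist _ (existT _ m (z, y)) (And3 Sm cz zy).
exact: (att_kill sU (@rcz) rzy c).
Qed.
End Next.

(** The zero complex as an empty sum, so that it satisfies [P] by closure under sums. *)
Definition W0 : cplx L^c := dsumc (fun v : void => match v with end : cplx L^c).
Fact phi0_act i j k (e : i + j = k) (x : homM U W0 i) (a : G j) :
  czero (homM U W0) N k (dgact (homM U W0) e x a) = dgact N e (czero (homM U W0) N i x) a.
Proof. by rewrite /= -[in RHS](scale0r 0) dgactZl scale0r. Qed.
Definition r0 : rstate :=
  RState (good_dsum sU (fun v : void => match v with end : good U _))
    (P_sum (fun v : void => match v with end : P _)) (DGMap phi0_act).

Definition rseq n : rstate := iter n rnext r0.
Definition rT : cplx L^c := tel (fun n => rstep (rseq n)).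

Fact rT_good : good U rT.
Proof.
apply: good_tsum; first by apply: good_dsum => // n; apply: rG.
apply: (good_giso (shift_giso (addNr 1) _)).
by apply: good_dsum => // n; apply: rG.
Qed.
Fact rT_P : P rT.
Proof.
have H : P (dsumc (fun n => rW (rseq n))) by apply: P_sum => n; apply: rP.
by apply: P_ext => //; apply: P_shift.
Qed.
End Resolution.

Section DgSum.
Variables (K : fieldType) (L : falgType K) (U : cplx L^c) (sU : small U).
Local Notation G := (endDG U).
Variables (N : dgMod G) (I : Type) (W : I -> cplx L^c) (phi : forall t, dgMap (homM U (W t)) N).

Definition dsm i (f : HomC U (dsumc W) i) : N i :=
  fsum (fun t => phi t i (hpost U (dproj W t) i f)).

Lemma dsm_supp i (f : HomC U (dsumc W) i) s :
  (forall t : {classic I}, t \notin s -> hpost U (dproj W t) i f = 0) ->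
  dsm f = \sum_(t <- undup s) phi t i (hpost U (dproj W t) i f).
Proof. by move=> sf; apply: fsumE => t /sf ->; rewrite linear0. Qed.

Lemma dsm_linear i : linear (@dsm i).
Proof.
move=> a f g; have [s sf] := sU f; have [s' sg] := sU g.
have cat1 (c : {classic I}) : c \notin s ++ s' -> hpost U (dproj W c) i f = 0.
  by rewrite mem_cat negb_or => /andP[/sf].
have cat2 (c : {classic I}) : c \notin s ++ s' -> hpost U (dproj W c) i g = 0.
  by rewrite mem_cat negb_or => /andP[_ /sg].
rewrite (dsm_supp cat1) (dsm_supp cat2) (@dsm_supp _ _ (s ++ s')); last first.
  by move=> c cs; rewrite linearP cat1 // cat2 // scaler0 addr0.
rewrite scaler_sumr -big_split; apply: eq_bigr => c _.
by rewrite !linearP.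
Qed.

Lemma dsm_d i j (e : i + 1 = j) (f : HomC U (dsumc W) i) :
  dsm (cd (HomC U (dsumc W)) e f) = cd N e (dsm f).
Proof.
have [s sf] := sU f; rewrite (dsm_supp sf) linear_sum (@dsm_supp _ _ s); last first.
  by move=> t /sf ft; rewrite cfunC ft linear0.
by apply: eq_bigr => t _; rewrite cfunC; apply: (cfunC (phi t) e).
Qed.

Lemma dsm_act i j k (e : i + j = k) (x : HomC U (dsumc W) i) (a : G j) :
  dsm (hcomp e x (a : HomC U U j)) = dgact N e (dsm x) a.
Proof.
have [s sx] := sU x.
have act t : hpost U (dproj W t) k (hcomp e x (a : HomC U U j))
    = hcomp e (hpost U (dproj W t) i x) (a : HomC U U j).
  exact: (hfam_act (fun i => dproj W t i)).
rewrite (dsm_supp sx) (@dsm_supp _ _ s); last first.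
  by move=> t /sx xt; rewrite act xt hcomp0l.
rewrite (big_morph (fun v => dgact N e v a) (id1 := 0) (op1 := +%R)); first last.
- by rewrite -(scale0r 0) dgactZl scale0r.
- by move=> v w; rewrite dgactDl.
by apply: eq_bigr => t _; rewrite act; apply: (dgf_act (phi t) e _ a).
Qed.

Lemma dsm_in t i (f : HomC U (W t) i) : dsm (hpost U (dinj W t) i f) = phi t i f.
Proof.
rewrite /dsm (@fsum1 _ _ _ t).
  by congr (phi t i _); apply: hext => a b ab x; rewrite !hpostE dprojK.
move=> t' ne; rewrite (_ : hpost _ _ _ _ = 0) ?linear0 //.
by apply: hext => a b ab x; rewrite !hpostE dproj_neq // => /esym.
Qed.
End DgSum.

Section Resolution.
Variables (K : fieldType) (L : falgType K) (U : cplx L^c) (sU : small U).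
Local Notation G := (endDG U).
Variables (N : dgMod G) (C : nat -> cplx L^c) (u : forall n, cmap (C n) (C n.+1)).
Variables (phi : forall n, dgMap (homM U (C n)) N).
Variables (phiS : forall n i f, phi n.+1 i (hpost U (u n) i f) = phi n i f).
Local Notation T := (tel u).

(** The maps [phi n] are compatible, so their sum vanishes on the image of [tel_map]; it therefore
    extends to the telescope by zero on the suspended summand. *)
Lemma dsm_tel i (f : HomC U (dsumc C) i) : dsm phi (hpost U (tel_map u) i f) = 0.
Proof.
pose h : {linear HomC U (dsumc C) i -> N i} :=
  mkLin (dsm_linear sU phi (i := i)) \o hpost U (tel_map u) i.
rewrite -[LHS]/(h f) (small_fsum sU h) fsum0 // => n.
set g := hpost U (dproj C n) i f.
rewrite -[LHS]/(dsm phi (hpost U (tel_map u) i (hpost U (dinj C n) i g))).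
have -> : hpost U (tel_map u) i (hpost U (dinj C n) i g)
    = hpost U (dinj C n) i g - hpost U (dinj C n.+1) i (hpost U (u n) i g).
  by apply: hext => a b ab x; rewrite hxD hxN !hpostE tel_mapE.
rewrite -[LHS]/(mkLin (dsm_linear sU phi (i := i)) _) linearB /=.
by rewrite !dsm_in phiS subrr.
Qed.

Definition tphi_fun i : homM U T i -> N i := fun f => dsm phi (hfam (@tfst _ _ _ _ _) i f).
Fact tphi_linear i : linear (@tphi_fun i).
Proof. by move=> a f g; rewrite /tphi_fun linearP dsm_linear. Qed.
Fact tphi_subproof i j (e : i + 1 = j) (f : homM U T i) :
  mkLin (@tphi_linear j) (cd (homM U T) e f) = cd N e (mkLin (@tphi_linear i) f).
Proof.
rewrite -[LHS]/(dsm phi (hfam (@tfst _ _ _ _ _) j (cd (HomC U T) e f))) tfst_d.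
have [g' ->] : exists g', tq (twcone (tel_map u)) e (hpost U (tout _) i f) = hpost U (tel_map u) j g'.
  have e' : 1 + i = j by rewrite addrC.
  exists (hcomp e' (@shift_gb K L 1 (dsumc C)) (hpost U (tout (twcone (tel_map u))) i f)).
  apply: hext => a b ab x; have e2 := end_d_index1 e ab; have e4 := end_d_index2 e ab.
  rewrite hpostE (hcompE _ _ _ ab erefl e2) shift_gbE hfamE (hdE e _ ab erefl e2 erefl e4) tsum_dE.
  set g := hpost U (tout _) i f.
  rewrite [hx (hfam _ _ g) e4 _](_ : _ = (0, hx g e4 (cd U erefl x))) //.
  rewrite (_ : ksgn i _ = (0, ksgn i (hx g e4 (cd U erefl x)))); last first.
    by apply: etrans (ksgn_pair _ _ _) _; rewrite ksgn0.
  rewrite -[LHS]/(cd (dsumc C) e2 0 + tel_map u b (cc (dsumc C) e2 (hx g erefl x)) - 0).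
  by rewrite linear0 add0r subr0.
rewrite -[LHS]/(mkLin (dsm_linear sU phi (i := j)) _) linearD /= dsm_d //.
by rewrite dsm_tel addr0.
Qed.
Definition tphi_cmap : cmap (homM U T) N :=
  @CMap K (homM U T) N (fun i => mkLin (@tphi_linear i)) tphi_subproof.
Fact tphi_act i j k (e : i + j = k) (x : homM U T i) (a : G j) :
  tphi_cmap k (dgact (homM U T) e x a) = dgact N e (tphi_cmap i x) a.
Proof. by rewrite -[LHS]/(dsm phi (hfam _ k (hcomp e x (a : HomC U U j)))) hfam_act dsm_act. Qed.
Definition tphi : dgMap (homM U T) N := DGMap tphi_act.

Lemma tphi_in n i f : tphi i (hpost U (tel_in u n) i f) = phi n i f.
Proof.
rewrite -[LHS]/(dsm phi (hfam (@tfst _ _ _ _ _) i (hpost U (tel_in u n) i f))).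
by rewrite (_ : hfam _ _ _ = hpost U (dinj C n) i f) ?dsm_in //; apply: hext.
Qed.

Lemma tphi_kl m m' (e : m + 1 = m') z : tphi m (kl (tel_map u) e 0 z) = 0.
Proof.
rewrite -[LHS]/(dsm phi (hfam (@tfst _ _ _ _ _) m (kl (tel_map u) e 0 z))).
rewrite (_ : hfam _ _ _ = 0); last exact: hext.
by rewrite /dsm fsum0 // => n; rewrite !linear0.
Qed.

(** A cycle into the telescope comes from a finite stage up to a boundary, and is killed at the next
    stage; this is why countably many stages suffice. *)
Lemma tphi_kill (S : int -> Prop) :
  (forall n m (z : HomC U (C n) (m + 1)) (y : N m), S m -> cycle z -> phi n _ z = cd N erefl y ->
     exists2 x : HomC U (C n.+1) m, hpost U (u n) (m + 1) z = cd (HomC U (C n.+1)) erefl x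
       & phi n.+1 m x = y) ->
  forall m (z : HomC U T (m + 1)) (y : N m), S m -> cycle z -> tphi _ z = cd N erefl y ->
    exists2 x : HomC U T m, z = cd (HomC U T) erefl x & tphi m x = y.
Proof.
move=> kill m z y Sm cz zy; have [n [c cc [e zE]]] := TelA sU cz.
(* [e] has degree [m + 1 - 1]; [e'] is a primitive of the same boundary in degree [m], and its image
   corrects the prescribed value [y]. *)
have [e' eE] := bdry_elim (erefl (m + 1)) (bdry_intro (subrK 1 (m + 1)) e).
have cy : phi n _ c = cd N erefl (y - tphi m e').
  rewrite linearB -zy zE eE linearD [tphi _ (cd _ _ _)]cfunC addrK.
  exact: (esym (tphi_in _)).
have [x jc px] := kill n m c (y - tphi m e') Sm cc cy.
have := tel_step u (erefl (m + 1)) cc.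
set k := kl _ _ _ _ => kE.
exists (k + hpost U (tel_in u n.+1) m x + e').
  by rewrite !linearD -kE -cfunC -jc subrK zE eE.
by rewrite !linearD tphi_kl add0r [tphi m (hpost _ _ _ _)]tphi_in px subrK.
Qed.
End Resolution.

(** Cells of degrees in [S] suffice to resolve the degrees in [S]; the class [P] records
    which operations the resolution is built from. *)
Theorem resolution (K : fieldType) (L : falgType K) (U : cplx L^c) (sU : small U)
    (N : dgMod (endDG U)) (S : int -> Prop) (P : cplx L^c -> Prop) :
  (forall m, S m -> P (shift (- m) U)) ->
  (forall I (W : I -> cplx L^c), (forall t, P (W t)) -> P (dsumc W)) ->
  (forall B C (q : twist B C), P B -> P C -> P (tsum q)) ->
  (forall A, P A -> P (shift 1 A)) ->
  exists (W : cplx L^c) (phi : dgMap (homM U W) N),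
    [/\ good U W, P W & forall m (z : HomC U W (m + 1)) (y : N m),
      S m -> cycle z -> phi _ z = cd N erefl y ->
      exists2 x : HomC U W m, z = cd (HomC U W) erefl x & phi m x = y].
Proof.
move=> Pcell Psum Pext Pshift.
pose s n := rseq sU N Pcell Psum Pext n.
exists (rT sU N Pcell Psum Pext), (tphi sU (phi := fun n => rphi (s n)) (fun n => @rstepE K L U sU N S P Pcell Psum Pext (s n))).
split; [exact: rT_good | exact: rT_P |].
apply: tphi_kill => n m z y Sm cz zy.
exact: (rstep_kill sU Pcell Psum Pext Sm cz zy).
Qed.

Arguments RR {K} L.

Section DgMaps.
Variables (K : fieldType) (L : falgType K) (U : cplx L^c).
Local Notation cpx := (cplx L^c).
Implicit Types (W M : cpx).

(** Fullness of [Hom(U, -)] on good objects: evaluating [phi f] at [u] is a balanced pairing, so it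
    factors through [W], and the factor commutes with differentials because the values of maps from
    [U] span [W]. *)
Lemma good_dgmap W M (phi : dgMap (homM U W) (homM U M)) : good U W ->
  exists f : cmap W M, forall n (c : HomC U W n), phi n c = hpost U f n c.
Proof.
case=> _ GT GS.
pose b i j k (e : i + j = k) (f : HomC U W i) (u : U j) := hx (phi i f : HomC U M i) (ixC e) u.
have bD i j k (e : i + j = k) f f' u : b i j k e (f + f') u = b i j k e f u + b i j k e f' u.
  by rewrite /b linearD.
have bl i j k (e : i + j = k) f : linear (b i j k e f) by move=> a x y; rewrite /b linearP.
have ba i n i' j j' k (e1 : i + n = i') (e2 : j + n = j') (e : i' + j = k)
     (e' : i + j' = k) (f : HomC U W i) (a : HomC U U n) u :
     b i' j k e (hcomp e1 f a) u = b i j' k e' f (hx a e2 u).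
  rewrite /b -(hcompE e1 (phi i f : HomC U M i) a (ixC e) e2 (ixC e')).
  by congr (hx _ _ u); exact: (dgf_act phi e1 f (a : endDG U n)).
have [g gE] := GT _ (GBal bD bl ba).
have {}gE i j k (e' : j + i = k) (f : HomC U W i) u : g k (hx f e' u) = hx (phi i f : HomC U M i) e' u.
  by have e : i + j = k; [rewrite addrC | rewrite (gE _ _ _ e e') /= /b (hx_irr _ (ixC e) e')].
have gC i j (e : i + 1 = j) (x : W i) : g j (cd W e x) = cd M e (g i x).
  refine (GS i _ (g j \o cd W e) (cd M e \o g i) _ x) => n k e' f u /=.
  have e1 : k + (n + 1) = j by rewrite addrA e'.
  have e4 : k + 1 + n = j by rewrite -e -e' addrAC.
  have cdE (Z : cpx) (h : HomC U Z n) : cd Z e (hx h e' u)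
      = hx (cd (HomC U Z) erefl h : hob _ _ _) e1 u + ksgn n (hx h e4 (cd U erefl u)).
    by rewrite (hdE erefl h e1 e' e erefl e4) subrK.
  by rewrite cdE linearD ksgn_lin !gE cdE -(cfunC phi).
exists (CMap gC) => n c; apply: hext => i j e x; rewrite hpostE /=.
by rewrite gE.
Qed.

Fact hpost_act W M (f : cmap W M) i j k (e : i + j = k) (x : homM U W i) (a : endDG U j) :
  hpost U f k (dgact (homM U W) e x a) = dgact (homM U M) e (hpost U f i x) a.
Proof. exact: (hfam_act (fun i => f i)). Qed.
Definition hpost_dg W M (f : cmap W M) : dgMap (homM U W) (homM U M) := @DGMap _ _ (homM U W) (homM U M) (hpost U f) (@hpost_act W M f).
End DgMaps.

Section CellResolution.
Variables (K : fieldType) (L : falgType K) (U : cplx L^c) (sU : small U).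
Local Notation cpx := (cplx L^c).

Theorem cell_resolution (M : cpx) (S : int -> Prop) (P : cpx -> Prop) :
  (forall m, S m -> P (shift (- m) U)) ->
  (forall I (W : I -> cpx), (forall t, P (W t)) -> P (dsumc W)) ->
  (forall B C (q : twist B C), P B -> P C -> P (tsum q)) ->
  (forall A, P A -> P (shift 1 A)) ->
  exists (W : cpx) (f : cmap W M), [/\ good U W, P W & forall m, S m -> cv (hpost U f) m].
Proof.
move=> Pc Ps Pe Psh.
have [W [phi [gW PW H]]] := resolution sU (homM U M) Pc Ps Pe Psh.
have [f fE] := good_dgmap phi gW.
exists W, f; split=> // m Sm m' e z y cz fz; subst m'.
have [|x zE xy] := H m z y Sm cz; first by rewrite fE.
by exists x => //; rewrite -fE xy subrr; apply: bdry0.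
Qed.

Lemma cv_rr (M N : cpx) (f : cmap M N) m : cv (hpost (RR L) f) m -> cv f m.
Proof.
move=> H m' e z y cz fz.
have [||x zE bx] := H m' e (rr_elt z) (rr_elt y).
- by apply/rr_cycle; rewrite rr_eltK.
- by apply: rr_ev_inj; rewrite rr_post rr_ev_d !rr_eltK.
exists (rr_ev x); first by rewrite -rr_ev_d -zE rr_eltK.
have := proj1 (rr_bdry _) bx.
by rewrite -[rr_ev _]/(rr_ev (rr_elt y) - f m (rr_ev x)) rr_eltK.
Qed.
End CellResolution.

(** The case of the regular module, with cells in all degrees: [HomC (RR L)] is the complex itself,
    so being resolved by cells means being quasi-isomorphic to a cellular complex. *)
Theorem kproj_resolution (K : fieldType) (L : falgType K) (M : cplx L^c) :
  exists (P : cplx L^c) (q : cmap P M), kproj P /\ qis q.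
Proof.
have sR : small (RR L) by apply/perfb_small/RR_perfb.
have kR : kproj (RR L) by apply/perfb_kproj/RR_perfb.
have [W [f [_ kW H]]] : exists (W : cplx L^c) (f : cmap W M),
    [/\ good (RR L) W, kproj W & forall m, True -> cv (hpost (RR L) f) m].
  apply: cell_resolution => //.
  - by move=> m _; apply: kproj_shift.
  - by move=> I W; apply: kproj_dsum.
  - by move=> B C q; apply: kproj_tsum.
  - by move=> A; apply: kproj_shift.
by exists W, f; split=> //; apply/qis_cv => m; apply/cv_rr/H.
Qed.

(** * The derived category *)

Add Parametric Relation (R : pzRingType) (M N : cplx R) : (dhom M N) (@deq R M N)
  reflexivity proved by (@deq_refl R M N)
  symmetry proved by (@deq_sym R M N)
  transitivity proved by (@deq_trans R M N) as deq_rel.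

Add Parametric Morphism (R : pzRingType) (M N P : cplx R) : (@dcomp R M N P)
  with signature (@deq R N P) ==> (@deq R M N) ==> (@deq R M P) as dcomp_morphism.
Proof. by move=> g g' eg f f' ef; apply: deq_comp. Qed.

#[local] Hint Resolve deq_refl : core.

Lemma zmod_lem3 (V : zmodType) (p q : V) : - p + (q + p) = q.
Proof. by rewrite addrC addrK. Qed.

Section Localization.
Variable R : pzRingType.
Implicit Types M N P Q A B : cplx R.

Local Notation "g \* f" := (dcomp g f) (at level 40, left associativity).
Local Notation "f ~~ g" := (deq f g) (at level 70).

Lemma deq_invlK M N P (s : cmap M N) (qs : qis s) (f : dhom P M) :
  dinv s qs \* (dmap s \* f) ~~ f.
Proof. by rewrite deq_compA deq_invl deq_idl. Qed.
Lemma deq_invrK M N P (s : cmap M N) (qs : qis s) (f : dhom P N) :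
  dmap s \* (dinv s qs \* f) ~~ f.
Proof. by rewrite deq_compA deq_invr deq_idl. Qed.

Lemma qis_monic M N P (s : cmap M N) (f g : dhom P M) : qis s ->
  dmap s \* f ~~ dmap s \* g -> f ~~ g.
Proof. by move=> qs H; rewrite -(deq_invlK qs f) H deq_invlK. Qed.
Lemma qis_epic M N P (s : cmap M N) (f g : dhom N P) : qis s ->
  f \* dmap s ~~ g \* dmap s -> f ~~ g.
Proof.
by move=> qs H; rewrite -(deq_idr f) -(deq_idr g) -(deq_invr qs) !deq_compA H.
Qed.

Lemma diso_sym M N (f : dhom M N) (g : dhom N M) :
  dcomp g f ~~ did M /\ dcomp f g ~~ did N -> diso g.
Proof. by case=> fg gf; exists f; split. Qed.
Lemma dIso_refl M : dIso M M.
Proof. by exists (did M), (did M); split; apply: deq_idl. Qed.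
Lemma dIso_sym M N : dIso M N -> dIso N M.
Proof. by case=> f [g fg]; exists g; apply: diso_sym fg. Qed.
Lemma diso_comp M N P (g : dhom N P) (f : dhom M N) : diso g -> diso f -> diso (g \* f).
Proof.
move=> [g' [g'g gg']] [f' [f'f ff']]; exists (f' \* g'); split.
  by rewrite -deq_compA (deq_compA g' g f) g'g [did N \* f]deq_idl f'f.
by rewrite -deq_compA (deq_compA f f' g') ff' [did N \* g']deq_idl gg'.
Qed.
Lemma dIso_trans M N P : dIso M N -> dIso N P -> dIso M P.
Proof. by move=> [f If] [g Ig]; exists (g \* f); apply: diso_comp. Qed.
Lemma qis_diso M N (s : cmap M N) : qis s -> diso (dmap s).
Proof. by move=> qs; exists (dinv s qs); split; [apply: deq_invl | apply: deq_invr]. Qed.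
Lemma qis_dIso M N (s : cmap M N) : qis s -> dIso M N.
Proof. by move/qis_diso; exists (dmap s). Qed.

Section Pair.
Variables (A B C : cplx R).
Section In.
Variables (f : cmap A B) (g : cmap A C).
Fact cpair_linear i : linear (fun x => (f i x, g i x) : csum B C i).
Proof. by move=> a x y; rewrite !linearP. Qed.
Fact cpair_subproof i j (e : i + 1 = j) (x : A i) :
  mkLin (@cpair_linear j) (cd A e x) = cd (csum B C) e (mkLin (@cpair_linear i) x).
Proof. by rewrite /= !cfunC. Qed.
Definition cpair : cmap A (csum B C) := @CMap R A (csum B C) (fun i => mkLin (@cpair_linear i)) cpair_subproof.
End In.
Section Out.
Variables (f : cmap A C) (g : cmap B C).
Fact ccase_linear i : linear (fun x : csum A B i => f i x.1 + g i x.2).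
Proof. by move=> a x y; rewrite /= !linearP scalerDr addrACA. Qed.
Fact ccase_subproof i j (e : i + 1 = j) (x : csum A B i) :
  mkLin (@ccase_linear j) (cd (csum A B) e x) = cd C e (mkLin (@ccase_linear i) x).
Proof. by rewrite /= linearD !cfunC. Qed.
Definition ccase : cmap (csum A B) C := @CMap R (csum A B) C (fun i => mkLin (@ccase_linear i)) ccase_subproof.
End Out.
End Pair.

Lemma acyclic_fst A B : acyclic B -> qis (cfst A B).
Proof.
move=> aB i; split=> [[x y] cxy [j [e [x' /= xE]]]|y cy].
  have cy : cycle y by move=> k e'; exact: (congr1 snd (cxy k e')).
  have [y' yE] := bdry_elim e (aB _ y cy).
  by exists j, e, (x', y'); rewrite xE yE.
exists ((y, 0) : csum A B i); last by rewrite /= subrr; apply: bdry0.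
by move=> j e; rewrite /= cy linear0.
Qed.

Lemma kone_id_acyclic A : acyclic (kone (Defs.cid A)).
Proof. by apply/kone_acyclic => i; split=> // y cy; exists y => //; rewrite subrr; apply: bdry0. Qed.

(** A null-homotopic map factors through the cone of the identity, which is acyclic. *)
Lemma null_deq A B (f g : cmap A B) (h : forall i j, i + 1 = j -> {linear A j -> B i}) :
  (forall i j k (e : i + 1 = j) (e' : j + 1 = k) x,
     f j x - g j x = cd B e (h i j e x) + h j k e' (cd A e' x)) ->
  dmap f ~~ dmap g.
Proof.
move=> H; pose n := csubm f g; pose Z := kone (Defs.cid A).
pose hh i : {linear shift 1 A i -> B i} := h i (i + 1) erefl.
have hhE i j (e : i + 1 = j) x : hh j (cd (shift 1 A) e x) + n j (tw (twcone (Defs.cid A)) e x)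
    = cd B e (hh i x).
  case: j / e; rewrite twconeE cc_id csubmE (H _ _ _ erefl erefl) /=.
  rewrite /ksgn /= linearN (cd_irr (shift_index 1 erefl) erefl x).
  exact: zmod_lem3.
pose k : cmap Z B := tsum_map hhE.
(* [s] and [s0] are two sections of the projection to [A], a quasi-isomorphism since [Z] is acyclic,
   so they agree in the derived category. On the cone, [k] extends [f - g], so composing with [s]
   and [s0] gives [f] and [g]. *)
pose s : cmap A (csum A Z) := cpair (Defs.cid A) (tin _).
pose s0 : cmap A (csum A Z) := cpair (Defs.cid A) (czero A Z).
have ss0 : dmap s ~~ dmap s0.
  have qf := @acyclic_fst A Z (@kone_id_acyclic A).
  by apply: (qis_monic qf); rewrite -!deq_mapC; apply: deq_map.
have -> : dmap f ~~ dmap (ccase g k) \* dmap s.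
  rewrite -deq_mapC; apply: deq_map => i x /=.
  by rewrite linear0 addr0 addrC subrK.
rewrite ss0 -deq_mapC; apply: deq_map => i x /=.
by rewrite !linear0 !addr0.
Qed.
End Localization.

Lemma zmod_lem4 (V : zmodType) (a b c : V) : b - c = a - c - (a - b).
Proof. by rewrite opprB [RHS]addrC addrA subrK. Qed.

(** * The action of morphisms on homotopy classes *)

Section Action.
Variables (K : fieldType) (L : falgType K).
Local Notation cpx := (cplx L^c).
Implicit Types A B C M N P Q : cpx.
Local Notation "g \* f" := (dcomp g f) (at level 40, left associativity).
Local Notation "f ~~ g" := (deq f g) (at level 70).

Lemma htp_deq A B (f g : cmap A B) : bdry (c2h f - c2h g : HomC A B 0) -> dmap f ~~ dmap g.
Proof.
move=> /(bdry_elim (addNr 1)) [h hE].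
have ix (i j : int) : i + 1 = j -> j - 1 = i by move=> <-; rewrite addrK.
refine (@null_deq L^c A B f g (fun i j e => hx h (ix i j e)) _) => i j k e e' x.
have := hx_eq hE (addr0 j) x; rewrite hxD hxN !c2hE => ->.
have e4 : k + (-1) = j by rewrite -e' addrK.
by rewrite (hdE _ h (addr0 j) (ix i j e) e e' e4) ksgnNn ksgn1 opprK (hx_irr h _ (ix j k e')).
Qed.

Lemma kproj_post_qis P A B (s : cmap A B) : kproj P -> qis s -> qis (hpost P s).
Proof. by move=> kP qs; apply/qis_cv; apply: kproj_cv. Qed.

(** The action of the morphisms of the derived category on the classes of maps of degree [m] from a K-projective
    complex; a relation, since the inverse of a quasi-isomorphism acts by choosing a lift. *)
Fixpoint act P m M N (f : dhom M N) : HomC P M m -> HomC P N m -> Prop :=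
  match f in dhom M N return HomC P M m -> HomC P N m -> Prop with
  | dmap _ _ g => fun c c' => bdry (c' - hpost P g m c)
  | dinv _ _ s _ => fun c c' => bdry (c - hpost P s m c')
  | dcomp _ _ _ g f => fun c c'' => exists2 c', cycle c' & act f c c' /\ act g c' c''
  end.
Lemma act_map P m M N (g : cmap M N) c c' : @act P m M N (dmap g) c c' = bdry (c' - hpost P g m c).
Proof. by []. Qed.
Lemma act_inv P m M N (s : cmap M N) (qs : qis s) c c' :
  @act P m N M (dinv s qs) c c' = bdry (c - hpost P s m c').
Proof. by []. Qed.
Lemma act_comp P m M N Q (g : dhom N Q) (f : dhom M N) c c'' :
  @act P m M Q (g \* f) c c'' = exists2 c' : HomC P N m, cycle c' & act f c c' /\ act g c' c''.
Proof. by []. Qed.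

Lemma hpost_id A M m (c : HomC A M m) : hpost A (Defs.cid M) m c = c.
Proof. exact: hext. Qed.

Section Proj.
Variables (P : cpx) (kP : kproj P) (m : int).
Local Notation H M := (HomC P M m).

Lemma act_total M N (f : dhom M N) (c : H M) : cycle c -> exists2 c' : H N, cycle c' & act f c c'.
Proof.
elim: M N / f c => [M N g|M N s qs|M N Q g IHg f IHf] c cc; rewrite ?act_map ?act_inv ?act_comp.
- by exists (hpost P g m c); [apply: cyc_map | rewrite act_map subrr; apply: bdry0].
- by have [_ +] := kproj_post_qis kP qs m; move=> /(_ c cc) [c' cc' b]; exists c'.
- have [c1 cc1 a1] := IHf c cc; have [c2 cc2 a2] := IHg c1 cc1.
  by exists c2 => //; exists c1.
Qed.

Lemma act_sub M N (f : dhom M N) (c d : H M) (c' d' : H N) :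
  act f c c' -> act f d d' -> act f (c - d) (c' - d').
Proof.
have sub (Q : cpx) (x y z t : H Q) : x - y - (z - t) = x - z - (y - t).
  by rewrite !opprD !opprK addrACA.
elim: M N / f c d c' d' => [M N g|M N s qs|M N Q g IHg f IHf] c d c' d'; rewrite ?act_map ?act_inv ?act_comp.
- by move=> b b'; rewrite linearB sub; apply: bdryB.
- by move=> b b'; rewrite linearB sub; apply: bdryB.
- move=> [c1 cc1 [a1 a2]] [d1 cd1 [b1 b2]]; exists (c1 - d1); first exact: cycleB.
  by split; [apply: IHf | apply: IHg].
Qed.

Lemma act_bdry M N (f : dhom M N) (c : H M) (c' : H N) : bdry c -> bdry c' -> act f c c'.
Proof.
elim: M N / f c c' => [M N g|M N s qs|M N Q g IHg f IHf] c c' b b'; rewrite ?act_map ?act_inv ?act_comp.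
- by apply: bdryB => //; apply: bdry_map.
- by apply: bdryB => //; apply: bdry_map.
- by exists 0; [apply: cycle0 | split; [apply: IHf | apply: IHg] => //; apply: bdry0].
Qed.

Lemma act_inj M N (f : dhom M N) (c : H M) (c' : H N) : cycle c' -> act f c c' -> bdry c -> bdry c'.
Proof.
elim: M N / f c c' => [M N g|M N s qs|M N Q g IHg f IHf] c c' cc'; rewrite ?act_map ?act_inv ?act_comp.
- move=> b bc; rewrite -[c'](subrK (hpost P g m c)).
  by apply: bdryD => //; apply: bdry_map.
- move=> b bc; have [+ _] := kproj_post_qis kP qs m; apply=> //.
  by rewrite -[hpost P s m c'](subKr c); apply: bdryB.
- by move=> [c1 cc1 [a1 a2]] bc; apply: (IHg c1) => //; apply: (IHf c).
Qed.

Lemma act_fun M N (f : dhom M N) (c d : H M) (c' d' : H N) : cycle c' -> cycle d' ->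
  act f c c' -> act f d d' -> bdry (c - d) -> bdry (c' - d').
Proof. by move=> cc cd a b; apply: (act_inj (f := f)); [apply: cycleB | apply: act_sub]. Qed.

Lemma act_eqv M N (f : dhom M N) (c d : H M) (c' d' : H N) :
  act f c c' -> bdry (c - d) -> bdry (c' - d') -> act f d d'.
Proof.
move=> a b b'; rewrite -(subKr c d) -(subKr c' d').
by apply: act_sub => //; apply: act_bdry.
Qed.

(** Induction over the generators of the congruence. The action is the invariant by which an
    equation in a category given by generators and relations yields a homotopy. *)
Lemma act_deq M N (f g : dhom M N) : f ~~ g ->
  forall (c : H M) (c' : H N), cycle c -> cycle c' -> act f c c' <-> act g c c'.
Proof.
elim: M N f g /.
- by [].
- by move=> M N f g _ IH c c' cc cc'; rewrite IH.
- by move=> M N f g h _ IH1 _ IH2 c c' cc cc'; rewrite IH1 // IH2.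
- move=> M N Q g g' f f' _ IHg _ IHf c c' cc cc'.
  split=> -[c1 cc1 [a1 a2]]; exists c1 => //; split.
  + by apply/IHf.
  + by apply/IHg.
  + by apply/IHf.
  + by apply/IHg.
- move=> M N Q S h g f c c' cc cc'; split.
    by move=> [c1 cc1 [[c2 cc2 [a1 a2]] a3]]; exists c2 => //; split=> //; exists c1.
  by move=> [c2 cc2 [a1 [c1 cc1 [a2 a3]]]]; exists c1 => //; split=> //; exists c2.
- move=> M N f c c' cc cc'; split=> [[c1 cc1 [a b]]|a].
    apply: (act_eqv a); first by rewrite subrr; apply: bdry0.
    by rewrite -opprB; apply: bdryN; move: b; rewrite ?act_map hpost_id.
  by exists c' => //; split=> //; rewrite act_map hpost_id subrr; apply: bdry0.
- move=> M N f c c' cc cc'; split=> [[c1 cc1 [a b]]|a].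
    by apply: (act_eqv b); [rewrite -(hpost_id c); exact: a | rewrite subrr; apply: bdry0].
  by exists c => //; split=> //; rewrite act_map hpost_id subrr; apply: bdry0.
- move=> M N f g fg c c' cc cc'; rewrite !act_map; suff -> : hpost P f m c = hpost P g m c by [].
  by apply: hext => i j e x; rewrite !hpostE fg.
- move=> M N Q g f c c' cc cc'; rewrite ?act_map ?act_inv ?act_comp.
  have E : hpost P (ccomp g f) m c = hpost P g m (hpost P f m c) by apply: hext.
  rewrite E; split=> [b|[c1 cc1 [a1 a2]]].
    exists (hpost P f m c); first exact: cyc_map.
    by split=> //; rewrite act_map subrr; apply: bdry0.
  rewrite -[c'](subrK (hpost P g m c1)) -addrA -linearB.
  by apply: bdryD => //; apply: bdry_map.
- move=> M N s qs c c' cc cc'; rewrite ?act_map ?act_inv ?act_comp.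
  rewrite ?act_map hpost_id; split=> [[c1 cc1 [a b]]|b].
    have [+ _] := kproj_post_qis kP qs m; apply; first exact: cycleB.
    by rewrite linearB (zmod_lem4 c1); apply: bdryB.
  exists (hpost P s m c); first exact: cyc_map.
  split; first by rewrite act_map subrr; apply: bdry0.
  by rewrite act_inv -linearB -opprB linearN; apply/bdryN/bdry_map.
- move=> M N s qs c c' cc cc'; rewrite ?act_map ?act_inv ?act_comp.
  rewrite ?act_map hpost_id; split=> [[c1 cc1 [a b]]|b].
    by rewrite (zmod_lem4 (hpost P s m c1)); apply: bdryB; rewrite -opprB; apply: bdryN.
  have [_ +] := kproj_post_qis kP qs m; move=> /(_ c cc) [c1 cc1 b1]; exists c1 => //; split=> //.
  by rewrite act_map -[c'](subrK c) -addrA; apply: bdryD.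
Qed.
End Proj.
End Action.

Section FiveLemma.
Variable R : pzRingType.
Implicit Types A B P Q S : cplx R.

Lemma ses_qis_r P Q S (i : cmap P Q) (p : cmap Q S) : ses i p -> acyclic P -> qis p.
Proof.
move=> H aP m; split=> [x cx /(bdry_elim (subrK 1 m)) [y pE]|y cy].
  have [w wE] := ses_surj H y.
  have [z zE] : exists z, x - cd Q (subrK 1 m) w = i m z.
    by apply: (ses_ex H); rewrite linearB cfunC wE pE subrr.
  rewrite -[x](subrK (cd Q (subrK 1 m) w)) zE; apply: bdryD; last exact: bdry_intro.
  apply/bdry_map/aP/(@cycle1 _ _ _ _ erefl)/(ses_inj H).
  by rewrite cfunC -zE linearB cdd cx subrr.
have [w wE] := ses_surj H y.
have [z zE] : exists z, cd Q (erefl (m + 1)) w = i _ z.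
  by apply: (ses_ex H); rewrite cfunC wE cy.
have [|z' z'E] := bdry_elim (erefl (m + 1)) (aP _ z _).
  by apply/(@cycle1 _ _ _ _ erefl)/(ses_inj H); rewrite cfunC -zE cdd.
exists (w - i m z'); first by apply: (@cycle1 _ _ _ _ erefl); rewrite linearB zE z'E cfunC subrr.
by rewrite linearB wE (ses_zero H) subr0 subrr; apply: bdry0.
Qed.

Section KoneMap.
Variables (A B A' B' : cplx R) (f : cmap A B) (f' : cmap A' B') (a : cmap A A') (b : cmap B B').
Variable h : forall i j, i + 1 = j -> {linear A j -> B' i}.
Variable hE : forall i j k (e : i + 1 = j) (e' : j + 1 = k) x,
  b j (f j x) - f' j (a j x) = cd B' e (h e x) + h e' (cd A e' x).

Definition kmap_fun i (p : kone f i) : kone f' i := (b i p.1 + h (erefl (i + 1)) p.2, a (i + 1) p.2).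
Fact kmap_linear i : linear (@kmap_fun i).
Proof.
move=> c x y; congr pair => /=; last exact: linearP.
by rewrite !linearP scalerDr addrACA.
Qed.
Fact kmap_subproof i j (e : i + 1 = j) (p : kone f i) :
  mkLin (@kmap_linear j) (cd (kone f) e p) = cd (kone f') e (mkLin (@kmap_linear i) p).
Proof.
case: p => y x; rewrite !kone_dE; case: j / e; congr pair => /=; last first.
  by rewrite linearN cfunC.
rewrite ?cc_id !linearD linearN cfunC -addrA -[RHS]addrA; congr (_ + _).
have := hE erefl (shift_index 1 (erefl (i + 1))) x.
rewrite (_ : h (shift_index 1 erefl) _ = h erefl (cd A (shift_index 1 erefl) x)); last first.
  by rewrite (eq_irrelevance (shift_index 1 erefl) erefl).
by move=> /eqP; rewrite subr_eq -addrA [h _ _ + _]addrC addrA => /eqP ->; rewrite addrK.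
Qed.
Definition kone_map : cmap (kone f) (kone f') :=
  @CMap R (kone f) (kone f') (fun i => mkLin (@kmap_linear i)) kmap_subproof.
End KoneMap.

Section Five.
Variables (P Q S P' Q' S' : cplx R) (i : cmap P Q) (p : cmap Q S) (i' : cmap P' Q') (p' : cmap Q' S').
Variables (H : ses i p) (H' : ses i' p') (u : cmap P P') (v : cmap Q Q') (w : cmap S S').
Hypotheses (uv : forall n x, i' n (u n x) = v n (i n x)) (vw : forall n x, p' n (v n x) = w n (p n x)).

Let hz (A B A' B' : cplx R) (f : cmap A B) (f' : cmap A' B') (a : cmap A A') (b : cmap B B')
  (E : forall n x, f' n (a n x) = b n (f n x)) l j k (e : l + 1 = j) (e' : j + 1 = k) x :
  b j (f j x) - f' j (a j x) = cd B' e (linHom_zero (A j) (B' l) x)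
    + linHom_zero (A k) (B' j) (cd A e' x).
Proof. by rewrite E subrr /= linear0 addr0. Qed.

(** The cones of [u], [v] and [w] form a short exact sequence, so acyclicity of the outer two passes
    to the middle one. *)
Lemma five_qis : qis u -> qis w -> qis v.
Proof.
move=> /kone_acyclic au /kone_acyclic aw; apply/kone_acyclic => m.
have uv' n x := esym (@uv n x); have vw' n x := esym (@vw n x).
have Hs : ses (kone_map (@hz _ _ _ _ u v i i' uv')) (kone_map (@hz _ _ _ _ v w p p' vw')).
  split=> [n [x y] [/=]|n [x y]|n [x y]|n [x y] [/=]].
  - rewrite addr0 => xE yE.
    by congr pair; [apply: (ses_inj H') | apply: (ses_inj H)].
  - have [x' <-] := ses_surj H' x; have [y' <-] := ses_surj H y.
    by exists (x', y'); congr pair; rewrite /= addr0.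
  - by congr pair; rewrite /= ?addr0 ?(ses_zero H') ?(ses_zero H).
  - rewrite addr0 => xE yE.
    have [x' ->] := ses_ex H' xE; have [y' ->] := ses_ex H yE.
    by exists (x', y'); congr pair; rewrite /= addr0.
exact: (ses_mid Hs (au m) (aw m)).
Qed.
End Five.

Lemma kone_map_qis A B A' B' (f : cmap A B) (f' : cmap A' B') (a : cmap A A') (b : cmap B B') h hE :
  qis a -> qis b -> qis (@kone_map A B A' B' f f' a b h hE).
Proof.
move=> qa qb.
apply: (five_qis (tses (twcone f)) (tses (twcone f')) _ _ qb (qis_shift 1 qa)) => // n x.
by congr pair; rewrite /= ?linear0 ?addr0.
Qed.

(** The natural map from the cone of [i] to [S] is onto with kernel the cone of the identity of [P],
    which is acyclic. *)
Lemma ses_kone P Q S (i : cmap P Q) (p : cmap Q S) : ses i p -> exists s : cmap (kone i) S, qis s.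
Proof.
move=> H.
have pE k j (e : k + 1 = j) x : linHom_zero _ (S j) (cd (shift 1 P) e x) + p j (tw (twcone i) e x)
    = cd S e (linHom_zero (shift 1 P k) (S k) x).
  by rewrite twconeE /= (ses_zero H) add0r linear0.
exists (tsum_map pE).
have E n (x : P n) : i n (Defs.cid P n x) = i n (Defs.cid P n x) by [].
have jE k j l (e : k + 1 = j) (e' : j + 1 = l) x :
    i j (Defs.cid P j x) - i j (Defs.cid P j x) = cd Q e (linHom_zero (P j) (Q k) x)
      + linHom_zero (P l) (Q j) (cd P e' x).
  by rewrite subrr /= linear0 addr0.
have Hs : ses (@kone_map P P P Q (Defs.cid P) i (Defs.cid P) i _ jE) (tsum_map pE).
  split=> [n [x y] [/=]|n y|n [x y]|n [x y] /=].
  - by rewrite addr0 => /(ses_inj H) -> ->.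
  - by have [x <-] := ses_surj H y; exists (x, 0); rewrite /= addr0.
  - by rewrite /= !addr0 (ses_zero H).
  - rewrite addr0 => /(ses_ex H) [z ->]; exists (z, y).
    by congr pair; rewrite /= addr0.
exact: ses_qis_r Hs (@kone_id_acyclic _ P).
Qed.

Section ConeKone.
Variables (A B : cplx R) (f : cmap A B).
Fact ck_linear i : linear (fun x : cone f i => (x : kone f i)).
Proof. by []. Qed.
Definition cone_kone : cmap (cone f) (kone f) :=
  @CMap R (cone f) (kone f) (fun i => mkLin (@ck_linear i)) (@cone_kone_subproof _ _ _ f).
Fact kc_linear i : linear (fun x : kone f i => (x : cone f i)).
Proof. by []. Qed.
Definition kone_cone : cmap (kone f) (cone f) :=
  @CMap R (kone f) (cone f) (fun i => mkLin (@kc_linear i))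
   (fun i j e x => esym (@cone_kone_subproof _ _ _ f i j e x)).
Lemma iso_qis (M N : cplx R) (s : cmap M N) (t : cmap N M) :
  (forall i x, t i (s i x) = x) -> (forall i x, s i (t i x) = x) -> qis s.
Proof.
move=> ts st i; split=> [x _ /(bdry_map t)|y cy]; first by rewrite ts.
by exists (t i y); [apply: cyc_map | rewrite st subrr; apply: bdry0].
Qed.
Lemma cone_kone_qis : qis cone_kone.
Proof. exact: (@iso_qis _ _ cone_kone kone_cone). Qed.
End ConeKone.

Lemma triangle_intro A B P (f : cmap A B) : dIso P (kone f) -> triangle A B P.
Proof.
move=> /dIso_trans /(_ (dIso_sym (qis_dIso (cone_kone_qis f)))) [c Ic].
have [c' [c'c cc']] := Ic.
exists (dmap f), (dcomp c' (dmap (cone_in f))), (dcomp (dmap (cone_out f)) c).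
exists A, B, f, (did A), (did B), c; split.
  split=> //; by exists (did _); split; apply: deq_idl.
split; first by rewrite [dcomp (did B) _]deq_idl [dcomp _ (did A)]deq_idr.
  by rewrite deq_compA cc' [dcomp (did _) _]deq_idl [dcomp _ (did B)]deq_idr.
rewrite (_ : deq (dsusp (did A)) (did _)) ?[dcomp (did _) _]deq_idl //.
exact: deq_map.
Qed.

(** Closure properties and Hom vanishing depend only on the three objects, so the maps of the
    triangle are dropped and a chain map with its cone is kept. *)
Lemma triangle_elim M N P : triangle M N P -> exists (A B : cplx R) (f : cmap A B),
  [/\ dIso M A, dIso N B & dIso P (kone f)].
Proof.
move=> [u [v [w [A [B [f [a [b [c [[Ia Ib Ic] _]]]]]]]]]].
exists A, B, f; split; [by exists a | by exists b |].
by apply: dIso_trans (qis_dIso (cone_kone_qis f)); exists c.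
Qed.

Lemma triangle_ses P Q S (i : cmap P Q) (p : cmap Q S) : ses i p -> triangle P Q S.
Proof. by move=> /ses_kone [s qs]; apply/triangle_intro/dIso_sym/(qis_dIso qs). Qed.
End FiveLemma.

(** * Morphisms out of K-projective complexes *)

Section Lifting.
Variables (K : fieldType) (L : falgType K).
Local Notation cpx := (cplx L^c).
Implicit Types A B C M N P Q : cpx.
Local Notation "g \* f" := (dcomp g f) (at level 40, left associativity).
Local Notation "f ~~ g" := (deq f g) (at level 70).

Lemma hpost_c2h A M N (t : cmap M N) (f : cmap A M) : hpost A t 0 (c2h f) = c2h (ccomp t f).
Proof. by apply: hext0 => i e x; rewrite hpostE !c2hE. Qed.
Lemma hpost_hid A M (t : cmap A M) : hpost A t 0 (hid A) = c2h t.
Proof. by apply: hext0 => i e x; rewrite hpostE hidE c2hE. Qed.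

(** A chain map from a K-projective complex lifts through each formal inverse up to homotopy, so a
    whole formal composite collapses to one chain map. *)
Lemma lift_dhom P M N (f : dhom M N) (s : cmap P M) : kproj P ->
  exists g : cmap P N, f \* dmap s ~~ dmap g.
Proof.
move=> kP; elim: M N / f s => [M N f|M N t qt|M N Q g IHg f IHf] s.
- by exists (ccomp f s); rewrite deq_mapC.
- have [_ +] := kproj_post_qis kP qt 0; move=> /(_ _ (c2h_cycle s)) [c cc b].
  exists (h2c cc); suff -> : dmap s ~~ dmap t \* dmap (h2c cc) by rewrite deq_invlK.
  by rewrite -deq_mapC; apply: htp_deq; rewrite -hpost_c2h h2cK.
have [f' fE] := IHf s; have [g' gE] := IHg f'.
by exists g'; rewrite -deq_compA fE.
Qed.

Lemma dhom_rep P N (f : dhom P N) : kproj P -> exists g : cmap P N, f ~~ dmap g.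
Proof. by move=> /(lift_dhom f (Defs.cid P)) [g gE]; exists g; rewrite -gE deq_idr. Qed.

(** Both maps act on the class of the identity, and equal morphisms act equally; this returns a
    homotopy. *)
Lemma dmap_htp P N (f g : cmap P N) : kproj P ->
  dmap f ~~ dmap g -> bdry (c2h f - c2h g : HomC P N 0).
Proof.
move=> kP /(act_deq kP (m := 0)) /(_ (hid P) (c2h f) (@hid_cycle _ _ P) (c2h_cycle f)).
by rewrite !act_map !hpost_hid => -[+ _]; apply; rewrite subrr; apply: bdry0.
Qed.

Lemma diso_deq M N (f g : dhom M N) : f ~~ g -> diso f -> diso g.
Proof. by move=> fg [f' [f'f ff']]; exists f'; rewrite -fg. Qed.

Lemma RR_kproj : kproj (RR L).
Proof. exact/perfb_kproj/RR_perfb. Qed.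

(** Tested on [RR], where the action is the one on cohomology. *)
Lemma diso_qis M N (s : cmap M N) : diso (dmap s) -> qis s.
Proof.
move=> [g [gs sg]] m; split=> [x cx bx|y cy].
  have cc : cycle (rr_elt x : HomC (RR L) M m) by apply/rr_cycle; rewrite rr_eltK.
  have [c1 cc1 a1] := act_total RR_kproj g (cyc_map (hpost (RR L) s) cc).
  have bc1 : bdry c1.
    apply: (act_inj RR_kproj cc1 a1); apply/rr_bdry.
    by rewrite rr_post rr_eltK.
  have : act (g \* dmap s) (rr_elt x) c1.
    exists (hpost (RR L) s m (rr_elt x)); first exact: cyc_map.
    by split=> //; rewrite act_map subrr; apply: bdry0.
  move=> /(proj1 (act_deq RR_kproj gs cc cc1)); rewrite act_map hpost_id => b.
  have : bdry (rr_elt x : HomC (RR L) M m) by rewrite -(subKr c1 (rr_elt x)); apply: bdryB.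
  by move/rr_bdry; rewrite rr_eltK.
have cc : cycle (rr_elt y : HomC (RR L) N m) by apply/rr_cycle; rewrite rr_eltK.
have [c1 cc1 a1] := act_total RR_kproj g cc.
exists (rr_ev c1); first exact/rr_cycle.
have : act (dmap s \* g) (rr_elt y) (hpost (RR L) s m c1).
  by exists c1 => //; split=> //; rewrite act_map subrr; apply: bdry0.
have cs : cycle (hpost (RR L) s m c1) by apply: cyc_map.
move=> /(proj1 (act_deq RR_kproj sg cc cs)); rewrite act_map hpost_id => b.
have /rr_bdry := bdryN b; rewrite opprB.
by rewrite -[rr_ev _]/(rr_ev (rr_elt y) - s m (rr_ev c1)) rr_eltK.
Qed.

Lemma dIso_rep P N : kproj P -> dIso P N -> exists s : cmap P N, qis s.
Proof.
move=> kP [f If]; have [s sE] := dhom_rep f kP.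
by exists s; apply/diso_qis/(diso_deq sE).
Qed.

Lemma dIso_roof M N : dIso M N -> exists P (s : cmap P M) (t : cmap P N), [/\ kproj P, qis s & qis t].
Proof.
move=> MN; have [P [s [kP qs]]] := kproj_resolution M.
have [t qt] := dIso_rep kP (dIso_trans (qis_dIso qs) MN).
by exists P, s, t; split.
Qed.

Lemma dIso_shift k M N : dIso M N -> dIso (shift k M) (shift k N).
Proof.
move=> /dIso_roof [P [s [t [_ qs qt]]]].
exact: dIso_trans (dIso_sym (qis_dIso (qis_shift k qs))) (qis_dIso (qis_shift k qt)).
Qed.

Lemma qis_hv Q M N m (s : cmap M N) : kproj Q -> qis s -> hv Q M m <-> hv Q N m.
Proof.
move=> kQ /(kproj_post_qis kQ) /(_ m) [H1 H2]; split=> H c cc.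
  have [c' cc' b] := H2 c cc; rewrite -[c](subrK (hpost Q s m c')).
  by apply: bdryD => //; apply/bdry_map/H.
by apply: H1 => //; apply/H/cyc_map.
Qed.

Lemma dIso_hv Q M N m : kproj Q -> dIso M N -> hv Q M m <-> hv Q N m.
Proof.
by move=> kQ /dIso_roof [P [s [t [_ qs qt]]]]; rewrite -(qis_hv m kQ qs) (qis_hv m kQ qt).
Qed.

Lemma dIso_cohom M N m : dIso M N -> cohom0 M m <-> cohom0 N m.
Proof. by move=> MN; rewrite -!hv_rr; apply: dIso_hv => //; apply: RR_kproj. Qed.

Lemma hom_zero_hv P M N (q : cmap P M) : kproj P -> qis q -> hom_zero M N <-> hv P N 0.
Proof.
move=> kP qq; split=> [H c cc|H f].
  have E : dmap (h2c cc) ~~ dmap (czero P N).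
    have := H (dmap (h2c cc) \* dinv q qq) => E.
    apply: (@deq_trans _ _ _ _ (dmap (h2c cc) \* dinv q qq \* dmap q)).
      by rewrite -deq_compA deq_invl deq_idr.
    by rewrite E -deq_mapC; apply: deq_map.
  have := dmap_htp kP E; rewrite h2cK (_ : c2h _ = 0) ?subr0 //.
  by apply: hext0 => i e x; rewrite c2hE.
apply: (qis_epic qq); have [g gE] := lift_dhom f q kP; rewrite gE -deq_mapC.
apply: htp_deq; rewrite (_ : c2h (ccomp _ _) = 0) ?subr0; first exact/H/c2h_cycle.
by apply: hext0 => i e x; rewrite c2hE.
Qed.

Lemma hom_zero_shift P M N (q : cmap P M) k : kproj P -> qis q -> hom_zero M (shift k N) <-> hv P N k.
Proof. by move=> kP qq; rewrite (hom_zero_hv _ kP qq) hv_shift_r add0r. Qed.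

Lemma cid_qis M : qis (Defs.cid M).
Proof. exact: (@iso_qis _ _ _ _ (Defs.cid M)). Qed.

Section TriangleHom.
Variables (M N P Q : cpx) (kQ : kproj Q) (H : triangle M N P).
Lemma tri_hv_right m m' : m + 1 = m' -> hv Q N m -> hv Q M m' -> hv Q P m.
Proof.
case: (triangle_elim H) => A [B [f [MA NB PC]]] e.
rewrite (dIso_hv m kQ NB) (dIso_hv m' kQ MA) (dIso_hv m kQ PC) => hB hA.
by apply: (ses_mid (hses_post (twcone f) Q) hB); apply/hv_shift_r; rewrite e.
Qed.
Lemma tri_hv_mid m : hv Q M m -> hv Q P m -> hv Q N m.
Proof.
case: (triangle_elim H) => A [B [f [MA NB PC]]].
rewrite (dIso_hv m kQ NB) (dIso_hv m kQ MA) (dIso_hv m kQ PC) => hA hC.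
apply: (ses_left (hses_post (twcone f) Q) (subrK 1 m) _ hC).
by apply/hv_shift_r; rewrite subrK.
Qed.
Lemma tri_hv_left m m' : m + 1 = m' -> hv Q P m -> hv Q N m' -> hv Q M m'.
Proof.
case: (triangle_elim H) => A [B [f [MA NB PC]]] e.
rewrite (dIso_hv m' kQ NB) (dIso_hv m' kQ MA) (dIso_hv m kQ PC) => hC hB.
have := ses_right (hses_post (twcone f) Q) e hC hB => /hv_shift_r; by rewrite e.
Qed.
End TriangleHom.

Lemma dadd_act P m M N (f g h : dhom M N) (c : HomC P M m) (x y z : HomC P N m) :
  kproj P -> cycle c -> cycle x -> cycle y -> cycle z -> is_dadd f g h ->
  act f c x -> act g c y -> act h c z -> bdry (z - (x + y)).
Proof.
move=> kP cc cx cy cz [p [pf pg ph]] ax ay az.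
have [w cw aw] := act_total kP p cc.
have key (s : cmap (csum N N) N) (k : dhom M N) (t : HomC P N m) : cycle t ->
    dmap s \* p ~~ k -> act k c t -> bdry (t - hpost P s m w).
  move=> ct sk ak; have := proj2 (act_deq kP sk cc ct) ak.
  move=> [w' cw' [aw' b]]; have {}b : bdry (t - hpost P s m w') := b.
  rewrite -[t](subrK (hpost P s m w')) -addrA -linearB; apply: bdryD => //.
  by apply/bdry_map/(act_fun kP cw' cw aw' aw); rewrite subrr; apply: bdry0.
have E : hpost P (cfold N) m w = hpost P (cfst N N) m w + hpost P (csnd N N) m w by apply: hext.
have := key _ _ _ cz ph az; rewrite E => b1.
have b2 := key _ _ _ cx pf ax; have b3 := key _ _ _ cy pg ay.
rewrite (_ : _ - _ = z - (hpost P (cfst N N) m w + hpost P (csnd N N) m w)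
   - (x - hpost P (cfst N N) m w + (y - hpost P (csnd N N) m w))).
  by apply: bdryB => //; apply: bdryD.
by rewrite [in RHS]addrACA -opprD opprB addrA subrK.
Qed.

Section Sums.
Variable I : Type.

Lemma dsum_ext (P : I -> cpx) N (u v : dhom (dsumc P) N) : (forall t, kproj (P t)) ->
  (forall t, u \* dmap (dinj P t) ~~ v \* dmap (dinj P t)) -> u ~~ v.
Proof.
move=> kP H; have kD := kproj_dsum kP.
have [a aE] := dhom_rep u kD; have [b bE] := dhom_rep v kD; rewrite aE bE.
have F t : exists h : HomC (P t) N (-1), c2h (ccomp a (dinj P t)) - c2h (ccomp b (dinj P t))
    = cd (HomC (P t) N) (addNr 1) h.
  apply/(bdry_elim (addNr 1))/dmap_htp => //.
  by rewrite !deq_mapC -aE -bE.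
apply: htp_deq.
suff -> : c2h a - c2h b = cd (HomC (dsumc P) N) (addNr 1) (hcopair (fun t => sval (boolp.cid (F t)))).
  exact: bdry_intro.
rewrite hd_copair; apply: hdsum_ext => t; rewrite hpre_copair -(svalP (boolp.cid (F t))).
by apply: hext0 => i e x; rewrite hpreE !hxD !hxN !c2hE.
Qed.

Lemma dsum_fin (M : I -> cpx) i (x : dsumc M i) (s : seq {classic I}) :
  (forall t : {classic I}, t \notin s -> dproj M t i x = 0) ->
  x = \sum_(t <- undup s) dinj M t i (dproj M t i x).
Proof. by move=> xs; rewrite {1}(dsumE x); apply: fsumE => t /xs ->; rewrite linear0. Qed.

Section DsumMap.
Variables (P M : I -> cpx) (q : forall t, cmap (P t) (M t)).
Definition dsum_map : cmap (dsumc P) (dsumc M) := dcopair (fun t => ccomp (dinj M t) (q t)).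
Lemma dsum_map_in t i (x : P t i) : dsum_map i (dinj P t i x) = dinj M t i (q t i x).
Proof. exact: dcopairE. Qed.
Lemma dsum_map_proj t i (x : dsumc P i) : dproj M t i (dsum_map i x) = q t i (dproj P t i x).
Proof.
apply: (@dlin_ext _ _ P i _ (dproj M t i \o dsum_map i) (q t i \o dproj P t i)) => t' {}x.
rewrite -[LHS]/(dproj M t i (dsum_map i (dinj P t' i x))) dsum_map_in.
rewrite -[RHS]/(q t i (dproj P t i (dinj P t' i x))).
have [E|ne] := pselect (t' = t); first by subst t'; rewrite !dprojK.
by rewrite !dproj_neq // linear0.
Qed.
Lemma dsum_map_qis : (forall t, qis (q t)) -> qis dsum_map.
Proof.
move=> H; apply/qis_cv => m m' e z y cz zy.
have F t : exists2 x : P t m, dproj P t m' z = cd (P t) e x & bdry (dproj M t m y - q t m x).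
  apply: (proj1 (qis_cv _) (H t)); first exact: cyc_map.
  by rewrite -dsum_map_proj zy cfunC.
pose x t := s2val (cid2 (F t)).
have xz t : dproj P t m' z = cd (P t) e (x t) by apply: (s2valP (cid2 (F t))).
have xy t : bdry (dproj M t m y - q t m (x t)) by apply: (s2valP' (cid2 (F t))).
have [s zs] := dsum_supp z; have [s' ys] := dsum_supp y.
have zs' (t : {classic I}) : t \notin s ++ s' -> dproj P t m' z = 0.
  by rewrite mem_cat negb_or => /andP[/zs].
have ys' (t : {classic I}) : t \notin s ++ s' -> dproj M t m y = 0.
  by rewrite mem_cat negb_or => /andP[_ /ys].
exists (\sum_(t <- undup (s ++ s')) dinj P t m (x t)).
  rewrite (dsum_fin zs') linear_sum; apply: eq_bigr => t _.
  by rewrite -cfunC xz.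
rewrite (dsum_fin ys') linear_sum -sumrB; apply: big_ind; [exact: bdry0 | exact: bdryD |] => t _.
by rewrite dsum_map_in -linearB; apply/bdry_map/xy.
Qed.
End DsumMap.
End Sums.
End Lifting.

(** * Sums, products and triangles in the derived category *)

Section Universal.
Variables (K : fieldType) (L : falgType K).
Local Notation cpx := (cplx L^c).
Implicit Types A B C D N P Q : cpx.
Local Notation "g \* f" := (dcomp g f) (at level 40, left associativity).
Local Notation "f ~~ g" := (deq f g) (at level 70).

Lemma dcomp0r M N P (f : dhom N P) : f \* dzero M N ~~ dzero M P.
Proof.
elim: N P / f => [N P f|N P t qt|N P Q g IHg f IHf].
- by rewrite -deq_mapC; apply: deq_map => i x; rewrite /= linear0.
- by apply: (qis_monic qt); rewrite deq_invrK -deq_mapC; apply: deq_map => i x; rewrite /= linear0.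
- by rewrite -deq_compA IHf.
Qed.
Lemma dcomp0l M N P (f : dhom M N) : dzero N P \* f ~~ dzero M P.
Proof.
elim: M N / f => [M N f|M N t qt|M N Q g IHg f IHf].
- by rewrite -deq_mapC; apply: deq_map.
- by apply: (qis_epic qt); rewrite -deq_compA deq_invl deq_idr -deq_mapC; apply: deq_map.
- by rewrite deq_compA IHg.
Qed.

Section Family.
Variable I : Type.

Lemma family_res (M : I -> cpx) : exists (P : I -> cpx) (q : forall t, cmap (P t) (M t)),
  (forall t, kproj (P t)) /\ (forall t, qis (q t)).
Proof.
pose F t := boolp.cid (kproj_resolution (M t)).
pose G t := boolp.cid (svalP (F t)).
exists (fun t => sval (F t)), (fun t => sval (G t)).
by split=> t; case: (svalP (G t)).
Qed.

(** A sum of quasi-isomorphisms is one, so the summands may be replaced by K-projective resolutions;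
    morphisms out of the sum of these are families of homotopy classes. *)
Lemma dsumc_coproduct (M : I -> cpx) : is_coproduct (fun t => dmap (dinj M t)).
Proof.
move=> N f; have [P [q [kP qq]]] := family_res M.
pose F t := boolp.cid (lift_dhom (f t) (q t) (kP t)).
have qQ := dsum_map_qis qq.
have E t : dmap (dinj M t) \* dmap (q t) ~~ dmap (dsum_map q) \* dmap (dinj P t).
  by rewrite -!deq_mapC; apply: deq_map => i x /=; rewrite -[RHS]/(dsum_map q i (dinj P t i x)) dsum_map_in.
exists (dmap (dcopair (fun t => sval (F t))) \* dinv _ qQ); split=> [t|g gE].
  apply: (qis_epic (qq t)); rewrite -!deq_compA E deq_invlK -deq_mapC (svalP (F t)).
  by apply: deq_map => i x; apply: dcopairE.
apply: (qis_epic qQ); rewrite -[in X in _ ~~ X]deq_compA deq_invl deq_idr.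
apply: (dsum_ext kP) => t; rewrite -deq_compA -E deq_compA gE (svalP (F t)) -deq_mapC.
by apply: deq_map => i x; rewrite -[RHS]/(dcopair (fun t => sval (F t)) i (dinj P t i x)) dcopairE.
Qed.

(** The source [N] is resolved; maps into a product of complexes, and their homotopies, are then
    chosen componentwise. *)
Lemma cprod_product (M : I -> cpx) : is_product (fun t => dmap (pproj M t)).
Proof.
move=> N f; have [P [q [kP qq]]] := kproj_resolution N.
pose F t := boolp.cid (lift_dhom (f t) q kP).
exists (dmap (ptuple (fun t => sval (F t))) \* dinv _ qq); split=> [t|g gE].
  apply: (qis_epic qq); rewrite -!deq_compA deq_invl deq_idr -deq_mapC (svalP (F t)).
  exact: deq_map.
apply: (qis_epic qq); rewrite -[in X in _ ~~ X]deq_compA deq_invl deq_idr.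
have [g' g'E] := lift_dhom g q kP; rewrite g'E; apply: htp_deq.
have H t : exists h : HomC P (M t) (-1), c2h (ccomp (pproj M t) g') - c2h (sval (F t))
    = cd (HomC P (M t)) (addNr 1) h.
  apply/(bdry_elim (addNr 1))/dmap_htp => //.
  by apply: deq_trans (svalP (F t)); rewrite deq_mapC -g'E deq_compA gE.
suff -> : c2h g' - c2h (ptuple (fun t => sval (F t)))
    = cd (HomC P (cprod M)) (addNr 1) (htuple (fun t => sval (boolp.cid (H t)))).
  exact: bdry_intro.
rewrite hd_tuple; apply: hprod_ext => t; rewrite hpost_tuple -(svalP (boolp.cid (H t))).
by apply: hext0 => i e x; rewrite hpostE !hxD !hxN linearB !c2hE.
Qed.

Lemma coproduct_iso (M : I -> cpx) C D (i : forall t, dhom (M t) C) (j : forall t, dhom (M t) D) :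
  is_coproduct i -> is_coproduct j -> exists2 g : dhom C D, diso g & forall t, g \* i t ~~ j t.
Proof.
move=> Hi Hj; have [g [gE _]] := Hi _ j; have [h [hE _]] := Hj _ i.
exists g => //; exists h; split.
  have [k [_ kU]] := Hi _ i.
  apply: (@deq_trans _ _ _ _ k).
    by apply: kU => t; rewrite -deq_compA gE hE.
  by apply/deq_sym/kU => t; apply: deq_idl.
have [k [_ kU]] := Hj _ j.
apply: (@deq_trans _ _ _ _ k).
  by apply: kU => t; rewrite -deq_compA hE gE.
by apply/deq_sym/kU => t; apply: deq_idl.
Qed.

Lemma product_iso (M : I -> cpx) C D (i : forall t, dhom C (M t)) (j : forall t, dhom D (M t)) :
  is_product i -> is_product j -> dIso C D.
Proof.
move=> Hi Hj; have [g [gE _]] := Hj _ i; have [h [hE _]] := Hi _ j.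
exists g, h; split.
  have [k [_ kU]] := Hi _ i.
  apply: (@deq_trans _ _ _ _ k).
    by apply: kU => t; rewrite deq_compA hE gE.
  by apply/deq_sym/kU => t; apply: deq_idr.
have [k [_ kU]] := Hj _ j.
apply: (@deq_trans _ _ _ _ k).
  by apply: kU => t; rewrite deq_compA gE hE.
by apply/deq_sym/kU => t; apply: deq_idr.
Qed.
End Family.

Lemma coprod_dsumc (C : cpx -> Prop) I (M : I -> cpx) : coprod_closed C -> (forall t, C (M t)) -> C (dsumc M).
Proof. by move=> CC HM; exact: CC (@dsumc_coproduct I M) HM. Qed.

Lemma prod_cprod (C : cpx -> Prop) I (M : I -> cpx) : prod_closed C -> (forall t, C (M t)) -> C (cprod M).
Proof. by move=> CC HM; exact: CC (@cprod_product I M) HM. Qed.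

Lemma hv_coprod_closed Q m : kproj Q -> small Q -> coprod_closed (fun M => hv Q M m).
Proof.
move=> kQ sQ I M N inj Hi HM.
have [g Ig _] := coproduct_iso (@dsumc_coproduct _ M) Hi.
by apply/(dIso_hv m kQ (ex_intro _ g Ig))/hv_dsum_r.
Qed.

Lemma hv_prod_closed Q m : kproj Q -> prod_closed (fun M => hv Q M m).
Proof.
move=> kQ I M N inj Hi HM.
by apply/(dIso_hv m kQ (product_iso (@cprod_product _ M) Hi))/hv_prod_r.
Qed.

Lemma kone_htp A B A' B' (f : cmap A B) (f' : cmap A' B') (a : cmap A A') (b : cmap B B') :
  bdry (c2h (ccomp b f) - c2h (ccomp f' a) : HomC A B' 0) -> qis a -> qis b ->
  exists s : cmap (kone f) (kone f'), qis s.
Proof.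
move=> /(bdry_elim (addNr 1)) [h hE] qa qb.
have ix (i j : int) : i + 1 = j -> j - 1 = i by move=> <-; rewrite addrK.
have H i j k (e : i + 1 = j) (e' : j + 1 = k) x :
    b j (f j x) - f' j (a j x) = cd B' e (hx h (ix i j e) x) + hx h (ix j k e') (cd A e' x).
  have := hx_eq hE (addr0 j) x; rewrite hxD hxN !c2hE => ->.
  have e4 : k + (-1) = j by rewrite -e' addrK.
  by rewrite (hdE _ h (addr0 j) (ix i j e) e e' e4) ksgnNn ksgn1 opprK (hx_irr h _ (ix j k e')).
exists (kone_map (h := fun i j e => hx h (ix i j e)) H).
exact: kone_map_qis.
Qed.

Lemma cone_ses A B (f : cmap A B) : ses (cone_in f) (cone_out f).
Proof.
split=> [n x []|n y|n x|n [x y]] //=; first by exists (0, y).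
by move=> ->; exists x.
Qed.

(** Rotation: the cone of a lift of the second map of a triangle is the suspension of the first object. *)
Lemma dist_rotate Z Y Y' (al : dhom Z Y) (be : dhom Y Y') ga C C' (q : cmap C Y) (q' : cmap C' Y') (u : cmap C C') :
  dist al be ga -> kproj C -> kproj C' -> qis q -> qis q' ->
  dmap q' \* dmap u ~~ be \* dmap q -> dIso (kone u) (shift 1 Z).
Proof.
move=> [A [B [f [a [b [c [[Ia Ib Ic] [_ E _]]]]]]]] kC kC' qq qq' uE.
have [b' b'E] := lift_dhom b q kC; have [c' c'E] := lift_dhom c q' kC'.
have qb : qis b' by apply/diso_qis/(diso_deq b'E)/diso_comp/qis_diso.
have qc : qis c' by apply/diso_qis/(diso_deq c'E)/diso_comp/qis_diso.
have [|s qs] := @kone_htp _ _ _ _ u (cone_in f) b' c' _ qb qc.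
  apply: dmap_htp => //; rewrite !deq_mapC -c'E -b'E -deq_compA uE.
  by rewrite !deq_compA E.
apply: dIso_trans (qis_dIso qs) _.
have [t qt] := ses_kone (cone_ses f).
apply: dIso_trans (qis_dIso qt) _; apply/dIso_shift/dIso_sym; by exists a.
Qed.

Lemma dist_comp0 (Z Y Y' : cpx) (al : dhom Z Y) (be : dhom Y Y') ga : dist al be ga ->
  be \* al ~~ dzero Z Y'.
Proof.
move=> [A [B [f [a [b [c [[_ _ [c' [c'c _]]] [E1 E2 _]]]]]]]].
have E0 : dmap (cone_in f) \* dmap f ~~ dzero A (cone f).
  apply: (qis_monic (cone_kone_qis f)); rewrite -!deq_mapC.
  apply: (@deq_trans _ _ _ _ (dmap (ccomp (tin (twcone f)) f))); first exact: deq_map.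
  apply: htp_deq; rewrite (_ : c2h (ccomp (cone_kone f) _) = 0); last first.
    by apply: hext0 => i e x; rewrite c2hE.
  rewrite subr0; exists (-1), (addNr 1), (kl f (addNr 1) 0 (- hid A)).
  rewrite (kl_d f (addNr 1) (add0r 1)) linear0 !linearN opprK (@hid_cycle _ _ A _ (add0r 1)) .
  by apply: hext0 => i e x; rewrite c2hE klE add0r linear0 oppr0 hx0 hpostE hidE oppr0.
apply: (@deq_trans _ _ _ _ (c' \* (c \* (be \* al)))).
  by rewrite deq_compA c'c deq_idl.
rewrite [c \* (be \* al)]deq_compA E2 -(deq_compA _ b al) E1 (deq_compA (dmap (cone_in f))) E0.
by rewrite dcomp0l dcomp0r.
Qed.
End Universal.

(** * Rickard's construction as a telescope of complexes *)

Section RickardTelescope.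
Variables (K : fieldType) (L : falgType K).
Local Notation cpx := (cplx L^c).
Implicit Types A B C D M N P Q : cpx.
Local Notation "g \* f" := (dcomp g f) (at level 40, left associativity).
Local Notation "f ~~ g" := (deq f g) (at level 70).

Lemma act_scale P m M N (f : dhom M N) a (c : HomC P M m) (d : HomC P N m) :
  act f c d -> act f (a *: c) (a *: d).
Proof.
elim: M N / f c d => [M N g|M N s qs|M N Q g IHg f IHf] c d.
- by rewrite !act_map (linearZ_LR (hpost P g m)) -scalerBr; apply: bdryZ.
- by rewrite !act_inv (linearZ_LR (hpost P s m)) -scalerBr; apply: bdryZ.
move=> [c1 cc1 [a1 a2]]; exists (a *: c1); last by split; [apply: IHf | apply: IHg].
by move=> j e; rewrite linearZ_LR cc1 scaler0.
Qed.

Lemma act00 P m M N (f : dhom M N) : act f (0 : HomC P M m) (0 : HomC P N m).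
Proof. by apply: act_bdry; apply: bdry0. Qed.

Lemma act_add P m M N (f : dhom M N) (c d : HomC P M m) (c' d' : HomC P N m) :
  act f c c' -> act f d d' -> act f (c + d) (c' + d').
Proof.
move=> a b; have := act_sub a (act_sub (act00 P m f) b).
by rewrite !sub0r !opprK.
Qed.

Lemma act_c2h P M N (f : dhom M N) (q : cmap P M) (s : cmap P N) : kproj P ->
  f \* dmap q ~~ dmap s -> act f (c2h q) (c2h s).
Proof.
move=> kP /(act_deq kP (m := 0)) /(_ (hid P) (c2h s) (@hid_cycle _ _ P) (c2h_cycle s)) [_ H].
have [|c1 cc1 [a1 a2]] := H; first by rewrite act_map hpost_hid subrr; apply: bdry0.
apply: (act_eqv a2); last by rewrite subrr; apply: bdry0.
by rewrite -(hpost_hid q).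
Qed.

(** [lincomb] is a relation in the derived category, with sums given by [is_dadd]. Vanishing of [be]
    on basis elements is propagated to combinations through the action on homotopy classes. *)
Lemma lincomb_kill P M Y Y' (be : dhom Y Y') I (b : I -> dhom M Y) : kproj P ->
  (forall t, be \* b t ~~ dzero M Y') ->
  forall s f, lincomb b s f -> forall (c : HomC P M 0) x, cycle c -> cycle x -> act f c x -> act be x 0.
Proof.
move=> kP H; elim=> [|[k t] s IH] f /=.
  move=> f0 c x cc cx /(proj1 (act_deq kP f0 cc cx)); rewrite act_map => bx.
  apply: act_bdry; last exact: bdry0.
  by move: bx; rewrite (_ : hpost _ _ _ _ = 0) ?subr0 //; apply: hext.
move=> [h' /IH {}IH dd] c x cc cx ax.
have [y1 cy1 b1] := act_total kP (b t) cc.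
have [z cz bz] := act_total kP be cy1.
have b0 : bdry z.
  have : act (be \* b t) c z by exists y1.
  move=> /(proj1 (act_deq kP (H t) cc cz)); rewrite act_map (_ : hpost _ _ _ _ = 0) ?subr0 //.
  exact: hext.
have a1 : act be y1 0 by apply: (act_eqv bz); rewrite ?subrr ?subr0 //; apply: bdry0.
have [x2 cx2 ax2] := act_total kP h' cc.
have cy : cycle (k *: y1) by move=> j e; rewrite linearZ_LR cy1 scaler0.
have a3 : act (dscale k (b t)) c (k *: y1).
  exists y1 => //; split=> //; rewrite act_map (_ : hpost _ _ _ _ = k *: y1) ?subrr; first exact: bdry0.
  exact: hext.
have := dadd_act kP cc cy cx2 cx dd a3 ax2 ax => bd.
have a4 := act_add (act_scale k a1) (IH c x2 cc cx2 ax2).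
apply: (act_eqv a4); last by rewrite scaler0 addr0 subrr; apply: bdry0.
by rewrite -opprB; apply: bdryN.
Qed.

Variables (r : nat) (X : 'I_r -> cpx).

(** The two properties of a stage that are used later. A map from the shift of [X_j] by [m < 0] is a
    map from [X_j] of degree [- m], so the maps killed by a stage are those of positive degree. *)
Definition rstepC C C' (u : cmap C C') : Prop :=
  (exists (I : Type) (m : I -> int) (j : I -> 'I_r), (forall t, m t < 0) /\
     dIso (kone u) (shift 1 (dsumc (fun t => shift (m t) (X (j t)))))) /\
  (forall Q j k (c : HomC Q C k), kproj Q -> dIso Q (X j) -> 0 < k -> cycle c ->
     bdry (hpost Q u k c)).

Lemma rickard_step_lift Y Y' (be : dhom Y Y') C C' (q : cmap C Y) (q' : cmap C' Y') (u : cmap C C') :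
  rickard_step X be -> kproj C -> kproj C' -> qis q -> qis q' ->
  dmap q' \* dmap u ~~ be \* dmap q -> rstepC u.
Proof.
move=> [B [b [Z [inj [al [ga [Hb Hi aE Hd]]]]]]] kC kC' qq qq' uE.
have uZ := dist_rotate Hd kC kC' qq qq' uE; have be0 := dist_comp0 Hd.
split.
  exists (rickard_index B), (fun t => ri_m t), (fun t => ri_j t); split; first by case.
  apply: dIso_trans uZ _; apply: dIso_shift.
  have [g Ig _] := coproduct_iso Hi (@dsumc_coproduct _ _ _ (fun t => shift (ri_m t) (X (ri_j t)))).
  by exists g.
move=> Q j k c kQ QX k0 cc; pose m := - k; have m0 : m < 0 by rewrite oppr_lt0.
have kP : kproj (shift m Q) by apply: kproj_shift.
have [s qs] := dIso_rep kP (dIso_shift m QX).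
have e0 : k + m = 0 by rewrite subrr.
(* Shifting the source turns a class of degree [k] into a chain map from the shift by [- k], to
   which the basis of the Rickard step in degree [- k] applies. *)
pose c' : HomC (shift m Q) C 0 := hcomp e0 c (@shift_gb _ _ m Q).
have cc' : cycle c' by apply: hcomp_cycle => //; apply: shift_gb_cycle.
pose f : dhom (shift m (X j)) Y := dmap q \* dmap (h2c cc') \* dinv s qs.
have [[S LS] _] : (exists S, lincomb (b j m) S f) /\ True by split=> //; have [+ _] := Hb j m m0; apply.
have fs : f \* dmap s ~~ dmap (ccomp q (h2c cc')) by rewrite -deq_compA deq_invl deq_idr deq_mapC.
have bb t : be \* b j m t ~~ dzero (shift m (X j)) Y'.
  by rewrite -(aE (RickardIndex m0 t)) deq_compA be0 dcomp0l.
have ab := lincomb_kill kP bb LS (c2h_cycle s) (c2h_cycle (ccomp q (h2c cc'))) (act_c2h kP fs).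
have : act (be \* dmap q) c' 0.
  exists (c2h (ccomp q (h2c cc'))); first exact: c2h_cycle.
  by split=> //; rewrite act_map -hpost_c2h h2cK subrr; apply: bdry0.
move=> /(proj2 (act_deq kP uE cc' (@cycle0 _ _ _))) [c1 cc1 [b1 b2]].
have {}b1 : bdry (c1 - hpost (shift m Q) u 0 c') := b1.
have {}b2 : bdry (0 - hpost (shift m Q) q' 0 c1) := b2.
have bc1 : bdry c1.
  have [+ _] := kproj_post_qis kP qq' 0; apply=> //.
  by move: b2; rewrite sub0r => /bdryN; rewrite opprK.
have bu : bdry (hpost (shift m Q) u 0 c') by rewrite -(subKr c1 (hpost _ _ _ _)); apply: bdryB.
have mk : k + m = 0 by [].
have ek : 0 + k = k by rewrite add0r.
suff -> : hpost Q u k c = hcomp ek (hpost (shift m Q) u 0 c') (@shift_ga _ _ k m mk Q).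
  by apply: hcomp_bdryl => //; apply: shift_ga_cycle.
rewrite (hpost_comp _ (add0r 0) c') (hcompA _ ek ek (add0r k)).
rewrite /c' (hcompA e0 ek (shift_pk mk) (addr0 k)) shift_gba hcomp1r.
exact: hpost_comp.
Qed.

(** The Milnor colimit is specified by a triangle in the derived category. K-projective resolutions
    of the stages turn the transition morphisms into chain maps, and the triangle then identifies
    [T] with an actual telescope. *)
Theorem rickard_tel i T : rickard X i T -> exists (C : nat -> cpx) (u : forall n, cmap (C n) (C n.+1)),
  [/\ forall n, kproj (C n), dIso (X i) (C 0%N), dIso T (tel u) & forall n, rstepC (u n)].
Proof.
move=> [Y [be [Y0 Hs [Cc [inj [phi [v [w [Hi Hadd Hd]]]]]]]]].
have [C [q [kC qq]]] := family_res Y.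
pose U n := boolp.cid (dhom_rep (dinv _ (qq n.+1) \* (be n \* dmap (q n))) (kC n)).
pose u n := sval (U n).
have uE n : dmap (q n.+1) \* dmap (u n) ~~ be n \* dmap (q n).
  by rewrite -(svalP (U n)) deq_invrK.
exists C, u; split=> //.
- by rewrite -Y0; apply/dIso_sym/(qis_dIso (qq 0%N)).
- pose D := dsumc C; have kD : kproj D by apply: kproj_dsum.
  have [g Ig gE] := coproduct_iso (@dsumc_coproduct _ _ _ Y) Hi.
  have [h hE] := lift_dhom g (dsum_map q) kD.
  have qh : qis h by apply/diso_qis/(diso_deq hE)/diso_comp/qis_diso/dsum_map_qis.
  have hn n : dmap h \* dmap (dinj C n) ~~ inj n \* dmap (q n).
    rewrite -hE -gE -!deq_compA -!deq_mapC; apply: deq_comp => //.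
    by apply: deq_map => j x; apply: dsum_map_in.
  have sq : dmap h \* dmap (tel_map u) ~~ phi \* dmap h.
    apply: (dsum_ext kC) => n; rewrite -!deq_compA hn.
    have [s sE] := lift_dhom (phi \* inj n) (q n) (kC n); rewrite (deq_compA phi) sE.
    pose hh k := ccomp h (dinj C k).
    apply: (@deq_trans _ _ _ _ (dmap (csubm (hh n) (ccomp (hh n.+1) (u n))))).
      rewrite -!deq_mapC; apply: deq_map => j x.
      by rewrite -[LHS]/(h j (tel_map u j (dinj C n j x))) tel_mapE linearB.
    apply: htp_deq.
    have a1 := act_c2h (kC n) sE.
    have a2 : act (inj n.+1 \* be n) (c2h (q n)) (c2h (ccomp (hh n.+1) (u n))).
      apply: (act_c2h (kC n)).
      by rewrite -deq_compA -uE deq_compA -hn -!deq_mapC; apply: deq_map.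
    have a3 : act (inj n) (c2h (q n)) (c2h (hh n)).
      by apply: (act_c2h (kC n)); rewrite -hn -deq_mapC; apply: deq_map.
    have := dadd_act (kC n) (c2h_cycle _) (c2h_cycle _) (c2h_cycle _) (c2h_cycle _) (Hadd n) a1 a2 a3.
    rewrite (_ : c2h (csubm _ _) = c2h (hh n) - c2h (ccomp (hh n.+1) (u n))).
      by rewrite opprD addrCA addrC.
    by apply: hext0 => j e x; rewrite hxD hxN !c2hE.
  case: Hd => A [B [f [a [b [c [[Ia Ib Ic] [E _ _]]]]]]].
  have [a' a'E] := lift_dhom a h kD; have [b' b'E] := lift_dhom b h kD.
  have qa : qis a' by apply/diso_qis/(diso_deq a'E)/diso_comp/qis_diso.
  have qb : qis b' by apply/diso_qis/(diso_deq b'E)/diso_comp/qis_diso.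
  have [|s qs] := @kone_htp _ _ _ _ _ _ (tel_map u) f a' b' _ qa qb.
    apply: dmap_htp => //; rewrite !deq_mapC -a'E -b'E -deq_compA sq.
    by rewrite !deq_compA E.
  apply: (dIso_trans _ (dIso_sym (qis_dIso qs))).
  by apply: (dIso_trans _ (qis_dIso (cone_kone_qis f))); exists c.
- by move=> n; apply: (rickard_step_lift (Hs n) _ _ (qq n) (qq n.+1) (uE n)).
Qed.
End RickardTelescope.

(** * The t-structure of a silting complex *)

Section ShiftSum.
Variables (K : fieldType) (L : falgType K).
Local Notation cpx := (cplx L^c).
Implicit Types A B C M N P Q : cpx.

Lemma giso_comp p q n A B C : p + q = n -> giso p A B -> giso q B C -> giso n A C.
Proof.
move=> pq [a p' b e1 e2 ca cb ab ba] [a' q' b' e1' e2' ca' cb' ab' ba'].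
have qp : q + p = n by rewrite addrC.
have e3 : p' + q' = p' + q' by []; pose n' := p' + q'.
have N1 : n + n' = 0 by rewrite /n' -pq addrACA e1 e1' addr0.
have N2 : n' + n = 0 by rewrite addrC.
have h1 : p + (p' + q') = q' by rewrite addrA e1 add0r.
have h2 : q' + n = p by rewrite -pq addrC -addrA e1' addr0.
apply: (@GIso K L n A C (hcomp qp a' a) n' (hcomp e3 b b') N1 N2).
- exact: hcomp_cycle.
- exact: hcomp_cycle.
- rewrite (hcompA qp N1 h1 e1') -(hcompA e1 (add0r q') e3 h1) ab hcomp1l.
  exact: ab'.
- have h3 : q' + n = p by [].
  rewrite (hcompA e3 N2 h3 e2) -(hcompA e2' (add0r p) qp h3) ba' hcomp1l.
  exact: ba.
Qed.

Lemma giso0_dIso A B : giso 0 A B -> dIso A B.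
Proof.
case=> a p' b e1 e2 ca cb ab ba; have p0 : p' = 0 by rewrite -[p']add0r.
subst p'; apply: (@qis_dIso _ _ _ (h2c ca)).
have comp (X Y Z : cpx) (g : HomC Y Z 0) (f : HomC X Y 0) e (cg : cycle g) (cf : cycle f) i x :
    hx (hcomp e g f) (addr0 i) x = h2c cg i (h2c cf i x).
  by rewrite (hcompE e g f (addr0 i) (addr0 i) (addr0 i)).
apply: (@iso_qis _ _ _ (h2c ca) (h2c cb)) => i x.
  by rewrite -(comp _ _ _ _ _ e2) (hx_eq ba) hidE.
by rewrite -(comp _ _ _ _ _ e1) (hx_eq ab) hidE.
Qed.

Lemma shift_add k l n M : k + l = n -> dIso (shift k (shift l M)) (shift n M).
Proof.
move=> e; apply: giso0_dIso.
have g1 : giso k (shift k (shift l M)) (shift l M) := giso_sym (shift_giso (addNr k) _).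
have g2 : giso l (shift l M) M := giso_sym (shift_giso (addNr l) _).
exact: giso_comp (addrN n) (giso_comp e g1 g2) (shift_giso (addNr n) M).
Qed.

Lemma shift0 M : dIso (shift 0 M) M.
Proof. exact: giso0_dIso (giso_sym (shift_giso (addr0 0) M)). Qed.

Lemma shiftK k l M : k + l = 0 -> dIso (shift k (shift l M)) M.
Proof. by move=> e; apply: dIso_trans (shift_add M e) (shift0 M). Qed.

Lemma hv_kone Q A B (f : cmap A B) m : hv Q (kone f) m <-> cv (hpost Q f) m.
Proof.
split=> [H m' e z y cz fz|H w cw].
  have [|w wE] := bdry_elim (subrK 1 m) (H (kl f e y z) _).
    apply: (@cycle1 _ _ _ _ e); rewrite (kl_d f e erefl) fz subrr cz oppr0.
    exact: kl0.
  have [y' [z' w'E]] := kl_surj (subrK 1 m) w.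
  move: wE; rewrite w'E (kl_d f (subrK 1 m) e) => /kl_inj [yE zE].
  exists (- z'); first by rewrite linearN.
  by rewrite yE linearN opprK subrK; apply: bdry_intro.
have [y [z wE]] := kl_surj erefl w; subst w.
have := cw _ erefl; rewrite (kl_d f erefl erefl) -(kl0 Q f erefl) => /kl_inj [/eqP].
rewrite subr_eq0 => /eqP fz /eqP; rewrite oppr_eq0 => /eqP dz.
have [x zE /(bdry_elim (subrK 1 m)) [y' y'E]] := H _ erefl z y (cycle1 dz) (esym fz).
exists (m - 1), (subrK 1 m), (kl f (subrK 1 m) y' (- x)).
rewrite (kl_d f (subrK 1 m) erefl) !linearN !opprK -zE -y'E subrK //.
Qed.
End ShiftSum.

Section TStructure.
Variables (K : fieldType) (L : falgType K).
Local Notation cpx := (cplx L^c).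
Implicit Types A B C M N P Q V W : cpx.
Variable U : cpx.

Definition hle M : Prop := forall k : int, 0 < k -> hv U M k.
Definition hge M : Prop := forall k : int, k < 0 -> hv U M k.

Hypotheses (kU : kproj U) (sU : small U) (silt : forall k : int, 0 < k -> hv U U k).
Hypothesis gen : forall M, (forall k, hv U M k) -> acyclic M.

(** Truncation at [c]: cells [U[-m]] with [m <= c] resolve the degrees up to [c], and by silting
    they contribute nothing above [c]. The predicate [P] carries along whatever the cellular
    operations preserve. *)
Lemma approx c M (P : cpx -> Prop) :
  (forall m, m <= c -> P (shift (- m) U)) ->
  (forall I (W : I -> cpx), (forall t, P (W t)) -> P (dsumc W)) ->
  (forall B C (q : twist B C), P B -> P C -> P (tsum q)) ->
  (forall A, P A -> P (shift 1 A)) ->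
  exists W (f : cmap W M), [/\ kproj W, P W, forall k, c < k -> hv U W k & forall k, k <= c -> hv U (kone f) k].
Proof.
move=> Pc Ps Pe Psh.
have [||||W [f [_ [kW PW HW] H]]] := @cell_resolution K L U sU M (fun m => m <= c)
   (fun W => [/\ kproj W, P W & forall k, c < k -> hv U W k]).
- move=> m mc; split; [exact: kproj_shift | exact: Pc |] => k ck.
  by apply/hv_shift_r/silt; rewrite subr_gt0; apply: le_lt_trans ck.
- move=> I W HW; split; first by apply: kproj_dsum => t; case: (HW t).
    by apply: Ps => t; case: (HW t).
  by move=> k ck; apply: hv_dsum_r => // t; case: (HW t) => _ _; apply.
- move=> A B q [kA PA HA] [kB PB HB]; split; [exact: kproj_tsum | exact: Pe |] => k ck.
  by apply: (ses_mid (hses_post q U)); [apply: HA | apply: HB].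
- move=> A [kA PA HA]; split; [exact: kproj_shift | exact: Psh |] => k ck.
  by apply/hv_shift_r/HA; apply: (lt_trans ck); rewrite ltrDl.
by exists W, f; split=> // k kc; apply/hv_kone/H.
Qed.

Lemma approx_qis c M W (f : cmap W M) : (forall k, c < k -> hv U M k) ->
  (forall k, c < k -> hv U W k) -> (forall k, k <= c -> hv U (kone f) k) -> qis f.
Proof.
move=> HM HW HV; apply/kone_acyclic/gen => k; have [|ck] := leP k c; first exact: HV.
apply: (ses_mid (hses_post (twcone f) U)); first exact: HM.
by apply/hv_shift_r/HW; apply: (lt_trans ck); rewrite ltrDl.
Qed.

(** Up to quasi-isomorphism [M] is cellular, with cells [U[-m]] for [m <= c], and [N] is orthogonal
    to these. All degrees [k <= 0] are carried along so that the condition is stable under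
    suspension. *)
Lemma orth c M N : (forall k, c < k -> hv U M k) -> (forall k, k <= c -> hv U N k) -> hom_zero M N.
Proof.
move=> HM HN.
have [||||W [f [kW PW HW HV]]] := @approx c M (fun W => forall k, k <= 0 -> hv W N k).
- by move=> m mc k k0; apply/hv_shift_l/HN; rewrite opprK -[c]add0r; apply: lerD.
- by move=> I W H k k0; apply: hv_dsum_l => t; apply: H.
- move=> A B q HA HB k k0; apply: (ses_mid (hses_pre q N)); [exact: HB | exact: HA].
- by move=> A HA k k0; apply/hv_shift_l/HA; lia.
by apply/(hom_zero_hv _ kW (approx_qis HM HW HV))/PW.
Qed.

Lemma hle_iso : iso_closed hle.
Proof. by move=> M N MN H k k0; apply/(dIso_hv k kU MN)/H. Qed.
Lemma hge_iso : iso_closed hge.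
Proof. by move=> M N MN H k k0; apply/(dIso_hv k kU MN)/H. Qed.
Lemma hle_shift : shift_closed 1 hle.
Proof. by move=> M H k k0; apply/hv_shift_r/H; lia. Qed.
Lemma hge_shift : shift_closed (-1) hge.
Proof. by move=> M H k k0; apply/hv_shift_r/H; lia. Qed.
Lemma hle_ext : ext_closed hle.
Proof. by move=> M N P T HM HP k k0; apply: (tri_hv_mid kU T); [apply: HM | apply: HP]. Qed.
Lemma hge_ext : ext_closed hge.
Proof. by move=> M N P T HM HP k k0; apply: (tri_hv_mid kU T); [apply: HM | apply: HP]. Qed.
Lemma hle_coprod : coprod_closed hle.
Proof. by move=> I M N inj Hi H k k0; apply: (hv_coprod_closed kU sU Hi) => t; apply: H. Qed.
Lemma hge_prod : prod_closed hge.
Proof. by move=> I M N p Hp H k k0; apply: (hv_prod_closed kU Hp) => t; apply: H. Qed.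

Theorem h_t_structure : t_structure hle hge.
Proof.
split; [exact: hle_iso | exact: hge_iso | exact: hle_shift | exact: hge_shift | |].
  move=> M N HM HN; apply: (@orth 0) => // k k0.
  by apply/hv_shift_r/HN; lia.
move=> M; have [||||W [f [kW _ HW HV]]] := @approx 0 M (fun _ => True); try by [].
exists W, (kone f); split=> //; last exact/triangle_intro/dIso_refl.
exists (shift 1 (kone f)); last exact: shiftK.
by move=> k k0; apply/hv_shift_r/HV; lia.
Qed.

Lemma rperp_hle M : shift_class 1 (rperp hle) M <-> hge M.
Proof.
split=> [[N HN NM] k k0|H].
  apply/(dIso_hv k kU NM)/hv_shift_r.
  have : hle (shift (- (k + 1)) U) by move=> j j0; apply/hv_shift_r/silt; lia.
  move=> /HN /(hom_zero_hv _ (kproj_shift kU) (cid_qis _)) /hv_shift_l.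
  by rewrite opprK add0r.
exists (shift (-1) M); last exact: shiftK.
by move=> N HN; apply: (@orth 0) => // k k0; apply/hv_shift_r/H; lia.
Qed.

Lemma lperp_hge M : shift_class (-1) (lperp hge) M <-> hle M.
Proof.
split=> [[N HN NM] k k0|H].
  apply/(dIso_hv k kU NM)/hv_shift_r; set j := k - 1.
  (* Truncating at [-1] puts the cone in [hge], so that the map from [N] to the cone is zero. A
     class of [U] in [N] of degree [j >= 0] therefore comes from [W], where it vanishes. *)
  have [||||W [f [kW _ HW HV]]] := @approx (-1) N (fun _ => True); try by [].
  have HVge : hge (kone f) by move=> i i0; apply: HV; lia.
  move=> c cc; have := act_deq kU (HN _ HVge (dmap (tin (twcone f)))) cc (cyc_map (hpost U (tin (twcone f))) cc).
  rewrite !act_map subrr => -[+ _] => /(_ (@bdry0 _ _ _)).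
  rewrite (_ : hpost U (czero _ _) _ _ = 0) ?subr0; last exact: hext.
  rewrite (_ : hpost U (tin (twcone f)) j c = kl f erefl c 0); last first.
    by apply: hext => a b ab x; rewrite klE hx0 oppr0.
  move=> /(bdry_elim (subrK 1 j)) [w]; have [y [z ->]] := kl_surj (subrK 1 j) w.
  rewrite (kl_d f (subrK 1 j) erefl) => /kl_inj [-> /esym/eqP]; rewrite oppr_eq0 => /eqP dz.
  apply: bdryB; first exact: bdry_intro.
  by apply/bdry_map/HW; [rewrite /j; lia | apply: cycle1 dz].
exists (shift 1 M); last exact: shiftK.
by move=> N HN; apply: (@orth (-1)) => k k0; [apply/hv_shift_r/H; lia | apply: HN; lia].
Qed.

Lemma hle_generated (C : cpx -> Prop) : iso_closed C -> shift_closed 1 C -> ext_closed C ->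
  coprod_closed C -> C U -> forall M, hle M -> C M.
Proof.
move=> Ci Cs Ce Cc CU M HM.
have CsU n : C (shift n%:Z U).
  elim: n => [|n IH]; first exact: Ci (dIso_sym (shift0 U)) CU.
  by apply: Ci (Cs _ IH); apply: shift_add; rewrite -PoszD add1n.
have [||||W [f [kW CW HW HV]]] := @approx 0 M C.
- by move=> m m0; have -> : - m = `|m|%N%:Z by lia.
- by move=> I W HC; apply: coprod_dsumc.
- by move=> A B q CA CB; apply: Ce (triangle_ses (tses q)) CA CB.
- exact: Cs.
exact: Ci (qis_dIso (approx_qis HM HW HV)) CW.
Qed.
End TStructure.

(** * Linear algebra over the ground field *)

Section Separation.
Variables (K : fieldType) (V : lmodType K) (W : V -> Prop) (HW : is_submod W).

Lemma is_submodN (P : V -> Prop) x : is_submod P -> P x -> P (- x).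
Proof. by case=> P0 H px; have := H (-1) _ _ px P0; rewrite scaleN1r addr0. Qed.
Lemma is_submodD (P : V -> Prop) x y : is_submod P -> P x -> P y -> P (x + y).
Proof. by case=> _ H px py; have := H 1 _ _ px py; rewrite scale1r. Qed.
Lemma is_submodZ (P : V -> Prop) a x : is_submod P -> P x -> P (a *: x).
Proof. by case=> P0 H px; have := H a _ _ px P0; rewrite addr0. Qed.

Lemma maximal_submod v : ~ W v -> exists A : V -> Prop, [/\ is_submod A, (forall x, W x -> A x), ~ A v
  & forall B : V -> Prop, is_submod B -> (forall x, A x -> B x) -> ~ B v -> forall x, B x -> A x].
Proof.
move=> Wv; pose good (A : V -> Prop) := [/\ is_submod A, (forall x, W x -> A x) & ~ A v].
pose P (A : V -> Prop) := (forall x, ~ A x) \/ good A.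
have [|A [PA Amax]] := @classical_sets.Zorn_bigcup V P.
  move=> F FP tot.
  have [[x [X FX Xx]]|no] := pselect (exists x, exists2 X, F X & X x); last first.
    by left=> x [X FX Xx]; apply: no; exists x, X.
  have gd Y y : F Y -> Y y -> good Y by move=> FY Yy; case: (FP _ FY) => [/(_ y)|].
  have [[X0 _] WX _] := gd X x FX Xx.
  right; split; first split.
  - by exists X.
  - move=> a y z [Y FY Yy] [Z FZ Zz]; have [HY _ _] := gd _ _ FY Yy; have [HZ _ _] := gd _ _ FZ Zz.
    have [YZ|ZY] := tot _ _ FY FZ.
      by exists Z => //; apply: (proj2 HZ) => //; apply: YZ.
    by exists Y => //; apply: (proj2 HY) => //; apply: ZY.
  - by move=> y /WX; exists X.
  by move=> [Y FY Yv]; have [_ _] := gd _ _ FY Yv; apply.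
have gA : good A.
  case: PA => // A0; exfalso; apply: (Amax W); last by right; split.
  split=> [x /A0 //|H]; apply: (A0 0); apply: H; exact: (proj1 HW).
case: gA => HA WA Av; exists A; split=> // B HB AB Bv x Bx; apply: contrapT => nAx.
apply: (Amax B); last by right; split=> // y /WA /AB.
by split=> // H; apply/nAx/H.
Qed.

(** A maximal subspace that contains [W] and avoids [v] is a complement of the line through [v]; the
    functional is the coefficient of [v]. *)
Lemma separation v : ~ W v -> exists f : {linear V -> K^o}, (forall x, W x -> f x = 0) /\ f v = 1.
Proof.
move=> /maximal_submod [A [HA WA Av Amax]].
have ex x : exists c, A (x - c *: v).
  have [Ax|nAx] := pselect (A x); first by exists 0; rewrite scale0r subr0.
  pose B y := exists c, A (y - c *: x).
  have HB : is_submod B.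
    split; first by exists 0; rewrite scale0r subr0; apply: (proj1 HA).
    move=> a y z [c Ac] [d Ad]; exists (a * c + d).
    rewrite (_ : _ - _ = a *: (y - c *: x) + (z - d *: x)); first exact: (proj2 HA).
    by rewrite scalerBr scalerDl scalerA opprD addrACA.
  have AB y : A y -> B y by move=> Ay; exists 0; rewrite scale0r subr0.
  have Bx : B x by exists 1; rewrite scale1r subrr; apply: (proj1 HA).
  have [c Ac] : B v by apply: contrapT => nBv; apply: nAx; apply: (Amax B).
  have c0 : c != 0 by apply: contraPneq Ac => -> ; rewrite scale0r subr0.
  exists c^-1; rewrite (_ : _ - _ = (- c^-1) *: (v - c *: x)); first exact: is_submodZ.
  by rewrite scalerBr !scaleNr opprK scalerA mulVf // scale1r addrC.
pose f x := sval (boolp.cid (ex x)).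
have fE x c : A (x - c *: v) -> f x = c.
  move=> Ac; have Af : A (x - f x *: v) := svalP (boolp.cid (ex x)).
  apply/eqP; rewrite -subr_eq0; apply: contraPT Av => ne; apply.
  have := is_submodD HA Ac (is_submodN HA Af).
  rewrite opprB addrC addrA subrK -scalerBl => /(is_submodZ (f x - c)^-1 HA).
  by rewrite scalerA mulVf // scale1r.
have fL : linear (f : V -> K^o).
  move=> a x y; apply: fE.
  have Ax : A (x - f x *: v) := svalP (boolp.cid (ex x)).
  have Ay : A (y - f y *: v) := svalP (boolp.cid (ex y)).
  rewrite (_ : _ - _ = a *: (x - f x *: v) + (y - f y *: v)); first exact: (proj2 HA).
  by rewrite scalerBr scalerDl scalerA opprD addrACA.
exists (mkLin fL); split=> [x Wx|]; apply: fE; first by rewrite scale0r subr0; apply: WA.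
by rewrite scale1r subrr; apply: (proj1 HA).
Qed.
End Separation.

(** Separate the graph of all [(d x, phi x)] from [(0, 1)]: up to sign, the first component of the
    separating functional is the extension. *)
Lemma functional_extension (K : fieldType) (V V' : lmodType K) (d : {linear V -> V'}) (phi : {linear V -> K^o}) :
  (forall x, d x = 0 -> phi x = 0) -> exists l : {linear V' -> K^o}, forall x, l (d x) = phi x.
Proof.
move=> H; pose W (p : V' * K^o) := exists x, p = (d x, phi x).
have HW : is_submod W.
  split=> [|a y z [x1 ->] [x2 ->]]; first by exists 0; rewrite !linear0.
  by exists (a *: x1 + x2); rewrite !linearP.
have nW : ~ W (0, 1).
  by move=> [x [/esym /H -> /eqP]]; rewrite oner_eq0.
have [f [fW f1]] := separation HW nW.
have lin : linear (fun y : V' => - f (y, 0) : K^o).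
  move=> a y z; rewrite (_ : (a *: y + z, 0) = a *: (y, 0) + (z, 0)).
    by rewrite linearP opprD scalerN.
  by congr pair; rewrite /= scaler0 addr0.
exists (mkLin lin) => x /=.
have : f (d x, phi x) = 0 by apply: fW; exists x.
rewrite (_ : (d x, phi x) = (d x, 0) + phi x *: (0, 1)); last first.
  by congr pair; rewrite /= ?scaler0 ?addr0 // add0r; apply: esym (mulr1 _).
by rewrite linearD linearZ f1 => /eqP; rewrite addr_eq0 => /eqP ->; rewrite opprK; apply: mulr1.
Qed.

(** * Finite dimension by spanning lists and by functionals *)

Section FiniteSpan.
Variables (K : fieldType) (V : lmodType K).
Implicit Types (s : seq V) (fs : seq {linear V -> K^o}).

Fixpoint lspan s (x : V) : Prop := if s is v :: s' then exists c, lspan s' (x - c *: v) else x = 0.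
Fixpoint killed fs (x : V) : Prop := if fs is f :: fs' then f x = 0 /\ killed fs' x else True.

Lemma lspan_submod s : is_submod (lspan s).
Proof.
elim: s => [|v s IH]; first by split=> // a x y /= -> ->; rewrite scaler0 addr0.
split; first by exists 0; rewrite scale0r subr0; apply: (proj1 IH).
move=> a x y [c Hc] [d Hd]; exists (a * c + d).
rewrite (_ : _ - _ = a *: (x - c *: v) + (y - d *: v)); first exact: (proj2 IH).
by rewrite scalerBr scalerDl scalerA opprD addrACA.
Qed.

Lemma lspan_sum I (r : seq I) (e : I -> V) (c : I -> K) : lspan [seq e i | i <- r] (\sum_(i <- r) c i *: e i).
Proof.
elim: r => [|i r IH]; first by rewrite big_nil.
by exists (c i); rewrite big_cons addrC addKr.
Qed.

Lemma lspan_jinj s : exists fs, forall x, lspan s x -> killed fs x -> x = 0.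
Proof.
elim: s => [|v s [fs IH]]; first by exists [::].
have [sv|nsv] := pselect (lspan s v).
  exists fs => x [c Hc]; apply: IH; rewrite -(subrK (c *: v) x).
  by apply: is_submodD (lspan_submod s) Hc _; apply: is_submodZ (lspan_submod s) sv.
have [f [fs0 f1]] := separation (lspan_submod s) nsv.
exists (f :: fs) => x [c Hc] [fx kx]; apply: IH kx.
move: (fs0 _ Hc); rewrite linearB fx linearZ f1 sub0r => /eqP; rewrite oppr_eq0 => /eqP c10.
have c0 : c = 0 by rewrite -[c]mulr1; exact: c10.
by move: Hc; rewrite c0 scale0r subr0.
Qed.

(** Finitely many functionals with trivial common kernel are the handier form of finite dimension,
    as they restrict to subspaces at once. Here they are turned into a spanning list, by induction
    on the functionals. *)
Lemma jinj_span fs (P : V -> Prop) : is_submod P -> (forall x, P x -> killed fs x -> x = 0) ->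
  exists s, (forall v, List.In v s -> P v) /\ forall x, P x -> lspan s x.
Proof.
elim: fs P => [|f fs IH] P HP H; first by exists [::]; split=> // x /H; apply.
pose P' x := P x /\ f x = 0.
have HP' : is_submod P'.
  split; first by split; [apply: (proj1 HP) | rewrite linear0].
  move=> a x y [Px fx] [Py fy]; split; first exact: (proj2 HP).
  by rewrite linearP fx fy scaler0 addr0.
have [|s [sP' Hs]] := IH P' HP'; first by move=> x [Px fx] kx; apply: H.
have [[p [Pp fp]]|no] := pselect (exists p, P p /\ f p <> 0); last first.
  exists s; split=> [v /sP' []//|x Px]; apply: Hs; split=> //.
  by apply: contrapT => fx; apply: no; exists x.
exists (p :: s); split=> [v [<- //|/sP' []//]|x Px].
exists (f x / f p : K); apply: Hs; split; first by apply: (is_submodD HP Px); apply: (is_submodN HP); apply: is_submodZ.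
rewrite linearB linearZ; apply/eqP; rewrite subr_eq0; apply/eqP/esym.
by apply: divfK; apply/eqP.
Qed.
End FiniteSpan.

Section RestrictScalars.
Variables (K : fieldType) (L : falgType K).

Definition kres (V : lmodType L^c) : Type := V.
HB.instance Definition _ (V : lmodType L^c) := GRing.Zmodule.on (kres V).
Section Scale.
Variable V : lmodType L^c.
Definition kres_scale (k : K) (x : kres V) : kres V := calg L k *: (x : V).
Lemma calgM a b : calg L a * calg L b = calg L (a * b).
Proof. by rewrite calgC /calg; apply: etrans (mulr_algl _ _) _; rewrite scalerA mulrC. Qed.
Fact kres_scaleA a b (x : kres V) : kres_scale a (kres_scale b x) = kres_scale (a * b) x.
Proof. by rewrite /kres_scale scalerA calgM. Qed.
Fact kres_scale1 : left_id 1 kres_scale.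
Proof. by move=> x; rewrite /kres_scale /calg scale1r; apply: scale1r. Qed.
Fact kres_scaleDr : right_distributive kres_scale +%R.
Proof. by move=> a x y; apply: scalerDr. Qed.
Fact kres_scaleDl (x : kres V) : {morph kres_scale^~ x : a b / a + b}.
Proof. by move=> a b; rewrite /kres_scale /calg scalerDl; apply: scalerDl. Qed.
HB.instance Definition _ := GRing.Zmodule_isLmodule.Build K (kres V)
  kres_scaleA kres_scale1 kres_scaleDr kres_scaleDl.
End Scale.

Lemma fin_dim_span (V : lmodType L^c) : fin_dim V -> exists s : seq (kres V), forall x, lspan s x.
Proof.
move=> [n [e H]]; exists [seq (e i : kres V) | i <- index_enum 'I_n] => x.
by have [c ->] := H x; apply: (@lspan_sum K (kres V) _ (index_enum 'I_n) e c).
Qed.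

Lemma fin_dim_jinj (V : lmodType L^c) : fin_dim V ->
  exists fs : seq {linear kres V -> K^o}, forall x, killed fs x -> x = 0.
Proof. by move=> /fin_dim_span [s H]; have [fs F] := lspan_jinj s; exists fs => x; apply: F. Qed.

Lemma L_coord (x : L) : x = \sum_(i < \dim {:L}) coord (vbasis {:L}) i x *: (vbasis {:L})`_i.
Proof. by rewrite -coord_vbasis ?memvf. Qed.

Lemma fin_gen_dim (V : lmodType L^c) : fin_gen V -> fin_dim V.
Proof.
move=> [n [e H]]; pose J := ('I_n * 'I_(\dim {:L}))%type.
pose v (p : J) : V := ((vbasis {:L})`_p.2 : L^c) *: e p.1.
exists #|{: J}|, (fun i => v (enum_val i)) => x; have [c ->] := H x.
pose k (p : J) : K := coord (vbasis {:L}) p.2 (c p.1 : L).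
exists (fun i => k (enum_val i)).
transitivity (\sum_(p : J) calg L (k p) *: v p).
  rewrite -(pair_bigA _ (fun i j => calg L (k (i, j)) *: v (i, j))) /=; apply: eq_bigr => i _.
  rewrite {1}(L_coord (c i)) scaler_suml; apply: eq_bigr => j _.
  rewrite /v scalerA; congr (_ *: _); rewrite calgC.
  by apply: esym; apply: mulr_algl.
rewrite (reindex (@enum_val _ {: J})) /=; last exact/onW_bij/enum_val_bij.
by apply: eq_bigl.
Qed.
End RestrictScalars.

(** * The Nakayama duality *)

Section CoDual.
Variables (K : fieldType) (L : falgType K).
Local Notation DL := (dualL L : lmodType L^c).
Implicit Types (I M : lmodType L^c).

Lemma calg_mul k (a : L) : calg L k * (a : L^c) = (k *: a : L) :> L^c.
Proof. by rewrite calgC; apply: mulr_algl. Qed.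

Definition dapp (phi : dualL L) (x : L) : K := (phi : 'Hom(L, K^o)) x.

Lemma dapp_eq (phi psi : dualL L) : (forall x, dapp phi x = dapp psi x) -> phi = psi.
Proof. by move=> H; apply/lfunP => x; apply: H. Qed.
Lemma dappD phi psi x : dapp (phi + psi) x = dapp phi x + dapp psi x.
Proof. exact: dualLaddE. Qed.
Lemma dapp0 x : dapp 0 x = 0.
Proof. by apply: (addIr (dapp 0 x)); rewrite -dappD !add0r. Qed.
Lemma dapp_sum J (r : seq J) (F : J -> dualL L) x : dapp (\sum_(j <- r) F j) x = \sum_(j <- r) dapp (F j) x.
Proof. by elim/big_rec2: _ => [|j a b _ <-]; [apply: dapp0 | apply: dappD]. Qed.
Lemma dappZ (a : L^c) phi x : dapp (a *: phi) x = dapp phi ((a : L) * x).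
Proof. exact: dualLscaleE. Qed.
Lemma dapp_mul a phi x : dapp (dualLmul a phi) x = dapp phi (x * a).
Proof. exact: dualLmulE. Qed.
Lemma dappK k phi x : dapp (calg L k *: phi) x = k * dapp phi x.
Proof.
rewrite dappZ (_ : (calg L k : L) * x = k *: x); first by rewrite /dapp linearZ.
exact: mulr_algl.
Qed.
Lemma dapp_lin phi : linear (dapp phi : L -> K^o).
Proof. by move=> k x y; apply: (linearP (phi : 'Hom(L, K^o))). Qed.

Definition mkdual (f : L -> K) (H : linear (f : L -> K^o)) : dualL L := linfun (mkLin H).
Lemma mkdualE f H x : dapp (@mkdual f H) x = f x.
Proof. by rewrite /dapp lfunE. Qed.

Lemma dapp_inj x y : (forall phi, dapp phi x = dapp phi y) -> x = y.
Proof.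
move=> H; rewrite (L_coord x) (L_coord y); apply: eq_bigr => i _; congr (_ *: _).
have lin : linear (coord (vbasis {:L}) i : L -> K^o) by move=> k a b; rewrite linearP.
by have := H (mkdual lin); rewrite !mkdualE.
Qed.

(** Sending [phi] to the value of [psi phi] at one is a functional on [D(L)], hence evaluation at
    some [a], computed in a basis of [L]; linearity over [L] then determines [psi]. *)
Lemma end_dual (psi : {linear DL -> DL}) : exists a : L, forall phi, psi phi = dualLmul a phi.
Proof.
have lin i : linear (coord (vbasis {:L}) i : L -> K^o) by move=> k a b; rewrite linearP.
pose c i := mkdual (lin i).
pose a := \sum_(i < \dim {:L}) dapp (psi (c i)) 1 *: (vbasis {:L})`_i.
have psi1 phi : dapp (psi phi) 1 = dapp phi a.
  have phiE : phi = \sum_(i < \dim {:L}) calg L (dapp phi (vbasis {:L})`_i) *: c i.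
    apply: dapp_eq => x; rewrite {1}(L_coord x) dapp_sum.
    rewrite -[LHS]/((mkLin (dapp_lin phi)) _) linear_sum; apply: eq_bigr => i _.
    by rewrite dappK mkdualE linearZ; apply: mulrC.
  rewrite {1}phiE linear_sum dapp_sum -[RHS]/((mkLin (dapp_lin phi)) a) linear_sum.
  by apply: eq_bigr => i _; rewrite linearZ dappK linearZ; apply: mulrC.
exists a => phi; apply: dapp_eq => x.
rewrite dapp_mul -[x in LHS]mulr1 -(dappZ (x : L^c)) -linearZ psi1.
exact: dappZ.
Qed.

(** A finite presentation of [I] as a direct summand of copies of [D(L)]. *)
Record cdual I := CDual {
  cn : nat; ci : 'I_cn -> {linear DL -> I}; cp : 'I_cn -> {linear I -> DL};
  cE : forall x, x = \sum_a ci a (cp a x) }.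

Lemma killed_nth (V : lmodType K) (fs : seq {linear V -> K^o}) f0 x :
  (forall i : 'I_(size fs), nth f0 fs i x = 0) -> killed fs x.
Proof.
elim: fs => //= f fs IH H; split; first exact: (H ord0).
by apply: IH => i; apply: (H (lift ord0 i)).
Qed.

(** Jointly injective functionals [f_i] on the finite-dimensional module [I] embed it in a power of
    [D(L)], sending [x] to the functionals with value [f_i (x a)] at [a]. Injectivity of [I] splits
    the embedding. *)
Lemma inj_codual I : injective_module I -> fin_gen I -> inhabited (cdual I).
Proof.
move=> HI /fin_gen_dim /fin_dim_jinj [fs Hfs]; pose n := size fs.
pose f (i : 'I_n) : {linear kres I -> K^o} := nth (linHom_zero _ _) fs i.
have lin (i : 'I_n) (x : I) : linear (fun a : L => f i ((a : L^c) *: x) : K^o).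
  move=> k a b; rewrite -linearP; congr (f i _); rewrite scalerDl; congr (_ + _).
  by rewrite -[RHS]/(calg L k *: ((a : L^c) *: x)) scalerA calg_mul.
have linF (i : 'I_n) : linear (fun x : I => mkdual (lin i x) : DL).
  move=> c x y; apply: dapp_eq => a; rewrite dappD dappZ !mkdualE -linearD; congr (f i _).
  by rewrite scalerDr scalerA.
pose F i := mkLin (linF i).
have FE i x a : dapp (F i x) a = f i ((a : L^c) *: x) by rewrite mkdualE.
have linU : linear (fun x : I => (fun i => F i x) : dprod (fun _ : 'I_n => DL)).
  by move=> c x y; apply: functional_extensionality_dep => i; apply: linearP.
pose u := mkLin linU.
have uI : injective u.
  move=> x y xy; apply/eqP; rewrite -subr_eq0; apply/eqP; apply: Hfs; apply: (@killed_nth _ _ (linHom_zero _ _)) => i.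
  have H : F i (x - y) = 0 by rewrite linearB; apply/eqP; rewrite subr_eq0; apply/eqP; apply: (f_equal (fun h : dprod _ => h i) xy).
  have := FE i (x - y) 1; rewrite H dapp0 => /esym; rewrite -/(f i).
  by rewrite [X in f i X](_ : _ = x - y) //; apply: scale1r.
have [g gE] := HI _ _ u (mkLin (@cid_linear _ I)) uI.
pose ia (a : 'I_n) (phi : DL) : dprod (fun _ : 'I_n => DL) := fun t => if t == a then phi else 0.
have linI a : linear (ia a).
  move=> c x y; apply: functional_extensionality_dep => t.
  rewrite -[RHS]/(c *: ia a x t + ia a y t) /ia; case: eqP => // _.
  by rewrite scaler0 addr0.
constructor; apply: (@CDual I n (fun a => g \o mkLin (linI a)) F) => x.
rewrite -[LHS](gE x); transitivity (g (\sum_a ia a (F a x))); last by rewrite linear_sum.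
congr (g _); apply: functional_extensionality_dep => t.
have evs (r : seq 'I_n) (G : 'I_n -> dprod (fun _ : 'I_n => DL)) : (\sum_(a <- r) G a) t = \sum_(a <- r) G a t.
  by elim/big_rec2: _ => // a p q _ <-.
rewrite evs (bigD1 t) //= big1 ?addr0; first by rewrite /ia eqxx.
by move=> a /negbTE; rewrite /ia eq_sym => ->.
Qed.

Section Coef.
Variables (I : lmodType L^c) (d : cdual I).
Local Notation "'io' a" := (@ci I d a : nuHom I) (at level 10).

Definition coefL a (g : nuHom I) : L := sval (boolp.cid (end_dual (cp (c:=d) a \o hfun g))).
Lemma coefLE a (g : nuHom I) phi : cp (c:=d) a (hfun g phi) = dualLmul (coefL a g) phi.
Proof. exact: (svalP (boolp.cid (end_dual (cp (c:=d) a \o hfun g))) phi). Qed.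
Lemma coefL_uniq a g x : (forall phi, dapp (cp (c:=d) a (hfun g phi)) 1 = dapp phi x) -> coefL a g = x.
Proof. by move=> H; apply: dapp_inj => phi; rewrite -H coefLE dapp_mul mul1r. Qed.
Lemma coefL_ev a g phi : dapp (cp (c:=d) a (hfun g phi)) 1 = dapp phi (coefL a g).
Proof. by rewrite coefLE dapp_mul mul1r. Qed.

Fact coefL_linear a : linear (coefL a : nuHom I -> (L^c)^o).
Proof.
move=> c g h; apply: coefL_uniq => phi.
rewrite -[hfun _ phi]/(hfun g (dualLmul (c : L) phi) + hfun h phi) linearD dappD !coefL_ev dapp_mul.
exact: (esym (linearD (mkLin (dapp_lin phi)) (coefL a g * (c : L)) (coefL a h))).
Qed.

Lemma nu_basis (g : nuHom I) : g = \sum_a (coefL a g : L^c) *: io a.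
Proof.
apply: lin_eq => phi.
have evs (r : seq 'I_(cn d)) (G : 'I_(cn d) -> nuHom I) :
    (\sum_(a <- r) G a : {linear _ -> _}) phi = \sum_(a <- r) hfun (G a) phi.
  by elim/big_rec2: _ => // a p q _ <-.
rewrite evs (cE d (hfun g phi)); apply: eq_bigr => a _.
by rewrite coefLE.
Qed.

Lemma nu_dbasis : dbasis (nuHom I).
Proof.
exists (cn d), (fun a => io a), (fun a => mkLin (coefL_linear a)) => g.
exact: nu_basis.
Qed.

(** The trace behind the duality of [Hom(nu^-1 I, M)] and [Hom(M, I)]. For [I = D(L)], presented by
    identities, it applies [h] to the identity and evaluates the result at one. *)
Definition ntr (h : linHom (nuHom I) I) : K := \sum_a dapp (cp (c:=d) a (hfun h (io a))) 1.

Lemma ntr_linear : linear (ntr : linHom (nuHom I) I -> K^o).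
Proof.
move=> k g h; rewrite /ntr scaler_sumr -big_split; apply: eq_bigr => a _.
rewrite -[hfun _ (io a)]/(calg L k *: hfun g (io a) + hfun h (io a)) linearP dappD dappK.
by [].
Qed.

Section Represent.
Variable M : lmodType L^c.

Fact rk1_linear a (m : M) : linear (fun g : nuHom I => (coefL a g : L^c) *: m).
Proof.
move=> c g h; rewrite -[coefL a _]/(mkLin (coefL_linear a) (c *: g + h)) linearP scalerDl.
by rewrite scalerA.
Qed.
Definition rk1 a m : linHom (nuHom I) M := mkLin (rk1_linear a m).

Fact rk1Z a m k : rk1 a (calg L k *: m) = k *: rk1 a m.
Proof. by apply: lin_eq => g; rewrite /= !scalerA calgC. Qed.
Fact rk1D a m m' : rk1 a (m + m') = rk1 a m + rk1 a m'.
Proof. by apply: lin_eq => g; rewrite /= scalerDr. Qed.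

Lemma hom_rk1 (f : linHom (nuHom I) M) : f = \sum_a rk1 a (hfun f (io a)).
Proof.
apply: lin_eq => g.
have evs (r : seq 'I_(cn d)) (G : 'I_(cn d) -> linHom (nuHom I) M) :
    (\sum_(a <- r) G a : {linear _ -> _}) g = \sum_(a <- r) hfun (G a) g.
  by elim/big_rec2: _ => // a p q _ <-.
rewrite evs -[LHS]/(hfun f g) {1}(nu_basis g) linear_sum; apply: eq_bigr => a _.
by rewrite linearZ.
Qed.

(** The values of [l] on the rank-one maps [rk1 a m] prescribe the components of [g m] in the copies
    of [D(L)]. *)
Lemma ntr_rep (l : {linear linHom (nuHom I) M -> K^o}) : exists g : {linear M -> I},
  forall f : linHom (nuHom I) M, l f = ntr (lcomp g f).
Proof.
have lin1 a m : linear (fun x : L => l (rk1 a ((x : L^c) *: m)) : K^o).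
  move=> k x y; rewrite -linearP; congr (l _); rewrite scalerDl rk1D; congr (_ + _).
  by rewrite -rk1Z scalerA calg_mul.
have lin2 a : linear (fun m => mkdual (lin1 a m) : DL).
  move=> c x y; apply: dapp_eq => z; rewrite dappD dappZ !mkdualE -linearD; congr (l _).
  by rewrite -rk1D scalerDr scalerA.
have lin3 : linear (fun m => \sum_a ci (c:=d) a (mkdual (lin1 a m))).
  move=> c x y; rewrite scaler_sumr -big_split; apply: eq_bigr => a _.
  by rewrite -[mkdual _]/(mkLin (lin2 a) (c *: x + y)) !linearP.
exists (mkLin lin3) => f; rewrite {1}(hom_rk1 f) linear_sum /ntr; apply: eq_bigr => b _.
set m := hfun f (io b).
rewrite -[hfun _ _]/(\sum_a ci (c:=d) a (mkdual (lin1 a m))) linear_sum dapp_sum.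
transitivity (l (\sum_a rk1 a ((coefL b (io a) : L^c) *: m))); last first.
  rewrite linear_sum; apply: eq_bigr => a _.
  by rewrite (coefL_ev b (io a)) mkdualE.
congr (l _); apply: lin_eq => g.
have evs (r : seq 'I_(cn d)) (G : 'I_(cn d) -> linHom (nuHom I) M) :
    (\sum_(a <- r) G a : {linear _ -> _}) g = \sum_(a <- r) hfun (G a) g.
  by elim/big_rec2: _ => // a p q _ <-.
rewrite evs /= {1}(nu_basis g).
rewrite -[coefL b _]/(mkLin (coefL_linear b) (\sum_a (coefL a g : L^c) *: io a)) linear_sum scaler_suml.
by apply: eq_bigr => a _; rewrite linearZ scalerA.
Qed.

Lemma ntr_nondeg (g : {linear M -> I}) : (forall f : linHom (nuHom I) M, ntr (lcomp g f) = 0) -> forall m, g m = 0.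
Proof.
move=> H m; rewrite (cE d (g m)) big1 // => a _; rewrite (_ : cp a _ = 0) ?linear0 //.
apply: dapp_eq => x; rewrite dapp0 -[x]mulr1 -(dappZ (x : L^c)) -!linearZ; move: (_ *: m) => m'.
rewrite -(H (rk1 a m')) /ntr {1}(cE d (g m')) linear_sum dapp_sum; apply: eq_bigr => b _.
rewrite (coefL_ev a (io b)) -[hfun _ (io b)]/(g ((coefL a (io b) : L^c) *: m')) linearZ linearZ.
by rewrite dappZ mulr1.
Qed.
End Represent.
End Coef.

(** In coordinates both sides are the same double sum. This cyclicity is what makes the supertrace
    vanish on boundaries. *)
Lemma ntr_cyclic I I' (d : cdual I) (d' : cdual I') (u : {linear I -> I'}) (h : linHom (nuHom I') I) :
  ntr d' (lcomp u h) = ntr d (lcomp h (mkLin (nuinv_linear u))).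
Proof.
rewrite /ntr.
transitivity (\sum_b \sum_a dapp (cp (c:=d) a (hfun h (ci (c:=d') b))) (coefL b (lcomp u (ci (c:=d) a)))).
  apply: eq_bigr => b _; rewrite -[hfun _ _]/(u (hfun h (ci (c:=d') b))).
  rewrite {1}(cE d (hfun h _)) !linear_sum dapp_sum; apply: eq_bigr => a _.
  exact: (coefL_ev b (lcomp u (ci (c:=d) a))).
rewrite exchange_big; apply: eq_bigr => a _ /=.
rewrite [in RHS](nu_basis d' (lcomp u (ci (c:=d) a))).
rewrite !linear_sum dapp_sum; apply: eq_bigr => b _.
by rewrite !linearZ dappZ mulr1.
Qed.
End CoDual.

(** * The supertrace pairing of complexes *)

Section Supertrace.
Variables (K : fieldType) (L : falgType K).
Local Notation cpx := (cplx L^c).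
Implicit Types M : cpx.
Variables (T : cpx) (dT : forall i, cdual (T i)) (a : int) (N : nat).
Hypothesis T0 : forall i, (i < a) || (a + N%:Z <= i) -> forall x : T i, x = 0.
Local Notation nT := (nuinv T).

Definition str (h : HomC nT T 0) : K :=
  \sum_(k < N) ksgn (a + k%:Z) (ntr (dT (a + k%:Z)) (hx h (addr0 (a + k%:Z)))).

Lemma ntr_sgn i n (f : linHom (nuHom (T i)) (T i)) : ntr (dT i) (ksgn n f) = ksgn n (ntr (dT i) f).
Proof. exact: (@ksgn_lin n K _ _ (mkLin (ntr_linear (dT i))) f). Qed.

Lemma str_linear : linear (str : HomC nT T 0 -> K^o).
Proof.
move=> c f g; rewrite /str scaler_sumr -big_split; apply: eq_bigr => k _.
set i := a + k%:Z; set F := ntr _ (hx f _); set G := ntr _ (hx g _).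
have E : ntr (dT i) (hx (c *: f + g) (addr0 i)) = c * F + G := ntr_linear (dT i) c _ _.
rewrite -[RHS]/(c * ksgn i F + ksgn i G) E /ksgn; case: ifP => _ //.
by rewrite mulrN opprD.
Qed.

Lemma strD f g : str (f + g) = str f + str g.
Proof. exact: (linearD (mkLin str_linear)). Qed.
Lemma strN f : str (- f) = - str f.
Proof. exact: (linearN (mkLin str_linear)). Qed.
Lemma str_sgn n f : str (ksgn n f) = ksgn n (str f).
Proof. exact: (@ksgn_lin n K _ _ (mkLin str_linear) f). Qed.

Lemma alt_sum (F : nat -> K) m : \sum_(k < m) ksgn (a + k%:Z) (F k + F k.+1) = ksgn a (F 0%N) - ksgn (a + m%:Z) (F m).
Proof.
elim: m => [|m IH]; first by rewrite big_ord0 addr0 subrr.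
rewrite big_ord_recr /= IH ksgnD addrA subrK; congr (_ + _).
by rewrite (@ksgn_succ (a + m%:Z) (a + m.+1%:Z)) ?opprK //; lia.
Qed.

(** By cyclicity the boundary contributes [A (i - 1) + A i] in degree [i], and the alternating sum
    telescopes; the end terms vanish because [T] is zero there. *)
Lemma str_d (h : HomC nT T (-1)) e : str (cd (HomC nT T) e h) = 0.
Proof.
have e1 (j : int) : j + 1 + (-1) = j by rewrite addrK.
pose nd j j' (e' : j + 1 = j') : linHom (nuHom (T j)) (nuHom (T j')) := mkLin (nuinv_linear (cd T e')).
pose A j : K := ntr (dT j) (lcomp (hx h (e1 j)) (nd j _ erefl)).
have AE j i (ji : j + 1 = i) (ij : i + (-1) = j) : ntr (dT i) (lcomp (cd T ji) (hx h ij)) = A j.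
  by case: i / ji ij => ij; rewrite (eq_irrelevance ij (e1 j)); apply: ntr_cyclic.
have main i : ntr (dT i) (hx (cd (HomC nT T) e h : hob nT T 0) (addr0 i)) = A (i - 1) + A i.
  have := linearD (mkLin (ntr_linear (dT i))) (lcomp (cd T (subrK 1 i)) (hx h (erefl (i - 1)))) (lcomp (hx h (e1 i)) (nd i _ erefl)).
  rewrite -[mkLin _ (lcomp (cd _ _) _)]/(ntr (dT i) _) -[mkLin _ (lcomp (hx _ _) _)]/(A i) AE => <-.
  congr (ntr (dT i) _); apply: lin_eq => x.
  by rewrite (hdE e h (addr0 i) (erefl (i - 1)) (subrK 1 i) erefl (e1 i)) ksgnNn ksgn1 opprK.
rewrite /str (eq_bigr (fun k : 'I_N => ksgn (a + k%:Z) (A (a + k%:Z - 1) + A (a + k.+1%:Z - 1)))); last first.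
  by move=> k _; rewrite main; congr (ksgn _ (_ + A _)); lia.
rewrite (alt_sum (fun k => A (a + k%:Z - 1))).
have z i (f : linHom (nuHom (T i)) (T i)) : (forall x, hfun f x = 0) -> ntr (dT i) f = 0.
  by move=> H; rewrite /ntr big1 // => b _; rewrite H linear0 dapp0.
rewrite /A !z ?ksgn0 ?subrr // => x /=.
  rewrite [lcomp _ _](_ : _ = 0) ?linear0 //; apply: lin_eq => phi; apply: T0; lia.
by apply: T0; lia.
Qed.

Section Duality.
Variables (M : cpx) (n m : int) (e : m + n = 0).

Definition hs i (f : linHom (nuHom (T i)) (M (i + n))) : HomC nT M n := @hsup K L nT M n i (i + n) erefl f.
Fact hsup_linear i : linear (@hs i).
Proof.
move=> c f g; rewrite /hs; apply: hext => p q e' x; rewrite hxD hxZ.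
have [E|ne] := pselect (p = i); last by rewrite !hsup_neq // scaler0 addr0.
by subst p; case: q / e'; rewrite !hsupE.
Qed.

Lemma range_dec i : (exists k : 'I_N, i = a + k%:Z) \/ ((i < a) || (a + N%:Z <= i)).
Proof.
have [h|/norP[]] := boolP ((i < a) || (a + N%:Z <= i)); first by right.
rewrite -!(leNgt, ltNge) => h1 h2; left.
have lt : (`|i - a| < N)%N by lia.
by exists (Ordinal lt) => /=; lia.
Qed.

Lemma nT0 i : (i < a) || (a + N%:Z <= i) -> forall x : nT i, x = 0.
Proof. by move=> /T0 H x; apply: lin_eq => phi; apply: H. Qed.

Lemma hsup_sum (f : HomC nT M n) : f = \sum_(k < N) hs (hx f (erefl (a + k%:Z + n))).
Proof.
rewrite /hs.
apply: hext => i j e' x; rewrite hx_sum.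
have [[k E]|out] := range_dec i; last first.
  by rewrite (nT0 out x) linear0 big1 // => k _; rewrite linear0.
subst i; rewrite (bigD1 k) //= big1 ?addr0; first by case: j / e'; rewrite hsupE.
move=> k' ne; apply: hsup_neq => E; case/eqP: ne; apply: val_inj => /=; lia.
Qed.

Lemma str_comp (g : HomC M T m) (f : HomC nT M n) :
  str (hcomp e g f) = \sum_(k < N) ksgn (a + k%:Z)
    (ntr (dT _) (lcomp (hx g (etrans (esym (addrA _ n m)) (etrans (congr1 (+%R _) (ixC e)) (addr0 _))))
       (hx f (erefl (a + k%:Z + n))))).
Proof.
rewrite /str; apply: eq_bigr => k _; congr (ksgn _ (ntr _ _)); apply: lin_eq => x.
exact: hcompE.
Qed.

Lemma str_rep (l : {linear HomC nT M n -> K^o}) : exists g : HomC M T m, forall f, l f = str (hcomp e g f).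
Proof.
have G i := boolp.cid (ntr_rep (dT i) (l \o mkLin (@hsup_linear i))).
have ix j i : j + m = i -> j = i + n by move=> <-; rewrite -addrA e addr0.
pose g : HomC M T m := mkh (fun j i e' => mkLin (ksgn_linear i (sval (G i) \o cc M (ix j i e')))).
exists g => f; rewrite str_comp {1}(hsup_sum f) linear_sum; apply: eq_bigr => k _.
have := svalP (G (a + k%:Z)) (hx f erefl); rewrite -[LHS]/(l (hs _)) => ->.
apply: etrans (ntr_sgn _ _); congr (ntr (dT _) _); apply: lin_eq => x.
rewrite -[RHS]/(hfun (ksgn _ (lcomp _ _)) x) hfun_sgn.
by rewrite -[hfun (lcomp (hx g _) _) x]/(ksgn _ (sval (G _) (cc M _ (hx f erefl x)))) cc_id ksgnK.
Qed.

Lemma str_nondeg (g : HomC M T m) : (forall f : HomC nT M n, str (hcomp e g f) = 0) -> g = 0.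
Proof.
move=> H; apply: hext => j i e' x; rewrite hx0.
have [[k E]|out] := range_dec i; last exact: T0.
move: (esym E) e' => {}E; case: i / E => e'; have jE : a + k%:Z + n = j by rewrite -e' -addrA e addr0.
case: j / jE e' x => e' x; apply: (ntr_nondeg (d := dT (a + k%:Z))) => f0.
have := H (hs f0); rewrite /hs str_comp (bigD1 k) //= big1 ?addr0.
  move=> /ksgn_inj <-; congr (ntr _ _); apply: lin_eq => y /=.
  by rewrite hsupE; apply: hx_irr.
move=> k' ne; rewrite (_ : lcomp _ _ = 0).
  rewrite (_ : ntr _ _ = 0) ?ksgn0 //.
  exact: (linear0 (mkLin (ntr_linear (dT (a + k'%:Z))))).
apply: lin_eq => y /=; rewrite hsup_neq ?linear0 // => E; case/eqP: ne; apply: val_inj => /=; lia.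
Qed.
End Duality.

(** Nakayama duality [D Hom(nu^-1 T, M) = Hom(M, T)]. *)
Theorem nakayama M (n m : int) : m + n = 0 -> hv nT M n <-> hv M T m.
Proof.
move=> e; split=> [H g cg|H f cf].
  have e' : m - 1 + (n + 1) = 0 by rewrite addrACA subrr addr0.
  have ek : (-1 : int) + 1 = 0 by [].
  (* As [g] is a cycle, pairing with it vanishes on boundaries, which by hypothesis are all the
     cycles of degree [n]. So the pairing depends only on [d f] and extends to a functional of
     [d f]; the map [h] representing that functional is, up to sign, a primitive of [g] by
     nondegeneracy. *)
  have linp : linear (fun f : HomC nT M n => str (hcomp e g f) : K^o).
    by move=> c f f'; rewrite hcompDr hcompZr str_linear.
  have kills f : cd (HomC nT M) (erefl (n + 1)) f = 0 -> str (hcomp e g f) = 0.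
    move=> df; have [y ->] := bdry_elim (subrK 1 n) (H f (cycle1 df)).
    have e1 : m + (n - 1) = -1 by rewrite addrA e.
    have e2 : m + 1 + (n - 1) = 0 by rewrite addrACA subrr addr0.
    have := str_d (hcomp e1 g y) ek; rewrite (hd_comp e1 erefl (subrK 1 n) ek e2 e) cg hcomp0l add0r str_sgn.
    by move/ksgn_inj.
  have [l lE] := @functional_extension K _ _ (cd (HomC nT M) (erefl (n + 1))) (mkLin linp) kills.
  have [h hE] := str_rep e' l.
  suff gE : g = cd (HomC M T) (subrK 1 m) (ksgn m h) by rewrite gE; apply: bdry_intro.
  apply/eqP; rewrite -subr_eq0; apply/eqP; apply: (str_nondeg (e := e)) => f.
  rewrite -scaleN1r hcompDl hcompZl scaleN1r strD strN.
  have e1 : m - 1 + n = -1 by rewrite addrAC e.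
  have := str_d (hcomp e1 h f) ek; rewrite (hd_comp e1 (subrK 1 m) (erefl (n + 1)) ek e e') strD str_sgn.
  rewrite -hE lE -[mkLin linp f]/(str (hcomp e g f)).
  rewrite (ksgn_lin m (cd (HomC M T) (subrK 1 m))) hcomp_sgnl str_sgn => /eqP.
  rewrite addr_eq0 => /eqP ->; rewrite ksgnN opprK.
  have -> : ksgn m (ksgn (m - 1) (str (hcomp e g f))) = - str (hcomp e g f).
    by rewrite (ksgn_succ _ (subrK 1 m)) ksgnK.
  by rewrite subrr.
(* Conversely, if [f] is not a boundary, a functional vanishing on boundaries detects it. The
   representing map [g] is then a cycle, hence a boundary, and so pairs to zero with the cycle
   [f]. *)
apply: contrapT => nb.
have HB : is_submod (fun x : HomC nT M n => bdry x).
  by split=> [|c x y bx by_]; [apply: bdry0 | apply: bdryD => //; apply: bdryZ].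
have [l [l0 l1]] := separation HB nb.
have [g gE] := str_rep e l.
have e' : m + 1 + (n - 1) = 0 by rewrite addrACA subrr addr0.
have ek : (-1 : int) + 1 = 0 by [].
have cg : cycle g.
  apply: (@cycle1 _ _ _ _ (erefl (m + 1))); apply: (str_nondeg (e := e')) => y.
  have e1 : m + (n - 1) = -1 by rewrite addrA e.
  have := str_d (hcomp e1 g y) ek; rewrite (hd_comp e1 erefl (subrK 1 n) ek e' e) strD str_sgn.
  by rewrite -gE l0 ?ksgn0 ?addr0 //; apply: bdry_intro.
have [h hE] := bdry_elim (subrK 1 m) (H g cg).
move: l1; rewrite gE hE.
have e1 : m - 1 + n = -1 by rewrite addrAC e.
have e2 : m - 1 + (n + 1) = 0 by rewrite addrACA subrr addr0.
have := str_d (hcomp e1 h f) ek; rewrite (hd_comp e1 (subrK 1 m) (erefl (n + 1)) ek e e2) cf hcomp0r ksgn0 addr0.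
by move=> -> /eqP; rewrite eq_sym oner_eq0.
Qed.
End Supertrace.

(** * Finite approximations *)

Lemma In_nth (V : Type) (x0 : V) (s : seq V) (c : 'I_(size s)) : List.In (nth x0 s c) s.
Proof.
case: c => c /=; elim: s c => // v s IH [|c] lt; [by left | by right; apply: IH].
Qed.
Lemma nth_In (V : Type) (x0 v : V) (s : seq V) : List.In v s -> exists c : 'I_(size s), v = nth x0 s c.
Proof.
elim: s => //= v0 s IH [->|/IH [c ->]]; first by exists ord0.
by exists (lift ord0 c).
Qed.

Section FiniteDimension.
Variables (K : fieldType) (L : falgType K).
Local Notation cpx := (cplx L^c).
Implicit Types M N W A B C : cpx.

Lemma dbasis_fin (V : lmodType L^c) (J : finType) (u : J -> V) (l : J -> {linear V -> (L^c)^o}) :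
  (forall x, x = \sum_j (l j x : L^c) *: u j) -> dbasis V.
Proof.
move=> H; exists #|{: J}|, (fun i => u (enum_val i)), (fun i => l (enum_val i)) => x.
rewrite {1}(H x) (reindex (@enum_val _ {: J})) /=; last exact/onW_bij/enum_val_bij.
by apply: eq_bigl.
Qed.

Lemma dbasis_sum (V : lmodType L^c) (J : finType) (Q : J -> lmodType L^c)
  (al : forall t, {linear Q t -> V}) (be : forall t, {linear V -> Q t}) :
  (forall x, x = \sum_t al t (be t x)) -> (forall t, dbasis (Q t)) -> dbasis V.
Proof.
move=> H dQ; pose F t := boolp.cid (dQ t); pose n t := sval (F t).
pose G t := boolp.cid (svalP (F t)); pose u t : 'I_(n t) -> Q t := sval (G t).
pose E t := boolp.cid (svalP (G t)); pose l t : 'I_(n t) -> {linear Q t -> (L^c)^o} := sval (E t).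
have uE t x : x = \sum_i (l t i x : L^c) *: u t i by apply: (svalP (E t)).
apply: (@dbasis_fin V {t : J & 'I_(n t)} (fun p => al (tag p) (u (tag p) (tagged p)))
   (fun p => l (tag p) (tagged p) \o be (tag p))) => x.
rewrite {1}(H x).
rewrite -(sig_big_dep xpredT (fun _ => xpredT) (fun t i => ((l t i \o be t) x : L^c) *: al t (u t i))) /=.
by apply: eq_bigr => t _; rewrite {1}(uE t (be t x)) linear_sum; apply: eq_bigr => i _; rewrite linearZ.
Qed.

Lemma bounded_tsum B C (q : twist B C) : bounded B -> bounded C -> bounded (tsum q).
Proof.
move=> [a [b H]] [a' [b' H']]; exists (Order.min a a'), (Order.max b b') => i io [x y].
by congr pair; [apply: H | apply: H']; move: io; rewrite lt_min gt_max; lia.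
Qed.

Lemma bounded_shift m M : bounded M -> bounded (shift m M).
Proof. by move=> [a [b H]]; exists (a - m), (b - m) => i io x; apply: H; lia. Qed.

Lemma perfb_tsum B C (q : twist B C) : perfb B -> perfb C -> perfb (tsum q).
Proof.
move=> [bB dB] [bC dC]; split=> [|i]; first exact: bounded_tsum.
pose Q (t : bool) : lmodType L^c := if t then B i else C i.
pose al (t : bool) : {linear Q t -> tsum q i} := if t as t return {linear Q t -> tsum q i} then tin q i : {linear _ -> _} else tsnd q i.
pose be (t : bool) : {linear tsum q i -> Q t} := if t as t return {linear tsum q i -> Q t} then tfst q i else tout q i : {linear _ -> _}.
apply: (@dbasis_sum _ _ Q al be) => [[x y]|[]]; [|exact: dB | exact: dC].
by rewrite big_bool; congr pair; rewrite /= ?addr0 ?add0r.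
Qed.

Lemma perfb_shift m M : perfb M -> perfb (shift m M).
Proof. by move=> [bM dM]; split=> [|i]; [apply: bounded_shift | apply: dM]. Qed.

Lemma perfb_dsum (J : finType) M : perfb M -> perfb (dsumc (fun _ : J => M)).
Proof.
move=> [[a [b H]] dM]; split=> [|i].
  exists a, b => i io x; apply: dsum_eq => t.
  by rewrite [LHS](H i io) [RHS](H i io).
apply: (@dbasis_sum _ J (fun _ => M i) (fun t => dinj (fun _ => M) t i) (fun t => dproj (fun _ => M) t i)) => // x.
apply: dsum_eq => t; rewrite linear_sum (bigD1 t) //= big1 ?addr0 => [|t' /eqP ne].
  by rewrite -[RHS]/(dproj (fun _ => M) t i (dinj (fun _ => M) t i (dproj (fun _ => M) t i x))) dprojK.
exact: (@dproj_neq _ _ (fun _ => M) t' t i).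
Qed.

Lemma perfb_fin M i : perfb M -> fin_dim (M i).
Proof. by case=> _ dM; apply/fin_gen_dim/dbasis_fin_gen/dM. Qed.

Lemma fin_dim_pair (V W : lmodType L^c) : fin_dim V -> fin_dim W -> fin_dim (V * W)%type.
Proof.
move=> [n [e H]] [m [f H']].
exists (n + m)%N, (fun i => match split i with inl j => (e j, 0) | inr j => (0, f j) end) => -[x y].
have [c ->] := H x; have [d ->] := H' y.
exists (fun i => match split i with inl j => c j | inr j => d j end).
rewrite big_split_ord /=.
have sl j : split (lshift m j : 'I_(n + m)) = inl j by rewrite -[lshift _ _]/(unsplit (inl j)) unsplitK.
have sr j : split (rshift n j : 'I_(n + m)) = inr j by rewrite -[rshift _ _]/(unsplit (inr j)) unsplitK.
rewrite [X in _ = X + _](eq_bigr (fun j => calg L (c j) *: ((e j, 0) : V * W))); last by move=> j _; rewrite sl.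
rewrite [X in _ = _ + X](eq_bigr (fun j => calg L (d j) *: ((0, f j) : V * W))); last by move=> j _; rewrite sr.
have ev1 (k : nat) (G : 'I_k -> V * W) : \sum_i G i = (\sum_i (G i).1, \sum_i (G i).2).
  by elim/big_rec3: _ => // i p q r _ ->.
rewrite !ev1 /=; congr pair => /=.
  by rewrite [X in _ + X]big1 ?addr0 // => i _; rewrite scaler0.
by rewrite [X in X + _]big1 ?add0r // => i _; rewrite scaler0.
Qed.

Lemma killed_cat (V : lmodType K) (fs gs : seq {linear V -> K^o}) x : killed (fs ++ gs) x -> killed fs x /\ killed gs x.
Proof. by elim: fs => //= f fs IH [fx /IH []]. Qed.

Lemma killed_all (V : lmodType K) (Q : nat -> V -> Prop) :
  (forall k, exists fs : seq {linear V -> K^o}, forall x, killed fs x -> Q k x) ->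
  forall p : nat, exists fs : seq {linear V -> K^o}, forall x, killed fs x -> forall k, (k < p)%N -> Q k x.
Proof.
move=> H; elim=> [|p [fs IH]]; first by exists [::].
have [gs G] := H p; exists (fs ++ gs) => x /killed_cat [kf kg] k.
by rewrite ltnS leq_eqVlt => /orP[/eqP ->|]; [apply: G | apply: IH].
Qed.

(** Evaluate at finitely many generators in finitely many degrees, then apply functionals that
    separate the points of the finite-dimensional values. *)
Lemma hom_jinj U M m : bounded U -> (forall i, fin_gen (U i)) -> (forall i, fin_dim (M i)) ->
  exists fs : seq {linear HomC U M m -> K^o}, forall x, killed fs x -> x = 0.
Proof.
move=> [a [b U0]] gU fM.
have H k : exists fs : seq {linear HomC U M m -> K^o}, forall f, killed fs f ->
    forall x, hx f (erefl (a + k%:Z + m)) x = 0.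
  set i := a + k%:Z; have [n [u uE]] := gU i; have [gs G] := fin_dim_jinj (fM (i + m)).
  have lin (v : U i) : linear (fun f : HomC U M m => hx f (erefl (i + m)) v : kres (M (i + m))) by [].
  have ev v : exists fs : seq {linear HomC U M m -> K^o}, forall f, killed fs f -> hx f (erefl (i + m)) v = 0.
    exists (map (fun g : {linear kres (M (i + m)) -> K^o} => (g \o mkLin (lin v) : {linear HomC U M m -> K^o})) gs).
    move=> f kf; apply: G; by elim: gs kf => //= g gs IH [gf /IH].
  (* [killed_all] ranges over natural numbers, so the predicate is stated for every proof of [t < n]
     and is vacuous beyond [n]. *)
  have [fs F] := killed_all (Q := fun t f => forall lt : (t < n)%N, hx f (erefl (i + m)) (u (Ordinal lt)) = 0)
     (fun t => match ltnP t n with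
               | LtnNotGeq lt => match ev (u (Ordinal lt)) with ex_intro fs F =>
                    ex_intro _ fs (fun f kf lt' => etrans (congr1 (fun l => hx f erefl (u (Ordinal l))) (bool_irrelevance lt' lt)) (F f kf)) end
               | GeqNotLtn ge => ex_intro _ [::] (fun f _ lt => False_ind _ (elimF idP (leq_gtF ge) lt))
               end) n.
  exists fs => f kf x; have [c ->] := uE x; rewrite linear_sum big1 // => t _.
  have := F f kf t (ltn_ord t) (ltn_ord t); rewrite (_ : Ordinal _ = t); last exact: val_inj.
  by move=> E; rewrite linearZ; move: E => /= ->; rewrite scaler0.
have [fs F] := killed_all H (`|b - a| + 1)%N; exists fs => f kf.
apply: hext => i j e x; rewrite hx0.
have [i_out|/norP[]] := boolP ((i < a) || (b < i)); first by rewrite (U0 i i_out x) linear0.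
rewrite -!leNgt => ai ib; have ik : i = a + (`|i - a|%N)%:Z by lia.
have lt : (`|i - a| < `|b - a| + 1)%N by lia.
have := F f kf _ lt; rewrite -ik => Fi; case: j / e; exact: Fi.
Qed.

Lemma in_Db_fin M : bounded M -> (forall i, fin_dim (M i)) -> in_Db M.
Proof. by move=> bM fM; exists M; split=> //; apply: dIso_refl. Qed.
End FiniteDimension.

(** * Approximation by finitely many cells *)

Section FiniteApproximation.
Variables (K : fieldType) (L : falgType K).
Local Notation cpx := (cplx L^c).
Implicit Types A B C W : cpx.
Variables (U : cpx) (pU : perfb U) (silt : forall k : int, 0 < k -> hv U U k).
Variables (M : cpx) (fM : forall i, fin_dim (M i)) (P : cpx -> Prop).
Hypotheses (Pc : forall m, P (shift m U)) (Pe : forall B C (q : twist B C), P B -> P C -> P (tsum q))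
  (Ps : forall d A, P A -> P (dsumc (fun _ : 'I_d => A))).

Let sU : small U := perfb_small pU.

Definition fstate W (f : cmap W M) k0 : Prop :=
  [/\ good U W, P W, perfb W & forall k, k0 <= k -> hv U (kone f) k].

(** The cycles of degree [m] in [Hom(U, kone f)] form a finite-dimensional space; attaching one cell
    for each member of a spanning list makes them boundaries. The new cells have no [h^k] for
    [k > m], so what vanished above degree [m] stays zero. *)
Lemma finapp_step W (f : cmap W M) m : fstate f (m + 1) -> exists W' (f' : cmap W' M), fstate f' m.
Proof.
move=> [gW PW pW HV].
have fV i : fin_dim (kone f i) by exact: (fin_dim_pair (fM i) (perfb_fin (i + 1) pW)).
have [fs F] := @hom_jinj K L U (kone f) m (proj1 pU) (fun i => dbasis_fin_gen (proj2 pU i)) fV.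
have Hc : is_submod (fun x : HomC U (kone f) m => cycle x).
  by split=> [|c x y cx cy]; [apply: cycle0 | move=> j e; rewrite linearP cx cy scaler0 addr0].
have [s [sc Hs]] := jinj_span Hc (fun x _ => F x).
have sc' (c : 'I_(size s)) : cycle (nth 0 s c : HomC U (kone f) m).
  exact/sc/In_nth.
have D (c : 'I_(size s)) : exists yz : HomC U M m * HomC U W (m + 1), nth 0 s c = kl f erefl yz.1 yz.2.
  by have [y [z E]] := kl_surj erefl (nth 0 s c); exists (y, z).
pose y c := (sval (boolp.cid (D c))).1; pose z c := (sval (boolp.cid (D c))).2.
have yz (c : 'I_(size s)) : nth 0 s c = kl f erefl (y c) (z c) := svalP (boolp.cid (D c)).
have dyz (c : 'I_(size s)) : cd (HomC U M) erefl (y c) - hpost U f (m + 1) (z c) = 0 /\ cycle (z c).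
  have := sc' c _ (erefl (m + 1)); rewrite yz (kl_d f erefl erefl) -(kl0 U f erefl) => /kl_inj [-> /eqP].
  by rewrite oppr_eq0 => /eqP /cycle1.
have cz (c : 'I_(size s)) : cycle (z c) by case: (dyz c).
have zy (c : 'I_(size s)) : hpost_dg U f _ (z c) = cd (HomC U M) erefl (y c).
  by case: (dyz c) => /eqP; rewrite subr_eq0 => /eqP ->.
pose mm (_ : 'I_(size s)) := m.
have gA : good U (@att K L U W _ mm z cz) by apply: good_att.
have [f' f'E] := good_dgmap (@att_map K L U sU W (homM U M) (hpost_dg U f) _ mm z y cz zy) gA.
have f'in k (g : HomC U W k) : hpost U f' k (hpost U (@att_in K L U W _ mm z cz) k g) = hpost U f k g.
  by rewrite -f'E att_map_in.
exists (@att K L U W _ mm z cz), f'; split=> //.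
- exact: (@Pe _ _ (twist_of (att_cycle (m:=mm) cz)) PW (@Ps (size s) _ (Pc (- m)))).
- exact: (perfb_tsum (twist_of (att_cycle (m:=mm) cz)) pW (@perfb_dsum K L 'I_(size s) _ (perfb_shift (- m) pU))).
move=> k mk; apply/hv_kone => k' e z' y' cz' fz'.
(* In degree [k + 1 > m] the new cells have no classes, so the given cycle can be moved into [W] by
   a boundary. *)
have hC : hv U (dsumc (@cell K L U _ mm)) k'.
  by apply: hv_dsum_r => // c; apply/hv_shift_r/silt; rewrite /mm; lia.
have [x0 x0E] := bdry_elim e (hC _ (cyc_map (hpost U (tout _)) cz')).
have Hses := hses_post (twist_of (att_cycle (m:=mm) cz)) U.
have [x' x'E] := ses_surj Hses x0.
have [z1 z1E] : exists z1, z' - cd (HomC U _) e x' = hpost U (@att_in K L U W _ mm z cz) k' z1.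
  by apply: (ses_ex Hses); rewrite linearB x0E -x'E -cfunC subrr.
have cz1 : cycle z1.
  apply: (@cycle1 _ _ _ _ (erefl (k' + 1))); apply: (ses_inj Hses).
  by rewrite cfunC -[hpost U (tin _) _ z1]z1E linearB cdd subr0 cz'.
pose y1 := y' - hpost U f' k x'.
have fz1 : hpost U f k' z1 = cd (HomC U M) e y1.
  by rewrite -f'in -z1E linearB fz' cfunC -linearB.
suff [x1 x1E bx1] : exists2 x1, hpost U (@att_in K L U W _ mm z cz) k' z1 = cd (HomC U _) e x1 & bdry (y1 - hpost U f' k x1).
  exists (x1 + x'); first by rewrite linearD -x1E -z1E subrK.
  by rewrite linearD opprD addrCA addrC.
have [km|mk'] := eqVneq k m; last first.
  have km' : m + 1 <= k by move: mk mk'; lia.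
  have [x1 x1E bx1] := proj1 (hv_kone U f k) (HV k km') k' e z1 y1 cz1 fz1.
  by exists (hpost U (@att_in K L U W _ mm z cz) k x1); rewrite ?f'in // x1E cfunC.
subst k; subst k'.
have cw : cycle (kl f erefl y1 z1 : HomC U (kone f) m).
  apply: (@cycle1 _ _ _ _ erefl); rewrite (kl_d f erefl erefl) fz1 subrr (cz1 _ erefl) oppr0.
  exact: kl0.
(* In the new degree [m] the pair [(y1, z1)] is a combination of the spanning list. [Q] records the
   primitive that each cell supplies, and these primitives combine linearly. *)
pose Q (r : seq (HomC U (kone f) m)) := forall v, List.In v r -> exists y2 z2 x2, [/\ v = kl f erefl y2 z2,
     hpost U (@att_in K L U W _ mm z cz) (m + 1) z2 = cd (HomC U _) erefl x2 & y2 = hpost U f' m x2].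
have Qs : Q s.
  move=> v /(nth_In 0) [c ->].
  have [x2 x2E x2y] := @att_kill K L U sU W (homM U M) (hpost_dg U f) _ mm z y cz zy c.
  by exists (y c), (z c), x2; split=> //; rewrite -x2y f'E.
have comb r : Q r -> forall y3 z3, lspan r (kl f erefl y3 z3 : HomC U (kone f) m) ->
    exists2 x1, hpost U (@att_in K L U W _ mm z cz) (m + 1) z3 = cd (HomC U _) erefl x1 & y3 = hpost U f' m x1.
  elim: r => [|v r IH] Qr y3 z3.
    move=> H; have {H} : kl f erefl y3 z3 = kl f erefl 0 0 by rewrite (kl0 U f erefl); exact: H.
    move=> /kl_inj [-> ->]; exists 0.
      exact: etrans (linear0 (hpost U _ _)) (esym (linear0 (cd (HomC U _) _))).
    exact: esym (linear0 (hpost U _ _)).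
  move=> [c Hc']; have [y2 [z2 [x2 [vE zE yE]]]] := Qr v (or_introl erefl).
  have [|x3 z3E y3E] := IH (fun v h => Qr v (or_intror h)) (y3 - c *: y2) (z3 - c *: z2).
    rewrite (_ : kl _ _ _ _ = kl f erefl y3 z3 - c *: v) // vE.
    apply: hext => i j ij x; rewrite hxD hxN hxZ !klE !hxD !hxN !hxZ; congr pair; rewrite /= ?scalerN.
    by rewrite opprD.
  exists (x3 + c *: x2).
    by rewrite linearD linearZ_LR -z3E -zE -linearZ_LR -linearD subrK.
  by rewrite linearD linearZ_LR -y3E -yE subrK.
by have [x1 x1E ->] := comb s Qs _ _ (Hs _ cw); exists x1 => //; rewrite subrr; apply: bdry0.
Qed.

Theorem finapp b : (forall k, b <= k -> hv U M k) -> forall n : nat, exists W (f : cmap W M), fstate f (b - n%:Z).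
Proof.
move=> HM; elim=> [|n [W [f Hf]]]; last first.
  by apply: (@finapp_step _ f); rewrite (_ : _ + 1 = b - n%:Z) //; lia.
pose W : cpx := dsumc (fun _ : 'I_0 => shift 0 U).
have W0 k (c : HomC U W k) : c = 0.
  by apply: hext => i j e x; apply: dsum_eq => -[].
exists W, (czero W M); split.
- by apply: good_dsum => // -[].
- exact: Ps (Pc 0).
- by apply: perfb_dsum; apply: perfb_shift.
move=> k bk; apply/hv_kone => k' e z y cz.
rewrite (_ : hpost _ _ _ _ = 0); last exact: hext.
move=> /esym dy; exists 0; first by rewrite (W0 _ z) linear0.
by rewrite linear0 subr0; apply: HM (cycle1 dy); lia.
Qed.
End FiniteApproximation.

(** * Rickard's telescopes *)

Section OutOfCone.
Variables (K : fieldType) (L : falgType K).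
Local Notation cpx := (cplx L^c).
Variables (A B E : cpx) (f : cmap A B).

Fact kr_index m m' i j : m + 1 = m' -> i + m' = j -> i + 1 + m = j :> int.
Proof. by move=> <- <-; rewrite addrAC addrA. Qed.
Fact kr_linear m m' (e : m + 1 = m') (z : HomC B E m') (y : HomC A E m) i j (ij : i + m' = j) :
  linear (fun p : kone f i => hx z ij p.1 + hx y (kr_index e ij) p.2).
Proof. by move=> a p q /=; rewrite !linearP scalerDr addrACA. Qed.
Definition kr m m' (e : m + 1 = m') (z : HomC B E m') (y : HomC A E m) : HomC (kone f) E m' :=
  mkh (fun i j ij => mkLin (kr_linear e z y ij)).
Lemma krE m m' (e : m + 1 = m') (z : HomC B E m') (y : HomC A E m) i j (ij : i + m' = j) p :
  hx (kr e z y) ij p = hx z ij p.1 + hx y (kr_index e ij) p.2.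
Proof. by []. Qed.

Lemma kr_inj m m' (e : m + 1 = m') (z z' : HomC B E m') (y y' : HomC A E m) :
  kr e z y = kr e z' y' -> z = z' /\ y = y'.
Proof.
move=> H; split.
  apply: hext => i j ij x; have := hx_eq H ij (x, 0).
  by rewrite !krE /= !linear0 !addr0.
apply: hext => i j ij x.
have ii : i - 1 + 1 = i by rewrite subrK.
have ij' : i - 1 + m' = j by rewrite -e -ij; lia.
have := hx_eq H ij' (0, cc A (esym ii) x).
rewrite !krE /= !linear0 !add0r; move: (kr_index _ _); case: _ / (esym ii) => e1 /=.
by rewrite !(hx_irr _ e1 ij).
Qed.

Lemma kr_surj m m' (e : m + 1 = m') (w : HomC (kone f) E m') :
  exists (z : HomC B E m') (y : HomC A E m), w = kr e z y.
Proof.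
have ix i j : i + m = j -> i - 1 + m' = j by move=> <-; rewrite -e; lia.
have lin i j (ij : i + m = j) : linear (fun x : A i =>
    hx w (ix i j ij) ((0, cc A (esym (subrK 1 i)) x) : kone f (i - 1))).
  move=> a x y; rewrite -linearP; congr (hx _ _ _); congr pair; last exact: linearP.
  by rewrite /= scaler0 addr0.
exists (hpre E (tin (twcone f)) m' w), (mkh (fun i j ij => mkLin (lin i j ij))).
apply: hext => i j ij [b a]; rewrite krE hpreE mkhE /=.
have -> : hx w (ix (i + 1) j (kr_index e ij)) (0, cc A (esym (subrK 1 (i + 1))) a) = hx w ij (0, a).
  move: (ix _ _ _) (esym _); rewrite (_ : i + 1 - 1 = i) ?addrK // => e1 e2.
  by rewrite cc_id (hx_irr w e1 ij).
rewrite -(linearD (hx w ij)) /=; congr (hx w ij _); congr pair.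
  by rewrite addr0.
by rewrite add0r.
Qed.

Lemma kr_d m m' m'' (e : m + 1 = m') (e' : m' + 1 = m'') (z : HomC B E m') (y : HomC A E m) :
  cd (HomC (kone f) E) e' (kr e z y)
  = kr e' (cd (HomC B E) e' z) (cd (HomC A E) e y - ksgn m' (hpre E f m' z)).
Proof.
apply: hext => i k ik [b a].
have e2 : i + m' + 1 = k by rewrite -addrA e'.
have e4 : i + 1 + m' = k by rewrite -ik -e'; lia.
rewrite (hdE e' _ ik erefl e2 erefl e4) !krE kone_dE.
rewrite (hdE e' z ik erefl e2 erefl e4).
have e5 : i + 1 + m = i + m' by rewrite -e; lia.
have e6 : i + 1 + 1 + m = k by rewrite -ik -e' -e; lia.
rewrite hxD hxN hx_sgn hpreE (hdE e y (kr_index e' ik) e5 e2 erefl e6) /=.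
rewrite !linearD !(linearN (hx y _)) !ksgnD !ksgnN.
rewrite (hx_irr y (kr_index e erefl) e5) (hx_irr y (kr_index e e4) e6).
rewrite (hx_irr z (kr_index e' ik) e4) (ksgn_succ (n:=m) (hx y e6 _) e) (@cd_irr _ A _ _ (shift_index 1 erefl) erefl).
rewrite !opprD !opprK; move: (cd E _ _) (cd E _ _) (ksgn m' _) (ksgn m' _) (ksgn m _) => p q s t w.
by rewrite -(addrA (- t)) [- s - w]addrC addrACA (addrA p).
Qed.

Lemma kr0 m m' (e : m + 1 = m') : kr e 0 0 = 0.
Proof. by apply: hext => i j ij p; rewrite krE !hx0 addr0. Qed.

Lemma hv_kone_l m m' (e : m + 1 = m') : hv (kone f) E m' <-> cv (hpre E f) m.
Proof.
split=> [H m1 e1 z y cz fz|H w cw].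
  case: m1 / e1 z cz fz => z cz fz; case: m' / e H => H.
  have cw : cycle (kr erefl z (ksgn (m + 1) y)).
    apply: (@cycle1 _ _ _ _ erefl); rewrite kr_d (cz _ erefl) ksgn_lin -fz subrr; exact: kr0.
  have [w' wE] := bdry_elim (erefl (m + 1)) (H _ cw).
  have [x [v w'E]] := kr_surj (subrK 1 m) w'.
  move: wE; rewrite w'E (kr_d _ (erefl (m + 1))) => /kr_inj [zE yE].
  exists x; first by rewrite zE.
  have -> : y - hpre E f m x = ksgn (m + 1) (cd (HomC A E) (subrK 1 m) v).
    rewrite -[y](ksgnK (m + 1)) yE ksgnB (ksgn_succ (ksgn m _) (erefl (m + 1))) ksgnK opprK.
    by rewrite addrK.
  by rewrite -ksgn_lin; apply: bdry_intro.
have [z [y wE]] := kr_surj e w; subst w.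
have := cw _ (erefl (m' + 1)); rewrite kr_d -(kr0 erefl) => /kr_inj [dz /eqP]; rewrite subr_eq0 => /eqP dy.
have [||x zE /(bdry_elim (subrK 1 m)) [v yE]] := H m' e z (ksgn m' y).
- exact: cycle1 dz.
- by rewrite ksgn_lin dy ksgnK.
exists m, e, (kr (subrK 1 m) x (ksgn m' v)).
by rewrite (kr_d (subrK 1 m) e) -zE ksgn_lin -yE ksgnB ksgnK (ksgn_succ (hpre E f m x) e) opprK addrK.
Qed.
End OutOfCone.

Section HomRange.
Variables (K : fieldType) (L : falgType K).
Local Notation cpx := (cplx L^c).

Lemma cv_inj (R : pzRingType) (M N : cplx R) (f : cmap M N) m m' (e : m + 1 = m') (x : M m') :
  cv f m -> cycle x -> bdry (f m' x) -> bdry x.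
Proof.
move=> H cx /(bdry_elim e) [y yE]; have [z zE _] := H m' e x y cx yE.
by rewrite zE; apply: bdry_intro.
Qed.
Lemma cv_surj (R : pzRingType) (M N : cplx R) (f : cmap M N) (m : int) (y : N m) :
  cv f m -> cycle y -> exists2 x : M m, cycle x & bdry (y - f m x).
Proof.
move=> H cy; have [||x xE bx] := H (m + 1) erefl 0 y; first exact: cycle0.
  by rewrite linear0 (cy _ erefl).
by exists x => //; apply: (@cycle1 _ _ _ _ erefl); rewrite -xE.
Qed.

Definition sle c (M : cpx) : Prop := forall k : int, c < k -> cohom0 M k.
Definition sge a (M : cpx) : Prop := forall k : int, k < a -> cohom0 M k.

Lemma rr_gen (M : cpx) : (forall k, hv (RR L) M k) -> acyclic M.
Proof. by move=> H k; apply/hv_rr/H. Qed.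

(** This is [orth] for the regular module, whose t-structure is the standard one. *)
Lemma std_orth (D E : cpx) (c a m : int) : kproj D -> sle c D -> sge a E -> c + m < a -> hv D E m.
Proof.
move=> kD HD HE cam; apply/(hom_zero_shift E m kD (@cid_qis K L D)).
have H := @orth K L (RR L) (@RR_kproj K L) (perfb_small (RR_perfb L)) (@rr_silting K L) rr_gen c D (shift m E).
refine (H _ _) => k kc.
  exact/hv_rr/HD.
by apply/hv_rr/cohom0_shift/HE; lia.
Qed.

Lemma sge_le a b M : a <= b -> sge b M -> sge a M.
Proof. by move=> ab H k ka; apply: H; lia. Qed.
Lemma bounded_sge (M : cpx) : bounded M -> exists a, sge a M.
Proof.
move=> [a [b H]]; exists a => k ka x _.
rewrite (H k _ x); first exact: bdry0.
by rewrite ka.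
Qed.
Lemma bounded_sle (M : cpx) : bounded M -> exists a, sle a M.
Proof.
move=> [a [b H]]; exists b => k ka x _.
rewrite (H k _ x); first exact: bdry0.
by rewrite ka orbT.
Qed.
Lemma sge_iso a M N : dIso M N -> sge a M -> sge a N.
Proof. by move=> MN H k ka; apply/(dIso_cohom k MN)/H. Qed.
Lemma sle_iso a M N : dIso M N -> sle a M -> sle a N.
Proof. by move=> MN H k ka; apply/(dIso_cohom k MN)/H. Qed.
Lemma sge_dsum a I (M : I -> cpx) : (forall t, sge a (M t)) -> sge a (dsumc M).
Proof.
by move=> H k ka; apply/hv_rr/hv_dsum_r => [|t]; [exact: perfb_small (RR_perfb L)|apply/hv_rr/H].
Qed.
Lemma sge_kone a A B (f : cmap A B) : sge (a + 1) A -> sge a B -> sge a (kone f).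
Proof.
move=> HA HB k ka; apply: (ses_mid (tses _)); first exact: HB.
by apply/cohom0_shift/HA; lia.
Qed.
Lemma sge_of_kone a A B (f : cmap A B) : sge a A -> sge a (kone f) -> sge a B.
Proof.
move=> HA HB k ka; apply: (ses_left (tses (twcone f)) (subrK 1 k)); last exact: HB.
by apply/cohom0_shift; rewrite subrK; apply: HA.
Qed.
Lemma sge_shift a k M : sge a M -> sge (a - k) (shift k M).
Proof. by move=> H j ja; apply/cohom0_shift/H; lia. Qed.

(** Although an object of D^b need not be perfect, finitely many stages of its resolution by the
    regular module form a perfect complex, with a cone whose cohomology lies as far to the left as
    desired. *)
Lemma in_Db_approx X Q c : in_Db X -> kproj Q -> dIso Q X ->
  exists P (g : cmap P Q), perfb P /\ sle c (kone g).
Proof.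
move=> [N [bN fN NX]] kQ QX.
have [s qs] := dIso_rep kQ (dIso_trans QX (dIso_sym NX)).
have [b Hb] := bounded_sle bN.
pose d := Num.max b c.
have HN k : d + 1 <= k -> hv (RR L) N k by move=> kd; apply/hv_rr/Hb; lia.
have [P [g [gP _ pP Hg]]] := @finapp _ _ (RR L) (RR_perfb L) (@rr_silting K L) N fN (fun=> True)
  (fun _ => I) (fun _ _ _ _ _ => I) (fun _ _ _ => I) _ HN `|d - c|%N.
have kP := perfb_kproj pP.
have [g' bg] : exists g' : cmap P Q, bdry (c2h g - c2h (ccomp s g') : HomC P N 0).
  have [x cx bx] := cv_surj (kproj_cv kP qs (m := 0)) (c2h_cycle g).
  by exists (h2c cx); rewrite -hpost_c2h h2cK.
exists P, g'; split=> // k ck.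
have H1 : bdry (c2h (ccomp s g') - c2h (ccomp g (Defs.cid P)) : HomC P N 0).
  rewrite (_ : c2h (ccomp g (Defs.cid P)) = c2h g); last by apply: hext0 => i e x; rewrite !c2hE.
  by rewrite -[_ - _]opprB; apply: bdryN.
have [t qt] := kone_htp H1 (@cid_qis K L P) qs.
apply/(dIso_cohom k (qis_dIso qt))/hv_rr/Hg; rewrite /d; move: ck; clear; lia.
Qed.

Lemma hv_pre_iff P Q (g : cmap P Q) (E : cpx) m : hv (kone g) E m -> hv (kone g) E (m + 1) ->
  hv Q E m <-> hv P E m.
Proof.
move=> /(hv_kone_l _ _ (subrK 1 m)) H0 /(hv_kone_l _ _ erefl) H1; split=> H x cx.
  have [y cy bxy] := cv_surj H1 cx.
  by rewrite -[x](subrK (hpre E g m y)); apply: bdryD => //; apply/bdry_map/H.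
exact: (cv_inj (subrK 1 m) H0 cx (H _ (cyc_map _ cx))).
Qed.

Lemma kinj_hv_l (T M N : cpx) (s : cmap M N) m : kinj T -> qis s -> hv N T m <-> hv M T m.
Proof. by move=> kT /kone_acyclic qs; apply: (hv_pre_iff (g:=s)); apply: (kT _ qs). Qed.

Lemma kinj_dIso_l (T M N : cpx) m : kinj T -> dIso M N -> hv M T m <-> hv N T m.
Proof.
move=> kT /dIso_roof [P [s [t [_ qs qt]]]].
by rewrite (kinj_hv_l m kT qs) (kinj_hv_l m kT qt).
Qed.
End HomRange.

(** * Hom between simple-minded objects and telescopes *)

Section RickardFacts.
Variables (K : fieldType) (L : falgType K).
Local Notation cpx := (cplx L^c).
Variables (r : nat) (X Q : 'I_r -> cpx).
Hypotheses (dX : forall i, in_Db (X i)) (kQ : forall i, kproj (Q i)) (QX : forall i, dIso (Q i) (X i)).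
Hypothesis neg : forall (m : int) i j, m < 0 -> hom_zero (X i) (shift m (X j)).

Lemma hvQ_neg i j (m : int) : m < 0 -> hv (Q i) (X j) m.
Proof.
have [q qq] := dIso_rep (@kQ i) (QX i).
by move=> m0; apply/(hom_zero_shift (X j) m (@kQ i) qq)/neg.
Qed.

Lemma finite_bound (b : 'I_r -> int) : exists a : int, forall i, a <= b i.
Proof.
exists (- \sum_i `|b i|) => i; rewrite (bigD1 i) //= opprD.
have : 0 <= \sum_(j < r | j != i) `|b j| by apply: sumr_ge0.
by move: (\sum_(j < r | _) _) (b i) => p q; lia.
Qed.

Lemma sgeX : exists a, forall i, sge a (X i).
Proof.
have H i : exists b, sge b (X i).
  by have [N [bN _ NX]] := dX i; have [b Hb] := bounded_sge bN; exists b; apply: sge_iso Hb.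
have [a Ha] := finite_bound (fun i => sval (boolp.cid (H i))).
by exists a => i; apply: sge_le (Ha i) (svalP (boolp.cid (H i))).
Qed.

Section Approximation.
Variables (M : cpx) (dM : in_Db M) (kM : kproj M).

(** A substitute for compactness of [M]: against targets with no cohomology below [a], and in
    degrees up to [m], maps from [M] are maps from a perfect complex. The cone is pushed below
    [a - m] so that the standard orthogonality applies. *)
Lemma in_Db_perf (a m : int) : exists P (g : cmap P M), perfb P /\
  forall E k, k <= m -> sge a E -> hv (kone g) E k.
Proof.
have [P [g [pP Hg]]] := in_Db_approx (a - m - 1) dM kM (dIso_refl M).
exists P, g; split=> // E k km HE; apply: (std_orth (kproj_kone (perfb_kproj pP) kM) Hg HE).
by lia.
Qed.

Lemma in_Db_dsum a m I (E : I -> cpx) : (forall t, sge a (E t)) -> (forall t, hv M (E t) m) ->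
  hv M (dsumc E) m.
Proof.
move=> HE H; have [P [g [pP Hg]]] := in_Db_perf a (m + 1).
have F F' : sge a F' -> hv M F' m <-> hv P F' m by move=> sF; apply: hv_pre_iff; apply: Hg => //; lia.
by apply/F; [apply: sge_dsum|apply: hv_dsum_r => [|t]; [apply: perfb_small|apply/F]].
Qed.
End Approximation.

Variables (j0 : 'I_r) (C : nat -> cpx) (u : forall n, cmap (C n) (C n.+1)).
Hypotheses (XC : dIso (X j0) (C 0%N)) (st : forall n, rstepC X (u n)).
Variable a : int.
Hypothesis Xa : forall i, sge a (X i).

(** The summands of the cone are the [X_j] shifted by [m t + 1 <= 0], and such shifts only move
    cohomology to the right. *)
Lemma step_sge n : sge a (kone (u n)).
Proof.
have [[I [m [j [m0 Hd]]]] _] := st n.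
apply: (sge_iso (dIso_sym Hd)); apply: (@sge_le K L _ (a + 1 - 1)); first by lia.
apply/sge_shift/sge_dsum => t; apply: (@sge_le K L _ (a - m t)); last exact/sge_shift/Xa.
by have := m0 t; lia.
Qed.
Lemma C_sge n : sge a (C n).
Proof.
elim: n => [|n IH]; first by apply: (sge_iso XC); apply: Xa.
exact: sge_of_kone IH (@step_sge n).
Qed.
Lemma tel_sge : sge (a - 1) (tel u).
Proof. apply: sge_kone; first by rewrite subrK; apply: sge_dsum C_sge.
by apply: (@sge_le K L _ a); [lia|apply: sge_dsum C_sge]. Qed.

Section DbSource.
Variables (M : cpx) (dM : in_Db M) (kM : kproj M) (k : int).

Lemma step_van n : (forall i m, m <= k -> hv M (X i) m) -> hv M (kone (u n)) k.
Proof.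
have [[I [m [j [m0 Hd]]]] _] := st n => H.
apply/(dIso_hv k kM Hd)/hv_shift_r; apply: (@in_Db_dsum _ dM kM a) => t.
  apply: (@sge_le K L _ (a - m t)); last exact/sge_shift/Xa.
  by have := m0 t; lia.
by apply/hv_shift_r/H; have := m0 t; lia.
Qed.
Lemma C_van n : (forall i m, m <= k -> hv M (X i) m) -> hv M (C n) k.
Proof.
move=> H; elim: n => [|n IH]; first exact/(dIso_hv k kM XC)/H.
apply: (ses_left (hses_post (twcone (u n)) M) (subrK 1 k)); last exact: step_van.
by apply/hv_shift_r; rewrite subrK.
Qed.

Lemma tel_van : (forall i m, m <= k -> hv M (X i) m) -> hv M (tel u) k.
Proof.
move=> H; have [P [g [pP Hg]]] := in_Db_perf dM kM (a - 1) (k + 1).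
have F E : sge (a - 1) E -> hv M E k <-> hv P E k by move=> sE; apply: hv_pre_iff; apply: Hg => //; lia.
apply/(F _ tel_sge) => w cw; have [n [c cc [e ->]]] := TelA (perfb_small pP) cw.
apply: bdryD; last exact: bdry_intro.
apply/bdry_map/(proj1 (F (C n) _)) => //; last exact: C_van.
by apply: sge_le _ (@C_sge n); lia.
Qed.
End DbSource.

(* The kernel of [Hom(M, C_n) -> Hom(M, C_{n+1})] comes from maps of degree less
   than [k] to the [X_i]. *)
Lemma tel_inj M k : in_Db M -> kproj M -> (forall i m, m < k -> hv M (X i) m) ->
  hv M (tel u) k -> hv M (X j0) k.
Proof.
move=> dM kM H HT.
have [P [g [pP Hg]]] := in_Db_perf dM kM (a - 1) (k + 1).
have F E (k' : int) : k' <= k -> sge (a - 1) E -> hv M E k' <-> hv P E k'.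
  by move=> k0 sE; apply: hv_pre_iff; apply: Hg => //; lia.
have aa E : sge a E -> sge (a - 1) E by apply: sge_le; lia.
apply/(dIso_hv k kM XC)/F => //; first exact: aa (@C_sge 0%N).
move=> c cc; apply: (TelB (u:=u)) => //; first exact: perfb_small.
  move=> n x cx; apply: (cv_inj (subrK 1 k) _ cx).
  apply/hv_kone/F; [by lia|exact: aa (@step_sge n)|].
  by apply: (step_van dM kM) => i m mk; apply: H; lia.
by apply: (proj1 (F _ k (lexx k) tel_sge) HT); apply: cyc_map.
Qed.

Lemma in_Db_Q i : in_Db (Q i).
Proof. by have [N [bN fN NX]] := dX i; exists N; split=> //; apply: dIso_trans NX (dIso_sym (QX i)). Qed.

Lemma tel_neg i (k : int) : k < 0 -> hv (Q i) (tel u) k.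
Proof.
by move=> k0; apply: (tel_van (in_Db_Q i) (@kQ i)) => j m mk; apply: hvQ_neg; lia.
Qed.

(* A map of positive degree from [X_i] to the [n]-th stage lifts from its finite
   approximation, and is killed by the next stage. *)
Lemma tel_pos i (k : int) : 0 < k -> hv (Q i) (tel u) k.
Proof.
move=> k0; have [P [g [pP Hg]]] := in_Db_perf (in_Db_Q i) (@kQ i) (a - 1) (k + 1).
have F E : sge (a - 1) E -> hv (Q i) E k <-> hv P E k by move=> sE; apply: hv_pre_iff; apply: Hg => //; lia.
apply/(F _ tel_sge) => w cw; have [n [c cc [e ->]]] := TelA (perfb_small pP) cw.
apply: bdryD; last exact: bdry_intro.
have Cn : sge (a - 1) (C n) by apply: sge_le _ (@C_sge n); lia.
have [c' cc' bc] := cv_surj (proj1 (hv_kone_l (C n) g (erefl (k + 1))) (Hg _ _ (lexx _) Cn)) cc.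
have b' : bdry (hpost (Q i) (u n) k c') := (st n).2 (Q i) i k c' (@kQ i) (QX i) k0 cc'.
have b1 : bdry (hpost P (u n) k c).
  rewrite -[c](subrK (hpre (C n) g k c')) linearD; apply: bdryD; first exact: bdry_map.
  have -> : hpost P (u n) k (hpre (C n) g k c') = hpre (C n.+1) g k (hpost (Q i) (u n) k c') by apply: hext.
  exact: bdry_map.
rewrite -[hpost P _ k c](subrK (hpost P (tel_in u n.+1) k (hpost P (u n) k c))); apply: bdryD; last exact: bdry_map.
by rewrite (tel_step u (subrK 1 k) cc); apply: bdry_intro.
Qed.

(** The [X_i] have no maps of negative degree between them, so [tel_inj] applies in degree zero and
    the identity of [X j0] survives in the telescope. *)
Lemma tel_zero : ~ hom_zero (X j0) (X j0) -> ~ hv (Q j0) (tel u) 0.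
Proof.
move=> X0 HT; apply: X0; have [q qq] := dIso_rep (@kQ j0) (QX j0).
apply/(hom_zero_hv _ (@kQ j0) qq)/(tel_inj (in_Db_Q j0) (@kQ j0)) => //.
by move=> i m m0; apply: hvQ_neg.
Qed.

Section LeftArgument.
Variable T : cpx.
Hypotheses (kT : kinj T) (XT : forall i (k : int), 0 < k -> hv (X i) T k).

Lemma step_left n (k : int) : 0 < k -> hv (kone (u n)) T k.
Proof.
have [[I [m [j [m0 Hd]]]] _] := st n => k0.
apply/(kinj_dIso_l k kT Hd)/hv_shift_l/hv_dsum_l => t.
by apply/hv_shift_l/XT; have := m0 t; lia.
Qed.
Lemma C_left n (k : int) : 0 < k -> hv (C n) T k.
Proof.
move=> k0; elim: n => [|n IH]; first exact/(kinj_dIso_l k kT XC)/XT.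
have H := @step_left n k k0; have k1 : 0 < k + 1 by lia.
exact: (proj2 (hv_pre_iff H (@step_left n _ k1)) IH).
Qed.

(* The inverse system of the [Hom(C_n, T)] is surjective in degree [0], so its
   derived limit vanishes. *)
Lemma tel_left (k : int) : 0 < k -> hv (tel u) T k.
Proof.
move=> k0; apply/(hv_kone_l _ _ (subrK 1 k)) => k' e z y cz fz.
case: k' / e z cz fz => z cz fz.
have k1 : 0 < k - 1 + 1 by rewrite subrK.
have [x0 x0E] := bdry_elim erefl (hv_dsum_l (fun n => @C_left n _ k1) cz).
pose y' := y - hpre T (tel_map u) (k - 1) x0.
have cy : cycle y'.
  by apply: (@cycle1 _ _ _ _ erefl); rewrite linearB -fz x0E cfunC subrr.
have next n (x : {x : HomC (C n) T (k - 1) | cycle x}) :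
    exists x' : {x : HomC (C n.+1) T (k - 1) | cycle x},
      bdry (sval x - hpre T (dinj C n) _ y' - hpre T (u n) _ (sval x')).
  have cx : cycle (sval x - hpre T (dinj C n) _ y') by apply: cycleB (svalP x) (cyc_map _ cy).
  have [x' cx' bx] := cv_surj (proj1 (hv_kone_l T (u n) erefl) (@step_left n _ k1)) cx.
  by exists (exist _ x' cx').
(* The lifts are chosen recursively: up to a boundary, [F n.+1] is a preimage of [F n] minus the
   [n]-th component of [y'] under the map induced by [u n]. Together they solve the equation for
   [tel_map] up to a boundary. *)
pose F := fix F n : {x : HomC (C n) T (k - 1) | cycle x} :=
  if n is n'.+1 then sval (boolp.cid (next n' (F n'))) else exist _ 0 (@cycle0 _ _ _).
have HF n : exists v, sval (F n) - hpre T (dinj C n) _ y' - hpre T (u n) _ (sval (F n.+1))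
    = cd (HomC (C n) T) (subrK 1 (k - 1)) v.
  by apply: bdry_elim; exact: (svalP (boolp.cid (next n (F n)))).
pose x1 : HomC (dsumc C) T (k - 1) := hcopair (fun n => sval (F n)).
pose v : HomC (dsumc C) T (k - 1 - 1) := hcopair (fun n => sval (boolp.cid (HF n))).
exists (x0 + x1).
  rewrite linearD -x0E (hd_copair erefl) (_ : hcopair _ = 0) ?addr0 //.
  by apply: hdsum_ext => n; rewrite hpre_copair linear0; apply: (svalP (F n)).
rewrite linearD opprD addrA -/y'.
have -> : y' - hpre T (tel_map u) (k - 1) x1 = cd (HomC (dsumc C) T) (subrK 1 (k - 1)) (- v).
  rewrite linearN (hd_copair (subrK 1 (k - 1))); apply: hdsum_ext => n.
  rewrite [RHS]linearN hpre_copair -(svalP (boolp.cid (HF n))) [LHS]linearB.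
  have -> : hpre T (dinj C n) (k - 1) (hpre T (tel_map u) (k - 1) x1)
    = sval (F n) - hpre T (u n) (k - 1) (sval (F n.+1)).
    by apply: hext => i j ij x; rewrite !hpreE tel_mapE linearB hxD hxN hpreE !hcopairE.
  by rewrite !opprB addrCA [RHS]addrC addrC -!addrA; congr (_ + _); rewrite addrC.
exact: bdry_intro.
Qed.
End LeftArgument.
End RickardFacts.

Section FiniteSums.
Variables (K : fieldType) (L : falgType K) (r : nat).
Local Notation cpx := (cplx L^c).
Variable N : 'I_r -> cpx.

Definition bs_in t : cmap (N t) (cbigsum N) :=
  @CMap L^c (N t) (cbigsum N) (fun i => psingle N t i) (fun i j e x => cfunC (psingle N t) e x).
Definition bs_out t : cmap (cbigsum N) (N t) :=
  @CMap L^c (cbigsum N) (N t) (fun i => pproj N t i) (fun _ _ _ _ => erefl).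

Lemma bs_sum i (x : cbigsum N i) : x = \sum_t bs_in t i (bs_out t i x).
Proof.
apply: functional_extensionality_dep => t.
have -> : (\sum_t bs_in t i (bs_out t i x)) t = \sum_t' bs_out t i (bs_in t' i (bs_out t' i x)).
  exact: (linear_sum (bs_out t i)).
rewrite (bigD1 t) //= big1 ?addr0; first by symmetry; apply: single_eq.
by move=> t' /eqP tt; apply: single_neq.
Qed.
Lemma bs_inK t i x : bs_out t i (bs_in t i x) = x.
Proof. exact: single_eq. Qed.

Lemma hv_bs M m : hv (cbigsum N) M m <-> forall t, hv (N t) M m.
Proof.
split=> [H t c cc|H c cc].
  have -> : c = hpre M (bs_in t) m (hpre M (bs_out t) m c).
    by apply: hext => i j e x; rewrite !hpreE bs_inK.
  by apply/bdry_map/H/cyc_map.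
have -> : c = \sum_t hpre M (bs_out t) m (hpre M (bs_in t) m c).
  apply: hext => i j e x; rewrite hx_sum {1}(bs_sum x) linear_sum.
  by apply: eq_bigr => t _; rewrite !hpreE.
elim/big_ind: _ => [|x y|t _]; [exact: bdry0|exact: bdryD|].
by apply/bdry_map/H/cyc_map.
Qed.

Lemma perfb_bs : (forall t, perfb (N t)) -> perfb (cbigsum N).
Proof.
move=> H; split; last first.
  by move=> i; apply: (dbasis_sum (al := fun t => bs_in t i) (be := fun t => bs_out t i) (@bs_sum i)) => t; have [_] := H t.
have bN t : exists ab : int * int, forall i : int, (i < ab.1) || (ab.2 < i) -> forall x : N t i, x = 0.
  by have [[a [b Hab]] _] := H t; exists (a, b).
pose ab t := sval (boolp.cid (bN t)).
have [a Ha] := finite_bound (fun t => (ab t).1).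
have [b Hb] := finite_bound (fun t => - (ab t).2).
exists a, (- b) => i Hi x; apply: functional_extensionality_dep => t.
apply: (svalP (boolp.cid (bN t))); rewrite -/(ab t); move: (Ha t) (Hb t) Hi; clear; lia.
Qed.
End FiniteSums.

(** * Duality: from telescopes to the silting complex *)

Section SiltingObject.
Variables (K : fieldType) (L : falgType K) (r : nat) (X T Q : 'I_r -> cplx L^c).
Local Notation cpx := (cplx L^c).
Hypotheses (dX : forall i, in_Db (X i)) (kQ : forall i, kproj (Q i)) (QX : forall i, dIso (Q i) (X i)).
Hypotheses (neg : forall (m : int) i j, m < 0 -> hom_zero (X i) (shift m (X j)))
  (X0 : forall i, ~ hom_zero (X i) (X i))
  (rT : forall i, rickard X i (T i)) (bT : forall i, bounded_injective (T i)).
Local Notation U := (cbigsum (fun i => nuinv (T i))).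

Lemma kT i : kinj (T i).
Proof. by have [b H] := bT i; apply: kinj_bounded => // j; case: (H j). Qed.

Lemma dual_basis i j : inhabited (cdual (T i j)).
Proof. by have [_ H] := bT i; have [? ?] := H j; apply: inj_codual. Qed.

Lemma nakayamaT i M (n m : int) : m + n = 0 -> hv (nuinv (T i)) M n <-> hv M (T i) m.
Proof.
have [[a [b Hab]] _] := bT i.
have D j : {d : cdual (T i j) | True} by apply: boolp.cid; have [d] := dual_basis i j; exists d.
apply: (nakayama (fun j => sval (D j)) (a := a) (N := `|b - a|%N.+1)) => j Hj x.
by apply: Hab; move: Hj; clear; lia.
Qed.

Lemma nu_perfb i : perfb (nuinv (T i)).
Proof.
have [[a [b Hab]] _] := bT i; split.
  by exists a, b => j Hj x; apply: lin_eq => y; apply: Hab.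
by move=> j; have [d] := dual_basis i j; apply: nu_dbasis.
Qed.

Lemma U_perfb : perfb U.
Proof. exact: perfb_bs nu_perfb. Qed.

Lemma hvU M (n m : int) : m + n = 0 -> hv U M n <-> forall i, hv M (T i) m.
Proof.
move=> mn; rewrite hv_bs; split=> H i; first exact/(nakayamaT i M mn).
exact/(nakayamaT i M mn).
Qed.

(** K-injectivity of [T i] allows [X j] to be replaced by its resolution. Positive degrees are
    killed stage by stage ([tel_pos]); negative ones never appear ([tel_neg]). *)
Lemma hvXT i j (m : int) : m != 0 -> hv (X j) (T i) m.
Proof.
move=> m0; have [a Xa] := sgeX dX; have [C [u [kC XC TC st]]] := rickard_tel (rT i).
have [q qq] := dIso_rep (@kQ j) (QX j).
apply/(kinj_hv_l m (@kT i) qq)/(dIso_hv m (@kQ j) TC).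
have [|m1] := ltP 0 m; first exact: (tel_pos dX kQ QX XC st Xa).
by apply: (tel_neg dX kQ QX neg XC st Xa); lia.
Qed.

Lemma hvXT0 i : ~ hv (X i) (T i) 0.
Proof.
have [a Xa] := sgeX dX; have [C [u [kC XC TC st]]] := rickard_tel (rT i).
have [q qq] := dIso_rep (@kQ i) (QX i).
move=> /(kinj_hv_l 0 (@kT i) qq)/(dIso_hv 0 (@kQ i) TC).
exact: (tel_zero dX kQ QX neg XC st Xa (@X0 i)).
Qed.

(** The telescope now stands in the first argument, where Hom turns it into a limit; [tel_left]
    controls the derived limit, starting from the vanishing of positive degrees on the [X_k]. *)
Lemma hvTT i j (m : int) : 0 < m -> hv (T i) (T j) m.
Proof.
move=> m0; have [C [u [kC XC TC st]]] := rickard_tel (rT i).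
apply/(kinj_dIso_l m (@kT j) TC); apply: (tel_left XC st (@kT j)) m0 => k n n0.
by apply: hvXT; lia.
Qed.

Lemma hvUX j (n : int) : n != 0 -> hv U (X j) n.
Proof. by move=> n0; apply/(hvU (X j) (addNr n)) => i; apply: hvXT; lia. Qed.
Lemma hvUX0 j : ~ hv U (X j) 0.
Proof. by move=> /(hvU (X j) (addr0 0)) /(_ j); apply: hvXT0. Qed.
Lemma hvUT j (n : int) : n < 0 -> hv U (T j) n.
Proof. by move=> n0; apply/(hvU (T j) (addNr n)) => i; apply: hvTT; lia. Qed.
(** Two applications of Nakayama duality turn [Hom(U, U[n])] into the spaces [Hom(T_i, T_j[n])]. *)
Lemma hvUU (n : int) : 0 < n -> hv U U n.
Proof.
move=> n0; apply/(hvU U (addNr n)) => i.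
by apply/hv_bs => j; apply/(nakayamaT j (T i) (addrN n)); apply: hvTT.
Qed.
End SiltingObject.

Lemma end_is_K_neq0 (K : fieldType) (L : falgType K) (M : cplx L^c) : end_is_K M -> ~ hom_zero M M.
Proof.
move=> [_ H] H0; have := H [:: (1, tt)] erefl _ (1, tt) (mem_head _ _) => /(_ _) H1.
suff : (1 : K) = 0 by apply/eqP; apply: oner_neq0.
apply: H1; exists (dzero M M); first exact: deq_refl.
exists (dzero M (csum M M)); split; first exact: (deq_trans (H0 _) (deq_sym (H0 _))).
  exact: H0.
exact: H0.
Qed.

(** * The dual of the regular module as a cogenerator *)

Section DualTest.
Variables (K : fieldType) (L : falgType K).
Local Notation cpx := (cplx L^c).
Local Notation DL := (dualL L).

Lemma dual_separation (V : lmodType L^c) (W : V -> Prop) v : is_submod W -> ~ W v ->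
  exists phi : {linear V -> DL}, (forall x, W x -> phi x = 0) /\ phi v <> 0.
Proof.
move=> HW nW.
have HW' : is_submod (W : kres V -> Prop).
  by split=> [|a x y]; [exact: HW.1|exact: HW.2].
have [f [f0 f1]] := separation HW' nW.
have lin (x : V) : linear (fun a : L => f ((a : L^c) *: x : V) : K^o).
  move=> k a b; rewrite -linearP; congr (f _); rewrite scalerDl; congr (_ + _).
  by rewrite -[RHS]/(calg L k *: ((a : L^c) *: x)) scalerA calg_mul.
have philin : linear (fun x : V => mkdual (lin x) : DL).
  move=> c x y; apply: dapp_eq => a; rewrite dappD dappZ !mkdualE -linearD; congr (f _).
  by rewrite scalerDr scalerA.
exists (mkLin philin); split=> [x Wx|/(f_equal (fun p => dapp p 1))].
  apply: dapp_eq => a; rewrite dapp0 mkdualE; apply: f0.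
  by rewrite -[X in W X]addr0; apply: HW.2 Wx HW.1.
rewrite dapp0 mkdualE [X in f X](_ : _ = v); last exact: scale1r.
by rewrite f1 => /eqP; rewrite oner_eq0.
Qed.

Lemma fin_dim_dual : fin_dim DL.
Proof.
have lin i : linear (coord (vbasis {:L}) i : L -> K^o) by move=> c x y; rewrite linearD linearZ.
exists (\dim {:L}), (fun i => mkdual (lin i)) => phi.
exists (fun i => dapp phi (vbasis {:L})`_i).
apply: dapp_eq => x; rewrite dapp_sum {1}(L_coord x) /dapp linear_sum; apply: eq_bigr => i _.
rewrite -/(dapp (calg L _ *: _) x) dappK mkdualE linearZ; exact: mulrC.
Qed.

Section Stalk.
Variable V : lmodType L^c.
(** A family indexed by proofs of [i = 0] is a single copy of [V] in degree zero, where the proof is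
    unique, and zero in the degrees where there is none. *)
Definition stalk : cpx := @Cplx L^c (fun i => dprod (fun _ : i = 0 => V))
  (fun i j _ => linHom_zero _ _) (fun _ _ _ _ _ _ => erefl).
Lemma stalk_eq i (x y : stalk i) : (forall e : i = 0, x e = y e) -> x = y.
Proof. by move=> H; apply: functional_extensionality_dep. Qed.
Lemma stalk_out (i : int) : i <> 0 -> forall x : stalk i, x = 0.
Proof. by move=> i0 x; apply: stalk_eq. Qed.
Lemma stalk_bounded : bounded stalk.
Proof. by exists 0, 0 => i i0; apply: stalk_out => i1; move: i0; rewrite i1. Qed.
Fact stalk_const_linear i : linear (fun v : V => (fun _ => v) : stalk i).
Proof. by []. Qed.
Definition stalk_val i (x : stalk i) : V := if pselect (i = 0) is left e then x e else 0.
Fact stalk_val_linear i : linear (@stalk_val i).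
Proof. by move=> a x y; rewrite /stalk_val; case: pselect => // _; rewrite scaler0 addr0. Qed.
Lemma stalkK i (x : stalk i) : x = (fun _ => stalk_val x).
Proof.
apply: stalk_eq => e; rewrite /stalk_val; case: pselect => // e'.
by rewrite (eq_irrelevance e e').
Qed.
Lemma fin_dim_stalk i : fin_dim V -> fin_dim (stalk i).
Proof.
move=> [n [e H]]; exists n, (fun a => (fun _ => e a) : stalk i) => x.
have [c cE] := H (stalk_val x); exists c; rewrite [LHS]stalkK cE.
transitivity (mkLin (@stalk_const_linear i) (\sum_a calg L (c a) *: e a)) => //.
by rewrite linear_sum; apply: eq_bigr => a _; rewrite linearZ.
Qed.
End Stalk.

Fact stalk_cdual_subproof i (x : stalk DL i) :
  x = \sum_(a < 1) mkLin (@stalk_const_linear DL i) (mkLin (@stalk_val_linear DL i) x).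
Proof. by rewrite big_ord1; apply: stalkK. Qed.
Definition stalk_cdual i : cdual (stalk DL i) :=
  CDual (ci := fun _ => mkLin (@stalk_const_linear DL i)) (cp := fun _ => mkLin (@stalk_val_linear DL i))
    (@stalk_cdual_subproof i).

(** A cycle that is not a boundary is separated from the boundaries by a map to [D(L)]. Killing
    boundaries makes it a chain map to the stalk, and if that map were null-homotopic it would
    vanish on all cycles. *)
Lemma dual_detects (M : cpx) : (forall m, hv M (stalk DL) m) -> acyclic M.
Proof.
move=> H m x cx; apply: contrapT => nb.
have HB : is_submod (fun x : M m => bdry x).
  by split=> [|a y z by' bz]; [exact: bdry0|apply: bdryD bz; apply: bdryZ].
have [phi [phi0 phix]] := dual_separation HB nb.
pose h : HomC M (stalk DL) (- m) := hsup (subrr m) (mkLin (@stalk_const_linear DL 0) \o phi).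
have ch : cycle h.
  apply: (@cycle1 _ _ _ _ erefl); apply: hext => i k ik y.
  have e2 : i - m + 1 = k by rewrite -ik addrA.
  have e4 : i + 1 - m = k by rewrite -ik; lia.
  transitivity (0 : stalk DL k); last by symmetry; apply: hx0.
  rewrite (hdE erefl h ik erefl e2 erefl e4).
  have -> : cd (stalk DL) e2 (hx h erefl y) = 0 by [].
  rewrite sub0r; apply: stalk_eq => k0.
  have im : i + 1 = m by move: k0 e4; clear; lia.
  have -> : hx h e4 (cd M erefl y) = 0; last by rewrite ksgn0 oppr0.
  have py : phi (cd M im y) = 0 by apply/phi0/bdry_intro.
  rewrite /h mkhE; case: pselect => // E; rewrite /= (cd_cc erefl E im) py.
  exact: (linear0 (cc (stalk DL) _)).
have [e eE] := bdry_elim (subrK 1 (- m)) (H _ _ ch).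
apply: phix.
have E0 : hx h (subrr m) x = 0.
  have e1 : m + (- m - 1) = -1 by lia.
  have e4 : m + 1 + (- m - 1) = 0 by lia.
  by rewrite eE (hdE (subrK 1 (- m)) e (subrr m) e1 erefl erefl e4) (cx _ erefl) linear0 ksgn0 subr0.
by move: E0; rewrite hsupE => /(f_equal (fun f : stalk DL 0 => f erefl)).
Qed.
End DualTest.

Section Generation.
Variables (K : fieldType) (L : falgType K).
Local Notation cpx := (cplx L^c).
Local Notation DL := (dualL L).

(** Up to isomorphism the regular module, written as the inverse Nakayama transform of [D(L)] so
    that duality applies to it as it stands. *)
Definition codual : cpx := nuinv (stalk DL).

Lemma codual_perfb : perfb codual.
Proof.
split; last by move=> i; apply: nu_dbasis (stalk_cdual L i).
by exists 0, 0 => i Hi x; apply: lin_eq => y; apply: stalk_out => i0; move: Hi; rewrite i0.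
Qed.

Lemma codual_hv M (n m : int) : m + n = 0 -> hv codual M n <-> hv M (stalk DL) m.
Proof.
apply: (nakayama (stalk_cdual L) (a := 0) (N := 1)) => i Hi; apply: stalk_out => i0.
by move: Hi; rewrite i0.
Qed.

Lemma in_Db_iso (M N : cpx) : dIso M N -> in_Db M -> in_Db N.
Proof. by move=> MN [P [bP fP PM]]; exists P; split=> //; apply: dIso_trans PM MN. Qed.

Lemma perfb_in_Db (M : cpx) : perfb M -> in_Db M.
Proof. by move=> pM; apply: in_Db_fin (proj1 pM) (fun i => perfb_fin i pM). Qed.

Lemma perfb_kone (A B : cpx) (f : cmap A B) : perfb A -> perfb B -> perfb (kone f).
Proof. by move=> pA pB; apply: perfb_tsum => //; apply: perfb_shift. Qed.

Lemma hv_bounded (A B : cpx) : bounded A -> bounded B -> exists c, forall k : int, c <= `|k| -> hv A B k.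
Proof.
move=> [a [b HA]] [a' [b' HB]]; exists (`|a| + `|b| + `|a'| + `|b'| + 1) => k ck x _.
rewrite (_ : x = 0); first exact: bdry0.
apply: hext => i j e y; rewrite hx0.
have [ij|ij] := boolP ((i < a) || (b < i)); first by rewrite (HA i ij y) linear0.
by apply: HB; move: ij ck; rewrite -e negb_or -!leNgt; clear; lia.
Qed.

(* Objects [Y] such that vanishing of [Hom(V, X_j[m])] for [m <= n] implies that of
   [Hom(V, Y[m])] for [m <= n - c], uniformly in [V]. *)
Definition uniformly_tested r (X : 'I_r -> cpx) (Y : cpx) : Prop := exists c : int, forall V (n : int),
  kproj V -> (forall j m, m <= n -> hv V (X j) m) -> forall m, m <= n - c -> hv V Y m.

Lemma uniformly_tested_thick r (X : 'I_r -> cpx) : is_thick (uniformly_tested X).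
Proof.
split.
- exists (kone (Defs.cid (RR L))); exists 0 => V n kV _ m _.
  exact: (kV _ (@kone_id_acyclic _ (RR L)) m).
- split.
  + by move=> M N MN [c H]; exists c => V n kV HV m mc; apply/(dIso_hv m kV MN)/(H V n).
  + by move=> M [c H]; exists (c + 1) => V n kV HV m mc; apply/hv_shift_r/(H V n) => //; lia.
  + by move=> M [c H]; exists (c + 1) => V n kV HV m mc; apply/hv_shift_r/(H V n) => //; lia.
  + move=> M N P t [c H] [c' H']; exists (`|c| + `|c'| + 1) => V n kV HV m mc.
    by apply: (tri_hv_right kV t (erefl (m + 1))); [apply: (H' V n)|apply: (H V n)] => //; lia.
move=> M N P PMN [c H]; exists c => V n kV HV m mc x cx.
have Hs := proj1 (dIso_hv m kV PMN) (H V n kV HV m mc).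
have -> : x = hpost V (cfst M N) m (hpost V (cpair (Defs.cid M) (czero M N)) m x) by apply: hext.
by apply/bdry_map/Hs/cyc_map.
Qed.
End Generation.

(** * The silting complex generates *)

Section SiltingGenerates.
Variables (K : fieldType) (L : falgType K) (r : nat) (X T Q : 'I_r -> cplx L^c).
Local Notation cpx := (cplx L^c).
Hypotheses (dX : forall i, in_Db (X i))
  (rT : forall i, rickard X i (T i)) (bT : forall i, bounded_injective (T i))
  (thX : forall M, in_Db M -> thick X M).
Local Notation U := (cbigsum (fun i => nuinv (T i))).
Local Notation DL := (dualL L).
Hypothesis silt : forall k : int, 0 < k -> hv U U k.

Lemma hvX_of_T V (n : int) : kproj V -> in_Db V -> (forall i m, m <= n -> hv V (T i) m) ->
  forall i m, m <= n -> hv V (X i) m.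
Proof.
move=> kV dV H.
have [a Xa] := sgeX dX.
have [c Vc] : exists c, sle c V.
  by have [N [bN _ NV]] := dV; have [c Hc] := bounded_sle bN; exists c; apply: sle_iso Hc.
(* Induction on the degree. Below [a - c] there are no maps, since [V] has no cohomology above [c]
   and the [X_i] have none below [a]; after that, a map of lowest degree would survive in [T_i] by
   [tel_inj]. *)
have HX (p : nat) : forall i m, m <= n -> m < a - c + p%:Z -> hv V (X i) m.
  elim: p => [|p IH] i m mn mp; first by apply: std_orth kV Vc (Xa i) _; lia.
  have [C [u [kC XC TC st]]] := rickard_tel (rT i).
  apply: (tel_inj XC st Xa dV kV) => [j m' m'm|]; first by apply: IH; lia.
  by apply/(dIso_hv m kV TC)/H.
by move=> i m mn; have := @HX `|(m - (a - c) + 1)%R|%N i m mn; apply; move: mn; clear; lia.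
Qed.

(** It suffices that [codual] has no maps to [M]. Approximate it by a finite complex [W] of shifts
    of [U] whose cone [V] has its [h^k] only far to the left. Then [V] has no maps to the [T_i],
    hence none to the [X_i], up to a high degree, and so none of degree zero to [D(L)]. By duality
    the map from [codual] to [V] is null. Every map from [codual] to [M] factors through it up to
    homotopy, because [W] has no maps to [M]. *)
Lemma U_generates M : (forall k, hv U M k) -> acyclic M.
Proof.
move=> HM; apply: dual_detects => m; apply/(codual_hv M (addrN m)).
move: (- m) => {}m.
have pU := U_perfb bT; have kU := perfb_kproj pU.
have [b Hb] := hv_bounded (proj1 pU) (proj1 (codual_perfb L)).
pose P (W : cpx) := forall k, hv W M k.
have Pc (k : int) : P (shift k U) by move=> n; apply/hv_shift_l/HM.
have Pe B C (q : twist B C) : P B -> P C -> P (tsum q).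
  by move=> HB HC n; apply: (ses_mid (hses_pre q M)); [apply: HC|apply: HB].
have Ps d A : P A -> P (dsumc (fun _ : 'I_d => A)) by move=> HA n; apply: hv_dsum_l.
have dDL : in_Db (stalk DL) := in_Db_fin (stalk_bounded DL) (fun i => fin_dim_stalk i (fin_dim_dual L)).
have XU i : uniformly_tested X (X i).
  by exists 0 => V n kV H m' m'n; apply: H; rewrite subr0 in m'n.
have [c Hc] := thX dDL (uniformly_tested_thick X) XU.
have HM' k : `|b| <= k -> hv U (codual L) k by move=> bk; apply: Hb; lia.
(* [c] is the loss of degrees when [D(L)] is tested through the [X_i], and [codual] has no [h^k]
   from degree [|b|] on; [|b| + |c|] steps make the [h^k] of the cone vanish from degree [- |c|]
   on. *)
have [W [f [gW PW pW HV]]] := @finapp _ _ U pU silt (codual L) (fun i => perfb_fin i (codual_perfb L)) P Pc Pe Ps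
  _ HM' `|(`|b| + `|c|)|%N.
have pV := perfb_kone f pW (codual_perfb L); have kV := perfb_kproj pV.
have VT i n : n <= `|c| -> hv (kone f) (T i) n.
  move=> nc; have mn : n + (- n) = 0 by rewrite subrr.
  by apply: (proj1 (hvU bT (kone f) mn)); apply: HV; move: nc; clear; lia.
have VX := hvX_of_T kV (perfb_in_Db pV) VT.
have V0 : hv (codual L) (kone f) 0.
  by apply/(codual_hv (kone f) (addr0 0))/(Hc _ `|c| kV VX); clear; lia.
have qs : qis (hpre M (tin (twcone f))).
  by apply: (ses_qis_r (hses_pre (twcone f) M)) => n; apply/hv_shift_l/PW.
move=> x cx; have [y cy bxy] := (qs m).2 x cx.
rewrite -[x](subrK (hpre M (tin (twcone f)) m y)); apply: bdryD => //.
have -> : hpre M (tin (twcone f)) m y = hcomp (addr0 m) y (c2h (tin (twcone f))).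
  by apply: hext => i j e z; rewrite hpreE (hcompE _ _ _ e (addr0 i) e) c2hE.
exact: hcomp_bdryr cy (V0 _ (c2h_cycle _)).
Qed.
End SiltingGenerates.

(** * Filtrations by the simple-minded objects *)

Section EndomorphismScalars.
Variables (K : fieldType) (L : falgType K).
Local Notation cpx := (cplx L^c).
Local Notation "f ~~ g" := (deq f g) (at level 70).

Lemma lincomb_scalar (P M : cpx) (c : HomC P M 0) : kproj P -> cycle c ->
  forall (s : seq (K * unit)) (h : dhom M M), lincomb (fun _ => did M) s h -> exists la : K, act h c (la *: c).
Proof.
move=> kP cc; elim=> [|[k t] s IH] h /=.
  move=> h0; exists 0; rewrite scale0r; apply/(act_deq kP h0 cc (@cycle0 _ _ _)).
  by rewrite act_map (_ : hpost _ _ _ _ = 0) ?subr0; [apply: bdry0|apply: hext].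
move=> [h' /IH [la a1] dd].
have cs (a : K) : cycle (a *: c) by move=> j e; rewrite linearZ_LR cc scaler0.
have a2 : act (dscale k (did M)) c (k *: c).
  exists c => //; split; first by rewrite act_map hpost_id subrr; apply: bdry0.
  by rewrite act_map (_ : hpost _ _ _ _ = k *: c) ?subrr; [apply: bdry0|apply: hext].
have [z cz az] := act_total kP h cc.
exists (k + la); apply: (act_eqv az); first by rewrite subrr; apply: bdry0.
rewrite scalerDl.
exact: (dadd_act kP cc (cs k) (cs la) cz dd a2 a1 az).
Qed.

Lemma end_is_K_scalar (P M : cpx) (q : cmap P M) (y : HomC P P 0) : kproj P -> qis q -> end_is_K M -> cycle y ->
  exists la : K, bdry (y - la *: hid P).
Proof.
move=> kP qq [HM _] cy; pose g := h2c cy.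
pose c := hpost P q 0 (hid P); have ci := @hid_cycle K L P.
have cc : cycle c by apply: cyc_map.
have [s Hs] := HM (dcomp (dmap q) (dcomp (dmap g) (dinv q qq))).
have [la a1] := lincomb_scalar kP cc Hs.
have a2 : act (dcomp (dmap q) (dcomp (dmap g) (dinv q qq))) c (hpost P q 0 y).
  exists y => //; split; last by rewrite act_map subrr; apply: bdry0.
  exists (hid P) => //; split; first by rewrite act_inv subrr; apply: bdry0.
  by rewrite act_map hpost_hid h2cK subrr; apply: bdry0.
have cl : cycle (la *: c) by move=> j e; rewrite linearZ_LR cc scaler0.
exists la; have cyl : cycle (y - la *: hid P).
  by apply: cycleB => // j e; rewrite linearZ_LR ci scaler0.
apply: (proj1 (kproj_post_qis kP qq 0) _ cyl).
rewrite linearB linearZ_LR.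
by apply: (act_fun kP (cyc_map (hpost P q) cy) cl a2 a1); rewrite subrr; apply: bdry0.
Qed.
End EndomorphismScalars.

Section Functionals.
Variables (K : fieldType) (V : lmodType K) (B S : V -> Prop).
Hypotheses (HS : is_submod S) (BS : forall x, B x -> S x).

(* A set of functionals separating [A] modulo [B] can be shortened on a proper
   subspace [S]. *)
Lemma killed_proper (fs : seq {linear V -> K^o}) (A : V -> Prop) y : is_submod A -> A y -> ~ S y ->
  (forall x, A x -> killed fs x -> B x) ->
  exists gs : seq {linear V -> K^o}, (size gs < size fs)%N /\ forall x, A x -> S x -> killed gs x -> B x.
Proof.
elim: fs A => [|f fs IH] A HA Ay Sy H; first by case: Sy; apply/BS/H.
have [f0|f0] := eqVneq (f y) 0.
  have HA' : is_submod (fun x => A x /\ f x = 0).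
    split=> [|a x z [Ax fx] [Az fz]]; first by rewrite linear0; split=> //; exact: HA.1.
    by split; [apply: HA.2|rewrite linearP fx fz scaler0 addr0].
  have [|gs [sg Hg]] := IH _ HA' (conj Ay f0) Sy.
    by move=> x [Ax fx] kx; apply: H.
  by exists (f :: gs); split=> // x Ax Sx [fx kx]; apply: Hg.
have lin (g : {linear V -> K^o}) : linear (fun x => g x - (g y / f y) * f x : K^o).
  by move=> a u v; rewrite !linearP /GRing.scale /=; ring.
exists [seq mkLin (lin g) | g <- fs]; split; first by rewrite /= size_map.
move=> x Ax Sx kx; pose c := f x / f y.
have Axy : A (x - c *: y) := (is_submodD HA Ax (is_submodN HA (is_submodZ _ HA Ay))).
have Bxy : B (x - c *: y).
  apply: H => //; split.
    by rewrite linearB linearZ_LR; apply/eqP; rewrite subr_eq0 eq_sym; apply/eqP; apply: divfK.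
  elim: (fs) kx => //= g gs IHg [gx kx]; split; last exact: IHg.
  by rewrite linearB linearZ_LR -[RHS]gx /c /GRing.scale /=; ring.
have Sc : S (c *: y).
  by rewrite -[c *: y](subKr x); exact: (is_submodD HS Sx (is_submodN HS (BS Bxy))).
have c0 : c = 0.
  apply/eqP; apply: contrapT => /negP c0; apply: Sy.
  by rewrite -[y](scalerK c0); apply: is_submodZ HS Sc.
by move: Bxy; rewrite c0 scale0r subr0.
Qed.
End Functionals.

Section ThickExtension.
Variables (K : fieldType) (L : falgType K).
Local Notation cpx := (cplx L^c).

(** A triangulated class contains the third object of a triangle together with the first two.
    Applied to successive cones this gives the suspension of [E], which is then shifted back. *)
Lemma triangulated_ext (C : cpx -> Prop) P E S (i : cmap P E) (p : cmap E S) : triangulated C ->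
  ses i p -> C P -> C S -> C E.
Proof.
move=> [Ciso C1 Cm1 Ctri] H CP CS.
have [s qs] := ses_kone H.
have Ck : C (kone i) by apply: Ciso (dIso_sym (qis_dIso qs)) CS.
have [t qt] := ses_kone (tses (twcone i)).
have Ck2 : C (kone (tin (twcone i))) by apply: Ciso (dIso_sym (qis_dIso qt)) (C1 _ CP).
have C3 := Ctri _ _ _ (triangle_ses (tses (twcone (tin (twcone i))))) Ck Ck2.
exact: (Ciso _ _ (shiftK E (addNr 1)) (Cm1 _ C3)).
Qed.

(** Closure under extensions is read off from the identification of D^b with a thick subcategory,
    instead of modelling the extension by finite-dimensional modules. *)
Lemma in_Db_ses r (X : 'I_r -> cpx) (P E S : cpx) (i : cmap P E) (p : cmap E S) :
  (forall M : cpx, in_Db M <-> thick X M) -> ses i p -> in_Db P -> in_Db S -> in_Db E.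
Proof.
move=> HX H /HX tP /HX tS; apply/HX => C tC CX.
by have [_ tri _] := tC; apply: (triangulated_ext tri H); [apply: tP|apply: tS].
Qed.

Lemma ext_ses_right (C : cpx -> Prop) P E S (i : cmap P E) (p : cmap E S) : iso_closed C -> ext_closed C ->
  ses i p -> C E -> C (shift 1 P) -> C S.
Proof.
move=> Ciso Cext H CE CP; have [s qs] := ses_kone H.
apply: Ciso (qis_dIso qs) _; exact: Cext (triangle_ses (tses (twcone i))) CE CP.
Qed.
End ThickExtension.

Section Filtration.
Variables (K : fieldType) (L : falgType K) (r : nat) (Q : 'I_r -> cplx L^c) (U : cplx L^c).
Local Notation cpx := (cplx L^c).
Hypotheses (kQ : forall j, kproj (Q j)) (dQ : forall j, in_Db (Q j)).
Hypotheses (UQ : forall j (n : int), n != 0 -> hv U (Q j) n) (UQ0 : forall j, ~ hv U (Q j) 0).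
Hypotheses (neg : forall i j (m : int), m < 0 -> hv (Q i) (Q j) m)
  (orthQ : forall i j, i != j -> hv (Q i) (Q j) 0)
  (endQ : forall j (y : HomC (Q j) (Q j) 0), cycle y -> exists la : K, bdry (y - la *: hid (Q j))).
(** [bound] excludes maps to [Q_j] of degree below [- b], where [b] is the top degree of [M]; [van]
    detects conversely that without maps of degree up to [- k] there is no [h^k]. So peeling only
    has to treat maps of degree exactly [- b]. *)
Hypothesis bound : forall j M (b m : int), kproj M -> (forall k : int, b < k -> hv U M k) -> m < - b -> hv M (Q j) m.
Hypothesis van : forall M (k : int), kproj M -> in_Db M -> (forall j (m : int), m <= - k -> hv M (Q j) m) -> hv U M k.
Hypothesis db_ext : forall (P E S : cpx) (i : cmap P E) (p : cmap E S), ses i p -> in_Db P -> in_Db S -> in_Db E.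

Section Peel.
Variables (M : cpx) (kM : kproj M) (dM : in_Db M) (b : int) (HM : forall k : int, b < k -> hv U M k).
Variables (j : 'I_r) (c : HomC M (Q j) (- b)) (cc : cycle c) (nc : ~ bdry c).

Fact peel_pk : (b + 1) + - (b + 1) = 0. Proof. exact: subrr. Qed.
Fact peel_deg : (b + 1) + - b = 1. Proof. lia. Qed.
Local Notation B := (shift (- (b + 1)) (Q j)).
Definition peel_hom : HomC M B 1 := hcomp peel_deg (shift_ga peel_pk (Q j)) c.
Lemma peel_cycle : cycle peel_hom.
Proof. by apply: hcomp_cycle cc; apply: shift_ga_cycle. Qed.
(* The cocone of the map [c : M -> Q_j[-b]]. *)
Definition peel : cpx := tsum (twist_of peel_cycle).

Lemma peel_kproj : kproj peel.
Proof. by apply: kproj_tsum kM; apply: kproj_shift. Qed.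

Lemma in_Db_shift k (N : cpx) : in_Db N -> in_Db (shift k N).
Proof.
move=> [N' [bN fN NN]]; exists (shift k N'); split; last exact: dIso_shift.
  exact: bounded_shift.
by move=> i; apply: fN.
Qed.
Lemma peel_in_Db : in_Db peel.
Proof. by apply: (db_ext (tses _)) dM; apply: in_Db_shift. Qed.

Lemma hvUB (k : int) : k != b + 1 -> hv U B k.
Proof. by move=> kb; apply/hv_shift_r/UQ; lia. Qed.

Lemma peel_hv (k : int) : k != b + 1 -> hv U M k -> hv U peel k.
Proof. by move=> kb HMk; apply: (ses_mid (hses_post _ U)) HMk; apply: hvUB. Qed.

(* As [Hom(Q_j, Q_i)] is [K] or [0], a map from the cocone of a nonzero [c] to
   [Q_i[-b-1]] vanishes on [Q_j[-b-1]]: this makes the class of [c] surjective. *)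
Lemma peel_top : hv U peel (b + 1).
Proof.
apply: (van peel_kproj peel_in_Db) => i m mb.
have HMm : hv M (Q i) m by apply: bound kM HM _; lia.
have Hs := hses_pre (twist_of peel_cycle) (Q i).
have [m1|m1] := ltP m (- (b + 1)).
  by apply: (ses_mid Hs) => //; apply/hv_shift_l/neg; lia.
have {mb m1} E : m = - (b + 1) by lia.
have [ij|ij] := eqVneq i j; last first.
  by apply: (ses_mid Hs) => //; apply/hv_shift_l; rewrite E subrr; apply: orthQ; rewrite eq_sym.
subst i; rewrite {}E in HMm *.
move=> x cx; pose y := hpre (Q j) (tin (twist_of peel_cycle)) _ x.
have cy : cycle y by apply: cyc_map.
suff [s sE] : exists s, y = cd (HomC B (Q j)) (subrK 1 _) s.
  have [s' s'E] := ses_surj Hs s.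
  have [|w wE] := ses_ex Hs (x := x - cd (HomC _ (Q j)) (subrK 1 _) s').
    by rewrite linearB cfunC s'E -sE subrr.
  have cw : cycle w.
    apply: (@cycle1 _ _ _ _ erefl); apply: (ses_inj Hs).
    by rewrite cfunC -wE linearB cdd subr0; apply: cx.
  rewrite -[x](subrK (cd (HomC _ (Q j)) (subrK 1 _) s')) wE; apply: bdryD; last exact: bdry_intro.
  exact/bdry_map/HMm.
apply: bdry_elim.
have cga := shift_ga_cycle peel_pk (Q j); have cgb := @shift_gb_cycle K L (- (b + 1)) (Q j).
have [la bla] := endQ (hcomp_cycle (addNr (b + 1)) cy cga).
set Y := hcomp _ y _ in bla.
have yE : y = hcomp (add0r (- (b + 1))) Y (@shift_gb K L (- (b + 1)) (Q j)).
  by rewrite (hcompA _ _ peel_pk (addr0 (- (b + 1)))) shift_gab hcomp1r.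
have yb : bdry (y - la *: @shift_gb K L (- (b + 1)) (Q j)).
  have -> : y - la *: @shift_gb K L (- (b + 1)) (Q j)
    = hcomp (add0r (- (b + 1))) (Y - la *: hid (Q j)) (@shift_gb K L (- (b + 1)) (Q j)).
    by rewrite hcompDl hcompNl hcompZl hcomp1l -yE.
  exact: hcomp_bdryl.
have Yc : bdry (hcomp (add0r (- b)) Y c : HomC M (Q j) (- b)).
  (* The boundary of the graded section of the projection to [M] is the attaching map, so composing
     the cycle [x] with it shows that [Y] composed with [c] is null-homotopic. As [Y] is homotopic
     to the scalar [la] and [c] is not null, [la] is zero. *)
  pose ka := hfam (tsnd (twist_of peel_cycle)) 0 (hid M).
  have dka : cd (HomC M peel) (erefl (0 + 1)) ka = hpost M (tin (twist_of peel_cycle)) 1 peel_hom.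
    rewrite (tsnd_d _ (erefl (0 + 1)) (hid M)) (tq_of peel_cycle (erefl (0 + 1)) (addr0 1)) hcomp1r.
    by rewrite (@hid_cycle K L M _ erefl) linear0 addr0.
  have e0 : - (b + 1) + 0 = - (b + 1) by rewrite addr0.
  have e1 : - (b + 1) + 1 = - b by lia.
  have e2 : - b + 0 = - b by rewrite addr0.
  have := hd_comp e0 e1 (erefl (0 + 1)) e1 e2 e1 x ka.
  rewrite (cx _ e1) hcomp0l add0r dka => E.
  have -> : hcomp (add0r (- b)) Y c = hcomp e1 x (hpost M (tin (twist_of peel_cycle)) 1 peel_hom).
    rewrite (hcompA (addNr (b + 1)) (add0r (- b)) peel_deg e1).
    apply: hext => p q e z; have e3 : p + 1 - (b + 1) = q by rewrite -e; lia.
    by rewrite !(hcompE _ _ _ e erefl e3) hpreE hpostE.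
  rewrite -[hcomp e1 x _](ksgnK (- (b + 1))) -E -ksgn_lin; exact: bdry_intro.
have lc : bdry (la *: c).
  have b2 : bdry (hcomp (add0r (- b)) (Y - la *: hid (Q j)) c : HomC M (Q j) (- b)) by apply: hcomp_bdryl.
  have := bdryB Yc b2; rewrite hcompDl hcompNl hcompZl hcomp1l opprD addrA subrr sub0r opprK.
  exact.
have la0 : la = 0.
  by apply/eqP; apply: contrapT => /negP l0; apply: nc; rewrite -[c](scalerK l0); apply: bdryZ.
by move: yb; rewrite la0 scale0r subr0.
Qed.

Lemma peel_bound (k : int) : b < k -> hv U peel k.
Proof.
move=> bk; have [->|kb] := eqVneq k (b + 1); first exact: peel_top.
by apply: peel_hv kb _; apply: HM.
Qed.

(** The new [h^b] is the kernel of the map from [h^b(M)] to [h^b] of the shifted [Q j]. By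
    [peel_top] this map is onto, and its target is nonzero, so the kernel is proper and needs fewer
    functionals. *)
Lemma peel_size (fs : seq {linear HomC U M b -> K^o}) : (forall x : HomC U M b, cycle x -> killed fs x -> bdry x) ->
  exists gs : seq {linear HomC U peel b -> K^o}, (size gs < size fs)%N /\
    forall x : HomC U peel b, cycle x -> killed gs x -> bdry x.
Proof.
move=> Hfs; have Hs := hses_post (twist_of peel_cycle) U.
pose S (x : HomC U M b) := bdry (hcomp (addrC 1 b) peel_hom x : HomC U B (b + 1)).
have HS : is_submod S.
  split=> [|a x y Sx Sy]; first by rewrite /S hcomp0r; apply: bdry0.
  by rewrite /S hcompDr hcompZr; apply: bdryD Sy; apply: bdryZ.
have BS x : bdry x -> S x by move=> bx; apply: hcomp_bdryr peel_cycle bx.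
have HA : is_submod (fun x : HomC U M b => cycle x).
  split=> [|a x y cx cy]; first exact: cycle0.
  by move=> k e; rewrite linearP cx cy scaler0 addr0.
have key (w : HomC U peel b) u : cd (HomC U peel) (erefl (b + 1)) w = hpost U (tin (twist_of peel_cycle)) (b + 1) u ->
    bdry (u - hcomp (addrC 1 b) peel_hom (hpost U (tout (twist_of peel_cycle)) b w)).
  move=> E; have /(f_equal (hfam (@tfst _ _ _ _ (twist_of peel_cycle)) (b + 1))) := E.
  rewrite tfst_tin tfst_d (tq_of peel_cycle erefl (addrC 1 b)) => <-.
  by rewrite addrK; apply: bdry_intro.
have [y cy nSy] : exists2 y : HomC U M b, cycle y & ~ S y.
  have nB : ~ hv U B (b + 1) by move=> /hv_shift_r; rewrite subrr; apply: UQ0.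
  apply: contrapT => H; apply: nB => z cz.
  have [w wE] := bdry_elim (erefl (b + 1)) (peel_top (cyc_map (hpost U (tin (twist_of peel_cycle))) cz)).
  have bz := key w z (esym wE).
  pose y := hpost U (tout (twist_of peel_cycle)) b w.
  have cy : cycle y.
    by apply: (@cycle1 _ _ _ _ erefl); rewrite -cfunC -wE (ses_zero Hs).
  have Sy : S y by apply: contrapT => nS; apply: H; exists y.
  by rewrite -[z](subrK (hcomp (addrC 1 b) peel_hom y)); apply: bdryD bz _.
have [gs [sg Hg]] := killed_proper HS BS HA cy nSy Hfs.
exists (map (fun g : {linear HomC U M b -> K^o} => g \o hpost U (tout (twist_of peel_cycle)) b : {linear HomC U peel b -> K^o}) gs); split; first by rewrite size_map.
move=> x cx kx; have Bb : hv U B b by apply: hvUB; lia.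
have cx' := cyc_map (hpost U (tout (twist_of peel_cycle))) cx.
suff bx : bdry (hpost U (tout (twist_of peel_cycle)) b x).
  have [v vE] := bdry_elim (subrK 1 b) bx; have [v' v'E] := ses_surj Hs v.
  have [|w wE] := ses_ex Hs (x := x - cd (HomC _ _) (subrK 1 _) v').
    by rewrite linearB cfunC v'E vE subrr.
  have cw : cycle w.
    apply: (@cycle1 _ _ _ _ erefl); apply: (ses_inj Hs).
    by rewrite cfunC -wE linearB cdd subr0; apply: cx.
  rewrite -[x](subrK (cd (HomC _ _) (subrK 1 _) v')) wE; apply: bdryD; last exact: bdry_intro.
  exact/bdry_map/Bb.
apply: Hg => //.
  have := key x 0; rewrite (cx _ erefl) linear0 => /(_ erefl); rewrite sub0r => /bdryN.
  by rewrite opprK.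
by elim: (gs) kx => //= g gs' IHg [gx kx]; split; [exact: gx|exact: IHg].
Qed.
End Peel.

Hypothesis dimfin : forall M (b : int), kproj M -> in_Db M -> exists fs : seq {linear HomC U M b -> K^o},
  forall x : HomC U M b, cycle x -> killed fs x -> bdry x.

Variable C : cpx -> Prop.
Variables (a : int) (Ciso : iso_closed C) (Cext : ext_closed C) (C0 : forall M, acyclic M -> C M).
Hypothesis gen : forall M, (forall k, hv U M k) -> acyclic M.

(** Outer induction on the number of degrees, inner induction on the length of a list of functionals
    separating the top [h^b]. The inner step peels; once all maps to [Q_j] of degree [- b] are null,
    [h^b] is zero and the outer induction takes over. *)
Lemma filtration (n : nat) M : kproj M -> in_Db M ->
  (forall j (k : int), a <= k -> k < a + n%:Z -> C (shift (- k) (Q j))) ->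
  (forall k : int, k < a -> hv U M k) -> (forall k : int, a + n%:Z <= k -> hv U M k) -> C M.
Proof.
elim: n M => [|n IH] M kM dM CQ lo hi.
  apply/C0/gen => k; have [ka|ak] := ltP k a; first exact: lo.
  by apply: hi; move: ak; clear; lia.
pose b := a + n%:Z.
have {hi} : forall k : int, b < k -> hv U M k by move=> k bk; apply: hi; move: bk; rewrite /b; clear; lia.
have [fs] := dimfin b kM dM.
move: {2}(size fs).+1 (ltnSn (size fs)) => d.
elim: d M fs kM dM lo => // d IHd M fs kM dM lo sfs Hfs hi.
have [[j [c cc nc]]|H] := pselect (exists j, exists2 c : HomC M (Q j) (- b), cycle c & ~ bdry c).
  have [gs [sg Hg]] := peel_size kM dM hi cc nc Hfs.
  have CP : C (peel cc).
    apply: (IHd (peel cc) gs) => //.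
    - exact: peel_kproj.
    - exact: peel_in_Db.
    - move=> k ka; apply: peel_hv; [move: ka; rewrite /b; clear; lia|exact: lo].
    - by move: sg sfs; clear; lia.
    - exact: peel_bound.
  apply: (ext_ses_right Ciso Cext (tses _) CP).
  have CQb : C (shift (- b) (Q j)) by apply: CQ; rewrite /b; clear; lia.
  by apply: Ciso CQb; apply: dIso_sym; apply: shift_add; clear; lia.
apply: (IH M kM dM) => // [j k ak kb|k bk].
  by apply: CQ ak _; move: kb; clear; lia.
have [kb|kb] := eqVneq k b; last by apply: hi; move: bk kb; rewrite /b; clear; lia.
rewrite kb; apply: (van kM dM) => j m mb.
have [m1|m1] := ltP m (- b); first exact: bound kM hi m1.
have -> : m = - b by move: mb m1; clear; lia.
by move=> c cc; apply: contrapT => nc; apply: H; exists j, c.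
Qed.
End Filtration.

(** * Towers and coaisles *)

Section Towers.
Variable R : pzRingType.

Section Limit.
Variables (M : nat -> cplx R) (p : forall n, cmap (M n.+1) (M n)).

Definition compatible i (x : cprod M i) : Prop := forall n, p n i (pproj M n.+1 i x) = pproj M n i x.
Fact compatible_submod i : is_submod (@compatible i).
Proof.
split=> [n|a x y Hx Hy n]; first exact: linear0.
by rewrite !linearP Hx Hy.
Qed.
Fact compatible_d i j (e : i + 1 = j) x : compatible x -> compatible (cd (cprod M) e x).
Proof. by move=> H n; rewrite !cfunC H. Qed.
Definition lim : cplx R := subc compatible_submod compatible_d.
Definition lim_in : cmap lim (cprod M) := subc_in _ _.
Definition lim_proj n : cmap lim (M n) := ccomp (pproj M n) lim_in.
Lemma lim_projE n i (x : lim i) : p n i (lim_proj n.+1 i x) = lim_proj n i x.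
Proof. exact: (subc_inP x n). Qed.
Lemma lim_eq i (x y : lim i) : (forall n, lim_proj n i x = lim_proj n i y) -> x = y.
Proof. by move=> H; apply: (@subc_in_inj _ _ _ compatible_submod compatible_d i); apply: cprod_eq. Qed.

Section Co.
Variables (N : cplx R) (f : forall n, cmap N (M n)) (fp : forall n i x, p n i (f n.+1 i x) = f n i x).
Fact lim_co_subproof i (x : N i) : compatible (ptuple f i x).
Proof. by move=> n; rewrite !ptupleE fp. Qed.
Definition lim_co : cmap N lim := subc_co compatible_submod compatible_d lim_co_subproof.
Lemma lim_coE n i x : lim_proj n i (lim_co i x) = f n i x.
Proof. by rewrite -[LHS]/(pproj M n i (lim_in i (lim_co i x))) subc_coE ptupleE. Qed.
End Co.

Hypothesis psurj : forall n i (y : M n i), exists x : M n.+1 i, p n i x = y.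

Definition lim_diff : cmap (cprod M) (cprod M) :=
  ptuple (fun n => csubm (pproj M n) (ccomp (p n) (pproj M n.+1))).
Lemma lim_diffE n i x : pproj M n i (lim_diff i x) = pproj M n i x - p n i (pproj M n.+1 i x).
Proof. by rewrite ptupleE csubmE. Qed.

(** Surjectivity of the [p n] makes the derived limit vanish: a preimage under the difference map is
    solved for one stage at a time. *)
Lemma ses_lim : ses lim_in lim_diff.
Proof.
split=> [i x x0|i y|i x|i x x0].
- apply: (@subc_in_inj _ _ _ compatible_submod compatible_d i); rewrite linear0; exact: x0.
- pose F := fix F n : M n i := if n is n'.+1 then
    sval (boolp.cid (psurj (F n' - pproj M n' i y))) else 0.
  exists (F : cprod M i); apply: cprod_eq => n; rewrite lim_diffE.
  have -> : p n i (pproj M n.+1 i (F : cprod M i)) = F n - pproj M n i y.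
    exact: (svalP (boolp.cid (psurj (F n - pproj M n i y)))).
  by rewrite opprB addrC subrK.
- by apply: cprod_eq => n; rewrite lim_diffE linear0 (subc_inP x n) subrr.
- have Px : compatible x.
    move=> n; apply/eqP; rewrite eq_sym -subr_eq0; apply/eqP.
    by rewrite -lim_diffE x0 linear0.
  by exists (mksub (compatible_submod i) Px); rewrite -[LHS](mksubK (compatible_submod i) Px).
Qed.

Lemma lim_proj_surj i (y : M 0%N i) : exists x : lim i, lim_proj 0%N i x = y.
Proof.
pose F := fix F n : M n i := if n is n'.+1 then sval (boolp.cid (psurj (F n'))) else y.
have PF : compatible (F : cprod M i).
  by move=> n; exact: (svalP (boolp.cid (psurj (F n)))).
exists (mksub (compatible_submod i) PF).
by rewrite -[LHS]/(pproj M 0%N i (sublin _ (mksub (compatible_submod i) PF))) mksubK.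
Qed.
End Limit.

(** Dropping the first term leaves a limit unchanged; by iteration, [lim_hv] asks for vanishing only
    from some stage on. *)
Lemma lim_tail (M : nat -> cplx R) (p : forall n, cmap (M n.+1) (M n)) :
  exists s : cmap (lim p) (lim (fun n => p n.+1)), qis s.
Proof.
pose s := @lim_co (fun n => M n.+1) (fun n => p n.+1) (lim p) (fun n => lim_proj p n.+1)
  (fun n i x => lim_projE n.+1 x).
pose g n : cmap (lim (fun n => p n.+1)) (M n) :=
  match n return cmap (lim (fun n => p n.+1)) (M n) with
  | 0%N => ccomp (p 0%N) (lim_proj (fun n => p n.+1) 0%N)
  | n'.+1 => lim_proj (fun n => p n.+1) n' end.
have gp n i x : p n i (g n.+1 i x) = g n i x.
  by case: n => [|n] //; rewrite /g (lim_projE (p := fun n => p n.+1)).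
exists s; apply: (@iso_qis _ _ _ s (lim_co gp)) => i x; apply: lim_eq => n.
  rewrite lim_coE; case: n => [|n]; rewrite /g /= ?lim_coE //.
  exact: (lim_projE 0%N x).
by rewrite lim_coE (lim_coE gp n.+1).
Qed.

Lemma ses_shift k (P E S : cplx R) (i : cmap P E) (p : cmap E S) : ses i p -> ses (cshift k i) (cshift k p).
Proof.
by case=> H1 H2 H3 H4; split=> n; [exact: H1|exact: H2|exact: H3|exact: H4].
Qed.

Lemma acyclic_dIso (M N : cplx R) : acyclic M -> acyclic N -> dIso M N.
Proof.
move=> aM aN; apply: (@qis_dIso _ _ _ (czero M N)) => i; split=> [x cx _|y cy]; first exact: aM.
by exists 0; [exact: cycle0|exact/aN/cycleB/cyc_map/cycle0].
Qed.
End Towers.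

Section TowerHom.
Variables (K : fieldType) (L : falgType K).
Local Notation cpx := (cplx L^c).

Lemma hses_post_ses U (P E S : cpx) (i : cmap P E) (p : cmap E S) : kproj U -> ses i p ->
  forall k : int, hv U S (k - 1) -> hv U E k -> hv U P k.
Proof.
move=> kU H k HS HE; have [s qs] := ses_kone H.
have e : k - 1 + 1 = k by rewrite subrK.
apply: (tri_hv_left kU (triangle_ses H) e) => //.
Qed.

Lemma lim_hv U (k : int) (N : nat) (M : nat -> cpx) (p : forall n, cmap (M n.+1) (M n)) : kproj U ->
  (forall n i (y : M n i), exists x : M n.+1 i, p n i x = y) ->
  (forall n, (N <= n)%N -> hv U (M n) k /\ hv U (M n) (k - 1)) -> hv U (lim p) k.
Proof.
move=> kU; elim: N M p => [|N IH] M p ps H.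
  by apply: (hses_post_ses kU (ses_lim ps)); apply: hv_prod_r => n; have [] := H n isT.
have [s qs] := lim_tail p; apply/(qis_hv k kU qs)/IH => [n i y|n Nn]; first exact: ps.
exact: H.
Qed.

Lemma ext_ses_left (C : cpx -> Prop) (P E S : cpx) (i : cmap P E) (p : cmap E S) : iso_closed C -> ext_closed C ->
  ses i p -> C E -> C (shift (-1) S) -> C P.
Proof.
move=> Ciso Cext H CE CS.
have [s qs] := ses_kone H.
have Hs := ses_shift (-1) (tses (twcone i)).
have [t qt] := ses_kone Hs.
apply: (Ciso _ _ (shiftK P (addNr 1))); apply: (Ciso _ _ (qis_dIso qt)).
apply: Cext (triangle_ses (tses (twcone (cshift (-1) (tin (twcone i)))))) _ _.
  exact: (Ciso _ _ (dIso_sym (dIso_shift (-1) (qis_dIso qs))) CS).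
exact: (Ciso _ _ (dIso_sym (shiftK E (addrN 1))) CE).
Qed.

Fact shift_cprod_subproof I (J : I -> cpx) i j (e : i + 1 = j) (x : cprod (fun t => shift 1 (J t)) i) :
  cd (cprod (fun t => shift 1 (J t))) e x = cd (shift 1 (cprod J)) e x.
Proof. by apply: functional_extensionality_dep => t. Qed.
Lemma shift_cprod I (J : I -> cpx) : dIso (cprod (fun t => shift 1 (J t))) (shift 1 (cprod J)).
Proof.
pose s : cmap (cprod (fun t => shift 1 (J t))) (shift 1 (cprod J)) :=
  @CMap L^c (cprod (fun t => shift 1 (J t))) (shift 1 (cprod J)) (fun i => mkLin (@cid_linear _ _))
    (@shift_cprod_subproof I J).
pose t : cmap (shift 1 (cprod J)) (cprod (fun t => shift 1 (J t))) :=
  @CMap L^c (shift 1 (cprod J)) (cprod (fun t => shift 1 (J t))) (fun i => mkLin (@cid_linear _ _))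
    (fun i j e x => esym (@shift_cprod_subproof I J i j e x)).
by apply: (@qis_dIso _ _ _ s); apply: (@iso_qis _ _ _ s t).
Qed.

Section Kernels.
Variables (M B : nat -> cpx) (p : forall n, cmap (M n.+1) (M n)) (b : forall n, cmap (B n) (M n.+1)).
Hypothesis Hs : forall n, ses (b n) (p n).
Let psurj n i (y : M n i) : exists x : M n.+1 i, p n i x = y.
Proof. by have [_ H _ _] := Hs n; apply: H. Qed.

Fixpoint tower_map n : cmap (M n) (M 0%N) :=
  match n with 0%N => Defs.cid _ | n'.+1 => ccomp (tower_map n') (p n') end.
Fact tower_ker_submod n i : is_submod (fun x : M n i => tower_map n i x = 0).
Proof. by split=> [|a x y Hx Hy]; rewrite ?linear0 // linearP Hx Hy scaler0 addr0. Qed.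
Fact tower_ker_d n i j (e : i + 1 = j) (x : M n i) : tower_map n i x = 0 -> tower_map n j (cd (M n) e x) = 0.
Proof. by move=> H; rewrite cfunC H linear0. Qed.
Definition tower_ker n : cpx := subc (@tower_ker_submod n) (@tower_ker_d n).
Definition ker_in n : cmap (tower_ker n) (M n) := subc_in _ _.
Fact ker_p_subproof n i (x : tower_ker n.+1 i) : tower_map n i (ccomp (p n) (ker_in n.+1) i x) = 0.
Proof. exact: (subc_inP x). Qed.
Definition ker_p n : cmap (tower_ker n.+1) (tower_ker n) :=
  subc_co (@tower_ker_submod n) (@tower_ker_d n) (@ker_p_subproof n).
Lemma ker_pE n i x : ker_in n i (ker_p n i x) = p n i (ker_in n.+1 i x).
Proof. exact: subc_coE. Qed.
Fact ker_b_subproof n i (x : B n i) : tower_map n.+1 i (b n i x) = 0.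
Proof. by rewrite /= (ses_zero (Hs n)) linear0. Qed.
Definition ker_b n : cmap (B n) (tower_ker n.+1) :=
  subc_co (@tower_ker_submod n.+1) (@tower_ker_d n.+1) (@ker_b_subproof n).
Lemma ker_bE n i x : ker_in n.+1 i (ker_b n i x) = b n i x.
Proof. exact: subc_coE. Qed.
Lemma ker_in_inj n i (x y : tower_ker n i) : ker_in n i x = ker_in n i y -> x = y.
Proof. exact: subc_in_inj. Qed.

Lemma ses_ker n : ses (ker_b n) (ker_p n).
Proof.
split=> i x.
- move=> x0; apply: (ses_inj (Hs n)); by rewrite -ker_bE x0 linear0.
- have [y yE] := psurj (ker_in n i x).
  have Py : tower_map n.+1 i y = 0 by rewrite /= yE; apply: (subc_inP x).
  exists (mksub (@tower_ker_submod n.+1 i) Py); apply: ker_in_inj; rewrite ker_pE -yE.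
  by congr (p n i _); apply: mksubK.
- by apply: ker_in_inj; rewrite ker_pE ker_bE (ses_zero (Hs n)) linear0.
- move=> x0; have [|y yE] := ses_ex (Hs n) (x := ker_in n.+1 i x).
    by rewrite -ker_pE x0 linear0.
  by exists y; apply: ker_in_inj; rewrite ker_bE.
Qed.

Definition lim_ker : cmap (lim ker_p) (lim p) :=
  @lim_co _ M p (lim ker_p) (fun n => ccomp (ker_in n) (lim_proj ker_p n))
    (fun n i x => etrans (esym (ker_pE _)) (f_equal (ker_in n i) (lim_projE n x))).
Lemma lim_kerE n i x : lim_proj p n i (lim_ker i x) = ker_in n i (lim_proj ker_p n i x).
Proof. by rewrite lim_coE. Qed.

Lemma ses_lim_ker : ses lim_ker (lim_proj p 0%N).
Proof.
split=> i x.
- move=> x0; apply: lim_eq => n; apply: ker_in_inj; by rewrite -lim_kerE x0 !linear0.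
- by apply: (lim_proj_surj (p := p)) => n i' y; apply: psurj.
- by rewrite lim_kerE; apply: (subc_inP (lim_proj ker_p 0%N i x)).
move=> x0.
have Px n : tower_map n i (lim_proj p n i x) = 0.
  by elim: n => [|n IH] //; rewrite /= lim_projE.
pose y : cprod tower_ker i := fun n => mksub (@tower_ker_submod n i) (Px n).
have yE n : ker_in n i (pproj tower_ker n i y) = lim_proj p n i x by apply: mksubK.
have Py : compatible ker_p y by move=> n; apply: ker_in_inj; rewrite ker_pE !yE lim_projE.
exists (mksub (compatible_submod ker_p i) Py); apply: lim_eq => n; by rewrite lim_kerE -yE.
Qed.

(** As [lim p] is acyclic, [M 0] is the suspension of the limit of the kernels of the maps from
    [M n] to [M 0]. These kernels are finite extensions of the [B n], and their limit is the fibre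
    of a map between products of them, so the objects [M n] themselves, about which nothing is
    known, stay out of the closure argument. All is suspended once because the suspended [B n] are
    what lies in [C]. *)
Lemma tower_class (C : cpx -> Prop) : iso_closed C -> ext_closed C -> prod_closed C ->
  (forall N, C N -> C (shift (-1) N)) -> (forall N, acyclic N -> C N) ->
  (forall n, C (shift 1 (B n))) -> acyclic (lim p) -> C (M 0%N).
Proof.
move=> Ciso Cext Cprod Cm1 C0 CB Ha.
have CJ n : C (shift 1 (tower_ker n)).
  elim: n => [|n IH].
    apply: C0; apply: acyclic_shift => i x _.
    have -> : x = 0 by apply: ker_in_inj; rewrite linear0; apply: (subc_inP x).
    exact: bdry0.
  exact: Cext (triangle_ses (ses_shift 1 (ses_ker n))) (CB n) IH.
have CP : C (shift 1 (cprod tower_ker)).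
  by apply: (Ciso _ _ (shift_cprod tower_ker)); apply: prod_cprod.
apply: (ext_ses_right Ciso Cext ses_lim_ker); first exact: C0.
apply: (ext_ses_left Ciso Cext (ses_shift 1 (@ses_lim _ _ ker_p _))) => //; last exact: Cm1.
by move=> n; have [_ H _ _] := ses_ker n.
Qed.
End Kernels.
End TowerHom.

(** * Fibres of maps to products of the injective complexes *)

Section CoaisleTower.
Variables (K : fieldType) (L : falgType K) (r : nat) (T : 'I_r -> cplx L^c) (U : cplx L^c).
Local Notation cpx := (cplx L^c).
Hypotheses (kU : kproj U) (naka : forall M (n m : int), m + n = 0 -> hv U M n <-> forall i, hv M (T i) m)
  (UT : forall j (n : int), n < 0 -> hv U (T j) n).
Hypothesis gen : forall M, (forall k, hv U M k) -> acyclic M.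

Section Step.
Variables (M : cpx) (n : int) (HM : forall k : int, k < n -> hv U M k).
Let I : Type := {j : 'I_r & {c : HomC M (T j) (- n) | cycle c}}.
Local Notation "'sT' t" := (shift (- (n + 1)) (T (tag t))) (at level 9, t at level 9).
Definition stepB : cpx := cprod (fun t : I => sT t).
Fact step_deg : n + 1 + - n = 1. Proof. by rewrite addrAC subrr add0r. Qed.
Definition step_part (t : I) : HomC M (sT t) 1 :=
  hcomp step_deg (shift_ga (subrr (n + 1)) (T (tag t))) (sval (tagged t)).
Definition step_hom : HomC M stepB 1 := htuple step_part.
Lemma step_cycle : cycle step_hom.
Proof.
apply: (@cycle1 _ _ _ _ erefl); rewrite (hd_tuple erefl).
apply: hprod_ext => t; rewrite hpost_tuple linear0.
by apply: (hcomp_cycle step_deg (shift_ga_cycle _ _) (svalP (tagged t))).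
Qed.
(* The fibre of [M -> prod T_j[-n]], over all maps [M -> T_j[-n]]. *)
Definition stepM : cpx := tsum (twist_of step_cycle).

Lemma stepB_hv (k : int) : k <= n -> hv U stepB k.
Proof. by move=> kn; apply: hv_prod_r => t; apply/hv_shift_r/UT; lia. Qed.

(** By duality [h^n] of the fibre is governed by its maps to the [T_j] of degree [- n]. Such a map
    comes from a map [w] on [M]; since [w] is itself one of the components of the map to the
    product, it becomes null on the fibre. *)
Lemma stepM_hv (k : int) : k < n + 1 -> hv U stepM k.
Proof.
move=> kn1; have [kn|kn] := ltP k n.
  apply: (ses_mid (hses_post _ U)); last exact: HM.
  by apply: stepB_hv; lia.
have {kn kn1} -> : k = n by lia.
apply/(naka stepM (addNr n)) => j x cx.
have Hs := hses_pre (twist_of step_cycle) (T j).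
have hB : hv stepB (T j) (- n) by apply: (proj1 (naka stepB (addNr n)) (stepB_hv (lexx n))).
have [s sE] := bdry_elim (subrK 1 (- n)) (hB _ (cyc_map (hpre (T j) (tin (twist_of step_cycle))) cx)).
have [s' s'E] := ses_surj Hs s.
have [|w wE] := ses_ex Hs (x := x - cd (HomC _ (T j)) (subrK 1 _) s').
  by rewrite linearB cfunC s'E sE subrr.
have cw : cycle w.
  apply: (@cycle1 _ _ _ _ erefl); apply: (ses_inj Hs).
  by rewrite cfunC -wE linearB cdd subr0; apply: cx.
rewrite -[x](subrK (cd (HomC _ (T j)) (subrK 1 _) s')) wE; apply: bdryD; last exact: bdry_intro.
pose t : I := Tagged (fun j => {c : HomC M (T j) (- n) | cycle c}) (exist _ w cw : {c : HomC M (T j) (- n) | cycle c}).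
(* The graded projection onto the product is the null-homotopy: up to sign its boundary is the map
   to the product, and the component indexed by [w] is taken. *)
pose tau : HomC stepM stepB 0 := hfam (@tfst _ _ _ _ (twist_of step_cycle)) 0 (hid stepM).
have dtau : cd (HomC stepM stepB) (erefl (0 + 1)) tau = - hcomp (addr0 1) step_hom (c2h (tout (twist_of step_cycle))).
  have := @tfst_d K L stepM stepB M (twist_of step_cycle) _ _ (erefl (0 + 1)) (hid stepM).
  rewrite (@hid_cycle K L stepM _ (erefl (0 + 1))) linear0 (tq_of step_cycle (erefl (0 + 1)) (addr0 1)) hpost_hid.
  by move=> /esym/eqP; rewrite addr_eq0 => /eqP.
have e0 : - (n + 1) + 0 = - (n + 1) by rewrite addr0.
have e1 : - (n + 1) + 1 = - n by lia.
have e2 : - n + 0 = - n by rewrite addr0.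
have cgb := @shift_gb_cycle K L (- (n + 1)) (T j).
have := hd_comp e0 e1 (erefl (0 + 1)) e1 e2 e1 (@shift_gb K L (- (n + 1)) (T j)) (hpost stepM (pproj (fun t : I => sT t) t) 0 tau).
rewrite (cgb _ e1) hcomp0l add0r -cfunC dtau linearN hcompNr.
have -> : hcomp e1 (@shift_gb K L (- (n + 1)) (T j)) (hpost stepM (pproj (fun t : I => sT t) t) 1
    (hcomp (addr0 1) step_hom (c2h (tout (twist_of step_cycle))))) = hpre (T j) (tout (twist_of step_cycle)) (- n) w.
  have -> : hpost stepM (pproj (fun t : I => sT t) t) 1 (hcomp (addr0 1) step_hom (c2h (tout (twist_of step_cycle))))
    = hcomp (addr0 1) (hpost M (pproj (fun t : I => sT t) t) 1 step_hom) (c2h (tout (twist_of step_cycle))).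
    apply: hext => p q e z; have ep := addr0 p.
    by rewrite hpostE !(hcompE _ _ _ e ep e) hpostE.
  have <- : hcomp e2 w (c2h (tout (twist_of step_cycle))) = hpre (T j) (tout (twist_of step_cycle)) (- n) w.
    by apply: hext => p q e z; rewrite (hcompE _ _ _ e (addr0 p) e) c2hE hpreE.
  rewrite hpost_tuple /step_part /=.
  rewrite -(hcompA e1 e2 (addr0 1) e1) -(hcompA (shift_pk (subrr (n + 1))) (add0r (- n)) step_deg e1) shift_gba hcomp1l.
  by [].
move=> E; rewrite -[hpre _ _ _ w]opprK -[- hpre _ _ _ w](ksgnK (- (n + 1))) -E.
by apply: bdryN; rewrite -ksgn_lin; apply: bdry_intro.
Qed.
End Step.

Lemma coaisle_tower (C : cpx -> Prop) M : iso_closed C -> ext_closed C -> prod_closed C ->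
  (forall N, C N -> C (shift (-1) N)) -> (forall N, acyclic N -> C N) -> (forall j, C (T j)) ->
  (forall k : int, k < 0 -> hv U M k) -> C M.
Proof.
move=> Ciso Cext Cprod Cm1 C0 CT HM.
pose St (n : nat) := {N : cpx | forall k : int, k < n%:Z -> hv U N k}.
have nxt n (N : cpx) (H : forall k : int, k < n%:Z -> hv U N k) (k : int) : k < n.+1%:Z -> hv U (stepM N n%:Z) k.
  by move=> kn; apply: stepM_hv => //; move: kn; clear; lia.
pose F := fix F n : St n := match n return St n with
  | 0%N => exist _ M HM
  | n'.+1 => exist _ (stepM (sval (F n')) n'%:Z) (nxt n' _ (svalP (F n'))) end.
pose p n : cmap (sval (F n.+1)) (sval (F n)) := tout (twist_of (@step_cycle (sval (F n)) n%:Z)).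
pose b n : cmap (stepB (sval (F n)) n%:Z) (sval (F n.+1)) := tin (twist_of (@step_cycle (sval (F n)) n%:Z)).
have Hs n : ses (b n) (p n) by apply: tses.
apply: (tower_class (M := fun n => sval (F n)) Hs Ciso Cext Cprod Cm1 C0).
  move=> n; apply: (Ciso _ _ (shift_cprod _)); apply: prod_cprod => // t.
  have Cn (m : nat) N : C N -> C (shift (- m%:Z) N).
    elim: m => [|m IH] CN; first by apply: (Ciso _ _ (dIso_sym (shift0 N))) CN.
    by apply: (Ciso _ _ _ (Cm1 _ (IH CN))); apply: shift_add; clear; lia.
  apply: (Ciso _ _ _ (Cn n _ (CT (tag t)))); apply: dIso_sym; apply: shift_add; clear; lia.
(* Stage [n] has no [h^i] for [i < n], so from stage [|k| + 1] on both degrees [k] and [k - 1],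
   which the limit involves, are empty. *)
apply: gen => k; apply: (lim_hv (N := `|k|%N.+1) kU) => [n i y|n kn].
  by have [_ H _ _] := Hs n; apply: H.
by split; apply: (svalP (F n)); move: kn; clear; lia.
Qed.
End CoaisleTower.

(** * Tensor products *)

Lemma zmod_sub0 (V : zmodType) (a b : V) : 0 = - a + b -> b = a.
Proof. by move=> H; rewrite -[a]addr0 H addrA subrr add0r. Qed.

Lemma zmod_cancel (V : zmodType) (p q s : V) : - (p + s) + (p + q) = q - s.
Proof. by rewrite opprD addrACA addNr add0r addrC. Qed.

Section TensorImage.
Variables (K : fieldType) (L : falgType K) (U : cplx L^c).
Local Notation cpx := (cplx L^c).
Local Notation G := (endDG U).

Section Good.
Variables (W : cpx) (gW : good U W).

Lemma good_h_projective : h_projective (homM U W).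
Proof.
move=> N f aN.
have FA : forall i b k j l (e1 : i + b = k) (e2 : k + 0 = l) (e3 : i + 0 = j) (e4 : j + b = l) x a,
    (cc N (etrans (esym (addr0 k)) e2) \o f k) (dgact (homM U W) e1 x a)
    = dgact N e4 ((cc N (etrans (esym (addr0 i)) e3) \o f i) x) a.
  move=> i b k j l e1 e2 e3 e4 x a /=.
  move: (etrans _ e2) (etrans _ e3) => e2' e3'; case: l / e2' e2 e4 => e2 e4; case: j / e3' e3 e4 => e3 e4.
  by rewrite (eq_irrelevance e1 e4); apply: (dgf_act f e4 x a).
pose F := @GLin K L U (homM U W) N 0 (fun i j e => cc N (etrans (esym (addr0 i)) e) \o f i) FA.
have FE i (e : i + 0 = i) x : gl F e x = f i x by rewrite /= cc_id.
have cF : gclosed F.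
  move=> i j i' j' e e' ei ej x.
  have Ei : j = i by rewrite -e addr0.
  have Ei' : j' = i' by rewrite -e' addr0.
  case: i / Ei e ei x => e ei x; case: i' / Ei' e' ei => e' ei.
  by rewrite !FE cfunC (cd_irr ej ei).
have [H HE] := good_proj gW aN cF.
have ix (i j : int) : j + 1 = i -> i + (0 - 1) = j by move=> <-; rewrite sub0r addrK.
exists (fun i j e => gl H (ix i j e)); split.
  by move=> i j k i' k' e ei ek e' x a; apply: glA.
move=> i j k e e' x; have e0 : i + 0 = i by rewrite addr0.
by rewrite -(FE i e0) (HE i i k j e0 e' (ix i j e) e (ix k i e')).
Qed.

Fact good_bal_subproof i j k i' j' k' (e : i + j = k) (ei : i + 1 = i') (ej : j + 1 = j')
    (ek : k + 1 = k') (e1 : i' + j = k') (e2 : i + j' = k') (x : HomC U W i) u :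
  cd W ek (hx x (ixC e) u) = hx (cd (HomC U W) ei x : hob U W i') (ixC e1) u + ksgn i (hx x (ixC e2) (cd U ej u)).
Proof. by rewrite (hdE ei x (ixC e1) (ixC e) ek ej (ixC e2)) subrK. Qed.
Definition good_bal : balanced (homM U W) W :=
  @Balanced K L U (homM U W) W (fun i j k e f u => hx f (ixC e) u)
    (fun i j k e x x' u => hxD x x' (ixC e) u)
    (fun i j k e x => (fun a u v => linearP (hx x (ixC e)) a u v) : linear _)
    (fun i n i' j j' k e1 e2 e e' x f u => @hcompE K L U U W i n i' e1 x f j k (ixC e) j' e2 (ixC e') u)
    (fun i j k i' j' k' e ei ej ek e1 e2 x u => good_bal_subproof e ei ej ek e1 e2 x u).

Lemma good_bal_univ (V : cpx) (phi : balanced (homM U W) V) : exists g : cmap W V,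
  (forall i j k (e : i + j = k) x u, g k (good_bal i j k e x u) = phi i j k e x u) /\
  (forall g' : cmap W V, (forall i j k (e : i + j = k) x u, g' k (good_bal i j k e x u) = phi i j k e x u) ->
    forall i, g' i =1 g i).
Proof.
have ba i n i' j j' k (e1 : i + n = i') (e2 : j + n = j') (e : i' + j = k)
     (e' : i + j' = k) (f : HomC U W i) (a : HomC U U n) u :
     bal phi e (hcomp e1 f a) u = bal phi e' f (hx a e2 u) by exact: (bal_act phi e1 e2 e e' f a u).
have [g gE] := good_tens gW (GBal (gb_f := fun i j k e f u => bal phi e f u)
  (fun i j k e => balDl phi e) (fun i j k e f => bal_linear phi e f) ba).
have gC i j (e : i + 1 = j) (x : W i) : g j (cd W e x) = cd V e (g i x).
  refine (good_span gW (g := g j \o cd W e) (g' := cd V e \o g i) _ x) => n k e' f u /=.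
  have e0 : n + k = i by rewrite addrC.
  have e1 : n + 1 + k = j by rewrite -e -e0; lia.
  have e2 : n + (k + 1) = j by rewrite -e -e0 addrA.
  rewrite (hx_irr f e' (ixC e0)) (good_bal_subproof e0 (erefl (n + 1)) (erefl (k + 1)) e e1 e2) linearD ksgn_lin.
  rewrite !(gE _ _ _ _ _ _ _) //.
  by rewrite (bal_d phi e0 (erefl (n + 1)) (erefl (k + 1)) e e1 e2).
exists (CMap gC); split=> [i j k e x u|g' g'E i x]; first exact: gE.
refine (good_span gW (g := g' i) (g' := g i) _ x) => n k e f u.
have e0 : n + k = i by rewrite addrC.
apply: etrans (esym (gE _ _ _ e0 e f u)); rewrite (hx_irr f e (ixC e0)); exact: g'E.
Qed.

Lemma good_is_tensor : is_tensor (homM U W) W.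
Proof. by exists good_bal => V phi; apply: good_bal_univ. Qed.

Fact dgid_act (N : dgMod G) i j k (e : i + j = k) (x : N i) (a : G j) :
  Defs.cid N k (dgact N e x a) = dgact N e (Defs.cid N i x) a.
Proof. by []. Qed.

Lemma good_is_Ltensor : is_Ltensor (homM U W) W.
Proof.
exists (homM U W), (DGMap (@dgid_act (homM U W))); split.
- exact: good_h_projective.
- by move=> i; split=> [x _ //|y cy]; exists y => //; rewrite subrr; apply: bdry0.
- exact: good_is_tensor.
Qed.
End Good.

Lemma dgact0l (N : dgMod G) i j k (e : i + j = k) (a : G j) : dgact N e 0 a = 0.
Proof. by apply: (addIr (dgact N e 0 a)); rewrite -dgactDl !add0r. Qed.

(** * Cones of dg modules *)

Section DgCone.
Variables (A P : dgMod G) (phi : dgMap A P).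
Local Notation C := (kone phi).
Fact dgcone_index i j k : i + j = k -> i + 1 + j = k + 1 :> int.
Proof. by move=> <-; rewrite addrAC. Qed.
Definition dgcone_act i j k (e : i + j = k) (x : C i) (a : G j) : C k :=
  (dgact P e x.1 a, dgact A (dgcone_index e) x.2 a).
Fact dgcone_leibniz i j k i' j' k' (e : i + j = k) (ei : i + 1 = i') (ej : j + 1 = j') (ek : k + 1 = k')
  (e1 : i' + j = k') (e2 : i + j' = k') x (a : G j) :
  cd C ek (dgcone_act e x a) = dgcone_act e1 (cd C ei x) a + ksgn i (dgcone_act e2 x (cd G ej a)).
Proof.
rewrite !kone_dE ksgn_pair /dgcone_act; congr pair; rewrite ![fst (_, _)]/= ![snd (_, _)]/=.
  rewrite (dgact_leibniz e ei ej ek e1 e2) dgactDl addrAC; congr (_ + _).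
  case: i' / ei e1 => e1; case: k' / ek e1 e2 => e1 e2 /=.
  by rewrite (eq_irrelevance (dgcone_index e) e1) (dgf_act phi e1).
have f1 : i + 1 + 1 + j = k + 1 + 1 by rewrite -e; lia.
have f2 : i + 1 + j' = k + 1 + 1 by rewrite -ej -e; lia.
case: i' / ei e1 => e1; case: k' / ek e1 e2 => e1 e2.
rewrite (dgact_leibniz (dgcone_index e) (shift_index 1 erefl) ej (shift_index 1 erefl) (dgcone_index e1) (dgcone_index e2)).
by rewrite opprD dgactNl (ksgn_succ (n := i)) ?opprK.
Qed.
Definition dgcone : dgMod G.
Proof.
apply: (@DGMod K G C dgcone_act).
- by move=> i j k e x x' a; congr pair; apply: dgactDl.
- by move=> i j k e c x a; congr pair; apply: dgactZl.
- by move=> i j k e x a a'; congr pair; apply: dgactDr.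
- by move=> i j k e c x a; congr pair; apply: dgactZr.
- by move=> i j k ij jk n e1 e2 e3 e4 x a b; congr pair; apply: dgactA.
- move=> i e [x y]; congr pair; first exact: dgact1.
  exact: dgact1.
- exact: dgcone_leibniz.
Defined.
Fact dgcone_in_act i j k (e : i + j = k) (x : P i) (a : G j) :
  tin (twcone phi) k (dgact P e x a) = dgact dgcone e (tin (twcone phi) i x) a.
Proof. by congr pair; rewrite /= dgact0l. Qed.
Definition dgcone_in : dgMap P dgcone := @DGMap K G P dgcone (tin (twcone phi)) dgcone_in_act.

(* A null-homotopy of [P -> cone(phi)] has two components: a map [P -> A] and a
   homotopy from its composite with [phi] to the identity. *)
Lemma h_projective_lift : h_projective P -> qis phi ->
  exists (psi : dgMap P A) (h : forall i j : int, j + 1 = i -> {linear P i -> P j}),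
    (forall i j k i' k' (e : i + j = k) (ei : i' + 1 = i) (ek : k' + 1 = k) (e' : i' + j = k') x (a : G j),
       h k k' ek (dgact P e x a) = dgact P e' (h i i' ei x) a) /\
    (forall i j k (e : j + 1 = i) (e' : i + 1 = k) (x : P i),
       x - phi i (psi i x) = cd P e (h i j e x) + h k i e' (cd P e' x)).
Proof.
move=> hP qp; have aC : acyclic dgcone := proj2 (kone_acyclic phi) qp.
have [h [hA hE]] := hP dgcone dgcone_in aC.
have pE i : i - 1 + 1 = i :> int by rewrite subrK.
pose psi_f i : {linear P i -> A i} := cc A (pE i) \o (tout (twcone phi) (i - 1) \o h i (i - 1) (pE i)).
have psiE i j (e : j + 1 = i) x : cc A e (h i j e x).2 = psi_f i x.
  have E : j = i - 1 by rewrite -e addrK.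
  by subst j; rewrite (eq_irrelevance e (pE i)).
have H1 i j k (e : j + 1 = i) (e' : i + 1 = k) (x : P i) :
    x = cd P e (h i j e x).1 + phi i (psi_f i x) + (h k i e' (cd P e' x)).1.
  rewrite -(psiE i j e); exact: (f_equal fst (hE i j k e e' x)).
have H2 i j k (e : j + 1 = i) (e' : i + 1 = k) (x : P i) :
    (h k i e' (cd P e' x)).2 = cd A (shift_index 1 e) (h i j e x).2.
  have E := f_equal snd (hE i j k e e' x).
  have {}E : 0 = - cd A (shift_index 1 e) (h i j e x).2 + (h k i e' (cd P e' x)).2 := E.
  exact: zmod_sub0 E.
have psiC i k (e' : i + 1 = k) (x : P i) : psi_f k (cd P e' x) = cd A e' (psi_f i x).
  rewrite -(psiE k i e') (H2 i (i - 1) k (pE i) e' x) -(psiE i (i - 1) (pE i) x).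
  have e2 : i - 1 + 1 + 1 = k by rewrite subrK.
  by rewrite (cd_cc _ _ e2) (cc_cd _ _ e2).
have psiA i j k (e : i + j = k) (x : P i) (a : G j) : psi_f k (dgact P e x a) = dgact A e (psi_f i x) a.
  have e' : i - 1 + j = k - 1 by rewrite -e addrAC.
  rewrite -(psiE k (k - 1) (pE k)) (hA _ _ _ _ _ e (pE i) (pE k) e' x a) -(psiE i (i - 1) (pE i) x).
  rewrite -[(dgact dgcone e' _ a).2]/(dgact A (dgcone_index e') (h i (i - 1) (pE i) x).2 a).
  move: (h _ _ _ x).2 (dgcone_index e') => y f; move: (pE i) (pE k) f y.
  move: (i - 1) (k - 1) => i1 k1 p1 p2; case: i / p1 e {x e'} => e; case: k / p2 e => e f y.
  by rewrite !cc_id (eq_irrelevance f e).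
exists (@DGMap K G P A (CMap psiC) psiA), (fun i j e => mkLin (@fst_linear K (P j) (shift 1 A j)) \o h i j e).
split=> [i j k i' k' e ei ek e' x a|i j k e e' x].
  exact: (f_equal fst (hA i j k i' k' e ei ek e' x a)).
by rewrite {1}(H1 i j k e e' x) addrAC addrK.
Qed.
End DgCone.

(** * Independence of the h-projective resolution *)

Section Comparison.
Variables (kU : kproj U) (sU : small U).
Variables (P : dgMod G) (W' : cpx) (hP : h_projective P) (tP : is_tensor P W').

(* The homotopy of [h_projective_lift] yields a balanced map from [P] to a contractible complex. *)
Section Path.
Variable V : cpx.
Fact path_index i j : i + 1 = j -> i = j + -1 :> int.
Proof. by move=> <-; rewrite addrK. Qed.
Fact path_subproof i j k (e : i + 1 = j) (e' : j + 1 = k) (x : V i) :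
  cd (shift (-1) V) e' (cc V (path_index e) x) + cc V (path_index e') (cd V e x) = 0.
Proof.
have e2 : i + 1 = k - 1 by rewrite -e' addrK e.
rewrite -[cd (shift (-1) V) e' _]/(- cd V (shift_index (-1) e') (cc V (path_index e) x)).
by rewrite (cc_cd _ _ e2) (cd_cc _ _ e2) addNr.
Qed.
Definition path_twist : twist (shift (-1) V) V :=
  @Twist L^c (shift (-1) V) V (fun i j e => cc V (path_index e)) path_subproof.
Lemma path_acyclic : acyclic (tsum path_twist).
Proof.
move=> i p cp; have e1 : i - 1 + 1 = i by rewrite subrK.
pose y : V (i - 1) := p.1.
exists (i - 1), e1, ((0, y) : tsum path_twist (i - 1)).
have E0 := f_equal fst (cp _ (erefl (i + 1))).
have E : cc V (path_index (erefl (i + 1))) p.2 = cd V (shift_index (-1) (erefl (i + 1))) p.1.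
  exact: zmod_sub0 (esym E0).
rewrite tsum_dE [p]surjective_pairing; congr pair; first by rewrite linear0 add0r cc_id.
have e3 : i + 1 - 1 = i by rewrite addrK.
have := f_equal (cc V e3) E; rewrite (cc_cc _ _ erefl) cc_id => ->.
by rewrite (cd_cc _ _ e1).
Qed.
End Path.

Definition bal_pull (A B : dgMod G) (psi : dgMap A B) V (t : balanced B V) : balanced A V.
Proof.
apply: (@Balanced K L U A V (fun i j l e x u => t i j l e (psi i x) u)).
- by move=> i j l e x x' u; rewrite linearD balDl.
- by move=> i j l e x; apply: bal_linear.
- by move=> i n i' j j' l e1 e2 e e' x f u; rewrite (dgf_act psi e1) (bal_act t e1 e2 e e').
- by move=> i j l i' j' l' e ei ej el e1 e2 x u; rewrite cfunC (bal_d t e ei ej el e1 e2).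
Defined.

Section PathBalanced.
Variables (V : cpx) (t : balanced P V) (F : dgMap P P) (h : forall i j : int, j + 1 = i -> {linear P i -> P j}).
Hypothesis hA : forall i j k i' k' (e : i + j = k) (ei : i' + 1 = i) (ek : k' + 1 = k) (e' : i' + j = k') x (a : G j),
  h ek (dgact P e x a) = dgact P e' (h ei x) a.
Hypothesis hE : forall i j k (e : j + 1 = i) (e' : i + 1 = k) (x : P i),
  F i x = cd P e (h e x) + h e' (cd P e' x).
Fact path_e i : i - 1 + 1 = i :> int. Proof. exact: subrK. Qed.
Fact path_e' i j k : i + j = k -> i - 1 + j = k + -1 :> int. Proof. by move=> <-; rewrite addrAC. Qed.
Lemma path_hE i j (e : j + 1 = i) x j' (e' : j' + 1 = i) i1 l (f : j + i1 = l) (f' : j' + i1 = l) u :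
  t j i1 l f (h e x) u = t j' i1 l f' (h e' x) u.
Proof.
have E : j' = j by apply: (addIr 1); rewrite e e'.
by subst j'; rewrite (eq_irrelevance e e') (eq_irrelevance f f').
Qed.
Lemma path_cdE m i0 i0' (y : P m) (q : m + 1 = i0) (q' : m + 1 = i0') j l (f : i0 + j = l) (f' : i0' + j = l) u :
  t i0 j l f (cd P q y) u = t i0' j l f' (cd P q' y) u.
Proof.
by move: f f'; case: i0 / q; case: i0' / q' => f f'; rewrite (eq_irrelevance f f').
Qed.
Definition path_bal : balanced P (tsum (path_twist V)).
Proof.
apply: (@Balanced K L U P (tsum (path_twist V))
  (fun i j k e x u => (t (i - 1) j (k + -1) (path_e' e) (h (path_e i) x) u, t i j k e (F i x) u))).
- by move=> i j k e x x' u; congr pair; rewrite linearD balDl.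
- by move=> i j k e x a u v; congr pair; [apply: (bal_linear t (path_e' e) (h (path_e i) x))|apply: (bal_linear t e (F i x))].
- move=> i n i' j j' k e1 e2 e e' x f u; congr pair.
    have e3 : i - 1 + n = i' - 1 by rewrite -e1 addrAC.
    by rewrite (hA e1 (path_e i) (path_e i') e3) (bal_act t e3 e2 (path_e' e) (path_e' e')).
  by rewrite (dgf_act F e1) (bal_act t e1 e2 e e').
move=> i j k i' j' k' e ei ej ek e1 e2 x u; rewrite tsum_dE ksgn_pair; congr pair; last first.
  by rewrite cfunC (bal_d t e ei ej ek e1 e2).
rewrite ![fst (_, _)]/= ![snd (_, _)]/=.
have f1 : i - 1 + 1 + j = k + -1 + 1 by rewrite -e; lia.
have f2 : i - 1 + j' = k + -1 + 1 by rewrite -e -ej; lia.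
have kk : k + -1 + 1 = k' + -1 by rewrite -ek; lia.
have f3 : i - 1 + 1 + j = k' + -1 by rewrite -kk.
have f4 : i - 1 + j' = k' + -1 by rewrite -kk.
transitivity (- cd V (shift_index (-1) ek) (t (i - 1) j (k + -1) (path_e' e) (h (path_e i) x) u)
  + cc V (path_index ek) (t i j k e (F i x) u)); first by [].
rewrite (bal_d t (path_e' e) (erefl (i - 1 + 1)) ej (shift_index (-1) ek) f3 f4).
have ccE l (q : k = l) (w : P i) : cc V q (t i j k e w u) = t i j l (etrans e q) w u.
  by case: l / q; rewrite cc_id.
rewrite ccE (hE (path_e i) ei) balDl.
rewrite -(@path_cdE _ _ _ (h (path_e i) x) (erefl (i - 1 + 1)) (path_e i) j _ f3 (etrans e (path_index ek)) u).
rewrite (@path_hE i' i ei (cd P ei x) (i' - 1) (path_e i') j _ (etrans e (path_index ek)) (path_e' e1) u).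
rewrite (eq_irrelevance (path_e' e2) f4) (ksgn_succ (t (i - 1) j' (k' + -1) f4 _ _) (path_e i)).
exact: zmod_cancel.
Defined.
End PathBalanced.

(** The given [P] is compared with a cellular resolution [Hom(U, W)] of it, where [W] is good. The
    maps [phi] and [psi] induce [a] and [b] between [W] and [W'], and the homotopy makes the
    identity minus [a b] factor through a contractible complex. So a class in [W'] passes through
    [Hom(U, W)], which has the cohomology of [P]. *)
Lemma tensor_hv (k : int) : cohom0 P k -> hv U W' k.
Proof.
move=> Pk; have [W [phi [gW _ HW]]] := @resolution K L U sU P (fun=> True) (fun=> True)
  (fun _ _ => I) (fun _ _ _ => I) (fun _ _ _ _ _ => I) (fun _ _ => I).
have qphi : qis phi.
  apply/qis_cv => m m' e z y cz fz; subst m'.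
  by have [x zE xy] := HW m z y I cz fz; exists x => //; rewrite xy subrr; apply: bdry0.
have [psi [h [hA hE]]] := h_projective_lift hP qphi.
have [tau tauP] := tP.
have [a [aE _]] := good_bal_univ gW (bal_pull phi tau).
have [b [bE _]] := tauP _ (bal_pull psi (good_bal W)).
have FA i j l (e : i + j = l) (x : P i) (f : G j) :
    csubm (Defs.cid P) (ccomp phi psi) l (dgact P e x f) = dgact P e (csubm (Defs.cid P) (ccomp phi psi) i x) f.
  rewrite !csubmE [ccomp _ _ _ _]/= (dgf_act psi e) (dgf_act phi e).
  by rewrite -[- dgact P e _ f]dgactNl -dgactDl.
pose F : dgMap P P := @DGMap K G P P (csubm (Defs.cid P) (ccomp phi psi)) FA.
have hE' i j l (e : j + 1 = i) (e' : i + 1 = l) (x : P i) : F i x = cd P e (h i j e x) + h l i e' (cd P e' x).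
  by rewrite -hE.
have [g [gE _]] := tauP _ (path_bal tau hA hE').
(* Uniqueness in the universal property: two chain maps out of [W'] are equal as soon as both induce
   the balanced map of [phi psi]. *)
have [ab [_ uniq]] := tauP _ (bal_pull psi (bal_pull phi tau)).
have E1 : forall i, csubm (Defs.cid W') (ccomp (tout (path_twist W')) g) i =1 ccomp a b i.
  move=> i y; rewrite (uniq (ccomp a b)) ?(uniq (csubm (Defs.cid W') (ccomp (tout (path_twist W')) g))) //.
    move=> p q l e x u; rewrite csubmE -[ccomp _ g l _]/(tout (path_twist W') l (g l (tau p q l e x u))) gE.
    rewrite -[tout _ l _]/(tau p q l e (x - phi p (psi p x)) u) -[Defs.cid W' l _]/(tau p q l e x u).
    have := balDl tau e (x - phi p (psi p x)) (phi p (psi p x)) u.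
    by rewrite subrK => ->; rewrite addrAC subrr add0r.
  move=> p q l e x u.
  by rewrite -[ccomp a b l _]/(a l (b l (tau p q l e x u))) bE -[bal_pull psi _ _ _ _ _ _ _]/(good_bal W p q l e (psi p x) u) aE.
move=> c cc.
have cE : c = hpost U a k (hpost U b k c) + hpost U (tout (path_twist W')) k (hpost U g k c).
  apply: hext => i j e x; rewrite hxD !hpostE.
  have := E1 j (hx c e x); rewrite csubmE => E2.
  by rewrite -[a j _]/(ccomp a b j (hx c e x)) -E2 subrK.
rewrite cE; apply: bdryD; apply: bdry_map; last first.
  by apply: (kU (@path_acyclic W')); apply: cyc_map.
have cb : cycle (hpost U b k c) by apply: cyc_map.
by apply: (proj1 (qphi k) _ cb); apply: Pk; apply: (cyc_map phi cb).
Qed.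
End Comparison.

Section Image.
Variables (kU : kproj U) (sU : small U) (gen : forall M, (forall k, hv U M k) -> acyclic M).

(** The set [D] of degrees covers both halves of the t-structure. For the converse, [M] is
    quasi-isomorphic to a cellular [W], which is good, hence the tensor product of the h-projective
    module [Hom(U, W)] with [U]. *)
Lemma Ltensor_imageP (D : int -> Prop) M :
  Ltensor_image (fun N : dgMod G => forall k, D k -> cohom0 N k) M <-> forall k, D k -> hv U M k.
Proof.
split=> [[N [W' [HN [P [q [hP qq tP]]] WM]]] k Dk|H].
  apply/(dIso_hv k kU WM)/(tensor_hv kU sU hP tP) => x cx.
  by apply: (proj1 (qq k) x cx); apply: (HN k Dk); apply: cyc_map.
have [W [f [gW _ Hf]]] := @cell_resolution K L U sU M (fun=> True) (fun=> True)
  (fun _ _ => I) (fun _ _ _ => I) (fun _ _ _ _ _ => I) (fun _ _ => I).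
have qf : qis f by apply/kone_acyclic/gen => k; apply/hv_kone/Hf.
exists (homM U W), W; split; [|exact: good_is_Ltensor|exact: qis_dIso qf].
by move=> k Dk; apply/(qis_hv k kU qf)/H.
Qed.
End Image.
End TensorImage.

(** * Comparison of the three t-structures *)

Section SimpleMinded.
Variables (K : fieldType) (L : falgType K) (r : nat) (X T : 'I_r -> cplx L^c).
Local Notation cpx := (cplx L^c).
Hypotheses (HX : simple_minded X) (HT : forall i, rickard X i (T i) /\ bounded_injective (T i)).
Local Notation U := (cbigsum (fun i => nuinv (T i))).

Let rT i : rickard X i (T i). Proof. by case: (HT i). Qed.
Let bT i : bounded_injective (T i). Proof. by case: (HT i). Qed.
Let dX i : in_Db (X i). Proof. by case: HX. Qed.
Let neg (m : int) i j : m < 0 -> hom_zero (X i) (shift m (X j)).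
Proof. by case: HX => _ _ [H _ _ _]; apply: H. Qed.
Let endX i : end_is_K (X i). Proof. by case: HX => _ _ [_ H _ _]. Qed.
Let orthX i j : i != j -> hom_zero (X i) (X j). Proof. by case: HX => _ _ [_ _ H _]; apply: H. Qed.
Let thX M : in_Db M <-> thick X M. Proof. by case: HX => _ _ [_ _ _ H]. Qed.
Let X0 i : ~ hom_zero (X i) (X i). Proof. exact: end_is_K_neq0. Qed.

Lemma nu_kproj : kproj U. Proof. exact: perfb_kproj (U_perfb bT). Qed.
Lemma nu_small : small U. Proof. exact: perfb_small (U_perfb bT). Qed.

Lemma resolved : exists Q : 'I_r -> cpx, (forall i, kproj (Q i)) /\ (forall i, dIso (Q i) (X i)).
Proof.
have [Q [q [kQ qq]]] := family_res X.
by exists Q; split=> // i; apply: qis_dIso (qq i).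
Qed.

Lemma nu_silting (n : int) : 0 < n -> hv U U n.
Proof. by have [Q [kQ QX]] := resolved; apply: (hvUU dX kQ QX neg rT bT). Qed.

Lemma nu_generates M : (forall k, hv U M k) -> acyclic M.
Proof. by apply: (U_generates dX rT bT (fun N => proj1 (thX N)) nu_silting). Qed.

Lemma hvU_X j (n : int) : n != 0 -> hv U (X j) n.
Proof. by have [Q [kQ QX]] := resolved; apply: (hvUX dX kQ QX neg rT bT). Qed.
Lemma hvU_T j (n : int) : n < 0 -> hv U (T j) n.
Proof. by have [Q [kQ QX]] := resolved; apply: (hvUT dX kQ QX neg rT bT). Qed.

(** Orthogonality in the t-structure of [U] supplies [bound], and the telescope with Nakayama
    duality supplies [van]. The result is applied to [U] with a class closed under suspension and to
    the [T_j] with one closed under cosuspension. *)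
Lemma filtration_X (C : cpx -> Prop) (a : int) (n : nat) M : iso_closed C -> ext_closed C ->
  (forall M, acyclic M -> C M) -> in_Db M ->
  (forall j (k : int), a <= k -> k < a + n%:Z -> C (shift (- k) (X j))) ->
  (forall k : int, k < a -> hv U M k) -> (forall k : int, a + n%:Z <= k -> hv U M k) -> C M.
Proof.
move=> Ciso Cext C0 dM CX lo hi.
have [Q [kQ QX]] := resolved.
have qQ j : exists q : cmap (Q j) (X j), qis q := dIso_rep (@kQ j) (QX j).
have dQ j : in_Db (Q j) := in_Db_iso (dIso_sym (QX j)) (@dX j).
have kU := nu_kproj.
have orthUQ j N (b m : int) : kproj N -> (forall k : int, b < k -> hv U N k) -> m < - b -> hv N (Q j) m.
  move=> kN HN mb; apply/(hom_zero_shift (Q j) m kN (@cid_qis K L N)).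
  have H := @orth K L U kU nu_small nu_silting nu_generates b N (shift m (Q j)).
  refine (H HN _) => k kb; apply/hv_shift_r/(dIso_hv _ kU (QX j))/hvU_X.
  by move: mb kb; clear; lia.
have [P [p [kP qp]]] := kproj_resolution M.
have hP k : hv U P k <-> hv U M k by apply: qis_hv.
apply: (Ciso _ _ (qis_dIso qp)).
apply: (@filtration K L r Q U kQ dQ _ _ _ _ _ orthUQ _ _ _ C a Ciso Cext C0 nu_generates n P kP).
- by move=> j k k0; apply/(dIso_hv k kU (QX j))/hvU_X.
- by move=> j /(dIso_hv 0 kU (QX j)); apply: (hvUX0 dX kQ QX neg X0 rT bT).
- move=> i j m m0; have [q qq] := qQ i.
  by apply/(dIso_hv m (@kQ i) (QX j))/(hom_zero_shift (X j) m (@kQ i) qq)/neg.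
- move=> i j ij; have [q qq] := qQ i.
  by apply/(dIso_hv 0 (@kQ i) (QX j))/(hom_zero_hv (X j) (@kQ i) qq)/orthX.
- by move=> j y cy; have [q qq] := qQ j; apply: (end_is_K_scalar (@kQ j) qq (@endX j) cy).
- move=> N k kN dN HN; apply/(hvU bT N (addNr k)) => i.
  have [a' Xa] := sgeX dX; have [C' [u [kC XC TC st]]] := rickard_tel (rT i).
  apply/(dIso_hv _ kN TC); apply: (tel_van XC st Xa dN kN) => j m mk.
  by apply/(dIso_hv m kN (QX j))/HN.
- by move=> A B E i p' H; apply: (in_Db_ses thX H).
- move=> N b kN [N' [bN fN NN]].
  have [s qs] := dIso_rep kN (dIso_sym NN).
  have pU := U_perfb bT.
  have [fs Hfs] := @hom_jinj K L U N' b (proj1 pU) (fun i => dbasis_fin_gen (proj2 pU i)) fN.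
  exists (map (fun g : {linear HomC U N' b -> K^o} => g \o hpost U s b : {linear HomC U N b -> K^o}) fs).
  move=> x cx kx; apply: (proj1 (kproj_post_qis kU qs b) x cx).
  rewrite (Hfs (hpost U s b x)); first exact: bdry0.
  by elim: (fs) kx => //= g gs IHg [gx kx]; split; [exact: gx|exact: IHg].
- exact: in_Db_iso (dIso_sym (qis_dIso qp)) dM.
- by move=> j k ak kn; apply: (Ciso _ _ (dIso_shift (- k) (dIso_sym (QX j)))); apply: CX.
- by move=> k ka; apply/hP/lo.
- by move=> k ka; apply/hP/hi.
Qed.

(** An acyclic complex is isomorphic to the empty coproduct, which a coproduct-closed class
    contains. *)
Lemma acyclic_coprod (C : cpx -> Prop) : iso_closed C -> coprod_closed C -> forall M, acyclic M -> C M.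
Proof.
move=> Ciso Ccop M aM; pose Z (v : void) : cpx := match v with end.
apply: (Ciso (dsumc Z)); last by apply: coprod_dsumc.
by apply: acyclic_dIso aM => i x _; rewrite (_ : x = 0); [apply: bdry0|apply: dsum_eq => -[]].
Qed.
Lemma acyclic_prod (C : cpx -> Prop) : iso_closed C -> prod_closed C -> forall M, acyclic M -> C M.
Proof.
move=> Ciso Cpr M aM; pose Z (v : void) : cpx := match v with end.
apply: (Ciso (cprod Z)); last by apply: prod_cprod.
by apply: acyclic_dIso aM => i x _; rewrite (_ : x = 0); [apply: bdry0|apply: cprod_eq => -[]].
Qed.

Lemma shift_closed_iter (C : cpx -> Prop) (e : int) : iso_closed C -> shift_closed e C ->
  forall (n : nat) N, C N -> C (shift (e *+ n) N).
Proof.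
move=> Ciso Ce; elim=> [|n IH] N CN; first exact: (Ciso _ _ (dIso_sym (shift0 N))).
by apply: (Ciso _ _ _ (Ce _ (IH N CN))); apply: shift_add; rewrite mulrS.
Qed.

Lemma nu_bounded : exists c : int, 0 <= c /\ forall k : int, c <= `|k| -> hv U U k.
Proof.
have [bU _] := U_perfb bT; have [c Hc] := hv_bounded bU bU.
by exists `|c|; split=> [|k ck]; [clear; lia|apply: Hc; move: ck; clear; lia].
Qed.

Lemma aisle_hle M : aisle X M <-> hle U M.
Proof.
have kU := nu_kproj; have sU := nu_small.
split=> [|HM C Ciso Csh Cext Ccop CX].
  apply; [exact: hle_iso|exact: hle_shift|exact: hle_ext|exact: hle_coprod|].
  by move=> i k k0; apply: hvU_X; lia.
apply: (hle_generated kU sU nu_silting nu_generates Ciso Csh Cext Ccop _ HM).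
have C0 := acyclic_coprod Ciso Ccop.
have [c [c0 Hc]] := nu_bounded.
(* [h^k(U)] is zero for [k > 0] by silting and for [k < - c] by boundedness, so only the shifts of
   the [X_j] by [0] up to [c] occur, and these are suspensions. *)
apply: (@filtration_X C (- c) `|c|%N.+1 U Ciso Cext C0 (perfb_in_Db (U_perfb bT))).
- move=> j k k1 k2; have := shift_closed_iter Ciso Csh `|k|%N (CX j).
  by rewrite (_ : 1 *+ `|k|%N = - k) //; move: k1 k2 c0; clear; lia.
- by move=> k kc; apply: Hc; move: kc c0; clear; lia.
- by move=> k kc; apply: nu_silting; move: kc c0; clear; lia.
Qed.

Lemma coaisle_hge M : coaisle X M <-> hge U M.
Proof.
have kU := nu_kproj; have sU := nu_small.
split=> [|HM C Ciso Csh Cext Cpr CX].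
  apply; [exact: hge_iso|exact: hge_shift|exact: hge_ext|exact: hge_prod|].
  by move=> i k k0; apply: hvU_X; lia.
have C0 := acyclic_prod Ciso Cpr.
apply: (coaisle_tower kU (fun M => hvU bT M) hvU_T nu_generates Ciso Cext Cpr Csh C0 _ HM) => j.
have [bTj fTj] := bT j; have [bU _] := U_perfb bT; have [c Hc] := hv_bounded bU bTj.
have dT : in_Db (T j) by apply: in_Db_fin => // i; apply: fin_gen_dim; case: (fTj i).
(* Negative degrees are empty by [hvU_T], and those from [|c|] on by boundedness, so only iterated
   cosuspensions of the [X_i] occur. *)
apply: (@filtration_X C 0 `|c|%N (T j) Ciso Cext C0 dT).
- move=> i k k1 k2; have := shift_closed_iter Ciso Csh `|k|%N (CX i).
  by rewrite (_ : -1 *+ `|k|%N = - k) //; move: k1; clear; lia.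
- by move=> k k0; apply: hvU_T.
- by move=> k kc; apply: Hc; move: kc; clear; lia.
Qed.

Lemma predicate_ext (A B : cpx -> Prop) : (forall M, A M <-> B M) -> A = B.
Proof. by move=> H; apply: functional_extensionality_dep => M; apply: propext. Qed.

Lemma t_structures_agree :
  let Dle := Ltensor_image (@std_le K (endDG U)) in
  let Dge := Ltensor_image (@std_ge K (endDG U)) in
  let Xle := aisle X in
  let Xge := coaisle X in
  [/\ t_structure Xle (shift_class 1 (rperp Xle)),
      t_structure (shift_class (-1) (lperp Xge)) Xge,
      t_structure Dle Dge,
      (forall M, Xle M <-> shift_class (-1) (lperp Xge) M) /\
      (forall M, shift_class 1 (rperp Xle) M <-> Xge M)
    & (forall M, Xle M <-> Dle M) /\
      (forall M, shift_class 1 (rperp Xle) M <-> Dge M)].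
Proof.
move=> Dle Dge Xle Xge.
have kU := nu_kproj; have sU := nu_small.
have EXle : Xle = hle U := predicate_ext aisle_hle.
have EXge : Xge = hge U := predicate_ext coaisle_hge.
have EDle : Dle = hle U.
  by apply: predicate_ext => M; apply: (Ltensor_imageP kU sU nu_generates (fun k => 0 < k) M).
have EDge : Dge = hge U.
  by apply: predicate_ext => M; apply: (Ltensor_imageP kU sU nu_generates (fun k => k < 0) M).
have ER : shift_class 1 (rperp (hle U)) = hge U.
  by apply: predicate_ext => M; apply: (rperp_hle kU sU nu_silting nu_generates).
have EL : shift_class (-1) (lperp (hge U)) = hle U.
  by apply: predicate_ext => M; apply: (lperp_hge kU sU nu_silting nu_generates).
rewrite EXle EXge EDle EDge ER EL.
have t := h_t_structure kU sU nu_silting nu_generates.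
by split.
Qed.
End SimpleMinded.

Local Close Scope ring_scope.

Theorem proposition3p8 (K : closedFieldType) (L : falgType K) (r : nat)
    (X T : 'I_r -> cplx L^c) :
  basic L ->
  simple_minded X ->
  (forall i, rickard X i (T i) /\ bounded_injective (T i)) ->
  let nuT := cbigsum (fun i => nuinv (T i)) in
  let Dle := Ltensor_image (@std_le K (endDG nuT)) in
  let Dge := Ltensor_image (@std_ge K (endDG nuT)) in
  let Xle := aisle X in
  let Xge := coaisle X in
  [/\ t_structure Xle (shift_class 1 (rperp Xle)),
      t_structure (shift_class (-1) (lperp Xge)) Xge,
      t_structure Dle Dge,
      (forall M, Xle M <-> shift_class (-1) (lperp Xge) M) /\
      (forall M, shift_class 1 (rperp Xle) M <-> Xge M)
    & (forall M, Xle M <-> Dle M) /\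
      (forall M, shift_class 1 (rperp Xle) M <-> Dge M)].
Proof. by move=> _ HX HT; exact: (t_structures_agree HX HT). Qed.
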